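(* Let $K=L^2(]0,\infty[,dt)$, let $\chi$ be the indicator function of $]0,1]$, and let $\{x\}$ denote the fractional part of $x$. For $0<\lambda<1$ let $\mathcal{B}_\lambda$ be the subspace of $K$ of finite linear combinations of the functions $t\mapsto\{\theta/t\}$ with $\lambda\leq\theta\leq1$, and let $D(\lambda)=\inf_{f\in\mathcal{B}_\lambda}\|\chi-f\|$. Then $$\liminf_{\lambda\to0}D(\lambda)\sqrt{\log\tfrac1\lambda}\ \geq\ \sqrt{\sum_\rho\frac{m_\rho^2}{|\rho|^2}},$$ where the sum is over the distinct non-trivial zeros $\rho$ of the Riemann zeta function and $m_\rho$ is the multiplicity of $\rho$.
   Context: $\|\cdot\|$ is the norm of $K=L^2(]0,\infty[,dt)$ (complex-valued functions). Non-trivial zeros of $\zeta$ are its zeros in the strip $0<\mathrm{Re}(s)<1$; each distinct zero appears once in the sum, weighted by the square of its multiplicity. *)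

(* Defs.v *)
From HB Require Import structures.
From mathcomp Require Import all_boot all_order all_algebra.
From mathcomp Require Import complex.
From mathcomp Require Import all_classical all_reals all_analysis.

Set Implicit Arguments.
Unset Strict Implicit.
Unset Printing Implicit Defensive.

Import Order.TTheory GRing.Theory Num.Theory.
Import numFieldNormedType.Exports.

Local Open Scope classical_set_scope.
Local Open Scope ring_scope.
Local Open Scope complex_scope.

Section ComplexAnalysis.
Variable R : realType.

(* [R[i]^o] is the carrier [R[i]] seen as a normed module over itself; this is
   what gives access to the usual topology of the complex plane. *)
Definition analytic_at (f : R[i]^o -> R[i]^o) (a : R[i]^o) : Prop :=
  exists c : nat -> R[i],
    \forall s \near a,
      (series (fun k => c k * (s - a) ^+ k : R[i]^o) n @[n --> \oo] --> f s).

Definition vanishing_order (f : R[i]^o -> R[i]^o) (a : R[i]^o) (m : nat) :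
    Prop :=
  exists g : R[i]^o -> R[i]^o,
    [/\ analytic_at g a, g a != 0
      & \forall s \near a, f s = (s - a) ^+ m * g s].

(* The order is unique, and it exists as soon as [f] is analytic at [a] and not
   identically zero near [a]; the default value 0 is only used otherwise. *)
Definition multiplicity (f : R[i]^o -> R[i]^o) (a : R[i]^o) : nat :=
  xget 0%N [set m | vanishing_order f a m].

Definition cexp (z : R[i]) : R[i] :=
  (expR (complex.Re z))%:C * (cos (complex.Im z) +i* sin (complex.Im z)).

(* n^z, for n > 0 *)
Definition natpowc (n : nat) (z : R[i]) : R[i] := cexp (z * (ln n%:R)%:C).

(* [zeta] is the analytic continuation to C \ {1} of the Dirichlet series
   sum_(n >= 1) n^-s, Re s > 1 (the index is shifted by one below).  By the
   identity theorem this determines [zeta] outside the point 1, where its value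
   is left free. *)
Definition is_riemann_zeta (zeta : R[i]^o -> R[i]^o) : Prop :=
  (forall s : R[i]^o, s != 1 -> analytic_at zeta s) /\
  (forall s : R[i]^o, 1 < complex.Re s ->
    (series (fun k => natpowc k.+1 (- s) : R[i]^o) n @[n --> \oo] --> zeta s)).

Definition nontrivial_zeros (zeta : R[i]^o -> R[i]^o) : set R[i] :=
  [set s | 0 < complex.Re s < 1 /\ zeta s = 0].

End ComplexAnalysis.

Section Approximation.
Variable R : realType.

Definition frac (x : R) : R := x - (Num.floor x)%:~R.

Definition L2norm (g : R -> R[i]) : \bar R :=
  sqrte (\int[lebesgue_measure]_(t in `]0%R, +oo[)
           (ComplexField.Normc.normc (g t) ^+ 2)%:E)%E.

Definition chi (t : R) : R[i] := (\1_(`]0, 1]) t : R)%:C.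

Definition Bspace (lambda : R) : set (R -> R[i]) :=
  [set f | exists (n : nat) (theta : 'I_n -> R) (c : 'I_n -> R[i]),
     (forall i, lambda <= theta i <= 1) /\
     f = (fun t => \sum_(i < n) c i * (frac (theta i / t))%:C)].

Definition D (lambda : R) : \bar R :=
  ereal_inf [set L2norm (fun t => chi t - f t) | f in Bspace lambda].

End Approximation.

(* Main.v *)
Require Import Defs.
From HB Require Import structures.
From mathcomp Require Import all_boot all_order all_algebra.
From mathcomp Require Import complex.
From mathcomp Require Import all_classical all_reals all_analysis.
From mathcomp Require Import measurable_realfun.
From mathcomp Require Import ring lra.

Set Implicit Arguments.
Unset Strict Implicit.
Unset Printing Implicit Defensive.

Import Order.TTheory GRing.Theory Num.Theory.
Import numFieldNormedType.Exports.

Local Open Scope classical_set_scope.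
Local Open Scope ring_scope.

(** With y = 1/t, an element of B_lambda becomes a combination F of the functions
    {theta y}, and its distance to chi is the norm of r = 1_[1, oo[ - F in
    L^2(]0, oo[, dy / y^2).  For 0 < Re s < 1 the integral of {y} y^(-s-1) over
    ]0, oo[ is -zeta(s)/s; hence at a zero rho of multiplicity m the functions
    (ln y)^k y^(-rho-1), k < m, integrate to 0 against every {theta y}.
    Put L = log(1/lambda) and test r against a combination of the functions
    p_rho(ln y / L) y^(-rho-1) cut at y = 1/lambda: the part of 1_[1, oo[ remains,
    up to the tail of F.  That tail is O(1), because a function with spectrum in
    [-lambda, lambda] is orthogonal to {theta y} - 1/2 for theta >= lambda, so that
    smoothing by a Jackson kernel leaves only a boundary term at the cut.  On the
    critical line the test functions have squared norm of order L and are almost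
    orthogonal; taking for p_rho the polynomial of degree < m that represents
    evaluation at 0 in L^2([0, 1]), whose squared norm is p_rho(0) = m^2, produces
    the weight m^2.  A zero off the line may
    be taken with Re > 1/2 by the functional equation, here deduced from Poisson
    summation for an explicit kernel [eta], and the same test then shows that
    D(lambda) sqrt(L) tends to infinity. *)

(** The sharp constant comes from the equality case of Cauchy-Schwarz: with coefficient rho/|rho|^2
    at each zero, the pairing of the test function with 1 and its squared norm divided by L tend to
    the same sum S, so that dist sqrt(L S) >= S up to lower order. The weight m^2 is the maximum of
    p(0)^2 over the squared norm of p for deg p < m, read off from a Hilbert matrix. The main
    obstacle is the tail beyond 1/lambda: the coefficients of F are unbounded, so every estimate
    there may involve F only through a weighted L^1 norm, which the residual controls. A zero with
    Re < 1/2 would give a test function too large at the cut, hence its reflection; transporting the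
    mere vanishing suffices, because one zero with Re > 1/2 already keeps D away from 0. The work is
    done over the reals: a complex coefficient is the pair (al, be) of [osc], and analytic
    continuation is an identity theorem for real power series along horizontal lines. *)

Local Notation fpart := Defs.frac.

(** * Integration on the half line *)

Section Measurability.
Context {R : realType}.

(** Since 0^-1 = 0, the continuous functions x / (x^2 + 1/(n+1)) converge to the inverse at every
    point, 0 included. *)
Lemma measurable_invr : measurable_fun setT (@GRing.inv R).
Proof.
pose h n (x : R) := x * (x ^+ 2 + n.+1%:R^-1)^-1.
have hc n : continuous (h n).
  move=> x; have p : x ^+ 2 + n.+1%:R^-1 != 0.
    by rewrite gt_eqF// ltr_wpDl ?sqr_ge0 ?invr_gt0.
  apply: cvgM; first exact: cvg_id.
  apply: cvgV => //; apply: cvgD; last exact: cvg_cst.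
  exact: exprn_continuous.
apply: (@measurable_fun_cvg _ _ _ _ h).
  by move=> n; exact: continuous_measurable_fun.
move=> x _; have [->|x0] := eqVneq x 0.
  by rewrite /h; under eq_fun do rewrite mul0r; rewrite invr0; exact: cvg_cst.
rewrite -[X in _ --> X](_ : x * (x ^+ 2 + 0)^-1 = x^-1); last first.
  by rewrite addr0 expr2 invfM mulrA mulfV// mul1r.
apply: cvgM; first exact: cvg_cst.
apply: cvgV; first by rewrite addr0 sqrf_eq0.
by apply: cvgD; [exact: cvg_cst|exact: cvg_harmonic].
Qed.

Lemma measurable_frac : measurable_fun setT (@Defs.frac R).
Proof.
apply: measurable_funB => //; apply: nondecreasing_measurable => // x y xy.
by rewrite ler_int; exact: le_floor.
Qed.

Lemma measurable_cos : measurable_fun setT (@cos R).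
Proof. by apply: continuous_measurable_fun => x; exact: continuous_cos. Qed.

Lemma measurable_sin : measurable_fun setT (@sin R).
Proof. by apply: continuous_measurable_fun => x; exact: continuous_sin. Qed.

Context d (T : measurableType d) (D : set T).
Implicit Types f : T -> R.

Lemma measurable_funV f : measurable_fun D f -> measurable_fun D (fun x => (f x)^-1).
Proof. by move=> mf; apply: (measurableT_comp measurable_invr). Qed.

Lemma measurable_fun_frac f : measurable_fun D f -> measurable_fun D (fun x => fpart (f x)).
Proof. by move=> mf; apply: (measurableT_comp measurable_frac). Qed.

Lemma measurable_fun_cos f : measurable_fun D f -> measurable_fun D (fun x => cos (f x)).
Proof. by move=> mf; apply: (measurableT_comp measurable_cos). Qed.

Lemma measurable_fun_sin f : measurable_fun D f -> measurable_fun D (fun x => sin (f x)).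
Proof. by move=> mf; apply: (measurableT_comp measurable_sin). Qed.

Lemma measurable_fun_expR f : measurable_fun D f -> measurable_fun D (fun x => expR (f x)).
Proof. by move=> mf; apply: (measurableT_comp (@measurable_expR R)). Qed.

Lemma measurable_fun_ln f : measurable_fun D f -> measurable_fun D (fun x => ln (f x)).
Proof. by move=> mf; apply: (measurableT_comp (@measurable_ln R)). Qed.

Lemma measurable_fun_normr f : measurable_fun D f -> measurable_fun D (fun x => `|f x|).
Proof. by move=> mf; apply: measurableT_comp. Qed.

End Measurability.

Ltac meas1 := first
  [ assumption | exact: measurable_cst | exact: measurable_id
  | exact: measurable_fst | exact: measurable_snd
  | apply: measurable_funV | apply: measurable_fun_frac
  | apply: measurable_fun_cos | apply: measurable_fun_sin
  | apply: measurable_fun_expR | apply: measurable_fun_ln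
  | apply: measurable_fun_normr
  | apply: measurable_funX | apply: measurable_funM
  | apply: measurable_funB | apply: measurable_funD | apply: measurable_funN ].
Ltac meas := repeat meas1.

(** * Affine changes of variable *)

Section Affine.
Context {R : realType}.
Local Notation mu := (@lebesgue_measure R).
Local Notation mR := (measurableTypeR R).

Lemma measurable_scale (a : R) : measurable_fun setT (fun x : mR => a * x : mR).
Proof. by apply: measurable_funM. Qed.

(** Uniqueness of Lebesgue measure: a times the pushforward gives every interval its length. *)
Lemma lebesgue_measure_scale (a : R) (A : set R) : 0 < a -> measurable A ->
  pushforward mu (fun x : mR => a * x : mR) A = (a^-1%:E * mu A)%E.
Proof.
move=> a0 mA.
have a1 : 0 <= a by exact: ltW.
pose m := mscale (NngNum a1) (pushforward mu (fun x : mR => a * x : mR)).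
have E : mu A = m (measurable_scale a) A.
  apply: lebesgue_measure_unique => //= _ [[x y]] _ <-.
  transitivity (a%:E * mu [set` `](x / a)%R, (y / a)%R]])%E; last first.
    congr (_ * mu _)%E; apply/seteqP.
    by split => t /=; rewrite !in_itv/= ltr_pdivrMr// ler_pdivlMr// ![_ * a]mulrC.
  rewrite !lebesgue_measure_itv/= !lte_fin ltr_pM2r ?invr_gt0//.
  case: ifP => _; last by rewrite mule0.
  by rewrite -!EFinD -EFinM; congr EFin; field; rewrite gt_eqF.
by rewrite E /m /mscale/= muleA -EFinM mulVf ?gt_eqF// mul1e.
Qed.

Lemma lebesgue_measure_shift (a : R) (A : set R) : measurable A ->
  pushforward mu (fun x : mR => a + x : mR) A = mu A.
Proof.
move=> mA.
have mf : measurable_fun setT (fun x : mR => a + x : mR) by exact: measurable_funD.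
apply/esym/lebesgue_measure_unique => //= _ [[x y]] _ <-.
transitivity (mu [set` `](x - a), (y - a)]]); last first.
  congr (mu _); apply/seteqP.
  by split => t /=; rewrite !in_itv/= ltrBlDl lerBrDl.
rewrite !lebesgue_measure_itv/= !lte_fin ltrD2r.
by case: ifP => // _; rewrite -!EFinD; congr EFin; ring.
Qed.

Lemma ge0_integral_scale (a : R) (f : R -> \bar R) (D : set R) : 0 < a ->
  measurable D ->
  measurable_fun setT f -> (forall x, (0 <= f x)%E) ->
  (\int[mu]_(x in (fun x => a * x)%R @^-1` D) f (a * x)%R = a^-1%:E * \int[mu]_(x in D) f x)%E.
Proof.
move=> a0 mD mf f0.
have a1 : 0 <= a^-1 by rewrite invr_ge0 ltW.
rewrite -(@ge0_integral_pushforward _ _ _ mR _ (fun x : mR => a * x : mR) (measurable_scale a) mu D f)//; last first.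
  exact: measurable_funTS.
rewrite -[a^-1]/((NngNum a1)%:num) -ge0_integral_mscale//; last exact: measurable_funTS.
by apply: eq_measure_integral; first exact: measurable_scale; move=> mS A mA _; transitivity (a^-1%:E * mu A)%E; [exact: lebesgue_measure_scale|].
Qed.

Lemma ge0_integral_shift (a : R) (f : R -> \bar R) :
  measurable_fun setT f -> (forall x, (0 <= f x)%E) ->
  (\int[mu]_x f (a + x)%R = \int[mu]_x f x)%E.
Proof.
move=> mf f0.
have mS : measurable_fun setT (fun x : mR => a + x : mR) by exact: measurable_funD.
have := @ge0_integral_pushforward _ _ _ mR _ (fun x : mR => a + x : mR) mS mu setT f measurableT mf (fun y _ => f0 y).
rewrite preimage_setT => <-.
by apply: eq_measure_integral => A mA _; exact: lebesgue_measure_shift.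
Qed.

Lemma ge0_integral_opp (f : R -> \bar R) :
  measurable_fun setT f -> (forall x, (0 <= f x)%E) ->
  (\int[mu]_x f (- x)%R = \int[mu]_x f x)%E.
Proof.
move=> mf f0.
have mS : measurable_fun setT (fun x : mR => - x : mR) by exact: measurable_funN.
have := @ge0_integral_pushforward _ _ _ mR _ (fun x : mR => - x : mR) mS mu setT f measurableT mf (fun y _ => f0 y).
rewrite preimage_setT => <-.
by apply: eq_measure_integral => A mA _; exact: lebesgue_measureN.
Qed.
End Affine.

Section Transfer.
Context {R : realType}.
Local Notation mu := (@lebesgue_measure R).
Local Notation L1 D f := (mu.-integrable D (EFin \o f)).

(** Each substitution is first proved for nonnegative functions, where no integrability is at stake;
    positive and negative parts carry it over to integrable ones. [phi] is the substitution, [j] its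
    Jacobian and [c] the resulting factor. *)
Lemma L1_transfer (D D' : set R) (phi j : R -> R) (c : R) (f : R -> R) :
  measurable D -> measurable D' -> 0 <= c -> (forall x, D' x -> 0 <= j x) ->
  measurable_fun setT phi -> measurable_fun setT j ->
  (forall h : R -> R, measurable_fun setT h -> (forall x, 0 <= h x) ->
    (\int[mu]_(x in D') (j x * h (phi x))%:E = c%:E * \int[mu]_(x in D) (h x)%:E)%E) ->
  measurable_fun setT f -> L1 D f ->
  L1 D' (fun x => j x * f (phi x)) /\
  \int[mu]_(x in D') (j x * f (phi x)) = c * \int[mu]_(x in D) f x.
Proof.
move=> mD mD' c0 j0 mphi mj H.
have A (g : R -> R) : measurable_fun setT g -> L1 D g -> L1 D' (fun x => j x * g (phi x)).
  move=> mg /integrableP[_ i]; apply/integrableP; split.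
    apply/measurable_EFinP/measurable_funTS; apply: measurable_funM => //.
    exact: measurableT_comp.
  have -> : (\int[mu]_(x in D') `|(EFin \o (fun x => j x * g (phi x))%R) x| =
      \int[mu]_(x in D') (j x * `|g (phi x)|)%:E)%E.
    by apply: eq_integral => x; rewrite inE => Dx /=; rewrite normrM ger0_norm ?j0.
  rewrite (H (fun z => `|g z|))//; last exact: measurable_fun_normr mg.
  by rewrite lte_mul_pinfty.
move=> mf i; split; first exact: A.
have ip : L1 D (f^\+)%R by exact: integrable_funrpos.
have im : L1 D (f^\-)%R by exact: integrable_funrneg.
have mp : measurable_fun setT (f^\+)%R by exact: measurable_funrpos.
have mm : measurable_fun setT (f^\-)%R by exact: measurable_funrneg.
have E (g : R -> R) : measurable_fun setT g -> (forall x, 0 <= g x) -> L1 D g ->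
    Rintegral mu D' (fun x => j x * g (phi x)) = c * Rintegral mu D g.
  move=> mg g0 ig; rewrite /Rintegral H// fineM//.
  exact: integrable_fin_num.
have -> : Rintegral mu D f = Rintegral mu D (f^\+)%R - Rintegral mu D (f^\-)%R.
  rewrite -RintegralB//; apply: eq_Rintegral => x _.
  by rewrite -[in LHS](funrposBneg f).
rewrite mulrBr -!E//.
rewrite -RintegralB//; try exact: A.
by apply: eq_Rintegral => x _; rewrite -mulrBr -[in LHS](funrposBneg f).
Qed.

End Transfer.

(** * Integrable real functions and the Cauchy-Schwarz inequality *)

Section Integrability.
Context {R : realType}.
Local Notation mu := (@lebesgue_measure R).
Local Notation L1 D f := (mu.-integrable D (EFin \o f)).
Local Notation pos := (`]0, +oo[%classic : set R).

Section OnSet.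
Variable D : set R.
Hypothesis mD : measurable D.

Lemma L1_measurable (f : R -> R) : L1 D f -> measurable_fun D f.
Proof. by move=> /integrableP[/measurable_EFinP]. Qed.

Lemma L1_le (f g : R -> R) : measurable_fun D f ->
  (forall x, D x -> `|f x| <= g x) -> L1 D g -> L1 D f.
Proof.
move=> mf fg; apply: le_integrable => //; first exact/measurable_EFinP.
by move=> x Dx /=; rewrite lee_fin (le_trans (fg _ Dx))// ler_norm.
Qed.

Lemma L1D (f g : R -> R) : L1 D f -> L1 D g -> L1 D (fun x => f x + g x).
Proof. by move=> ? ?; apply: (@integrableD _ _ _ mu D mD (EFin \o f) (EFin \o g)). Qed.

Lemma L1Zl (k : R) (f : R -> R) : L1 D f -> L1 D (fun x => k * f x).
Proof. by move=> ?; apply: (@integrableZl _ _ _ mu D mD k (EFin \o f)). Qed.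

Lemma L1B (f g : R -> R) : L1 D f -> L1 D g -> L1 D (fun x => f x - g x).
Proof. by move=> ? ?; apply: (@integrableB _ _ _ mu D mD (EFin \o f) (EFin \o g)). Qed.

Lemma L1_norm (f : R -> R) : L1 D f -> L1 D (fun x => `|f x|).
Proof. exact: integrable_norm. Qed.

Lemma L1_0 : L1 D (fun=> 0).
Proof. exact: integrable0. Qed.

Lemma L1_sum (I : Type) (s : seq I) (f : I -> R -> R) :
  (forall i, L1 D (f i)) -> L1 D (fun x => \sum_(i <- s) f i x).
Proof.
move=> h; elim: s => [|i s IH].
  by under eq_fun do rewrite big_nil; exact: L1_0.
by under eq_fun do rewrite big_cons; exact: L1D.
Qed.

Lemma Rintegral_sum (I : Type) (s : seq I) (f : I -> R -> R) :
  (forall i, L1 D (f i)) ->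
  \int[mu]_(x in D) (\sum_(i <- s) f i x) = \sum_(i <- s) \int[mu]_(x in D) f i x.
Proof.
move=> h; elim: s => [|i s IH].
  rewrite big_nil (_ : (fun x => _) = cst 0); last by apply/funext => x; rewrite big_nil.
  by rewrite Rintegral_cst// mul0r.
rewrite big_cons -IH -RintegralD//; last exact: L1_sum.
by apply: eq_Rintegral => x _; rewrite big_cons.
Qed.

Lemma L1_bounded (f g : R -> R) (M : R) : L1 D g -> measurable_fun D f ->
  (forall x, D x -> `|f x| <= M) -> L1 D (fun x => f x * g x).
Proof.
move=> ig mf fM.
apply: (@L1_le _ (fun x => M * `|g x|)).
- by apply: measurable_funM => //; exact: L1_measurable.
- by move=> x Dx; rewrite normrM ler_wpM2r ?fM.
- by apply: L1Zl; exact: L1_norm.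
Qed.

Lemma Rintegral_le_norm (f g : R -> R) : L1 D f -> L1 D g ->
  (forall x, D x -> `|f x| <= g x) -> `|\int[mu]_(x in D) f x| <= \int[mu]_(x in D) g x.
Proof.
move=> i1 i2 h; apply: le_trans; first exact: le_normr_Rintegral.
by apply: le_Rintegral => //; exact: L1_norm.
Qed.

Lemma cauchy_schwarz (f g : R -> R) : measurable_fun D f -> measurable_fun D g ->
  L1 D (fun x => f x ^+ 2) -> L1 D (fun x => g x ^+ 2) ->
  L1 D (fun x => f x * g x) /\
  `|\int[mu]_(x in D) (f x * g x)| <=
  Num.sqrt (\int[mu]_(x in D) (f x ^+ 2)) * Num.sqrt (\int[mu]_(x in D) (g x ^+ 2)).
Proof.
move=> mf mg if2 ig2.
have ifg : L1 D (fun x => f x * g x).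
  apply: (@L1_le _ (fun x => f x ^+ 2 + g x ^+ 2)); last exact: L1D.
    exact: measurable_funM.
  move=> x _; rewrite ler_norml; apply/andP; split; nra.
split=> //.
set A := \int[mu]_(x in D) (f x ^+ 2); set B := \int[mu]_(x in D) (g x ^+ 2).
set C := \int[mu]_(x in D) (f x * g x).
have A0 : 0 <= A by apply: Rintegral_ge0 => x _; exact: sqr_ge0.
have B0 : 0 <= B by apply: Rintegral_ge0 => x _; exact: sqr_ge0.
(* The integral of (s f + t g)^2 is a nonnegative quadratic form in (s, t); the inequality is its
   discriminant condition. *)
have Q (s t : R) : 0 <= s ^+ 2 * A + (2 * s * t) * C + t ^+ 2 * B.
  rewrite /A /B /C -!RintegralZl// -!RintegralD//; try by repeat (apply: L1D || apply: L1Zl).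
  apply: Rintegral_ge0 => x _.
  rewrite (_ : _ + _ = (s * f x + t * g x) ^+ 2) ?sqr_ge0//; ring.
rewrite -sqrtrM// -sqrtr_sqr ler_sqrt ?mulr_ge0//.
have [B1|B1] := ltP 0 B.
  have := Q B (- C); rewrite (_ : _ + _ = B * (A * B - C ^+ 2)); last by ring.
  by rewrite pmulr_rge0// subr_ge0.
have B00 : B = 0 by apply/eqP; rewrite eq_le B1.
have [->|C1] := eqVneq C 0; first by rewrite expr0n/= mulr_ge0.
(* With B = 0 and C nonzero this value of t makes the form equal to -1. *)
have := Q 1 (- (A + 1) / (2 * C)); rewrite B00 (_ : _ + _ = - 1); first lra.
by field.
Qed.

End OnSet.

Lemma L1_sub (D E : set R) (f : R -> R) : measurable D -> measurable E ->
  D `<=` E -> L1 E f -> L1 D f.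
Proof. by move=> mD mE DE; exact: integrableS. Qed.

Lemma L1_scale (a : R) (f : R -> R) : 0 < a -> measurable_fun setT f -> L1 pos f ->
  L1 pos (fun x => f (a * x)) /\
  \int[mu]_(x in pos) f (a * x) = a^-1 * \int[mu]_(x in pos) f x.
Proof.
move=> a0 mf i.
have E : (fun x => a * x)%R @^-1` pos = pos.
  by apply/seteqP; split => t /=; rewrite !in_itv/= !andbT pmulr_rgt0.
have H (h : R -> R) : measurable_fun setT h -> (forall x, 0 <= h x) ->
  (\int[mu]_(x in pos) (1 * h (a * x)%R)%:E = a^-1%:E * \int[mu]_(x in pos) (h x)%:E)%E.
  move=> mh h0; rewrite -{1}E.
  under eq_integral do rewrite mul1r.
  apply: (@ge0_integral_scale _ _ (EFin \o h)) => //; exact/measurable_EFinP.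
have mp : measurable_fun setT (fun x : R => a * x) by exact: measurable_funM.
have m1 : measurable_fun (setT : set R) (fun=> 1 : R) by exact: measurable_cst.
have a1 : 0 <= a^-1 by rewrite invr_ge0 ltW.
have [i1 i2] := @L1_transfer _ pos pos _ _ _ _ (measurable_itv _) (measurable_itv _) a1 (fun _ _ => ler01) mp m1 H mf i.
split; first by move: i1; apply: eq_integrable => // x _ /=; rewrite mul1r.
by rewrite -i2; apply: eq_Rintegral => x _; rewrite mul1r.
Qed.

Lemma L1_scaleT (a : R) (f : R -> R) : 0 < a -> measurable_fun setT f -> L1 setT f ->
  L1 setT (fun x => f (a * x)) /\
  \int[mu]_x f (a * x) = a^-1 * \int[mu]_x f x.
Proof.
move=> a0 mf i.
have H (h : R -> R) : measurable_fun setT h -> (forall x, 0 <= h x) ->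
  (\int[mu]_(x in setT) (1 * h (a * x)%R)%:E = a^-1%:E * \int[mu]_(x in setT) (h x)%:E)%E.
  move=> mh h0; rewrite -{1}(preimage_setT (fun x : R => a * x)).
  under eq_integral do rewrite mul1r.
  apply: (@ge0_integral_scale _ _ (EFin \o h)) => //; exact/measurable_EFinP.
have mp : measurable_fun setT (fun x : R => a * x) by exact: measurable_funM.
have m1 : measurable_fun (setT : set R) (fun=> 1 : R) by exact: measurable_cst.
have a1 : 0 <= a^-1 by rewrite invr_ge0 ltW.
have [i1 i2] := @L1_transfer _ setT setT _ _ _ _ measurableT measurableT a1 (fun _ _ => ler01) mp m1 H mf i.
split; first by move: i1; apply: eq_integrable => // x _ /=; rewrite mul1r.
by rewrite -i2; apply: eq_Rintegral => x _; rewrite mul1r.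
Qed.

Lemma L1_shift (a : R) (f : R -> R) : measurable_fun setT f -> L1 setT f ->
  L1 setT (fun x => f (a + x)) /\
  \int[mu]_x f (a + x) = \int[mu]_x f x.
Proof.
move=> mf i.
have H (h : R -> R) : measurable_fun setT h -> (forall x, 0 <= h x) ->
  (\int[mu]_(x in setT) (1 * h (a + x)%R)%:E = 1%:E * \int[mu]_(x in setT) (h x)%:E)%E.
  move=> mh h0; rewrite mul1e.
  under eq_integral do rewrite mul1r.
  apply: (@ge0_integral_shift _ _ (EFin \o h)) => //; exact/measurable_EFinP.
have mp : measurable_fun setT (fun x : R => a + x) by exact: measurable_funD.
have m1 : measurable_fun (setT : set R) (fun=> 1 : R) by exact: measurable_cst.
have [i1 i2] := @L1_transfer _ setT setT _ _ _ _ measurableT measurableT ler01 (fun _ _ => ler01) mp m1 H mf i.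
split; first by move: i1; apply: eq_integrable => // x _ /=; rewrite mul1r.
by move: i2; rewrite mul1r => <-; apply: eq_Rintegral => x _; rewrite mul1r.
Qed.

Lemma L1_opp (f : R -> R) : measurable_fun setT f -> L1 setT f ->
  L1 setT (fun x => f (- x)) /\
  \int[mu]_x f (- x) = \int[mu]_x f x.
Proof.
move=> mf i.
have H (h : R -> R) : measurable_fun setT h -> (forall x, 0 <= h x) ->
  (\int[mu]_(x in setT) (1 * h (- x)%R)%:E = 1%:E * \int[mu]_(x in setT) (h x)%:E)%E.
  move=> mh h0; rewrite mul1e.
  under eq_integral do rewrite mul1r.
  apply: (@ge0_integral_opp _ (EFin \o h)) => //; exact/measurable_EFinP.
have mp : measurable_fun setT (fun x : R => - x) by exact: measurable_funN.
have m1 : measurable_fun (setT : set R) (fun=> 1 : R) by exact: measurable_cst.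
have [i1 i2] := @L1_transfer _ setT setT _ _ _ _ measurableT measurableT ler01 (fun _ _ => ler01) mp m1 H mf i.
split; first by move: i1; apply: eq_integrable => // x _ /=; rewrite mul1r.
by move: i2; rewrite mul1r => <-; apply: eq_Rintegral => x _; rewrite mul1r.
Qed.

End Integrability.

(** * Fubini's theorem for real integrals *)

Section Fubini.
Context {R : realType}.
Local Notation mu := (@lebesgue_measure R).
Local Notation L1 D f := (mu.-integrable D (EFin \o f)).
Local Notation pos := (`]0, +oo[%classic : set R).

Lemma EFin_Rintegral (D : set R) (f : R -> R) : measurable D -> L1 D f ->
  (\int[mu]_(x in D) f x)%:E = (\int[mu]_(x in D) (f x)%:E)%E.
Proof. by move=> mD i; rewrite /Rintegral fineK//; exact: integrable_fin_num. Qed.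

(** The bound [g] on the inner integrals of |f| yields integrability on the product by Tonelli. The
    slices are integrable everywhere, so that no exceptional set enters the conclusion. *)
Lemma Rfubini (f : R * R -> R) (g : R -> R) : measurable_fun setT f -> L1 setT g ->
  (forall x, L1 setT (fun y => f (x, y))) ->
  (forall y, L1 setT (fun x => f (x, y))) ->
  (forall x, \int[mu]_y `|f (x, y)| <= g x) ->
  [/\ L1 setT (fun y => \int[mu]_x f (x, y)), L1 setT (fun x => \int[mu]_y f (x, y)) &
    \int[mu]_x (\int[mu]_y f (x, y)) = \int[mu]_y (\int[mu]_x f (x, y))].
Proof.
move=> mf ig i1 i2 fg.
have mEf : measurable_fun setT (EFin \o f) by exact/measurable_EFinP.
have imf : (mu \x mu)%E.-integrable setT (EFin \o f).
  apply/integrable12ltyP => //.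
  apply: (@le_lt_trans _ _ (\int[mu]_x (g x)%:E)%E); last exact: integrable_lty.
  apply: ge0_le_integral => //.
  - by move=> x _; exact: integral_ge0.
  - apply: (@measurable_fun_fubini_tonelli_F _ _ _ _ _ mu (abse \o (EFin \o f))) => //.
      exact: measurableT_comp.
    by move=> z; exact: abse_ge0.
  - by case/integrableP: ig.
  - move=> x _; rewrite (_ : \int[mu]_y _ = (\int[mu]_y `|f (x, y)|)%:E)%E ?lee_fin//.
    by rewrite EFin_Rintegral//; exact: L1_norm.
have E1 : (fun x => (\int[mu]_y (EFin \o f) (x, y))%E) = EFin \o (fun x => \int[mu]_y f (x, y)).
  by apply/funext => x /=; rewrite EFin_Rintegral.
have E2 : (fun y => (\int[mu]_x (EFin \o f) (x, y))%E) = EFin \o (fun y => \int[mu]_x f (x, y)).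
  by apply/funext => y /=; rewrite EFin_Rintegral.
have j1 := integrable_fubini_F imf; rewrite /fubini_F E1 in j1.
have j2 : L1 setT (fun y => \int[mu]_x f (x, y)).
  apply/integrableP; split.
    have := @measurable_fubini_G _ _ _ _ _ mu mu _ imf.
    by rewrite /fubini_G E2.
  have imf' : (\int[mu]_y \int[mu]_x `|(EFin \o f) (x, y)| < +oo)%E.
    by apply/integrable21ltyP.
  apply: le_lt_trans imf'; apply: ge0_le_integral => //.
  - have := @measurable_fubini_G _ _ _ _ _ mu mu _ imf.
    by rewrite /fubini_G E2 => h; apply: measurableT_comp.
  - apply: (@measurable_fun_fubini_tonelli_G _ _ _ _ _ mu (abse \o (EFin \o f))) => //.
      exact: measurableT_comp.
    by move=> z; exact: abse_ge0.
  - move=> y _ /=; rewrite (_ : \int[mu]_x _ = (\int[mu]_x `|f (x, y)|)%:E)%E; last first.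
      by rewrite EFin_Rintegral//; exact: L1_norm.
    by rewrite lee_fin; exact: le_normr_Rintegral.
split; [exact: j2|exact: j1|].
by have := Fubini imf; rewrite E1 E2 /Rintegral => ->.
Qed.

Lemma L1_indic (D : set R) (f : R -> R) : measurable D ->
  L1 D f <-> L1 setT (fun x => \1_D x * f x).
Proof.
move=> mD; have E := @integrable_mkcond _ _ _ mu D (EFin \o f) mD; apply: (iff_trans E).
rewrite (_ : (EFin \o f) \_ D = EFin \o (fun x => \1_D x * f x))//.
by apply/funext => x; rewrite patchE /= indicE; case: ifPn => _; rewrite ?mul1r ?mul0r.
Qed.

Lemma Rintegral_indic (D : set R) (f : R -> R) :
  \int[mu]_(x in D) f x = \int[mu]_x (\1_D x * f x).
Proof.
rewrite Rintegral_mkcond; apply: eq_Rintegral => x _.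
by rewrite patchE /= indicE; case: ifPn => _; rewrite ?mul1r ?mul0r.
Qed.

Lemma Rfubini_on (D E : set R) (f : R * R -> R) (g : R -> R) :
  measurable D -> measurable E ->
  measurable_fun setT f -> L1 D g ->
  (forall x, D x -> L1 E (fun y => f (x, y))) ->
  (forall y, E y -> L1 D (fun x => f (x, y))) ->
  (forall x, D x -> \int[mu]_(y in E) `|f (x, y)| <= g x) ->
  [/\ L1 E (fun y => \int[mu]_(x in D) f (x, y)), L1 D (fun x => \int[mu]_(y in E) f (x, y)) &
    \int[mu]_(x in D) (\int[mu]_(y in E) f (x, y)) = \int[mu]_(y in E) (\int[mu]_(x in D) f (x, y))].
Proof.
move=> mD mE mf ig i1 i2 fg.
pose h (z : R * R) := \1_D z.1 * (\1_E z.2 * f z).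
have H0 (A : set R) x : ~ A x -> \1_A x = 0 :> R by move=> nA; rewrite indicE memNset.
have H1 (A : set R) x : A x -> \1_A x = 1 :> R by move=> nA; rewrite indicE mem_set.
have mI (A : set R) : measurable A -> measurable_fun setT (\1_A : R -> R) by move=> mA; exact: measurable_indic.
have L0 (S : set R) : L1 S (fun=> 0) by exact: L1_0.
have I1 x : \int[mu]_y h (x, y) = \1_D x * \int[mu]_(y in E) f (x, y).
  rewrite (Rintegral_indic E) /h /=; have [Dx|nDx] := pselect (D x).
    by rewrite H1// mul1r; apply: eq_Rintegral => y _; rewrite mul1r.
  rewrite H0// mul0r -[RHS](mul0r (fine (mu setT))) -Rintegral_cst//.
  by apply: eq_Rintegral => y _; rewrite mul0r.
have I2 y : \int[mu]_x h (x, y) = \1_E y * \int[mu]_(x in D) f (x, y).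
  rewrite (Rintegral_indic D) /h /=; have [Ey|nEy] := pselect (E y).
    by rewrite H1// mul1r; apply: eq_Rintegral => x _; rewrite mul1r.
  rewrite H0// mul0r -[RHS](mul0r (fine (mu setT))) -Rintegral_cst//.
  by apply: eq_Rintegral => x _; rewrite mul0r mulr0.
have [] := @Rfubini h (fun x => \1_D x * g x).
- apply: measurable_funM; first by apply: (measurableT_comp (mI _ mD)); exact: measurable_fst.
  by apply: measurable_funM => //; apply: (measurableT_comp (mI _ mE)); exact: measurable_snd.
- exact: (proj1 (L1_indic g mD) ig).
- move=> x; rewrite /h /=; have [Dx|nDx] := pselect (D x).
    by rewrite H1//; under eq_fun do rewrite mul1r; apply: (proj1 (L1_indic (fun y => f (x, y)) mE)); exact: i1.
  by rewrite H0//; under eq_fun do rewrite mul0r; exact: L0.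
- move=> y; rewrite /h /=; have [Ey|nEy] := pselect (E y).
    by rewrite H1//; under eq_fun do rewrite mul1r; apply: (proj1 (L1_indic (fun x => f (x, y)) mD)); exact: i2.
  by rewrite H0//; under eq_fun do rewrite mul0r mulr0; exact: L0.
- move=> x; have [Dx|nDx] := pselect (D x).
    rewrite H1// mul1r (le_trans _ (fg _ Dx))// (Rintegral_indic E) le_eqVlt; apply/orP; left; apply/eqP.
    apply: eq_Rintegral => y _; rewrite /h /= H1// mul1r normrM; congr (_ * _).
    by rewrite indicE ger0_norm.
  rewrite H0// mul0r (_ : Rintegral _ _ _ = 0)// -[RHS](mul0r (fine (mu setT))) -Rintegral_cst//.
  by apply: eq_Rintegral => y _; rewrite /h /= H0// mul0r normr0.
move=> j1 j2 j3; split.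
- by apply: (proj2 (L1_indic _ mE)); move: j1; apply: eq_integrable => // y _ /=; rewrite I2.
- by apply: (proj2 (L1_indic _ mD)); move: j2; apply: eq_integrable => // y _ /=; rewrite I1.
rewrite (Rintegral_indic D) (Rintegral_indic E).
transitivity (\int[mu]_x \int[mu]_y h (x, y)); first by apply: eq_Rintegral => x _; rewrite I1.
by rewrite j3; apply: eq_Rintegral => y _; rewrite I2.
Qed.

End Fubini.

(** * The substitution y -> 1/y *)

Section Inversion.
Context {R : realType}.
Local Notation mu := (@lebesgue_measure R).
Local Notation L1 D f := (mu.-integrable D (EFin \o f)).
Local Notation pos := (`]0, +oo[%classic : set R).

Let w (y : R) : R := \1_pos y / y.

Let w0 y : 0 <= w y.
Proof.
rewrite /w indicE; case: (boolP (y \in pos)); last by rewrite mul0r.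
by rewrite inE /= in_itv/= andbT => y0; rewrite divr_ge0// ltW.
Qed.

Let mw : measurable_fun setT w.
Proof. by apply: measurable_funM; [exact: measurable_indic|apply: measurable_funV; exact: measurable_id]. Qed.

Let wscale a y : 0 < a -> w (a * y) = a^-1 * w y.
Proof.
move=> a0; rewrite /w !indicE invfM.
rewrite (_ : (a * y \in pos) = (y \in pos)); first by rewrite mulrCA.
by apply/idP/idP; rewrite !inE /= !in_itv/= !andbT pmulr_rgt0.
Qed.

Let haar (a : R) (f : R -> R) : 0 < a -> measurable_fun setT f -> (forall x, 0 <= f x) ->
  (\int[mu]_y (w y * f (a * y))%:E = \int[mu]_y (w y * f y)%:E)%E.
Proof.
move=> a0 mf f0.
have a1 : 0 <= a^-1 by rewrite invr_ge0 ltW.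
have := @ge0_integral_scale R a (fun y => (w y * f y)%:E) setT a0 measurableT.
rewrite preimage_setT => /(_ _ _)/wrap[].
  by apply/measurable_EFinP; exact: measurable_funM.
  by move=> x; rewrite lee_fin mulr_ge0.
move=> H.
have E : (\int[mu]_y (w (a * y) * f (a * y))%:E =
   a^-1%:E * \int[mu]_y (w y * f (a * y))%:E)%E.
  rewrite -ge0_integralZl//.
  - by apply: eq_integral => y _; rewrite wscale// -mulrA EFinM.
  - apply/measurable_EFinP; apply: measurable_funM => //; apply: (measurableT_comp mf).
    exact: measurable_funM.
  - by move=> y _; rewrite lee_fin mulr_ge0.
have := congr1 (fun z => (a%:E * z)%E) H; rewrite /= E !muleA -!EFinM mulfV ?gt_eqF// !mul1e.
by [].
Qed.

(** Group-theoretic rather than differential: dy/y is invariant under scaling ([haar]), and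
    inversion preserves an invariant measure of a commutative group. Tonelli and scaling turn
    [J h * J k] into [J h * I k], and a suitable h allows the common factor to be cancelled. *)
Lemma ge0_integral_inv (f : R -> R) : measurable_fun setT f -> (forall x, 0 <= f x) ->
  (\int[mu]_(y in pos) (y ^- 2 * f y^-1)%:E = 1%:E * \int[mu]_(y in pos) (f y)%:E)%E.
Proof.
move=> mf f0; rewrite mul1e.
have H0 y : 0 < y -> \1_pos y = 1 :> R by move=> y0; rewrite indicE mem_set//= in_itv/= andbT.
have mul_id (k : R -> R) : measurable_fun setT k -> measurable_fun setT (k \o GRing.inv).
  by move=> mk; apply: measurableT_comp => //; exact: measurable_invr.
pose I (k : R -> R) := (\int[mu]_y (w y * k y)%:E)%E.
pose J (k : R -> R) := (\int[mu]_y (w y * k y^-1)%:E)%E.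
have key (h k : R -> R) : measurable_fun setT h -> measurable_fun setT k ->
    (forall x, 0 <= h x) -> (forall x, 0 <= k x) -> (J h * J k = J h * I k)%E.
  move=> mh mk h0 k0.
  have P (u v : R -> R) (c : \bar R) : measurable_fun setT u -> (forall x, 0 <= u x) -> (0 <= c)%E ->
      (\int[mu]_y ((u y)%:E * c) = (\int[mu]_y (u y)%:E) * c)%E.
    move=> mu0 u0 c0; rewrite [RHS]muleC -ge0_integralZl//.
    - by apply: eq_integral => y _; rewrite muleC.
    - exact/measurable_EFinP.
    - by move=> y _; rewrite lee_fin.
  have Jk0 : (0 <= J k)%E by apply: integral_ge0 => y _; rewrite lee_fin mulr_ge0.
  have Jh0 : (0 <= J h)%E by apply: integral_ge0 => y _; rewrite lee_fin mulr_ge0.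
  have mwk : measurable_fun setT (fun x : R => w x * k x^-1).
    by apply: measurable_funM => //; exact: mul_id.
  have mwh : measurable_fun setT (fun x : R => w x * h x^-1).
    by apply: measurable_funM => //; exact: mul_id.
  (* substitute x -> x / y, exchange, then y -> x * y, exchange, then x -> x / y *)
  have S1 : (J h * J k = \int[mu]_y \int[mu]_x ((w y * h y^-1) * (w x * k (y / x)))%:E)%E.
    rewrite /J -(P _ (fun=> 0) _ mwh)//; last by move=> y; rewrite mulr_ge0.
    apply: eq_integral => y _.
    have [y0|y0] := ltP 0 y; last first.
      have wy : w y = 0 by rewrite /w indicE memNset ?mul0r//= in_itv/= andbT; apply/negP; rewrite -leNgt.
      rewrite wy !mul0r mul0e (_ : (fun x : R => _) = cst 0%E) ?integral0//.
      by apply/funext => x; rewrite !mul0r.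
    under [RHS]eq_integral do rewrite EFinM.
    rewrite ge0_integralZl//; last 3 first.
    - apply/measurable_EFinP; apply: measurable_funM => //; apply: (measurableT_comp mk).
      by apply: measurable_funM => //; exact: measurable_invr.
    - by move=> x _; rewrite lee_fin mulr_ge0.
    - by rewrite lee_fin mulr_ge0.
    congr (_ * _)%E.
    rewrite -(@haar y^-1 (fun x => k x^-1)) ?invr_gt0//; last exact: mul_id.
    by apply: eq_integral => x _; rewrite invfM invrK.
  have mF : measurable_fun setT (fun z : R * R => ((w z.1 * h z.1^-1) * (w z.2 * k (z.1 / z.2)))%:E).
    apply/measurable_EFinP; apply: measurable_funM.
      by apply: (measurableT_comp mwh); exact: measurable_fst.
    apply: measurable_funM; first by apply: (measurableT_comp mw); exact: measurable_snd.
    by apply: (measurableT_comp mk); meas.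
  have pF z : (0 <= ((w z.1 * h z.1^-1) * (w z.2 * k (z.1 / z.2)))%:E)%E by rewrite lee_fin; apply: mulr_ge0; apply: mulr_ge0.
  rewrite {}S1; apply: (eq_trans (@fubini_tonelli _ _ _ _ R mu mu _ mF pF)).
  have S2 : (\int[mu]_x \int[mu]_y ((w y * h y^-1) * (w x * k (y / x)))%:E =
     \int[mu]_x \int[mu]_y ((w y * k y) * (w x * h (x * y)^-1))%:E)%E.
    apply: eq_integral => x _.
    have [x0|x0] := ltP 0 x; last first.
      have wx : w x = 0 by rewrite /w indicE memNset ?mul0r//= in_itv/= andbT; apply/negP; rewrite -leNgt.
      by rewrite wx; apply: eq_integral => y _; rewrite !mul0r !mulr0.
    under eq_integral do rewrite -mulrA.
    rewrite -(@haar x (fun y => h y^-1 * (w x * k (y / x)))) //.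
    - apply: eq_integral => y _; congr EFin; rewrite [x * y / x]mulrAC mulfV ?gt_eqF// mul1r.
      by rewrite [h _ * _]mulrC [w x * k y]mulrC !mulrA.
    - apply: measurable_funM; first exact: mul_id.
      apply: measurable_funM => //; apply: (measurableT_comp mk); exact: measurable_funM.
    - by move=> y; apply: mulr_ge0 => //; apply: mulr_ge0.
  apply: (eq_trans S2).
  have mG : measurable_fun setT (fun z : R * R => ((w z.2 * k z.2) * (w z.1 * h (z.1 * z.2)^-1))%:E).
    apply/measurable_EFinP; apply: measurable_funM.
      by apply: measurable_funM; apply: measurableT_comp => //; exact: measurable_snd.
    apply: measurable_funM; first by apply: (measurableT_comp mw); exact: measurable_fst.
    by apply: (measurableT_comp mh); meas.
  have pG z : (0 <= ((w z.2 * k z.2) * (w z.1 * h (z.1 * z.2)^-1))%:E)%E by rewrite lee_fin; apply: mulr_ge0; apply: mulr_ge0.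
  apply: (eq_trans (@fubini_tonelli _ _ _ _ R mu mu _ mG pG)); rewrite [RHS]muleC /I -(P _ (fun=> 0)); last 3 first.
  - exact: measurable_funM.
  - by move=> y; rewrite mulr_ge0.
  - exact: Jh0.
  apply: eq_integral => y _.
  have [y0|y0] := ltP 0 y; last first.
    have wy : w y = 0 by rewrite /w indicE memNset ?mul0r//= in_itv/= andbT; apply/negP; rewrite -leNgt.
    rewrite wy !mul0r mul0e (_ : (fun x : R => _) = cst 0%E) ?integral0//.
    by apply/funext => x; rewrite !mul0r.
  under eq_integral do rewrite EFinM /=.
  rewrite ge0_integralZl; last 4 first.
  - exact: measurableT.
  - apply/measurable_EFinP; apply: measurable_funM => //; apply: (measurableT_comp mh).
    apply: measurable_funV; exact: measurable_funM.
  - by move=> x _; rewrite lee_fin mulr_ge0.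
  - by rewrite lee_fin mulr_ge0.
  congr (_ * _)%E.
  rewrite /J -(@haar y (fun x => h x^-1)); [|exact: y0|exact: mul_id|by move=> x; exact: h0].
  by apply: eq_integral => x _; rewrite [x * y]mulrC.
(* Cancellation requires [J h] finite and nonzero; for this h the bounds [hE] on [1/2, 1] give 1/4
   <= [J h] <= 1. *)
pose h : R -> R := \1_`[1, 2].
have mh : measurable_fun setT h by exact: measurable_indic.
have h0 x : 0 <= h x by rewrite /h indicE.
have hE x : (2^-1 * \1_`[2^-1, 1] x <= w x * h x^-1 <= 2 * \1_`[2^-1, 1] x).
  rewrite /h indicE /w !indicE /=; have [x0|x0] := ltP 0 x; last first.
    rewrite [x \in pos]memNset ?mul0r; last by rewrite /= in_itv/= andbT; apply/negP; rewrite -leNgt.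
    rewrite memNset; first by rewrite /= !mulr0 lexx.
    by rewrite /= in_itv/=; apply/negP; rewrite negb_and -ltNge; apply/orP; left; lra.
  rewrite [x \in pos]mem_set/= ?in_itv/= ?andbT// mul1r.
  have -> : (x^-1 \in `[1, 2]%classic) = (x \in (`[2^-1, 1]%classic : set R)).
    apply/idP/idP; rewrite !inE /= !in_itv/= => /andP[A B].
      by rewrite -[x]invrK invf_le1 ?invr_gt0// A andbT lef_pV2// ?posrE ?invr_gt0.
    rewrite invf_ge1// B/= -[2%:R]invrK lef_pV2 ?posrE ?invr_gt0//; lra.
  case: (boolP (x \in _)); last by rewrite !mulr0 lexx.
  rewrite inE /= in_itv/= => /andP[A B]; rewrite !mulr1; apply/andP; split.
    by rewrite (@le_trans _ _ 1)//; [lra|rewrite invf_ge1].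
  by rewrite -[2]invrK lef_pV2 ?posrE ?invr_gt0//; lra.
have I12 (c : R) : 0 <= c -> (\int[mu]_x (c * \1_(`[2^-1, 1]) x)%:E = (c / 2)%:E)%E.
  move=> c0; under eq_integral do rewrite EFinM.
  rewrite ge0_integralZl//.
  - have L : mu `[2^-1, 1]%classic = (1 - 2^-1 : R)%:E.
      by rewrite lebesgue_measure_itv/= lte_fin ifT//; lra.
    transitivity (mule c%:E (mu `[2^-1, 1]%classic)); first by rewrite integral_indic ?setIT.
    by rewrite L -EFinM; congr EFin; field.
  - by apply/measurable_EFinP; exact: measurable_indic.
have Jh1 : ((1/4)%:E <= J h)%E.
  rewrite (_ : 1/4 = 2^-1 / 2); last by field.
  rewrite -(I12 2^-1) ?invr_ge0//.
  apply: ge0_le_integral => //.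
  - by apply/measurable_EFinP; apply: measurable_funM => //; exact: measurable_indic.
  - by apply/measurable_EFinP; apply: measurable_funM => //; exact: mul_id.
  - by move=> x _; rewrite lee_fin; case/andP: (hE x).
have Jh2 : (J h <= 1%:E)%E.
  rewrite (_ : (1:R) = 2 / 2); last by field.
  rewrite -I12//.
  apply: ge0_le_integral => //.
  - by move=> x _; rewrite lee_fin mulr_ge0.
  - by apply/measurable_EFinP; apply: measurable_funM => //; exact: mul_id.
  - by apply/measurable_EFinP; apply: measurable_funM => //; exact: measurable_indic.
  - by move=> x _; rewrite lee_fin; case/andP: (hE x).
have Jhf : J h \is a fin_num.
  rewrite ge0_fin_numE; first exact: (le_lt_trans Jh2 (ltry _)).
  by apply: (le_trans _ Jh1); rewrite lee_fin; lra.
(* The factor y compensates the density 1/y: [I k] is the integral of f and [J k] that of y^-2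
   f(1/y). *)
pose k (y : R) := \1_pos y * (y * f y).
have mk : measurable_fun setT k.
  by apply: measurable_funM; [exact: measurable_indic|apply: measurable_funM].
have k0 x : 0 <= k x.
  rewrite /k indicE; case: (boolP (x \in _)); last by rewrite mul0r.
  by rewrite inE /= in_itv/= andbT => x0; rewrite mul1r mulr_ge0// ltW.
have := key h k mh mk h0 k0.
rewrite -(fineK Jhf) => E.
have fJ : 0 < fine (J h) by rewrite -lte_fin fineK// (lt_le_trans _ Jh1)// lte_fin; lra.
have {}E : J k = I k.
  have := congr1 (fun z => ((fine (J h))^-1%:E * z)%E) E.
  by rewrite /= !muleA -!EFinM mulVf ?gt_eqF// !mul1e.
rewrite [RHS]integral_mkcond [LHS]integral_mkcond.
transitivity (J k); [|rewrite E]; apply: eq_integral => y _; rewrite patchE /k /w.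
  case: ifPn => [|/negP]; rewrite inE /= in_itv/= andbT => y0.
    rewrite !H0 ?invr_gt0// !mul1r; congr EFin.
    by rewrite mulrA -expr2 -exprVn.
  rewrite (_ : \1_pos y = 0) ?mul0r//.
  by rewrite indicE memNset//= in_itv/= andbT.
case: ifPn => [|/negP]; rewrite inE /= in_itv/= andbT => y0.
  by rewrite !H0// !mul1r mulrA mulVf ?mul1r// gt_eqF.
rewrite (_ : \1_pos y = 0) ?mul0r//.
by rewrite indicE memNset//= in_itv/= andbT.
Qed.

Lemma L1_inv (f : R -> R) : measurable_fun setT f -> L1 pos f ->
  L1 pos (fun y => y ^- 2 * f y^-1) /\
  \int[mu]_(y in pos) (y ^- 2 * f y^-1) = \int[mu]_(y in pos) f y.
Proof.
move=> mf i.
have mj : measurable_fun setT (fun y : R => y ^- 2) by apply: measurable_funV; meas.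
have [i1 i2] := @L1_transfer _ pos pos _ (fun y => y ^- 2) 1 f (measurable_itv _) (measurable_itv _) ler01
  (fun x _ => ltac:(by rewrite invr_ge0 sqr_ge0)) measurable_invr mj ge0_integral_inv mf i.
by split=> //; rewrite i2 mul1r.
Qed.

End Inversion.

(** * Powers and derivatives *)

Section Power.
Context {R : realType}.
Local Notation mu := (@lebesgue_measure R).
Local Notation L1 D f := (mu.-integrable D (EFin \o f)).
Local Notation pos := (`]0, +oo[%classic : set R).

(** In exponential form the rules in the exponent ([pw0], [pwD], [pwN]) hold without any sign
    condition on y. *)
Definition pw (a y : R) : R := expR (a * ln y).

Lemma pw_eq (a b y : R) : a = b -> pw a y = pw b y. Proof. by move=> ->. Qed.

Lemma pw_ge0 a y : 0 <= pw a y. Proof. exact: expR_ge0. Qed.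
Lemma pw0 y : pw 0 y = 1. Proof. by rewrite /pw mul0r expR0. Qed.
Lemma pw1 y : 0 < y -> pw 1 y = y. Proof. by move=> y0; rewrite /pw mul1r lnK. Qed.
Lemma pwD a b y : pw (a + b) y = pw a y * pw b y. Proof. by rewrite /pw mulrDl expRD. Qed.
Lemma pwN a y : pw (- a) y = (pw a y)^-1. Proof. by rewrite /pw mulNr expRN. Qed.
Lemma pwB a b y : pw (a - b) y = pw a y / pw b y. Proof. by rewrite pwD pwN. Qed.
Lemma pw_1 a : pw a 1 = 1. Proof. by rewrite /pw ln1 mulr0 expR0. Qed.
Lemma pwM a x y : 0 < x -> 0 < y -> pw a (x * y) = pw a x * pw a y.
Proof. by move=> x0 y0; rewrite /pw lnM// mulrDr expRD. Qed.
Lemma pwV a y : 0 < y -> pw a y^-1 = pw (- a) y.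
Proof. by move=> y0; rewrite /pw lnV// mulrN mulNr. Qed.
Lemma pw2 y : 0 < y -> pw 2 y = y ^+ 2.
Proof. by move=> y0; rewrite -[2]/(1 + 1) pwD pw1// expr2. Qed.
Lemma pw_ler a b y : 1 <= y -> a <= b -> pw a y <= pw b y.
Proof. by move=> y1 ab; rewrite ler_expR ler_wpM2r// ln_ge0. Qed.
Lemma ler_pw a x y : 0 <= a -> 0 < x -> x <= y -> pw a x <= pw a y.
Proof. by move=> a0 x0 xy; rewrite ler_expR ler_wpM2l// ler_ln// posrE (lt_le_trans x0). Qed.
Lemma ger_pw a x y : a <= 0 -> 0 < x -> x <= y -> pw a y <= pw a x.
Proof. by move=> a0 x0 xy; rewrite ler_expR ler_wnM2l// ler_ln// posrE (lt_le_trans x0). Qed.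

Lemma measurable_pw a : measurable_fun setT (pw a).
Proof. by rewrite /pw; meas. Qed.

Lemma is_derive_pw (a y : R) : 0 < y -> is_derive y 1 (pw a) (a * pw (a - 1) y).
Proof.
move=> y0.
have h2 : is_derive y 1 (fun z : R => a * ln z) (a * y^-1).
  exact: (is_derive_eq (is_deriveZ _ (is_derive1_ln y0))).
apply: (is_derive_eq (is_derive1_comp _ _)).
by rewrite pwB pw1// /pw mulrCA.
Qed.

Lemma continuous_pw (a y : R) : 0 < y -> {for y, continuous (pw a)}.
Proof.
move=> y0; apply: differentiable_continuous; apply/derivable1_diffP.
by have [] := is_derive_pw a y0.
Qed.

Lemma pw_cvg0 b : b < 0 -> pw b x @[x --> +oo] --> 0.
Proof.
move=> b0; apply/cvgrPdist_le => e e0; near=> x.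
rewrite sub0r normrN ger0_norm ?pw_ge0//.
have x0 : expR (ln e / b) < x by near: x; exact: nbhs_pinfty_gt.
rewrite -[e]lnK// ler_expR -[_ <= _](@ler_ndivrMl _ b)//.
by rewrite mulrC -[_ / b]expRK ler_ln ?posrE ?expR_gt0// ?ltW//.
Unshelve. all: by end_near. Qed.

Lemma L1_pw_infty a : a < -1 -> L1 `[1, +oo[ (pw a).
Proof.
move=> a1; apply/integrableP; split.
  by apply/measurable_EFinP/measurable_funTS; exact: measurable_pw.
have -> : (\int[mu]_(x in `[1%R, +oo[) `|(EFin \o pw a) x| = \int[mu]_(x in `[1%R, +oo[) (pw a x)%:E)%E.
  by apply: eq_integral => x _ /=; rewrite ger0_norm ?pw_ge0.
have a0 : a + 1 != 0 by lra.
have dF (x : R) : 0 < x -> is_derive x 1 (fun x : R => (a + 1)^-1 * pw (a + 1) x) (pw a x).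
  move=> x0; have h := is_derive_pw (a + 1) x0.
  apply: (is_derive_eq (is_deriveZ _ h)).
  by rewrite /GRing.scale/= mulrA mulVf// mul1r addrK.
rewrite (@ge0_continuous_FTC2y _ (pw a) (fun x => (a + 1)^-1 * pw (a + 1) x) 1 ((a + 1)^-1 * 0)).
- by rewrite -EFinD ltry.
- by move=> x _; exact: pw_ge0.
- apply: continuous_in_subspaceT => x; rewrite inE /= in_itv/= andbT => x1.
  by apply: continuous_pw; lra.
- by apply: cvgM; [exact: cvg_cst|apply: pw_cvg0; lra].
- by move=> x x1; have [] := dF x (lt_trans ltr01 x1).
- apply: cvg_at_right_filter.
  by apply: cvgM; [exact: cvg_cst|apply: continuous_pw].
- move=> x; rewrite in_itv/= andbT => x1.
  by rewrite derive1E; have [_ ->] := dF x (lt_trans ltr01 x1).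
Qed.

Lemma L1_setU (D E : set R) (f : R -> R) : measurable D -> measurable E ->
  measurable_fun setT f -> L1 D f -> L1 E f -> L1 (D `|` E) f.
Proof.
move=> mD mE mf iD iE.
have iD' := proj1 (L1_indic _ mD) (L1_norm iD).
have iE' := proj1 (L1_indic _ mE) (L1_norm iE).
apply: (proj2 (L1_indic _ (measurableU _ _ mD mE))).
apply: (@L1_le _ setT measurableT _ (fun x => \1_D x * `|f x| + \1_E x * `|f x|)).
- by apply: measurable_funM => //; apply: measurable_indic; exact: measurableU.
- move=> x _; rewrite normrM !indicE in_setU.
  case: (x \in D); case: (x \in E); rewrite /= ?normr1 ?normr0 ?mul1r ?mul0r ?addr0 ?add0r//.
  by rewrite lerDl.
- exact: L1D.
Qed.

Lemma pos_split (x : R) : 0 < x -> pos = `]0, x]%classic `|` `]x, +oo[%classic.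
Proof. by move=> x0; rewrite -itv_bndbnd_setU// bnd_simp ltW. Qed.

Lemma L1_pos (x : R) (f : R -> R) : 0 < x -> measurable_fun setT f ->
  L1 `]0, x] f -> L1 `]x, +oo[ f -> L1 pos f.
Proof. by move=> x0 mf i1 i2; rewrite (pos_split x0); exact: L1_setU. Qed.

Lemma Rintegral_split (a x : R) (f : R -> R) : a <= x -> L1 `]a, +oo[ f ->
  \int[mu]_(y in `]a, +oo[) f y = \int[mu]_(y in `]a, x]) f y + \int[mu]_(y in `]x, +oo[) f y.
Proof.
move=> ax; have -> : `]a, +oo[%classic = `]a, x]%classic `|` `]x, +oo[%classic :> set R.
  by rewrite -itv_bndbnd_setU// bnd_simp.
move=> i; rewrite Rintegral_setU//; apply/disj_setPS => y [/=].
by rewrite !in_itv/= andbT => /andP[_ A] B; move: (lt_le_trans B A); rewrite ltxx.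
Qed.

(** Inversion reduces integrability at 0 to integrability at infinity: y^a on ]0, 1] corresponds to
    y^(-a-2) on [1, oo[. *)
Lemma L1_pw_0 a : -1 < a -> L1 `]0, 1] (pw a).
Proof.
move=> a1.
pose f (y : R) := \1_(`[1, +oo[) y * pw (- a - 2) y.
have mf : measurable_fun setT f.
  by apply: measurable_funM; [exact: measurable_indic|exact: measurable_pw].
have if1 : L1 pos f.
  apply: L1_sub (measurable_itv _) measurableT _ _ => //.
  by apply: (proj1 (L1_indic _ (measurable_itv _))); apply: L1_pw_infty; lra.
have [i _] := L1_inv mf if1.
have := @L1_sub _ `]0, 1]%classic pos _ (measurable_itv _) (measurable_itv _) _ i.
move=> /(_ _)/wrap[|].
  by move=> x /=; rewrite !in_itv/= => /andP[-> _].
apply: eq_integrable => // x; rewrite inE /= in_itv/= => /andP[x0 x1].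
congr EFin; rewrite /f indicE mem_set/= ?in_itv/= ?andbT ?invf_ge1// mul1r pwV// -pw2//.
by rewrite -pwN -pwD; apply: pw_eq; ring.
Qed.

Lemma L1_oneDsqr : L1 setT (fun x : R => (1 + x ^+ 2)^-1).
Proof.
have p (x : R) : 0 < 1 + x ^+ 2 by rewrite ltr_wpDr ?sqr_ge0.
apply/integrableP; split; first by apply/measurable_EFinP; meas.
have -> : (\int[mu]_x `|(EFin \o (fun x : R => ((1 + x ^+ 2)^-1)%R)) x| = \int[mu]_x ((oneDsqr x)^-1)%:E)%E.
  by apply: eq_integral => x _ /=; rewrite ger0_norm// invr_ge0 ltW.
rewrite (@ge0_symfun_integralT _ (fun x => (oneDsqr x)^-1)).
- have -> : [set x : R | 0 <= x] = `[0, +oo[%classic.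
    by apply/seteqP; split => x /=; rewrite in_itv/= andbT.
  by rewrite integral0y_oneDsqr -EFinM ltry.
- by move=> x; rewrite invr_ge0 ltW// p.
- exact: continuous_oneDsqrV.
- by move=> x /=; rewrite /oneDsqr sqrrN.
Qed.

End Power.

(** * Elementary calculus and Abel means of the sawtooth series *)

Section Calculus.
Context {R : realType}.
Implicit Types (f g : R -> R) (x : R).

(* [is_derive] is a class; this wrapper keeps unresolved derivatives as goals. *)
Definition der_at f x (d : R) : Prop := is_derive x (1 : R) f d.

Lemma der_eq f x (d d' : R) : der_at f x d -> d = d' -> der_at f x d'.
Proof. by move=> h <-. Qed.

Lemma der_cst x (c : R) : der_at (fun=> c) x 0.
Proof. exact: is_derive_cst. Qed.

Lemma der_id x : der_at (fun z => z) x 1.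
Proof. exact: is_derive_id. Qed.

Lemma derD f g x (df dg : R) : der_at f x df -> der_at g x dg ->
  der_at (fun z => f z + g z) x (df + dg).
Proof. exact: is_deriveD. Qed.

Lemma derN f x (df : R) : der_at f x df -> der_at (fun z => - f z) x (- df).
Proof. exact: is_deriveN. Qed.

Lemma derB f g x (df dg : R) : der_at f x df -> der_at g x dg ->
  der_at (fun z => f z - g z) x (df - dg).
Proof. exact: is_deriveB. Qed.

Lemma derM f g x (df dg : R) : der_at f x df -> der_at g x dg ->
  der_at (fun z => f z * g z) x (df * g x + f x * dg).
Proof.
move=> h1 h2; apply: (@der_eq _ _ (f x *: dg + g x *: df)).
  exact: (is_deriveM h1 h2).
by rewrite /GRing.scale/= addrC mulrC.
Qed.

Lemma derX f x (df : R) n : der_at f x df ->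
  der_at (fun z => f z ^+ n) x (n%:R * f x ^+ n.-1 * df).
Proof.
move=> h; elim: n => [|n IH].
  apply: (@der_eq _ _ 0); last by rewrite !mul0r.
  by under eq_fun do rewrite expr0; exact: der_cst.
under eq_fun do rewrite exprS.
apply: (der_eq (derM h IH)); case: n {IH} => [|n] /=; first by rewrite !expr0; ring.
by rewrite -[n.+2]addn1 natrD !exprS; ring.
Qed.

Lemma derV f x (df : R) : f x != 0 -> der_at f x df ->
  der_at (fun z => (f z)^-1) x (- f x ^- 2 * df).
Proof. by move=> h0 h; apply: (is_deriveV h0 h). Qed.

Lemma der_comp f g x (df dg : R) : der_at f (g x) df -> der_at g x dg ->
  der_at (fun z => f (g z)) x (df * dg).
Proof. by move=> h1 h2; exact: (is_derive_eq (is_derive1_comp h1 h2)). Qed.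

Lemma der_cos f x (df : R) : der_at f x df ->
  der_at (fun z => cos (f z)) x (- sin (f x) * df).
Proof. by move=> h; exact: (der_comp (is_derive_cos _) h). Qed.

Lemma der_sin f x (df : R) : der_at f x df ->
  der_at (fun z => sin (f z)) x (cos (f x) * df).
Proof. by move=> h; exact: (der_comp (is_derive_sin _) h). Qed.

Lemma der_atan f x (df : R) : der_at f x df ->
  der_at (fun z => atan (f z)) x ((1 + f x ^+ 2)^-1 * df).
Proof. by move=> h; exact: (der_comp (is_derive1_atan _) h). Qed.

Lemma der_pw (a : R) x : 0 < x -> der_at (fun z => pw a z) x (a * pw (a - 1) x).
Proof. exact: is_derive_pw. Qed.

Lemma der_ln x : 0 < x -> der_at (fun z => ln z) x x^-1.
Proof. exact: is_derive1_ln. Qed.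

Lemma der_sum (I : Type) (s : seq I) (h : I -> R -> R) (dh : I -> R) x :
  (forall i, der_at (h i) x (dh i)) ->
  der_at (fun z => \sum_(i <- s) h i z) x (\sum_(i <- s) dh i).
Proof.
move=> H; elim: s => [|i s IH].
  by under eq_fun do rewrite big_nil; rewrite big_nil; exact: der_cst.
by under eq_fun do rewrite big_cons; rewrite big_cons; exact: derD.
Qed.

Lemma der_continuous f x (df : R) : der_at f x df -> {for x, continuous f}.
Proof.
by move=> [h _]; apply: differentiable_continuous; apply/derivable1_diffP.
Qed.

Lemma mvt (f f' : R -> R) (a b : R) : a <= b ->
  (forall x, a <= x <= b -> der_at f x (f' x)) ->
  exists2 c, a <= c <= b & f b - f a = f' c * (b - a).
Proof.
move=> ab H.
have Hd x : x \in `]a, b[ -> is_derive x (1 : R) f (f' x).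
  by rewrite in_itv/= => /andP[? ?]; apply: H; rewrite !ltW.
have Hc : {within `[a, b], continuous f}.
  by apply: derivable_within_continuous => x; rewrite in_itv/= => hx; have [] := H x hx.
by have [c] := MVT_segment ab Hd Hc; rewrite in_itv/= => hc ->; exists c.
Qed.

(** The induction step of the Taylor bounds for sine and cosine: the difference in each of them has
    the difference in the preceding one as derivative. *)
Lemma ge0_from_derive (f f' : R -> R) : (forall x, der_at f x (f' x)) ->
  f 0 = 0 -> (forall x, 0 <= x -> 0 <= f' x) -> forall x, 0 <= x -> 0 <= f x.
Proof.
move=> H f0 f1 x x0.
have [c /andP[c0 _]] := mvt x0 (fun z _ => H z).
by rewrite f0 !subr0 => ->; rewrite mulr_ge0// f1.
Qed.

Ltac der := repeat first [ exact: der_cst | exact: der_id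
  | apply: der_cos | apply: der_sin | apply: der_atan
  | apply: derX | apply: derM | apply: derB | apply: derD | apply: derN].

Lemma sin_lex x : 0 <= x -> sin x <= x.
Proof.
move=> x0; rewrite -subr_ge0; move: x x0.
apply: (@ge0_from_derive _ (fun x => 1 - cos x)) => [x| |x _].
- by apply: der_eq; [der|ring].
- by rewrite sin0 subrr.
- by rewrite subr_ge0 cos_le1.
Qed.

Lemma cos_lb x : 1 - x ^+ 2 / 2 <= cos x.
Proof.
suff H (y : R) : 0 <= y -> 1 - y ^+ 2 / 2 <= cos y.
  have [x0|x0] := leP 0 x; first exact: H.
  by rewrite -cosN -sqrrN H// oppr_ge0 ltW.
move=> y0; rewrite -subr_ge0; move: y y0.
apply: (@ge0_from_derive _ (fun x => x - sin x)) => [z| |z z0].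
- by apply: der_eq; [der|rewrite /=; field].
- by rewrite cos0; ring.
- by rewrite subr_ge0 sin_lex.
Qed.

Lemma sin_lb x : 0 <= x -> x - x ^+ 3 / 6 <= sin x.
Proof.
move=> x0; rewrite -subr_ge0; move: x x0.
apply: (@ge0_from_derive _ (fun x => cos x - (1 - x ^+ 2 / 2))) => [z| |z z0].
- by apply: der_eq; [der|rewrite /=; field].
- by rewrite sin0; ring.
- by rewrite subr_ge0 cos_lb.
Qed.

Lemma cos_ub x : cos x <= 1 - x ^+ 2 / 2 + x ^+ 4 / 24.
Proof.
suff H (y : R) : 0 <= y -> cos y <= 1 - y ^+ 2 / 2 + y ^+ 4 / 24.
  have [x0|x0] := leP 0 x; first exact: H.
  have := H (- x); rewrite cosN sqrrN (_ : (- x) ^+ 4 = x ^+ 4); last by ring.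
  by apply; rewrite oppr_ge0 ltW.
move=> y0; rewrite -subr_ge0; move: y y0.
apply: (@ge0_from_derive _ (fun x => sin x - (x - x ^+ 3 / 6))) => [z| |z z0].
- by apply: der_eq; [der|rewrite /=; field].
- by rewrite cos0; ring.
- by rewrite subr_ge0 sin_lb.
Qed.

(** The factor is |1 - x e^(it)|^2. The product telescopes because of the recurrence sin((n+2)t) = 2
    cos t sin((n+1)t) - sin(nt). *)
Lemma abel_sum (n : nat) (x t : R) :
  (1 - 2 * x * cos t + x ^+ 2) * \sum_(j < n) x ^+ j * sin (j.+1%:R * t) =
  sin t - x ^+ n * sin (n.+1%:R * t) + x ^+ n.+1 * sin (n%:R * t).
Proof.
elim: n => [|n IH]; first by rewrite big_ord0 mul0r sin0 !mul1r; ring.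
rewrite big_ord_recr/= mulrDr IH.
have E : sin (n.+2%:R * t) = 2 * cos t * sin (n.+1%:R * t) - sin (n%:R * t).
  have -> : n.+2%:R * t = n.+1%:R * t + t by rewrite -[n.+2]addn1 natrD; ring.
  have -> : n%:R * t = n.+1%:R * t - t by rewrite -[n.+1]addn1 natrD; ring.
  by rewrite sinB sinD; ring.
by rewrite E !exprS; ring.
Qed.

Lemma inv_1Dsqr_div (a b : R) : a != 0 -> a ^+ 2 + b ^+ 2 != 0 ->
  (1 + (b / a) ^+ 2)^-1 = a ^+ 2 / (a ^+ 2 + b ^+ 2).
Proof.
move=> a0 ab0; have -> : 1 + (b / a) ^+ 2 = (a ^+ 2 + b ^+ 2) / a ^+ 2 by field.
by rewrite invf_div.
Qed.

(** The arctangent is the imaginary part of -log(1 - r e^(it)). In the derivative with respect to r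
    the full series cancels by [abel_sum], and only terms carrying r^n remain; the mean value
    theorem from 0 to r concludes. *)
Lemma abel_bound (n : nat) (r t : R) : 0 <= r < 1 ->
  `|\sum_(j < n) r ^+ j.+1 * sin (j.+1%:R * t) / j.+1%:R
    - atan (r * sin t / (1 - r * cos t))| <= 2 * r ^+ n / (1 - r) ^+ 2.
Proof.
move=> /andP[r0 r1].
pose f x := \sum_(j < n) x ^+ j.+1 * sin (j.+1%:R * t) / j.+1%:R - atan (x * sin t / (1 - x * cos t)).
pose f' x := (x ^+ n.+1 * sin (n%:R * t) - x ^+ n * sin (n.+1%:R * t)) / (1 - 2 * x * cos t + x ^+ 2).
have c1 : -1 <= cos t <= 1 by rewrite cos_le1 cos_geN1.
have cs : cos t ^+ 2 + sin t ^+ 2 = 1 by exact: cos2Dsin2.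
have P x : 0 <= x <= r -> 0 < 1 - x * cos t by move=> /andP[? ?]; nra.
have Q x : 0 <= x <= r -> (1 - r) ^+ 2 <= 1 - 2 * x * cos t + x ^+ 2.
  by move=> /andP[? ?]; nra.
have Q0 x : 0 <= x <= r -> 0 < 1 - 2 * x * cos t + x ^+ 2.
  by move=> hx; apply: lt_le_trans (Q x hx); rewrite exprn_gt0// subr_gt0.
have D x : 0 <= x <= r -> der_at f x (f' x).
  move=> hx; have p := P _ hx; have q := Q0 _ hx.
  apply: der_eq.
    apply: derB.
      apply: (@der_sum _ _ _ (fun j : 'I_n => x ^+ j * sin (j.+1%:R * t))) => j.
      have k0 : (j.+1%:R : R) != 0 by rewrite pnatr_eq0.
      apply: der_eq; first by der.
      by rewrite /=; field.
    apply: der_atan; apply: derM; first by der.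
    by apply: derV; [rewrite gt_eqF|der].
  have := abel_sum n x t; set S := \sum_(_ < _) _ => E.
  have {}E : S = (sin t - x ^+ n * sin (n.+1%:R * t) + x ^+ n.+1 * sin (n%:R * t)) / (1 - 2 * x * cos t + x ^+ 2).
    by rewrite -E mulrAC mulfV ?mul1r// gt_eqF.
  rewrite E /f'.
  have hd : 1 - 2 * x * cos t + x ^+ 2 = (1 - x * cos t) ^+ 2 + (x * sin t) ^+ 2.
    have -> : (x * sin t) ^+ 2 = x ^+ 2 * (1 - cos t ^+ 2) by rewrite exprMn -cs; ring.
    by ring.
  have nA := lt0r_neq0 p; have nd := lt0r_neq0 q.
  rewrite inv_1Dsqr_div//; last by rewrite -hd.
  rewrite -hd.
  by field; rewrite ?nA ?nd.
have [c hc] := mvt r0 D.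
have -> : f 0 = 0.
  by rewrite /f !mul0r atan0 subr0 big1// => j _; rewrite expr0n/= !mul0r.
rewrite !subr0 -/(f r) => ->.
rewrite normrM (ger0_norm r0) /f' normrM normfV (gtr0_norm (Q0 _ hc)).
have N : `|c ^+ n.+1 * sin (n%:R * t) - c ^+ n * sin (n.+1%:R * t)| <= 2 * r ^+ n.
  have /andP[c0 cr] := hc.
  have B (m : nat) z : (n <= m)%N -> `|c ^+ m * sin z| <= r ^+ n.
    move=> nm; rewrite normrM ger0_norm ?exprn_ge0//.
    have sz : `|sin z| <= 1 by rewrite ler_norml sin_le1 sin_geN1.
    rewrite -[leRHS]mulr1 ler_pM// ?exprn_ge0//.
    apply: (@le_trans _ _ (c ^+ n)); last by rewrite lerXn2r// nnegrE.
    by apply: ler_wiXn2l => //; lra.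
  have h1 := B n.+1 (n%:R * t) (leqnSn n); have h2 := B n (n.+1%:R * t) (leqnn n).
  have h3 := ler_normB (c ^+ n.+1 * sin (n%:R * t)) (c ^+ n * sin (n.+1%:R * t)).
  by apply: (le_trans h3); lra.
have I : (1 - 2 * c * cos t + c ^+ 2)^-1 <= (1 - r) ^- 2.
  by rewrite lef_pV2 ?posrE ?Q0 ?Q// exprn_gt0// subr_gt0.
rewrite -[leRHS]mulr1 ler_pM//; last exact: ltW.
  by rewrite mulr_ge0// invr_ge0 ltW// Q0.
by rewrite ler_pM// invr_ge0 ltW// Q0.
Qed.

Lemma trig_frac (y : R) : sin (2 * pi * y) = sin (2 * pi * fpart y) /\
  cos (2 * pi * y) = cos (2 * pi * fpart y).
Proof.
have E (z : R) (n : nat) : sin (2 * pi * (z + n%:R)) = sin (2 * pi * z) /\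
    cos (2 * pi * (z + n%:R)) = cos (2 * pi * z).
  have -> : 2 * pi * (z + n%:R) = 2 * pi * z + pi *+ 2 *+ n :> R.
    by rewrite -[pi *+ 2]mulr_natl -mulr_natr; ring.
  by rewrite (periodicn (@sinD2pi R)) (periodicn (@cosD2pi R)).
rewrite /Defs.frac; case: (Num.floor y) => n.
  have [e1 e2] := E (y - n%:R) n; rewrite subrK in e1 e2.
  by rewrite e1 e2.
by rewrite NegzE mulrNz opprK; have [-> ->] := E y n.+1.
Qed.

Lemma frac_ge0 (y : R) : 0 <= fpart y.
Proof. by rewrite /Defs.frac subr_ge0 floor_le_tmp. Qed.

Lemma frac_lt1 (y : R) : fpart y < 1.
Proof. by rewrite /Defs.frac ltrBlDl -intrD1 lt_succ_floor. Qed.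

Lemma frac_norm (y : R) : `|fpart y| <= 1.
Proof. by rewrite ger0_norm ?frac_ge0// ltW// frac_lt1. Qed.

(** At radius 1 and t = 2 pi z the quotient of [abel_bound] becomes cot(pi z) = tan(pi/2 - pi z):
    this is how the sawtooth arises. *)
Lemma atan_cot (z : R) : 0 < z < 1 ->
  atan (sin (2 * pi * z) / (1 - cos (2 * pi * z))) = pi / 2 - pi * z.
Proof.
move=> /andP[z0 z1].
have p0 := pi_gt0 R.
have h : pi / 2 - pi * z \in `](- (pi / 2)), (pi / 2)[ by rewrite in_itv/=; apply/andP; split; nra.
rewrite -[RHS]tanK//; congr atan.
have s0 : 0 < sin (pi * z) by apply: sin_gt0_pi; apply/andP; split; nra.
have -> : 2 * pi * z = pi * z + pi * z by ring.
rewrite sinD cosD /tan.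
have -> : sin (pi / 2 - pi * z) = cos (pi * z).
  by rewrite sinB sin_pihalf cos_pihalf; ring.
have -> : cos (pi / 2 - pi * z) = sin (pi * z).
  by rewrite cosB sin_pihalf cos_pihalf; ring.
have cs : cos (pi * z) ^+ 2 + sin (pi * z) ^+ 2 = 1 by exact: cos2Dsin2.
have -> : 1 - (cos (pi * z) * cos (pi * z) - sin (pi * z) * sin (pi * z)) = 2 * sin (pi * z) ^+ 2.
  by rewrite -{1}cs; ring.
by field; rewrite gt_eqF.
Qed.

(** Abel means are preferred to partial sums because the arctangent bounds them uniformly, as
    dominated convergence demands. The radius is 1 - 1/(N+1), and [n N] is so large that truncation
    costs at most 1/(pi (N+1)) <= 1/2; the arctangent contributes the other 1/2 of the bound 1. *)
Lemma sawtooth_approx : exists r : nat -> R, exists n : nat -> nat,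
  [/\ forall N, 0 <= r N < 1, r N @[N --> \oo] --> (1 : R), forall N, (N <= n N)%N,
    forall N y, `|\sum_(j < n N) (- (r N ^+ j.+1 / (pi * j.+1%:R))) * sin (2 * pi * j.+1%:R * y)| <= 1 &
    forall y, fpart y != 0 ->
      \sum_(j < n N) (- (r N ^+ j.+1 / (pi * j.+1%:R))) * sin (2 * pi * j.+1%:R * y) @[N --> \oo] --> fpart y - 2^-1].
Proof.
pose r N : R := 1 - N.+1%:R^-1.
have r01 N : 0 <= r N < 1.
  by rewrite /r subr_ge0 invf_le1// ?ler1n ?ltr0n//= ltrBlDr ltrDl invr_gt0.
have ex N : exists n : nat, (N <= n)%N /\ 2 * r N ^+ n / (1 - r N) ^+ 2 <= N.+1%:R^-1.
  have /andP[r0 r1] := r01 N.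
  have h : `|r N| < 1 by rewrite ger0_norm.
  have := @cvg_geometric R (2 / (1 - r N) ^+ 2) _ h.
  move=> /cvgrPdist_le /(_ N.+1%:R^-1); rewrite invr_gt0 ltr0n => /(_ isT) [k _ hk].
  exists (maxn k N); split; first exact: leq_maxr.
  have := hk (maxn k N) (leq_maxl _ _); rewrite sub0r normrN /geometric/=.
  by apply: le_trans; rewrite (le_trans _ (ler_norm _))// mulrAC.
have [n Hn] := choice ex.
exists r, n.
have p0 := pi_gt0 R.
have pv : 0 <= pi^-1 :> R by rewrite invr_ge0 ltW.
pose t y : R := 2 * pi * y.
have E N y : \sum_(j < n N) (- (r N ^+ j.+1 / (pi * j.+1%:R))) * sin (2 * pi * j.+1%:R * y) =
    - pi^-1 * \sum_(j < n N) r N ^+ j.+1 * sin (j.+1%:R * t y) / j.+1%:R.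
  rewrite mulr_sumr; apply: eq_bigr => j _; rewrite /t.
  have -> : j.+1%:R * (2 * pi * y) = 2 * pi * j.+1%:R * y by ring.
  have : (j.+1%:R : R) != 0 by rewrite pnatr_eq0.
  move: (j.+1%:R : R) (r N ^+ j.+1) => k a k0; have pn := lt0r_neq0 p0.
  by rewrite invfM; ring.
have B N y : `|\sum_(j < n N) (- (r N ^+ j.+1 / (pi * j.+1%:R))) * sin (2 * pi * j.+1%:R * y)
   - (- pi^-1 * atan (r N * sin (t y) / (1 - r N * cos (t y))))| <= pi^-1 * N.+1%:R^-1.
  rewrite E -mulrBr normrM normrN (@ger0_norm _ pi^-1)//.
  rewrite ler_wpM2l//.
  by apply: le_trans (abel_bound _ _ (r01 N)) _; case: (Hn N).
split=> //.
- rewrite -[X in _ --> X]subr0; apply: cvgB; first exact: cvg_cst.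
  exact: cvg_harmonic.
- by move=> N; case: (Hn N).
- move=> N y; have := B N y; set S := \sum_(_ < _) _; set A := atan _ => H.
  have hA : `|A| <= pi / 2.
    by rewrite ler_norml; apply/andP; split; [rewrite ltW// atan_gtNpi2|rewrite ltW// atan_ltpi2].
  have p2 : 2 <= pi :> R by exact: pi_ge2.
  rewrite (_ : S = (S - (- pi^-1 * A)) + (- pi^-1 * A)); last by ring.
  apply: (le_trans (ler_normD _ _)).
  have h1 : pi^-1 * N.+1%:R^-1 <= 2^-1 :> R.
    have q1 : pi^-1 <= 2^-1 :> R by rewrite lef_pV2 ?posrE.
    have q2 : N.+1%:R^-1 <= 1 :> R by rewrite invf_le1 ?ler1n ?ltr0n.
    have q3 : 0 <= N.+1%:R^-1 :> R by rewrite invr_ge0.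
    by apply: (le_trans _ q1); rewrite -[leRHS]mulr1 ler_wpM2l.
  have h2 : `|- pi^-1 * A| <= 2^-1.
    by rewrite normrM normrN (ger0_norm pv) mulrC ler_pdivrMr//; lra.
  by have h3 := le_trans H h1; lra.
- move=> y y0.
  have z01 : 0 < fpart y < 1 by rewrite frac_lt1 lt_neqAle eq_sym y0 frac_ge0.
  have [es ec] := trig_frac y.
  have c1 : 1 - cos (t y) != 0.
    (* Were the denominator 0, the quotient would be 0 by convention and [atan_cot] would force z =
       1/2, where the cosine is -1. *)
    apply/eqP => c1; have := atan_cot z01; rewrite -ec -es -/(t y) c1 invr0 mulr0 atan0 => H.
    have : cos (t y) = 1 by lra.
    have /andP[? ?] := z01.
    have zh : fpart y = 2^-1 by apply: (mulfI (lt0r_neq0 p0)); lra.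
    have : cos (t y) = -1.
      rewrite /t ec zh (_ : 2 * pi * 2^-1 = pi); first exact: cospi.
      by field.
    by lra.
  have L : - pi^-1 * atan (r N * sin (t y) / (1 - r N * cos (t y))) @[N --> \oo] --> fpart y - 2^-1.
    have -> : fpart y - 2^-1 = - pi^-1 * atan (1 * sin (t y) / (1 - 1 * cos (t y))).
      have pn := lt0r_neq0 p0.
      rewrite !mul1r /t es ec atan_cot//; apply: (mulfI pn).
      by rewrite mulrA mulrN mulfV//; lra.
    have r1 : r N @[N --> \oo] --> (1 : R).
      rewrite -[X in _ --> X]subr0; apply: cvgB; first exact: cvg_cst.
      exact: cvg_harmonic.
    apply: cvgM; first exact: cvg_cst.
    apply: (@cvg_comp _ _ _ (fun N => r N * sin (t y) / (1 - r N * cos (t y))) (@atan R)); last first.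
      exact: continuous_atan.
    apply: cvgM; first by apply: cvgM => //; exact: cvg_cst.
    apply: cvgV; first by rewrite mul1r.
    by apply: cvgB; [exact: cvg_cst|apply: cvgM => //; exact: cvg_cst].
  set S := fun N => \sum_(j < n N) _; set A := fun N => _ * atan _ in L.
  have D : S N - A N @[N --> \oo] --> (0 : R).
    apply/cvgr0Pnorm_le => e e0.
    have := @cvg_harmonic R; move=> /cvgr0Pnorm_le /(_ _ e0) [k _ hk].
    exists k => // N /= kN; apply: (le_trans (B N y)); apply: le_trans (hk N kN).
    rewrite /= ger0_norm ?invr_ge0// -[leRHS]mul1r ler_wpM2r ?invr_ge0// invf_le1//.
    by rewrite (@le_trans _ _ 2)// ?ler1n// pi_ge2.
  have -> : S = (fun N => (S N - A N) + A N) by apply/funext => N; rewrite subrK.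
  by rewrite -[X in _ --> X]add0r; exact: cvgD.
Qed.

End Calculus.

(** * Dominated convergence off a countable set *)

Section DominatedConvergence.
Context {R : realType}.
Local Notation mu := (@lebesgue_measure R).
Local Notation L1 D f := (mu.-integrable D (EFin \o f)).

(** The exceptional set E accommodates the jumps of the fractional part, where its Fourier series
    has a different sum. *)
Lemma Rintegral_dct (D E : set R) (F : nat -> R -> R) (f g : R -> R) :
  measurable D -> countable E ->
  (forall n, measurable_fun D (F n)) -> measurable_fun D f -> L1 D g ->
  (forall x, D x -> ~ E x -> F n x @[n --> \oo] --> f x) ->
  (forall n x, D x -> `|F n x| <= g x) ->
  \int[mu]_(x in D) F n x @[n --> \oo] --> \int[mu]_(x in D) f x.
Proof.
move=> mD cE mF mf ig Ff Fg.
have nE : mu.-negligible E.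
  apply/negligibleP; last exact: countable_lebesgue_measure0.
  exact: countable_measurable.
have h1 : {ae mu, forall x, D x -> (EFin \o F n) x @[n --> \oo] --> (EFin \o f) x}.
  apply: negligibleS nE => x /= h; apply: contrapT => nEx; apply: h => Dx.
  by apply: cvg_EFin; [near=> n|exact: Ff].
have h2 : {ae mu, forall x n, D x -> (`|(EFin \o F n) x| <= (EFin \o g) x)%E}.
  by apply: aeW => x n Dx /=; rewrite lee_fin; exact: Fg.
have mF' n : measurable_fun D (EFin \o F n) by exact/measurable_EFinP.
have mf' : measurable_fun D (EFin \o f) by exact/measurable_EFinP.
have [i _ c] := @dominated_convergence _ _ _ mu D mD (fun n => EFin \o F n) (EFin \o f) (EFin \o g) mF' mf' h1 ig h2.
apply: fine_cvg; rewrite fineK; first exact: c.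
exact: integrable_fin_num.
Unshelve. all: by end_near. Qed.

End DominatedConvergence.

(** * Fourier series of the fractional part *)

Section FourierKernels.
Context {R : realType}.
Local Notation mu := (@lebesgue_measure R).
Local Notation L1 D f := (mu.-integrable D (EFin \o f)).
Local Notation pos := (`]0, +oo[%classic : set R).

Lemma RintD (D : set R) (f g : R -> R) : measurable D -> L1 D f -> L1 D g ->
  \int[mu]_(x in D) (f x + g x) = \int[mu]_(x in D) f x + \int[mu]_(x in D) g x.
Proof. by move=> mD i1 i2; exact: (@RintegralD _ _ _ mu D f g mD i1 i2). Qed.

Lemma RintB (D : set R) (f g : R -> R) : measurable D -> L1 D f -> L1 D g ->
  \int[mu]_(x in D) (f x - g x) = \int[mu]_(x in D) f x - \int[mu]_(x in D) g x.
Proof. by move=> mD i1 i2; exact: (@RintegralB _ _ _ mu D f g mD i1 i2). Qed.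

Lemma RintZ (D : set R) (f : R -> R) (k : R) : measurable D -> L1 D f ->
  \int[mu]_(x in D) (k * f x) = k * \int[mu]_(x in D) f x.
Proof. by move=> mD i1; exact: (@RintegralZl _ _ _ mu D f k mD i1). Qed.

Lemma scale_div (b c v : R) n : b != 0 -> c / v ^+ n = b ^+ n * (c / (b * v) ^+ n).
Proof. by move=> b0; rewrite exprMn invfM mulrCA mulVKf// expf_neq0. Qed.

Lemma countable_frac0 (phi : R) : 0 < phi -> countable [set y : R | fpart (phi * y) = 0].
Proof.
move=> p0; apply: (@sub_countable _ _ _ (range (fun m : int => m%:~R / phi : R))).
  apply: subset_card_le => y /= h; exists (Num.floor (phi * y)) => //.
  move/eqP: h; rewrite /Defs.frac subr_eq0 => /eqP <-.
  by rewrite mulrC mulKf// gt_eqF.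
apply: (@sub_countable _ _ _ (setT : set int)); first exact: card_image_le.
exact: countableP.
Qed.

Lemma sin_norm (x : R) : `|sin x| <= 1.
Proof. by rewrite ler_norml sin_le1 sin_geN1. Qed.

Lemma cos_norm (x : R) : `|cos x| <= 1.
Proof. by rewrite ler_norml cos_le1 cos_geN1. Qed.

Lemma L1_sin (D : set R) (a : R) (T : R -> R) : measurable D -> L1 D T ->
  L1 D (fun y => sin (2 * pi * a * y) * T y).
Proof.
move=> mD iT; apply: (@L1_bounded _ _ mD _ _ 1) => //; first by meas.
by move=> x _; exact: sin_norm.
Qed.

Lemma L1_frac (D : set R) (phi : R) (T : R -> R) : measurable D -> L1 D T ->
  L1 D (fun y => fpart (phi * y) * T y).
Proof.
move=> mD iT; apply: (@L1_bounded _ _ mD _ _ 1) => //; first by meas.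
by move=> x _; exact: frac_norm.
Qed.

(** One choice of [b] and [n] serves all D, T and phi. Each [b N j] tends to the true Fourier
    coefficient and N <= [n N], so if only finitely many sine integrals are nonzero the limit is the
    corresponding finite Fourier sum, as [aetaE] exploits. *)
Lemma saw_limit : exists b : nat -> nat -> R, exists n : nat -> nat,
  [/\ forall N, (N <= n N)%N, forall j, b N j @[N --> \oo] --> - (pi * j.+1%:R)^-1 &
    forall (D : set R) (T : R -> R) (phi : R), measurable D -> L1 D T -> 0 < phi ->
    \sum_(j < n N) b N j * \int[mu]_(y in D) (sin (2 * pi * (j.+1%:R * phi) * y) * T y)
      @[N --> \oo] --> \int[mu]_(y in D) ((fpart (phi * y) - 2^-1) * T y)].
Proof.
have [r [n [r01 r1 Nn sB sC]]] := sawtooth_approx (R := R).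
exists (fun N j => - (r N ^+ j.+1 / (pi * j.+1%:R))), n; split=> //.
  move=> j; apply: cvgN; rewrite -[X in _ --> X]mul1r; apply: cvgM; last exact: cvg_cst.
  elim: (j.+1) => [|k IH]; first by under eq_fun do rewrite expr0; exact: cvg_cst.
  have h : r x * r x ^+ k @[x --> \oo] --> (1 * 1 : R) by exact: cvgM.
  rewrite mulr1 in h; rewrite (_ : (fun x => r x ^+ k.+1) = (fun x => r x * r x ^+ k))//.
  by apply/funext => x; exact: exprS.
move=> D T phi mD iT p0.
pose s N y := \sum_(j < n N) (- (r N ^+ j.+1 / (pi * j.+1%:R))) * sin (2 * pi * j.+1%:R * y).
have -> : (fun N => \sum_(j < n N) (- (r N ^+ j.+1 / (pi * j.+1%:R))) *
    \int[mu]_(y in D) (sin (2 * pi * (j.+1%:R * phi) * y) * T y)) =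
    (fun N => \int[mu]_(y in D) (s N (phi * y) * T y)).
  apply/funext => N.
  under eq_bigr => j _ do rewrite -(RintZ _ mD (L1_sin _ mD iT)).
  rewrite -Rintegral_sum//; last first.
    by move=> j; exact: (L1Zl mD _ (L1_sin _ mD iT)).
  apply: eq_Rintegral => y _; rewrite /s mulr_suml; apply: eq_bigr => j _.
  by rewrite [LHS]mulrA; congr (_ * sin _ * _); ring.
have mT := L1_measurable iT.
have ms N : measurable_fun D (s N \o (fun y => phi * y)).
  rewrite /s; apply: (@eq_measurable_fun _ _ _ _ _ (fun y => \sum_(j < n N)
    (- (r N ^+ j.+1 / (pi * j.+1%:R))) * sin (2 * pi * j.+1%:R * (phi * y)))) => //.
  by apply: measurable_sum => j; meas.
apply: (@Rintegral_dct _ _ [set y : R | fpart (phi * y) = 0] _ _ (fun y => `|T y|)) => //.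
- exact: countable_frac0.
- by move=> N; apply: measurable_funM => //; exact: ms.
- by meas.
- exact: L1_norm.
- move=> y Dy ny; apply: cvgM; last exact: cvg_cst.
  by apply: sC; apply/eqP.
- by move=> N y Dy; rewrite normrM -[leRHS]mul1r ler_wpM2r// sB.
Qed.

(** All frequencies of {phi y} - 1/2 are positive multiples of phi, hence at least phi. *)
Lemma saw_orth (D : set R) (T : R -> R) (phi : R) : measurable D -> L1 D T -> 0 < phi ->
  (forall a, phi <= a -> \int[mu]_(y in D) (sin (2 * pi * a * y) * T y) = 0) ->
  \int[mu]_(y in D) ((fpart (phi * y) - 2^-1) * T y) = 0.
Proof.
move=> mD iT p0 H; have [b [n [_ _ C]]] := saw_limit.
have := C D T phi mD iT p0.
have -> : (fun N => \sum_(j < n N) b N j * \int[mu]_(y in D) (sin (2 * pi * (j.+1%:R * phi) * y) * T y)) = cst 0.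
  apply/funext => N; rewrite big1// => j _; rewrite H ?mulr0//.
  by rewrite ler_peMl ?ler1n// ltW.
move=> c; have c0 : (cst 0 : nat -> R) x @[x --> \oo] --> (0 : R) by exact: cvg_cst.
by rewrite -(cvg_lim (@Rhausdorff R) c) (cvg_lim (@Rhausdorff R) c0).
Qed.

Lemma L1_decay2 (D : set R) (f : R -> R) (C : R) : measurable D -> measurable_fun D f ->
  (forall x, D x -> `|f x| * (1 + x ^+ 2) <= C) -> L1 D f.
Proof.
move=> mD mf H; apply: (@L1_le _ _ mD _ (fun x => C * (1 + x ^+ 2)^-1)) => //.
  by move=> x Dx; rewrite ler_pdivlMr ?H// ltr_wpDr ?sqr_ge0.
by apply: L1Zl => //; apply: L1_sub L1_oneDsqr.
Qed.

(** The Fejer kernel 2 sin^2(pi u) / u^2. By homogeneity the same integral at frequency b equals |b|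
    [cfej], so transforms built from it are piecewise linear in the frequency. *)
Definition fej (u : R) : R := (1 - cos (2 * pi * u)) / u ^+ 2.
Definition cfej : R := \int[mu]_(u in pos) fej u.

Lemma measurable_fej : measurable_fun setT fej. Proof. by rewrite /fej; meas. Qed.

Lemma fej_ge0 u : 0 <= fej u.
Proof. by rewrite /fej divr_ge0 ?sqr_ge0// subr_ge0 cos_le1. Qed.

Lemma fej_bound u : fej u * (1 + u ^+ 2) <= 2 * pi ^+ 2 + 2.
Proof.
have [->|u0] := eqVneq u 0.
  by rewrite /fej expr0n/= invr0 mulr0 mul0r addr_ge0// mulr_ge0// sqr_ge0.
have u2 : 0 < u ^+ 2 by rewrite exprn_even_gt0.
rewrite mulrDr mulr1 lerD//; last first.
  by rewrite /fej divfK ?gt_eqF//; have := cos_geN1 (2 * pi * u); lra.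
rewrite /fej ler_pdivrMr//; have := cos_lb (2 * pi * u).
by rewrite (_ : (2 * pi * u) ^+ 2 / 2 = 2 * pi ^+ 2 * u ^+ 2); [lra|field].
Qed.

Lemma L1_fej : L1 pos fej.
Proof.
apply: (@L1_decay2 _ _ (2 * pi ^+ 2 + 2)) => //.
  by apply: measurable_funTS; exact: measurable_fej.
by move=> x _; rewrite ger0_norm ?fej_ge0// fej_bound.
Qed.

Lemma cfej_gt0 : 0 < cfej.
Proof.
have mJ : measurable (`[4^-1, 2^-1]%classic : set R) by exact: measurable_itv.
have i1 : L1 `[4^-1, 2^-1] (fun=> 1 : R).
  apply: (proj2 (L1_indic _ mJ)); apply: (@eq_integrable _ _ _ mu setT _ (EFin \o \1_(`[4^-1, 2^-1]%classic : set R))).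
  - by [].
  - by move=> x _ /=; rewrite mulr1.
  - exact: integrable_indic_itv.
have sub : `[4^-1, 2^-1]%classic `<=` pos.
  by move=> x /=; rewrite !in_itv/= andbT => /andP[h _]; apply: lt_le_trans h; rewrite invr_gt0.
apply: (@lt_le_trans _ _ (\int[mu]_(x in `[4^-1, 2^-1]) (1 : R))).
  have L : mu `[4^-1, 2^-1]%classic = (2^-1 - 4^-1 : R)%:E.
    by rewrite lebesgue_measure_itv/= lte_fin ifT//; lra.
  have -> : \int[mu]_(x in `[4^-1, 2^-1]) (1 : R) = 1 * fine (mu `[4^-1, 2^-1]%classic).
    by rewrite Rintegral_cst.
  by rewrite L/=; lra.
apply: (@le_trans _ _ (\int[mu]_(x in `[4^-1, 2^-1]) fej x)).
  apply: le_Rintegral => //; first exact: L1_sub L1_fej.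
  move=> x /=; rewrite in_itv/= => /andP[x1 x2].
  have c0 : cos (2 * pi * x) <= 0.
    have p0 := pi_gt0 R.
    have -> : 2 * pi * x = pi / 2 + 2 * pi * (x - 4^-1) by field.
    rewrite cosD cos_pihalf sin_pihalf mul0r sub0r mul1r oppr_le0.
    by apply: sin_ge0_pi; apply/andP; split; nra.
  rewrite /fej ler_pdivlMr ?exprn_gt0//; last lra.
  by nra.
rewrite /cfej (Rintegral_indic pos) (Rintegral_indic `[4^-1, 2^-1]).
apply: le_Rintegral => //.
- by apply: (proj1 (L1_indic _ mJ)); exact: L1_sub L1_fej.
- by apply: (proj1 (L1_indic _ (measurable_itv _))); exact: L1_fej.
- move=> x _; rewrite ler_wpM2r ?fej_ge0// !indicE.
  case: (boolP (x \in `[4^-1, 2^-1]%classic)) => [|_]; last by rewrite ler0n.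
  by rewrite inE => /sub h; rewrite mem_set.
Qed.

Lemma fej_scale (b : R) : 0 <= b ->
  L1 pos (fun u => (1 - cos (2 * pi * b * u)) / u ^+ 2) /\
  \int[mu]_(u in pos) ((1 - cos (2 * pi * b * u)) / u ^+ 2) = b * cfej.
Proof.
rewrite le_eqVlt => /predU1P[<-|b0].
  have E : (fun u : R => (1 - cos (2 * pi * 0 * u)) / u ^+ 2) = fun=> 0.
    by apply/funext => u; rewrite mulr0 mul0r cos0 subrr mul0r.
  by rewrite E Rintegral_cst// !mul0r; split=> //; exact: L1_0.
have [i1 i2] := L1_scale b0 measurable_fej L1_fej.
have E u : (1 - cos (2 * pi * b * u)) / u ^+ 2 = b ^+ 2 * fej (b * u).
  by rewrite /fej [2 * pi * (b * u)]mulrA; apply: scale_div; rewrite gt_eqF.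
have -> : (fun u => (1 - cos (2 * pi * b * u)) / u ^+ 2) = (fun u => b ^+ 2 * fej (b * u)).
  by apply/funext.
split; first exact: L1Zl.
by rewrite RintegralZl// i2 mulrA expr2 mulfK// gt_eqF.
Qed.

(** Equal to 2 sin(pi u) (1 - cos(pi u)) / u^2. The coefficients 2 and -1 cancel the linear terms at
    0 and make the sine transform vanish from frequency 1 on. The kernel serves twice: in Poisson
    summation, and to recover the mean of a sum of fractional parts in [frac_sum_tail]. *)
Definition eta (u : R) : R := (2 * sin (pi * u) - sin (2 * pi * u)) / u ^+ 2.

Lemma measurable_eta : measurable_fun setT eta. Proof. by rewrite /eta; meas. Qed.

Lemma eta_bound u : `|eta u| * (1 + u ^+ 2) <= pi ^+ 2 + 4.
Proof.
have [->|u0] := eqVneq u 0.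
  by rewrite /eta expr0n/= invr0 mulr0 normr0 mul0r addr_ge0// sqr_ge0.
have u2 : 0 < u ^+ 2 by rewrite exprn_even_gt0.
have E : 2 * sin (pi * u) - sin (2 * pi * u) = 2 * sin (pi * u) * (1 - cos (pi * u)).
  by rewrite (_ : 2 * pi * u = pi * u + pi * u) ?sinD; ring.
have S := sin_norm (pi * u).
have C0 : 0 <= 1 - cos (pi * u) by rewrite subr_ge0 cos_le1.
have C2 : 1 - cos (pi * u) <= 2 by have := cos_geN1 (pi * u); lra.
have C3 : 1 - cos (pi * u) <= pi ^+ 2 * u ^+ 2 / 2.
  by have := cos_lb (pi * u); rewrite exprMn; lra.
have N : `|2 * sin (pi * u) - sin (2 * pi * u)| <= 2 * (1 - cos (pi * u)).
  rewrite E !normrM (ger0_norm C0) ler_wpM2r// (@ger0_norm _ 2)//.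
  by rewrite -[leRHS]mulr1 ler_wpM2l.
rewrite /eta normrM normfV (gtr0_norm u2) mulrDr mulr1 lerD//.
  by rewrite ler_pdivrMr//; lra.
by rewrite divfK ?gt_eqF//; lra.
Qed.

Lemma L1_eta : L1 pos eta.
Proof.
apply: (@L1_decay2 _ _ (pi ^+ 2 + 4)) => //.
  by apply: measurable_funTS; exact: measurable_eta.
by move=> x _; exact: eta_bound.
Qed.

(* The right-hand side is [cfej] times 2 min(a, 1/2) - min(a, 1), which vanishes for a >= 1. *)
Lemma eta_sine (a : R) : 0 <= a ->
  \int[mu]_(u in pos) (sin (2 * pi * a * u) * eta u) =
  cfej * ((a + 2^-1) - `|a - 2^-1| + (`|a - 1| - (a + 1)) / 2).
Proof.
move=> a0.
pose E b u : R := (1 - cos (2 * pi * b * u)) / u ^+ 2.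
have EN b u : E b u = E `|b| u.
  have [b0|b0] := ger0P b => //.
  by rewrite /E mulrN mulNr cosN.
have iE b : L1 pos (E b).
  have -> : E b = E `|b| by apply/funext => u; exact: EN.
  by have [] := fej_scale (normr_ge0 b).
have IE b : \int[mu]_(u in pos) E b u = `|b| * cfej.
  have [_ <-] := fej_scale (normr_ge0 b).
  by apply: eq_Rintegral => u _; exact: EN.
have H u : sin (2 * pi * a * u) * eta u =
    (E (a + 2^-1) u - E (a - 2^-1) u) + 2^-1 * (E (a - 1) u - E (a + 1) u).
  rewrite /eta /E.
  have -> : 2 * pi * (a + 2^-1) * u = 2 * pi * a * u + pi * u by field.
  have -> : 2 * pi * (a - 2^-1) * u = 2 * pi * a * u - pi * u by field.
  have -> : 2 * pi * (a + 1) * u = 2 * pi * a * u + 2 * pi * u by ring.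
  have -> : 2 * pi * (a - 1) * u = 2 * pi * a * u - 2 * pi * u by ring.
  rewrite !cosD !cosN !sinN.
  by move: (_ ^- 2) (sin _) (sin (pi * u)) (sin (2 * pi * u)) (cos _) (cos _) (cos _) => *; field.
have -> : \int[mu]_(u in pos) (sin (2 * pi * a * u) * eta u) =
   \int[mu]_(u in pos) ((E (a + 2^-1) u - E (a - 2^-1) u) + 2^-1 * (E (a - 1) u - E (a + 1) u)).
  by apply: eq_Rintegral => u _.
have mp : measurable pos by exact: measurable_itv.
have j1 := L1B mp (iE (a + 2^-1)) (iE (a - 2^-1)).
have j2 := L1B mp (iE (a - 1)) (iE (a + 1)).
rewrite (RintD mp j1 (L1Zl mp 2^-1 j2)) (RintZ _ mp j2) !RintB// !IE.
rewrite (@ger0_norm _ (a + 2^-1)) ?(@ger0_norm _ (a + 1)) ?addr_ge0 ?invr_ge0//.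
by field.
Qed.

Lemma eta_sine_ge1 (a : R) : 1 <= a -> \int[mu]_(u in pos) (sin (2 * pi * a * u) * eta u) = 0.
Proof.
move=> a1; rewrite eta_sine; last lra.
by rewrite !ger0_norm; [field|lra|lra].
Qed.

(* Jackson-type kernel: decays like u^-4, with Fourier transform supported in [-1, 1]. *)
Definition jack (u : R) : R := (1 - cos (pi * u)) ^+ 2 / u ^+ 4.

(** The cosine minus its quadratic Taylor polynomial, which makes the quotient by v^4 integrable.
    Scaling shows that frequency b >= 0 contributes b^3 [cjac]. *)
Definition qcos (v : R) : R := cos (2 * pi * v) - 1 + 2 * pi ^+ 2 * v ^+ 2.
Definition cjac : R := \int[mu]_v (qcos v / v ^+ 4).

Lemma qcos_bound v : `|qcos v / v ^+ 4| * (1 + v ^+ 2) <= 2 * pi ^+ 4 / 3 + 2 * pi ^+ 2.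
Proof.
have p0 : 0 <= pi ^+ 4 :> R by rewrite exprn_ge0// pi_ge0.
have [->|v0] := eqVneq v 0.
  rewrite expr0n/= invr0 mulr0 normr0 mul0r addr_ge0// mulr_ge0 ?sqr_ge0//.
    by rewrite mulr_ge0.
have v2 : 0 < v ^+ 2 by rewrite exprn_even_gt0.
have v4 : 0 < v ^+ 4 by rewrite exprn_even_gt0.
have q0 : 0 <= qcos v.
  by rewrite /qcos; have := cos_lb (2 * pi * v); rewrite !exprMn; lra.
have q1 : qcos v <= 2 * pi ^+ 4 / 3 * v ^+ 4.
  by rewrite /qcos; have := cos_ub (2 * pi * v); rewrite !exprMn; lra.
have q2 : qcos v <= 2 * pi ^+ 2 * v ^+ 2.
  by rewrite /qcos; have := cos_le1 (2 * pi * v); lra.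
rewrite ger0_norm; last by rewrite divr_ge0// ltW.
rewrite mulrDr mulr1 lerD//; first by rewrite ler_pdivrMr.
rewrite mulrAC ler_pdivrMr// (_ : v ^+ 4 = v ^+ 2 * v ^+ 2); last by ring.
by rewrite [leRHS]mulrA ler_wpM2r// ltW.
Qed.

Lemma qcos_scale (b : R) : 0 <= b ->
  L1 setT (fun u => qcos (b * u) / u ^+ 4) /\
  \int[mu]_u (qcos (b * u) / u ^+ 4) = b ^+ 3 * cjac.
Proof.
have mq : measurable_fun setT (fun v => qcos v / v ^+ 4) by rewrite /qcos; meas.
have iq : L1 setT (fun v => qcos v / v ^+ 4).
  by apply: (@L1_decay2 _ _ (2 * pi ^+ 4 / 3 + 2 * pi ^+ 2)) => // x _; exact: qcos_bound.
rewrite le_eqVlt => /predU1P[<-|b0].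
  have E : (fun u : R => qcos (0 * u) / u ^+ 4) = fun=> 0.
    apply/funext => u; rewrite /qcos !mul0r mulr0 cos0 subrr expr0n/= mulr0 add0r mul0r//.
  by rewrite E Rintegral_cst// expr0n/= !mul0r; split=> //; exact: L1_0.
have [i1 i2] := L1_scaleT b0 mq iq.
have -> : (fun u => qcos (b * u) / u ^+ 4) = (fun u => b ^+ 4 * (qcos (b * u) / (b * u) ^+ 4)).
  by apply/funext => u; apply: scale_div; rewrite gt_eqF.
split; first exact: (L1Zl measurableT _ i1).
rewrite (RintegralZl _ measurableT i1) i2 /cjac mulrA; congr (_ * _).
by rewrite exprSr mulfK// gt_eqF.
Qed.

Lemma measurable_jack : measurable_fun setT jack. Proof. by rewrite /jack; meas. Qed.

Lemma jack_ge0 u : 0 <= jack u.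
Proof. by rewrite /jack divr_ge0 ?sqr_ge0// exprn_even_ge0. Qed.

Definition Cjack : R := (pi ^+ 2 / 2 + 2) ^+ 2.

Lemma jack_bound u : jack u <= Cjack / (1 + u ^+ 2) ^+ 2.
Proof.
have p : 0 < 1 + u ^+ 2 by rewrite ltr_wpDr ?sqr_ge0.
rewrite ler_pdivlMr ?exprn_gt0//.
have [->|u0] := eqVneq u 0.
  by rewrite /jack expr0n/= invr0 mulr0 mul0r sqr_ge0.
have u2 : 0 < u ^+ 2 by rewrite exprn_even_gt0.
have C0 : 0 <= 1 - cos (pi * u) by rewrite subr_ge0 cos_le1.
have C2 : 1 - cos (pi * u) <= 2 by have := cos_geN1 (pi * u); lra.
have C3 : 1 - cos (pi * u) <= pi ^+ 2 / 2 * u ^+ 2.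
  by have := cos_lb (pi * u); rewrite exprMn; lra.
rewrite (_ : jack u * (1 + u ^+ 2) ^+ 2 = ((1 - cos (pi * u)) / u ^+ 2 * (1 + u ^+ 2)) ^+ 2); last first.
  by rewrite /jack; field.
rewrite lerXn2r ?nnegrE//.
- by rewrite !mulr_ge0 ?invr_ge0// ltW.
- by rewrite addr_ge0// divr_ge0// sqr_ge0.
rewrite mulrDr mulr1 lerD//; first by rewrite ler_pdivrMr.
by rewrite divfK// gt_eqF.
Qed.

Lemma L1_jack : L1 setT jack.
Proof.
apply: (@L1_decay2 _ _ Cjack) => //; first exact: measurable_jack.
move=> x _; rewrite ger0_norm ?jack_ge0//.
have p : 1 <= 1 + x ^+ 2 by rewrite lerDl sqr_ge0.
have p0 : 0 < 1 + x ^+ 2 by lra.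
apply: (@le_trans _ _ (Cjack / (1 + x ^+ 2) ^+ 2 * (1 + x ^+ 2))).
  by rewrite ler_wpM2r ?jack_bound// ltW.
rewrite expr2 invfM mulrA divfK ?gt_eqF// ler_pdivrMr// ler_peMr//.
by rewrite /Cjack sqr_ge0.
Qed.

Lemma jack_even u : jack (- u) = jack u.
Proof. by rewrite /jack mulrN cosN; congr (_ / _); ring. Qed.

(** The product is a fourth central difference of step 1/2 in the frequency, in which the polynomial
    part of [qcos] drops out. For a >= 1 all five nodes are nonnegative, where the integral is a
    cubic polynomial, annihilated by the difference. *)
Lemma jack_cos (a : R) : 1 <= a -> \int[mu]_u (cos (2 * pi * a * u) * jack u) = 0.
Proof.
move=> a1.
pose Q b u := qcos (b * u) / u ^+ 4.
have iQ b : 0 <= b -> L1 setT (Q b) by move=> b0; have [] := qcos_scale b0.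
have IQ b : 0 <= b -> \int[mu]_u (Q b u) = b ^+ 3 * cjac by move=> b0; have [] := qcos_scale b0.
have H u : cos (2 * pi * a * u) * jack u = 4^-1 * (((Q (a + 1) u + Q (a - 1) u) + 6 * Q a u) -
    4 * (Q (a + 2^-1) u + Q (a - 2^-1) u)).
  rewrite /Q /qcos /jack.
  have -> : 2 * pi * ((a + 2^-1) * u) = 2 * pi * a * u + pi * u by field.
  have -> : 2 * pi * ((a - 2^-1) * u) = 2 * pi * a * u - pi * u by field.
  have -> : 2 * pi * ((a + 1) * u) = 2 * pi * a * u + (pi * u + pi * u) by ring.
  have -> : 2 * pi * ((a - 1) * u) = 2 * pi * a * u - (pi * u + pi * u) by ring.
  have -> : 2 * pi * (a * u) = 2 * pi * a * u by ring.
  rewrite !cosD !cosN !sinN !sinD !cosD.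
  have cs : sin (pi * u) ^+ 2 = 1 - cos (pi * u) ^+ 2 by rewrite -(cos2Dsin2 (pi * u)); ring.
  have -> : sin (pi * u) * sin (pi * u) = 1 - cos (pi * u) ^+ 2 by rewrite -expr2.
  by move: (_ ^- 4) (sin _) (cos _) (sin _) (cos _) => *; field.
have a0 : 0 <= a by lra.
have a2 : 0 <= a - 1 by lra.
have a3 : 0 <= a + 1 by lra.
have a4 : 0 <= a + 2^-1 by lra.
have a5 : 0 <= a - 2^-1 by lra.
have -> : \int[mu]_u (cos (2 * pi * a * u) * jack u) = \int[mu]_u (4^-1 * (((Q (a + 1) u + Q (a - 1) u) + 6 * Q a u) -
    4 * (Q (a + 2^-1) u + Q (a - 2^-1) u))).
  by apply: eq_Rintegral => u _.
have j1 : L1 setT (fun u => Q (a + 1) u + Q (a - 1) u) by apply: L1D => //; exact: iQ.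
have j2 : L1 setT (fun u => 6 * Q a u) by apply: L1Zl => //; exact: iQ.
have j3 : L1 setT (fun u => Q (a + 2^-1) u + Q (a - 2^-1) u) by apply: L1D => //; exact: iQ.
have j4 : L1 setT (fun u => 4 * (Q (a + 2^-1) u + Q (a - 2^-1) u)) by exact: (L1Zl measurableT 4 j3).
have j5 : L1 setT (fun u => (Q (a + 1) u + Q (a - 1) u) + 6 * Q a u) by exact: (L1D measurableT j1 j2).
rewrite (RintegralZl _ measurableT (L1B measurableT j5 j4)).
rewrite (RintegralB measurableT j5 j4) (RintegralD measurableT j1 j2) (RintegralZl _ measurableT j3).
rewrite (RintegralZl _ measurableT (iQ _ a0)).
rewrite (RintegralD measurableT (iQ _ a3) (iQ _ a2)) (RintegralD measurableT (iQ _ a4) (iQ _ a5)).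
by rewrite !IQ//; field.
Qed.

Lemma jack_sin (a : R) : \int[mu]_u (sin (2 * pi * a * u) * jack u) = 0.
Proof.
have mf : measurable_fun setT (fun u => sin (2 * pi * a * u) * jack u).
  by apply: measurable_funM; [meas|exact: measurable_jack].
have i : L1 setT (fun u => sin (2 * pi * a * u) * jack u) by apply: L1_sin => //; exact: L1_jack.
have [_ h] := L1_opp mf i.
have : \int[mu]_u (sin (2 * pi * a * - u) * jack (- u)) = - \int[mu]_u (sin (2 * pi * a * u) * jack u).
  rewrite -mulN1r -RintegralZl//; apply: eq_Rintegral => u _.
  by rewrite jack_even mulrN sinN mulNr mulN1r.
by rewrite h; lra.
Qed.

End FourierKernels.

(** * The functional equation *)

Section FunctionalEquation.
Context {R : realType}.
Local Notation mu := (@lebesgue_measure R).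
Local Notation L1 D f := (mu.-integrable D (EFin \o f)).
Local Notation pos := (`]0, +oo[%classic : set R).

(* Re ((al + i be) y^-(sg + i ga)) *)
Definition osc (sg ga al be y : R) : R :=
  pw (- sg) y * (al * cos (ga * ln y) + be * sin (ga * ln y)).

(** With s = sg + i ga this is the vanishing of the integral of {y} y^(-s-1), that is of zeta(s)/s;
    letting [al] and [be] vary covers the real and imaginary parts together. *)
Definition mellin_zero (sg ga : R) : Prop := forall al be : R,
  \int[mu]_(y in pos) (fpart y * osc (sg + 1) ga al be y) = 0.

Lemma measurable_osc sg ga al be : measurable_fun setT (osc sg ga al be).
Proof. by rewrite /osc /pw; meas. Qed.

Lemma osc_bound sg ga al be y : `|osc sg ga al be y| <= (`|al| + `|be|) * pw (- sg) y.
Proof.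
rewrite /osc normrM ger0_norm ?pw_ge0// mulrC ler_wpM2r ?pw_ge0//.
rewrite (le_trans (ler_normD _ _))// !normrM lerD// -[leRHS]mulr1 ler_wpM2l//.
  exact: cos_norm.
exact: sin_norm.
Qed.

Lemma osc_shift (c sg ga al be y : R) : pw c y * osc sg ga al be y = osc (sg - c) ga al be y.
Proof. by rewrite /osc (_ : - (sg - c) = c + - sg); [rewrite pwD mulrA|ring]. Qed.

(** Multiplying al + i be by x^-s gives the complex number with real part [osc sg ga al be x] and
    imaginary part [osc sg ga be (- al) x]. *)
Lemma oscM (sg ga al be x y : R) : 0 < x -> 0 < y -> osc sg ga al be (x * y) =
  osc sg ga (osc sg ga al be x) (osc sg ga be (- al) x) y.
Proof.
move=> x0 y0; by rewrite /osc pwM// lnM// [ga * (_ + _)]mulrDr cosD sinD; ring.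
Qed.

Lemma osc_lin sg ga al be y : osc sg ga al be y = al * osc sg ga 1 0 y + be * osc sg ga 0 1 y.
Proof. by rewrite /osc; ring. Qed.

Lemma oscV (sg ga al be y : R) : 0 < y -> osc sg ga al be y^-1 = osc (- sg) (- ga) al be y.
Proof. by move=> y0; rewrite /osc pwV// lnV// mulrN mulNr opprK. Qed.

(** Near 0 the fractional part is y, which calls for sg < 1; at infinity it is only bounded, which
    calls for sg > 0. *)
Lemma L1_frac_pw (th : R) (sg : R) : 0 < th -> 0 < sg < 1 ->
  L1 pos (fun y => fpart (th * y) * pw (- sg - 1) y).
Proof.
move=> t0 /andP[s0 s1].
have m1 : measurable_fun setT (fun y => fpart y * pw (- sg - 1) y).
  by rewrite /pw; meas.
have i1 : L1 pos (fun y => fpart y * pw (- sg - 1) y).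
  apply: (@L1_pos _ 1) => //.
  - apply: (@L1_le _ _ (measurable_itv _) _ (pw (- sg))).
    + exact: measurable_funTS.
    + move=> y /=; rewrite in_itv/= => /andP[y0 y1].
      have E : pw (- sg) y = y * pw (- sg - 1) y by rewrite -{2}(pw1 y0) -pwD; apply: pw_eq; ring.
      rewrite ger0_norm ?mulr_ge0 ?pw_ge0 ?frac_ge0// E.
      rewrite ler_wpM2r ?pw_ge0// /Defs.frac gerBl ler0z.
      by rewrite floor_ge0 ltW.
    + by apply: L1_pw_0; lra.
  - apply: (@L1_le _ _ (measurable_itv _) _ (pw (- sg - 1))).
    + exact: measurable_funTS.
    + move=> y _; rewrite normrM (@ger0_norm _ (pw _ _)) ?pw_ge0// -[leRHS]mul1r ler_wpM2r ?pw_ge0//.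
      exact: frac_norm.
    + apply: (@L1_sub _ _ `[1, +oo[%classic) => //.
        by move=> y /=; rewrite !in_itv/= !andbT => /ltW.
      by apply: L1_pw_infty; lra.
have [i2 _] := L1_scale t0 m1 i1.
have i3 := L1Zl (measurable_itv _) (pw (sg + 1) th) i2.
move: i3; apply: eq_integrable => // y; rewrite inE /= in_itv/= andbT => y0.
congr EFin; rewrite pwM// mulrCA; congr (_ * _).
by rewrite mulrA -pwD (_ : sg + 1 + (- sg - 1) = 0) ?pw0 ?mul1r//; ring.
Qed.

Lemma L1_frac_osc (th sg ga al be : R) : 0 < th -> 0 < sg < 1 ->
  L1 pos (fun y => fpart (th * y) * osc (sg + 1) ga al be y).
Proof.
move=> t0 s01.
apply: (@L1_le _ _ (measurable_itv _) _ (fun y => (`|al| + `|be|) * (fpart (th * y) * pw (- sg - 1) y))).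
- by apply: measurable_funTS; apply: measurable_funM; [by meas|exact: measurable_osc].
- move=> y _; rewrite normrM ger0_norm ?frac_ge0// mulrCA ler_wpM2l ?frac_ge0//.
  by rewrite -opprD; exact: osc_bound.
- by apply: L1Zl => //; exact: L1_frac_pw.
Qed.

Lemma frac_osc_scale (th sg ga al be : R) : 0 < th -> 0 < sg < 1 ->
  \int[mu]_(y in pos) (fpart (th * y) * osc (sg + 1) ga al be y) =
  th^-1 * \int[mu]_(y in pos) (fpart y * osc (sg + 1) ga
    (osc (sg + 1) ga al be th^-1) (osc (sg + 1) ga be (- al) th^-1) y).
Proof.
move=> t0 s01; set a' := osc _ _ al be _; set b' := osc _ _ be _ _.
have m : measurable_fun setT (fun y => fpart y * osc (sg + 1) ga a' b' y).
  by apply: measurable_funM; [by meas|exact: measurable_osc].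
have i : L1 pos (fun y => fpart y * osc (sg + 1) ga a' b' y).
  by move: (L1_frac_osc ga a' b' ltr01 s01); apply: eq_integrable => // y _; rewrite /= mul1r.
have [_ <-] := L1_scale t0 m i.
apply: eq_Rintegral => y; rewrite inE /= in_itv/= andbT => y0.
by rewrite /a' /b' -oscM ?invr_gt0 ?mulr_gt0// mulKf// gt_eqF.
Qed.

Lemma mellin_zero_scale (sg ga al be th : R) : 0 < sg < 1 -> 0 < th -> mellin_zero sg ga ->
  \int[mu]_(y in pos) (fpart (th * y) * osc (sg + 1) ga al be y) = 0.
Proof. by move=> s01 t0 H; rewrite frac_osc_scale// H mulr0. Qed.

(** [aeta] involves {phi u}, whereas [peta] involves {v / phi}; Poisson summation makes [aeta phi]
    proportional to phi [peta phi]. This exchange of phi and 1/phi is the source of the symmetry s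
    -> 1 - s. *)
Definition aeta (phi : R) : R := \int[mu]_(u in pos) (fpart (phi * u) * eta u).
Definition peta (phi : R) : R := \int[mu]_(v in `]2^-1, 1]) (fpart (v / phi) * v ^- 2).
Local Notation hlf := (`]2^-1, 1]%classic : set R).

Let mpos : measurable pos. Proof. exact: measurable_itv. Qed.
Let mhlf : measurable hlf. Proof. exact: measurable_itv. Qed.

Lemma L1_hlf (f : R -> R) (M : R) : measurable_fun setT f ->
  (forall v, 2^-1 < v <= 1 -> `|f v| <= M) -> L1 hlf f.
Proof.
move=> mf H; apply: (@L1_le _ _ mhlf _ (fun v => M * \1_hlf v)).
- exact: measurable_funTS.
- move=> v hv; rewrite indicE mem_set// mulr1; apply: H.
  by move: hv; rewrite /= in_itv.
- apply: L1Zl => //; apply: (@L1_sub _ _ setT) => //.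
  exact: integrable_indic_itv.
Qed.

Lemma hlf_inv2 (v : R) : 2^-1 < v <= 1 -> 0 <= v ^- 2 <= 4.
Proof.
move=> /andP[v1 v2]; have v0 : 0 < v by apply: lt_trans v1; rewrite invr_gt0.
rewrite invr_ge0 sqr_ge0/= -[4]invrK lef_pV2 ?posrE ?exprn_gt0 ?invr_gt0//.
by nra.
Qed.

(** The tent is a superposition of steps 1_(a <= v). Summed over the multiples a = j phi, j >= 1,
    the steps count the j <= v / phi, and so produce the integer part of v / phi. *)
Lemma tri_integral (a : R) : 0 < a ->
  (a + 2^-1) - `|a - 2^-1| + (`|a - 1| - (a + 1)) / 2 =
  a * \int[mu]_(v in hlf) ((a <= v)%R%:R * v ^- 2).
Proof.
have F (x : R) : 2^-1 <= x <= 1 -> \int[mu]_(v in `]x, 1]) (v ^- 2) = x^-1 - 1.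
  move=> /andP[x1]; rewrite le_eqVlt => /predU1P[->|x2].
    by rewrite set_itv_ge ?bnd_simp// Rintegral_set0 invr1 subrr.
  have x0 : 0 < x by apply: lt_le_trans x1; rewrite invr_gt0.
  have d (v : R) : 0 < v -> der_at (fun v : R => - v^-1) v (v ^- 2).
    move=> v0; apply: der_eq; first by apply: derN; apply: derV; [rewrite gt_eqF|exact: der_id].
    by rewrite mulNr opprK mulr1.
  have cv : {within `[x, 1], continuous (fun v : R => v ^- 2)}.
    apply: continuous_in_subspaceT => v; rewrite inE /= in_itv/= => /andP[xv _].
    have v0 := lt_le_trans x0 xv.
    by apply: cvgV; [rewrite sqrf_eq0 gt_eqF|exact: exprn_continuous].
  rewrite Rintegral_itv_obnd_cbnd; last first.
    apply: (@integrableS _ _ _ mu `[x, 1]%classic) => //.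
      by move=> v /=; rewrite !in_itv/= => /andP[/ltW -> ->].
    by apply: continuous_compact_integrable => //; exact: segment_compact.
  rewrite /Rintegral (@continuous_FTC2 _ _ (fun v => - v^-1))//=.
  - by rewrite invr1; ring.
  - split.
    + by move=> v; rewrite in_itv/= => /andP[xv _]; have [] := d v (lt_trans x0 xv).
    + by apply: cvg_at_right_filter; apply: (der_continuous (d x x0)).
    + by apply: cvg_at_left_filter; apply: (der_continuous (d 1 ltr01)).
  - move=> v; rewrite in_itv/= => /andP[xv _].
    by rewrite derive1E; have [_ ->] := d v (lt_trans x0 xv).
move=> a0.
have [a1|a1] := leP a 2^-1.
  rewrite ler0_norm ?subr_le0// (@ler0_norm _ (a - 1)); last lra.
  rewrite (_ : \int[mu]_(v in hlf) _ = \int[mu]_(v in hlf) (v ^- 2)).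
    rewrite F ?lexx//=; last lra.
    by rewrite invrK; field.
  apply: eq_Rintegral => v; rewrite inE /= in_itv/= => /andP[v1 _].
  by rewrite (le_trans a1 (ltW v1)) mul1r.
rewrite ger0_norm; last lra.
have [a2|a2] := leP a 1.
  rewrite ler0_norm ?subr_le0//.
  have E : \int[mu]_(v in hlf) ((a <= v)%R%:R * v ^- 2) = \int[mu]_(v in `[a, 1]) (v ^- 2).
    rewrite (Rintegral_indic hlf) (Rintegral_indic `[a, 1]).
    apply: eq_Rintegral => v _; rewrite !indicE.
    have -> : (v \in `[a, 1]%classic) = (v \in hlf) && (a <= v).
      apply/idP/idP; rewrite !inE /= !in_itv/=.
        move=> /andP[av v1]; rewrite av andbT mem_set//= in_itv/= v1 andbT.
        exact: lt_le_trans a1 av.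
      by move=> /andP[]; rewrite inE /= in_itv/= => /andP[_ ->] ->.
    by case: (v \in hlf); case: (a <= v); rewrite ?mul0r ?mul1r ?mulr0.
  rewrite E -Rintegral_itv_obnd_cbnd; last first.
    apply: (@L1_sub _ _ hlf) => //.
      by move=> v /=; rewrite !in_itv/= => /andP[h ->]; rewrite andbT (lt_trans a1 h).
    apply: (@L1_hlf _ 4) => [|v hv]; first by meas.
    by have /andP[h1 h2] := hlf_inv2 hv; rewrite ger0_norm.
  rewrite F; last by rewrite (ltW a1).
  by field; rewrite gt_eqF.
rewrite ger0_norm; last lra.
rewrite (_ : \int[mu]_(v in hlf) _ = 0); first by field.
rewrite -[RHS](mul0r (fine (mu hlf))) -Rintegral_cst//.
apply: eq_Rintegral => v; rewrite inE /= in_itv/= => /andP[_ v1].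
by rewrite leNgt (le_lt_trans v1 a2) mul0r.
Qed.

Lemma floor_sum (x : R) (J : nat) : 0 <= x < J%:R ->
  \sum_(j < J) (j.+1%:R <= x)%R%:R = (Num.floor x)%:~R :> R.
Proof.
move=> /andP[x0 xJ].
have f0 : (0 <= Num.floor x)%R by rewrite floor_ge0.
have [n fn] : exists n : nat, Num.floor x = n%:Z by case: (Num.floor x) f0 => // n _; exists n.
have /andP[nx xn] := floor_itv x; rewrite fn in nx xn *.
have nJ : (n < J)%N by rewrite -(ltr_nat R) (le_lt_trans nx).
have -> : \sum_(j < J) (j.+1%:R <= x)%R%:R = \sum_(j < J) (j < n)%N%:R :> R.
  apply: eq_bigr => j _; congr (_%:R); congr nat_of_bool; apply/idP/idP => h.
    by rewrite -ltnS -(ltr_nat R) (le_lt_trans h)// -natr1 -[n%:R]/(n%:Z%:~R) -intrD1.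
  by apply: le_trans nx; rewrite -[(n%:Z)%:~R]/(n%:R) ler_nat.
rewrite -natr_sum -[(n%:Z)%:~R]/(n%:R); congr (_%:R).
rewrite -[RHS](card_ord n) -sum1_card big_mkcond/= (big_ord_widen_cond J (fun=> true) (fun=> 1%N)) 1?ltnW//.
by rewrite [RHS]big_mkcond/=; apply: eq_bigr => j _; case: (j < n)%N.
Qed.

(* Poisson summation for [eta], from the Fourier series of the sawtooth. *)
Lemma aetaE : exists B : R, forall phi, 0 < phi ->
  aeta phi = B + cfej / pi * phi * peta phi.
Proof.
have [b [n [nN bj C]]] := saw_limit (R := R).
pose m0 := \int[mu]_(u in pos) eta u.
exists (m0 / 2 - cfej / pi * \int[mu]_(v in hlf) v^-1) => phi p0.
have ieta : L1 pos eta by exact: L1_eta.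
have A1 : \int[mu]_(y in pos) ((fpart (phi * y) - 2^-1) * eta y) = aeta phi - m0 / 2.
  have i1 := L1_frac phi mpos ieta.
  have i2 := L1Zl mpos 2^-1 ieta.
  rewrite /aeta /m0 [_ / 2]mulrC -(RintZ _ mpos ieta) -(RintB mpos i1 i2).
  by apply: eq_Rintegral => y _; rewrite mulrBl.
pose a (j : nat) : R := j.+1%:R * phi.
have a0 j : 0 < a j by rewrite mulr_gt0.
pose t (x : R) := (x + 2^-1) - `|x - 2^-1| + (`|x - 1| - (x + 1)) / 2.
(* Harmonics of frequency at least 1 are not seen by [eta], so the Fourier series reduces to its
   first J terms. *)
have [J HJ] : exists J : nat, 1 < J%:R * phi.
  exists (Num.bound phi^-1); rewrite -ltr_pdivrMr// mul1r.
  by apply: archi_boundP; rewrite invr_ge0 ltW.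
have t0 j : (J <= j)%N -> t (a j) = 0.
  move=> Jj; have h : 1 <= a j.
    apply: ltW; apply: (lt_le_trans HJ); rewrite ler_wpM2r ?ler_nat ?(ltW p0)//.
    exact: leqW.
  by rewrite /t !ger0_norm; [field|lra|lra].
have := C pos eta phi mpos ieta p0; rewrite A1.
have -> : (fun N => \sum_(j < n N) b N j * \int[mu]_(y in pos) (sin (2 * pi * (j.+1%:R * phi) * y) * eta y)) =
    (fun N => \sum_(j < n N) b N j * (cfej * t (a j))).
  by apply/funext => N; apply: eq_bigr => j _; rewrite (eta_sine (ltW (a0 j))).
move=> C1.
have C2 : \sum_(j < n N) b N j * (cfej * t (a j)) @[N --> \oo] -->
    \sum_(j < J) (- (pi * j.+1%:R)^-1) * (cfej * t (a j)).
  have H : \sum_(j < J) b N j * (cfej * t (a j)) @[N --> \oo] -->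
      \sum_(j < J) (- (pi * j.+1%:R)^-1) * (cfej * t (a j)).
    elim: (J) => [|K IH].
      by under eq_cvg do rewrite big_ord0; rewrite big_ord0; exact: cvg_cst.
    under eq_cvg do rewrite big_ord_recr/=; rewrite big_ord_recr/=.
    by apply: cvgD => //; apply: cvgM; [exact: bj|exact: cvg_cst].
  apply: cvg_trans H; apply: near_eq_cvg; exists J => // N /= JN.
  have JnN := leq_trans JN (nN N).
  rewrite (big_ord_widen_cond _ (fun=> true) (fun j => b N j * (cfej * t (a j))) JnN).
  rewrite big_mkcond/=; apply: eq_bigr => j _; case: ltnP => // Jj.
  by rewrite t0// !mulr0.
have E : aeta phi - m0 / 2 = \sum_(j < J) (- (pi * j.+1%:R)^-1) * (cfej * t (a j)).
  by rewrite -(cvg_lim (@Rhausdorff R) C1) (cvg_lim (@Rhausdorff R) C2).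
have -> : aeta phi = m0 / 2 + (aeta phi - m0 / 2) by ring.
rewrite E.
have E2 : \sum_(j < J) (- (pi * j.+1%:R)^-1) * (cfej * t (a j)) =
    - (cfej / pi * phi) * \sum_(j < J) \int[mu]_(v in hlf) ((a j <= v)%R%:R * v ^- 2).
  rewrite mulr_sumr; apply: eq_bigr => j _; rewrite /t tri_integral//.
  rewrite /a; have : (j.+1%:R : R) != 0 by rewrite pnatr_eq0.
  set I := Rintegral _ _ _; move: I (j.+1%:R : R) => I k k0.
  rewrite invfM; transitivity (- (cfej / pi * phi) * (k^-1 * k) * I); first by ring.
  by rewrite mulVf// mulr1.
have iL (j : 'I_J) : L1 hlf (fun v => (a j <= v)%R%:R * v ^- 2).
  apply: (@L1_hlf _ 4) => [|v hv].
    apply: measurable_funM; last by meas.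
    rewrite (_ : (fun v : R => _) = \1_(`[a j, +oo[%classic)).
      exact: measurable_indic.
    by apply/funext => v; rewrite indicE; congr (_%:R); congr nat_of_bool; apply/idP/idP; rewrite inE /= in_itv/= andbT.
  have /andP[h1 h2] := hlf_inv2 hv; rewrite normrM (@ger0_norm _ (_ ^- 2))// normr_nat.
  by case: (a j <= v); rewrite ?mul1r// mul0r.
rewrite E2 -Rintegral_sum//.
have iv : L1 hlf (fun v => v^-1).
  apply: (@L1_hlf _ 2) => [|v /andP[v1 v2]]; first exact: measurable_invr.
  have v0 : 0 < v by apply: lt_trans v1; rewrite invr_gt0.
  by rewrite ger0_norm ?invr_ge0 ?(ltW v0)// -[2]invrK lef_pV2 ?posrE ?invr_gt0// ltW.
have ip : L1 hlf (fun v => fpart (v / phi) * v ^- 2).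
  apply: (@L1_hlf _ 4) => [|v hv]; first by meas.
  have /andP[h1 h2] := hlf_inv2 hv; rewrite normrM (@ger0_norm _ (_ ^- 2))//.
  by rewrite (le_trans _ h2)// -[leRHS]mul1r ler_wpM2r// frac_norm.
have -> : \int[mu]_(v in hlf) (\sum_(j < J) (a j <= v)%R%:R * v ^- 2) =
    phi^-1 * \int[mu]_(v in hlf) v^-1 - peta phi.
  rewrite -(RintZ _ mhlf iv) /peta -(RintB mhlf (L1Zl mhlf phi^-1 iv) ip).
  apply: eq_Rintegral => v; rewrite inE /= in_itv/= => /andP[v1 v2].
  have v0 : 0 < v by apply: lt_trans v1; rewrite invr_gt0.
  rewrite -mulr_suml.
  have -> : \sum_(j < J) (a j <= v)%R%:R = (Num.floor (v / phi))%:~R :> R.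
    rewrite -(@floor_sum _ J); first by apply: eq_bigr => j _; rewrite ler_pdivlMr.
    by rewrite divr_ge0 ?(ltW v0) ?(ltW p0)//= ltr_pdivrMr// (le_lt_trans v2).
  rewrite /Defs.frac; move: (Num.floor _)%:~R => f.
  by rewrite expr2; field; rewrite !gt_eqF.
rewrite mulrBr mulrA.
have -> : - (cfej / pi * phi) / phi = - (cfej / pi) by rewrite -mulNr mulfK// gt_eqF.
by ring.
Qed.

Lemma frac_small (x : R) : 0 <= x < 1 -> fpart x = x.
Proof.
move=> /andP[x0 x1]; rewrite /Defs.frac (_ : Num.floor x = 0) ?subr0//.
by apply/eqP; rewrite floor_eq x0.
Qed.

Lemma peta_bound (phi : R) : 0 <= peta phi <= 4.
Proof.
have ip : L1 hlf (fun v => fpart (v / phi) * v ^- 2).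
  apply: (@L1_hlf _ 4) => [|v hv]; first by meas.
  have /andP[h1 h2] := hlf_inv2 hv; rewrite normrM (@ger0_norm _ (_ ^- 2))//.
  by rewrite (le_trans _ h2)// -[leRHS]mul1r ler_wpM2r// frac_norm.
rewrite /peta Rintegral_ge0/=; last first.
  by move=> v _; rewrite mulr_ge0 ?frac_ge0// invr_ge0 sqr_ge0.
apply: (@le_trans _ _ (\int[mu]_(v in hlf) (4 : R))).
  apply: le_Rintegral => //.
    by apply: (@L1_hlf _ 4) => // v _; rewrite ger0_norm.
  move=> v /=; rewrite in_itv/= => hv; have /andP[h1 h2] := hlf_inv2 hv.
  by rewrite (le_trans _ h2)// -[leRHS]mul1r ler_wpM2r// ltW// frac_lt1.
have L : mu hlf = (1 - 2^-1 : R)%:E.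
  by rewrite lebesgue_measure_itv/= lte_fin ifT//; lra.
have -> : \int[mu]_(v in hlf) (4 : R) = 4 * fine (mu hlf) by rewrite Rintegral_cst.
by rewrite L/=; lra.
Qed.

(** Letting phi tend to 0 identifies the constant of [aetaE]: {phi u} tends to 0 boundedly, so
    [aeta] tends to 0, and phi [peta phi] does so because [peta] is bounded. *)
Lemma aeta_peta (phi : R) : 0 < phi -> aeta phi = cfej / pi * phi * peta phi.
Proof.
move=> p0; have [B HB] := aetaE; suff B0 : B = 0 by rewrite HB// B0 add0r.
have C1 : aeta n.+1%:R^-1 @[n --> \oo] --> (0 : R).
  have -> : (0 : R) = \int[mu]_(u in pos) (0 : R) by rewrite Rintegral_cst// mul0r.
  apply: (@Rintegral_dct _ _ set0 _ _ (fun u => `|eta u|)) => //.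
  - by move=> n; apply: measurable_funTS; apply: measurable_funM; [meas|exact: measurable_eta].
  - by apply: L1_norm; exact: L1_eta.
  - move=> u; rewrite /= in_itv/= andbT => u0 _.
    have H : n.+1%:R^-1 * u * eta u @[n --> \oo] --> (0 : R).
      rewrite -[X in _ --> X](mul0r (eta u)); apply: cvgM; last exact: cvg_cst.
      rewrite -[X in _ --> X](mul0r u); apply: cvgM; last exact: cvg_cst.
      exact: cvg_harmonic.
    apply: cvg_trans H; apply: near_eq_cvg.
    exists (Num.bound u) => // n /= un; rewrite frac_small//.
    rewrite mulr_ge0 ?invr_ge0 ?(ltW u0)//= mulrC ltr_pdivrMr// mul1r.
    rewrite (lt_le_trans (archi_boundP (ltW u0)))//.
    by rewrite ler_nat (leq_trans un).
  - move=> n u _; rewrite normrM -[leRHS]mul1r ler_wpM2r//; exact: frac_norm.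
have C2 : B + cfej / pi * n.+1%:R^-1 * peta n.+1%:R^-1 @[n --> \oo] --> (0 : R).
  by apply: cvg_trans C1; apply: near_eq_cvg; near=> n; rewrite HB.
have C3 : cfej / pi * n.+1%:R^-1 * peta n.+1%:R^-1 @[n --> \oo] --> (0 : R).
  have H : cfej / pi * 4 * n.+1%:R^-1 @[n --> \oo] --> (0 : R).
    rewrite -[X in _ --> X](mulr0 (cfej / pi * 4)); apply: cvgM; first exact: cvg_cst.
    exact: cvg_harmonic.
  apply: (@squeeze_cvgr _ _ _ _ (fun=> 0) (fun n => cfej / pi * 4 * n.+1%:R^-1)) => //; last exact: cvg_cst.
  near=> n; have /andP[h1 h2] := peta_bound n.+1%:R^-1.
  have c0 : 0 <= cfej / pi :> R by rewrite divr_ge0 ?pi_ge0// ltW// cfej_gt0.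
  have n0 : 0 <= n.+1%:R^-1 :> R by rewrite invr_ge0.
  apply/andP; split; first exact: mulr_ge0 (mulr_ge0 c0 n0) h1.
  by rewrite [leRHS]mulrAC ler_wpM2l//; exact: mulr_ge0 c0 n0.
have C4 : (B + cfej / pi * n.+1%:R^-1 * peta n.+1%:R^-1) - cfej / pi * n.+1%:R^-1 * peta n.+1%:R^-1
    @[n --> \oo] --> (0 - 0 : R) by exact: (cvgB C2 C3).
have C5 : (cst B : nat -> R) n @[n --> \oo] --> (0 - 0 : R).
  by apply: cvg_trans C4; apply: near_eq_cvg; near=> n; rewrite /= addrK.
rewrite subr0 in C5.
rewrite -(cvg_lim (@Rhausdorff R) C5); apply/esym/cvg_lim => //; exact: cvg_cst.
Unshelve. all: by end_near. Qed.

(** The sign of [eta] changes, so positivity is obtained indirectly: at phi = 1 orthogonality to the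
    sawtooth makes the integral equal to 2 [aeta 1], and [peta 1] is visibly positive. *)
Lemma eta_mass : 0 < \int[mu]_(u in pos) eta u.
Proof.
have c0 := @cfej_gt0 R; have p0 := @pi_gt0 R.
have H := @aeta_peta 1 ltr01.
have S := @saw_orth R pos eta 1 mpos L1_eta ltr01 (fun a a1 => eta_sine_ge1 a1).
have E : \int[mu]_(y in pos) ((fpart (1 * y) - 2^-1) * eta y) = aeta 1 - 2^-1 * \int[mu]_(u in pos) eta u.
  have i1 := L1_frac 1 mpos L1_eta.
  have i2 := L1Zl mpos 2^-1 (L1_eta (R := R)).
  rewrite /aeta -(RintZ _ mpos L1_eta) -(RintB mpos i1 i2).
  by apply: eq_Rintegral => y _; rewrite mulrBl.
rewrite S in E.
suff h : 0 < peta 1.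
  have : 0 < aeta 1 by rewrite H mulr1 mulr_gt0// divr_gt0.
  by lra.
have ip : L1 hlf (fun v => fpart (v / 1) * v ^- 2).
  apply: (@L1_hlf _ 4) => [|v hv]; first by meas.
  have /andP[h1 h2] := hlf_inv2 hv; rewrite normrM (@ger0_norm _ (_ ^- 2))//.
  by rewrite (le_trans _ h2)// -[leRHS]mul1r ler_wpM2r// frac_norm.
have L : mu `]2^-1, 3/4]%classic = (3/4 - 2^-1 : R)%:E.
  by rewrite lebesgue_measure_itv/= lte_fin ifT//; lra.
have i2 : L1 `]2^-1, 3/4] (fun=> 2^-1 : R).
  apply: (@L1_sub _ _ hlf) => //.
    by move=> v /=; rewrite !in_itv/= => /andP[-> h]; rewrite (le_trans h)//; lra.
  by apply: (@L1_hlf _ 2^-1) => // v _; rewrite ger0_norm// invr_ge0.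
apply: (@lt_le_trans _ _ (\int[mu]_(v in `]2^-1, 3/4]) (2^-1 : R))).
  have -> : \int[mu]_(v in `]2^-1, 3/4]) (2^-1 : R) = 2^-1 * fine (mu `]2^-1, 3/4]%classic).
    by rewrite Rintegral_cst.
  by rewrite L/=; lra.
rewrite /peta (Rintegral_indic hlf) (Rintegral_indic `]2^-1, 3/4]).
apply: le_Rintegral => //.
- by apply: (proj1 (L1_indic _ (measurable_itv _))).
- by apply: (proj1 (L1_indic _ mhlf)).
- move=> v _; rewrite !indicE; case: (boolP (v \in `]2^-1, 3/4]%classic)) => [|_]; last first.
    by rewrite mul0r !mulr_ge0 ?frac_ge0// invr_ge0 sqr_ge0.
  rewrite inE /= in_itv/= => /andP[v1 v2].
  have v0 : 0 < v by apply: lt_trans v1; rewrite invr_gt0.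
  rewrite mem_set/=; last by rewrite in_itv/= v1 (le_trans v2)//; lra.
  rewrite !mul1r divr1 frac_small; last by apply/andP; split; lra.
  rewrite ler_pdivlMr ?exprn_gt0//; nra.
Qed.

End FunctionalEquation.

(** * Transfer of zeros from s to 1 - s *)

Section Reflection.
Context {R : realType}.
Local Notation mu := (@lebesgue_measure R).
Local Notation L1 D f := (mu.-integrable D (EFin \o f)).
Local Notation pos := (`]0, +oo[%classic : set R).
Local Notation hlf := (`]2^-1, 1]%classic : set R).

Let mpos : measurable pos. Proof. exact: measurable_itv. Qed.
Let mhlf : measurable hlf. Proof. exact: measurable_itv. Qed.

Lemma L1_eq (D : set R) (f g : R -> R) : measurable D -> (forall x, D x -> f x = g x) ->
  L1 D f -> L1 D g.
Proof.
by move=> mD fg; apply: eq_integrable => // x; rewrite inE => Dx /=; rewrite fg.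
Qed.

Lemma Rint_eq0 (D : set R) (f : R -> R) : measurable D -> (forall x, D x -> f x = 0) ->
  \int[mu]_(x in D) f x = 0.
Proof.
move=> mD f0; transitivity (\int[mu]_(x in D) (0 : R)); last by rewrite Rintegral_cst// mul0r.
by apply: eq_Rintegral => x; rewrite inE; exact: f0.
Qed.

Lemma osc_eq (sg sg' ga al be y : R) : sg = sg' -> osc sg ga al be y = osc sg' ga al be y.
Proof. by move=> ->. Qed.

Lemma ftc_oc (F f : R -> R) (a b : R) : a < b ->
  (forall x, a <= x <= b -> der_at F x (f x)) ->
  (forall x, a <= x <= b -> {for x, continuous f}) ->
  L1 `]a, b] f /\ \int[mu]_(x in `]a, b]) f x = F b - F a.
Proof.
move=> ab d c.
have cf : {within `[a, b], continuous f}.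
  by apply: continuous_in_subspaceT => v; rewrite inE /= in_itv/=; exact: c.
have i0 : L1 `[a, b] f.
  by apply: continuous_compact_integrable => //; exact: segment_compact.
have i : L1 `]a, b] f.
  apply: (@L1_sub _ _ `[a, b]%classic) => //.
  by move=> v /=; rewrite !in_itv/= => /andP[/ltW -> ->].
split=> //; rewrite Rintegral_itv_obnd_cbnd// /Rintegral (@continuous_FTC2 _ _ F)//=.
- split.
  + by move=> v; rewrite in_itv/= => /andP[/ltW av /ltW vb]; have [] := d v; rewrite ?av.
  + by apply: cvg_at_right_filter; apply: (der_continuous (d a _)); rewrite lexx ltW.
  + by apply: cvg_at_left_filter; apply: (der_continuous (d b _)); rewrite lexx ltW.
- move=> v; rewrite in_itv/= => /andP[/ltW av /ltW vb].
  by rewrite derive1E; have [|_ ->] := d v; rewrite ?av.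
Qed.

Lemma frac_pw_scale (u sg : R) : 0 < u -> 0 < sg < 1 ->
  \int[mu]_(y in pos) (fpart (u * y) * pw (- sg - 1) y) =
  pw sg u * \int[mu]_(y in pos) (fpart y * pw (- sg - 1) y).
Proof.
move=> u0 s01.
have m1 : measurable_fun setT (fun y : R => fpart y * pw (- sg - 1) y).
  by rewrite /pw; meas.
have i1 : L1 pos (fun y => fpart y * pw (- sg - 1) y).
  by apply: (L1_eq mpos) (L1_frac_pw ltr01 s01) => y _; rewrite mul1r.
have [i2 E] := L1_scale u0 m1 i1.
have -> : pw sg u = pw (sg + 1) u * u^-1.
  by rewrite pwD pw1// mulfK// gt_eqF.
rewrite -mulrA -E -(RintZ _ mpos i2); apply: eq_Rintegral => y; rewrite inE /= in_itv/= andbT => y0.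
rewrite pwM// [RHS]mulrCA; congr (_ * _).
by rewrite mulrA -pwD (_ : sg + 1 + (- sg - 1) = 0) ?pw0 ?mul1r//; ring.
Qed.

Lemma L1_eta_pw (sg : R) : 0 < sg < 1 -> L1 pos (fun u => `|eta u| * pw sg u).
Proof.
move=> /andP[s0 s1].
have m : measurable_fun setT (fun u : R => `|eta u| * pw sg u).
  by apply: measurable_funM; [apply: measurable_fun_normr; exact: measurable_eta|exact: measurable_pw].
have i := L1_norm (L1_eta (R := R)).
apply: (@L1_pos _ 1) => //.
- apply: (@L1_le _ _ (measurable_itv _) _ (fun u => `|eta u|)).
  + exact: measurable_funTS.
  + move=> u; rewrite /= in_itv/= => /andP[u0 u1].
    rewrite normrM normr_id (@ger0_norm _ (pw _ _)) ?pw_ge0// -[leRHS]mulr1 ler_wpM2l//.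
    have := @ler_pw _ sg u 1 (ltW s0) u0 u1; by rewrite pw_1.
  + apply: (@L1_sub _ _ pos) => //.
    by move=> u; rewrite /= !in_itv/= => /andP[->].
- apply: (@L1_le _ _ (measurable_itv _) _ (fun u => (pi ^+ 2 + 4) * pw (sg - 2) u)).
  + exact: measurable_funTS.
  + move=> u; rewrite /= in_itv/= andbT => u1.
    have u0 : 0 < u by apply: lt_trans u1.
    rewrite normrM normr_id (@ger0_norm _ (pw _ _)) ?pw_ge0// [sg - 2]addrC pwD mulrA.
    rewrite ler_wpM2r ?pw_ge0// pwN pw2// ler_pdivlMr ?exprn_gt0//.
    apply: le_trans (eta_bound u); rewrite ler_wpM2l//; lra.
  + apply: L1Zl => //; apply: (@L1_sub _ _ `[1, +oo[%classic) => //.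
      by move=> u; rewrite /= !in_itv/= !andbT => /ltW.
    by apply: L1_pw_infty; lra.
Qed.

(** After exchanging the integrals, the inner one is a Mellin integral of phi -> {phi u}, a
    rescaling of the one that vanishes. *)
Lemma aeta_osc0 (sg ga al be : R) : 0 < sg < 1 -> mellin_zero sg ga ->
  \int[mu]_(phi in pos) (aeta phi * osc (sg + 1) ga al be phi) = 0.
Proof.
move=> s01 Z.
pose f (z : R * R) := fpart (z.2 * z.1) * eta z.1 * osc (sg + 1) ga al be z.2.
pose Z0 := \int[mu]_(y in pos) (fpart y * pw (- sg - 1) y).
pose M := `|al| + `|be|.
have mf : measurable_fun setT f.
  rewrite /f; apply: measurable_funM; first apply: measurable_funM; first by meas.
    by apply: (measurableT_comp measurable_eta); meas.
  by apply: (measurableT_comp (measurable_osc _ _ _ _)); meas.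
have mf' := mf.
have [||||_ _] := @Rfubini_on R pos pos f (fun u => M * Z0 * (`|eta u| * pw sg u)) mpos mpos mf.
- by apply: L1Zl => //; exact: L1_eta_pw.
- move=> u; rewrite /= in_itv/= andbT => u0.
  apply: (L1_eq mpos) (L1Zl mpos (eta u) (L1_frac_osc ga al be u0 s01)) => y _.
  by rewrite /f/= [y * u]mulrC; ring.
- move=> y; rewrite /= in_itv/= andbT => y0.
  apply: (L1_eq mpos) (L1Zl mpos (osc (sg + 1) ga al be y) (L1_frac y mpos (L1_eta (R := R)))) => u _.
  by rewrite /f/= mulrC.
- move=> u; rewrite /= in_itv/= andbT => u0.
  have i := L1_frac_pw u0 s01.
  have -> : M * Z0 * (`|eta u| * pw sg u) = M * `|eta u| * (pw sg u * Z0).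
    by move: M Z0 `|eta u| (pw sg u) => a b c d; ring.
  rewrite -(frac_pw_scale u0 s01) -(RintZ _ mpos i); apply: le_Rintegral => //.
  + apply: L1_norm; apply: (L1_eq mpos) (L1Zl mpos (eta u) (L1_frac_osc ga al be u0 s01)) => x _.
    by rewrite /f/= [x * u]mulrC; ring.
  + exact: L1Zl.
  + move=> y _; rewrite /f/= (normrM (_ * _)) (normrM (fpart _)) (@ger0_norm _ (fpart _)) ?frac_ge0//.
    have h := osc_bound (sg + 1) ga al be y; rewrite -/M opprD in h.
    have f0 := frac_ge0 (u * y); rewrite [y * u]mulrC.
    move: (`|osc _ _ _ _ _|) (pw _ _) (fpart _) h f0 (normr_ge0 (eta u)) => a b c h c0.
    move: `|eta u| => e e0.
    have := ler_wpM2l (mulr_ge0 c0 e0) h; lra.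
move=> E; transitivity (\int[mu]_(y in pos) \int[mu]_(u in pos) f (u, y)); last rewrite -E.
  apply: eq_Rintegral => y _.
  have i := L1_frac y mpos (L1_eta (R := R)).
  rewrite mulrC /aeta -(RintZ _ mpos i).
  by apply: eq_Rintegral => u _; rewrite /f/= mulrC.
apply: (Rint_eq0 mpos) => u; rewrite /= in_itv/= andbT => u0.
  have Z1 := mellin_zero_scale al be s01 u0 Z.
  transitivity (eta u * \int[mu]_(y in pos) (fpart (u * y) * osc (sg + 1) ga al be y)).
    rewrite -(RintZ _ mpos (L1_frac_osc ga al be u0 s01)).
    by apply: eq_Rintegral => y _; rewrite /f/= [y * u]mulrC; ring.
  by rewrite Z1 mulr0.
Qed.

Lemma peta_osc0 (sg ga al be : R) : 0 < sg < 1 -> mellin_zero sg ga ->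
  \int[mu]_(phi in pos) (peta phi * osc sg ga al be phi) = 0.
Proof.
move=> s01 Z; pose k : R := cfej / pi.
have k0 : k != 0 by rewrite gt_eqF// divr_gt0 ?cfej_gt0 ?pi_gt0.
rewrite -[RHS](@aeta_osc0 sg ga (al / k) (be / k) s01 Z).
apply: eq_Rintegral => phi; rewrite inE /= in_itv/= andbT => p0.
rewrite aeta_peta// -/k -(_ : pw 1 phi * osc (sg + 1) ga al be phi = osc sg ga al be phi); last first.
  by rewrite osc_shift addrK.
rewrite pw1// (osc_lin _ _ (al / k)) osc_lin.
move: (osc _ _ _ _ _) (osc _ _ _ _ _) (peta _) => a b c; move: k k0 => k k0.
by field.
Qed.

(** The inversion phi -> 1/phi replaces the exponent sg by 1 - sg; this is where the reflection
    takes place. *)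
Lemma inv_frac_pw (v sg : R) : 0 < v -> 0 < sg < 1 ->
  L1 pos (fun phi => fpart (v / phi) * pw (- sg) phi) /\
  \int[mu]_(phi in pos) (fpart (v / phi) * pw (- sg) phi) =
  \int[mu]_(y in pos) (fpart (v * y) * pw (- (1 - sg) - 1) y).
Proof.
move=> v0 s01; have s01' : 0 < 1 - sg < 1 by lra.
pose k y := fpart (v * y) * pw (- (1 - sg) - 1) y.
have mk : measurable_fun setT k by rewrite /k /pw; meas.
have [i E] := L1_inv mk (L1_frac_pw v0 s01').
have H y : 0 < y -> y ^- 2 * k y^-1 = fpart (v / y) * pw (- sg) y.
  move=> y0; rewrite /k mulrCA; congr (_ * _); rewrite pwV// -pw2// -pwN -pwD.
  by apply: pw_eq; ring.
split.
  by apply: (L1_eq mpos) i => y; rewrite /= in_itv/= andbT; exact: H.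
rewrite -/(k _) -E; apply: eq_Rintegral => y; rewrite inE /= in_itv/= andbT => y0.
by rewrite H.
Qed.

Lemma inv_frac_osc (v sg ga al be : R) : 0 < v -> 0 < sg < 1 ->
  L1 pos (fun phi => fpart (v / phi) * osc sg ga al be phi) /\
  \int[mu]_(phi in pos) (fpart (v / phi) * osc sg ga al be phi) =
  \int[mu]_(y in pos) (fpart (v * y) * osc ((1 - sg) + 1) (- ga) al be y).
Proof.
move=> v0 s01; have s01' : 0 < 1 - sg < 1 by lra.
pose k y := fpart (v * y) * osc ((1 - sg) + 1) (- ga) al be y.
have mk : measurable_fun setT k by apply: measurable_funM; [by meas|exact: measurable_osc].
have [i E] := L1_inv mk (L1_frac_osc (- ga) al be v0 s01').
have H y : 0 < y -> y ^- 2 * k y^-1 = fpart (v / y) * osc sg ga al be y.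
  move=> y0; rewrite /k mulrCA; congr (_ * _); rewrite oscV// opprK -pw2// -pwN osc_shift.
  by apply: osc_eq; ring.
split.
  by apply: (L1_eq mpos) i => y; rewrite /= in_itv/= andbT; exact: H.
rewrite -E; apply: eq_Rintegral => y; rewrite inE /= in_itv/= andbT => y0.
by rewrite H.
Qed.

Lemma continuous_osc (sg ga al be x : R) : 0 < x -> {for x, continuous (osc sg ga al be)}.
Proof.
move=> x0; apply: der_continuous; apply: derM; first exact: der_pw.
apply: derD; apply: derM; [exact: der_cst| |exact: der_cst|].
  by apply: der_cos; apply: derM; [exact: der_cst|exact: der_ln].
by apply: der_sin; apply: derM; [exact: der_cst|exact: der_ln].
Qed.

Lemma der_osc (sg ga al be x : R) : 0 < x ->
  der_at (osc sg ga al be) x (osc (sg + 1) ga (- sg * al + ga * be) (- sg * be - ga * al) x).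
Proof.
move=> x0; apply: der_eq.
  apply: derM; first exact: der_pw.
  apply: derD; apply: derM; [exact: der_cst| |exact: der_cst|].
    by apply: der_cos; apply: derM; [exact: der_cst|exact: der_ln].
  by apply: der_sin; apply: derM; [exact: der_cst|exact: der_ln].
have -> : pw (- sg) x = x * pw (- sg - 1) x.
  by rewrite -{2}(pw1 x0) -pwD; apply: pw_eq; ring.
rewrite /osc (_ : - (sg + 1) = - sg - 1); last by ring.
move: (cos (ga * ln x)) (sin (ga * ln x)) (pw (- sg - 1) x) (ln x) => c s p l.
by field; rewrite gt_eqF.
Qed.

Lemma L1_peta (phi : R) : L1 hlf (fun v => fpart (v / phi) * v ^- 2).
Proof.
apply: (@L1_hlf _ _ 4) => [|v hv]; first by meas.
have /andP[h1 h2] := hlf_inv2 hv; rewrite normrM (@ger0_norm _ (_ ^- 2))//.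
by rewrite (le_trans _ h2)// -[leRHS]mul1r ler_wpM2r// frac_norm.
Qed.

(** This is [peta_osc0] with the definition of [peta] inserted, the integrals exchanged and phi
    inverted. *)
Lemma reflect_fubini (sg ga a b : R) : 0 < sg < 1 -> mellin_zero sg ga ->
  \int[mu]_(v in hlf) (v ^- 2 * \int[mu]_(y in pos) (fpart (v * y) * osc ((1 - sg) + 1) (- ga) a b y)) = 0.
Proof.
move=> s01 Z; have s01' : 0 < 1 - sg < 1 by lra.
have half0 : (0 : R) < 2^-1 by rewrite invr_gt0.
rewrite -[RHS](@peta_osc0 sg ga a b s01 Z).
pose f (z : R * R) := fpart (z.1 / z.2) * z.1 ^- 2 * osc sg ga a b z.2.
pose W0 := \int[mu]_(y in pos) (fpart y * pw (- (1 - sg) - 1) y).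
pose M := `|a| + `|b|.
have mf : measurable_fun setT f.
  rewrite /f; apply: measurable_funM; first by meas.
  by apply: (measurableT_comp (measurable_osc _ _ _ _)); meas.
have ff (v phi : R) : f (v, phi) = v ^- 2 * (fpart (v / phi) * osc sg ga a b phi).
  by rewrite /f/= [RHS]mulrCA mulrA.
have [||||_ _] := @Rfubini_on R hlf pos f (fun v => v ^- 2 * M * (pw (1 - sg) v * W0)) mhlf mpos mf.
- apply: (@L1_hlf _ _ (4 * M * `|W0|)); first by rewrite /pw; meas.
  move=> v hv; have /andP[h1 h2] := hlf_inv2 hv; have /andP[v1 v2] := hv.
  have v0 := lt_trans half0 v1.
  have p0 := pw_ge0 (1 - sg) v.
  have p1 : pw (1 - sg) v <= 1.
    have := @ler_pw _ (1 - sg) v 1 _ v0 v2; rewrite pw_1; apply; lra.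
  rewrite !normrM (@ger0_norm _ M) ?addr_ge0// (@ger0_norm _ (pw _ _))// (@ger0_norm _ (_ ^- 2))//.
  apply: ler_pM => //; rewrite ?mulr_ge0 ?addr_ge0//.
    by rewrite ler_wpM2r// addr_ge0.
  by rewrite -[leRHS]mul1r ler_wpM2r.
- move=> v; rewrite /= in_itv/= => /andP[v1 v2]; have v0 := lt_trans half0 v1.
  have [i _] := inv_frac_osc ga a b v0 s01.
  by apply: (L1_eq mpos) (L1Zl mpos (v ^- 2) i) => y _; rewrite ff.
- move=> phi; rewrite /= in_itv/= andbT => p0.
  apply: (@L1_hlf _ _ (4 * (M * pw (- sg) phi))); first by rewrite /f/=; meas.
  move=> v hv; have /andP[h1 h2] := hlf_inv2 hv.
  rewrite ff normrM (@ger0_norm _ (_ ^- 2))//; apply: ler_pM => //.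
  rewrite normrM -[leRHS]mul1r; apply: ler_pM => //; first exact: frac_norm.
  exact: osc_bound.
- move=> v; rewrite /= in_itv/= => /andP[v1 v2]; have v0 := lt_trans half0 v1.
  have [i _] := inv_frac_osc ga a b v0 s01.
  have [j E] := inv_frac_pw v0 s01.
  rewrite -(frac_pw_scale v0 s01') -E -(RintZ _ mpos j); apply: le_Rintegral => //.
  + by apply: L1_norm; apply: (L1_eq mpos) (L1Zl mpos (v ^- 2) i) => y _; rewrite ff.
  + exact: L1Zl.
  + move=> y _; rewrite ff (normrM (v ^- 2)) (normrM (fpart _)) (@ger0_norm _ (_ ^- 2)) ?invr_ge0 ?sqr_ge0//.
    rewrite -mulrA ler_wpM2l ?invr_ge0 ?sqr_ge0// (@ger0_norm _ (fpart _)) ?frac_ge0//.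
    by rewrite [leRHS]mulrCA ler_wpM2l ?frac_ge0//; exact: osc_bound.
move=> E; transitivity (\int[mu]_(y in pos) \int[mu]_(x in hlf) f (x, y)); last first.
  apply: eq_Rintegral => phi _; rewrite mulrC /peta.
  rewrite -(RintZ _ mhlf (L1_peta phi)).
  by apply: eq_Rintegral => v _; rewrite /f/= mulrC.
rewrite -E; apply: eq_Rintegral => v; rewrite inE /= in_itv/= => /andP[v1 v2].
have v0 := lt_trans half0 v1; have [i <-] := inv_frac_osc ga a b v0 s01.
by rewrite -(RintZ _ mpos i); apply: eq_Rintegral => y _; rewrite ff.
Qed.

(** Scaling out v in [reflect_fubini] leaves a complex product W C = 0, where W is the Mellin
    integral at 1 - s and C is the integral of v^(-s-1) over ]1/2, 1]. As s C = 2^s - 1 is nonzero,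
    W vanishes. [W a b] and [C a b] stand for the real parts after multiplication by a + i b. *)
Theorem mellin_zero_reflect (sg ga : R) : 0 < sg < 1 ->
  mellin_zero sg ga -> mellin_zero (1 - sg) (- ga).
Proof.
move=> s01 Z; have s01' : 0 < 1 - sg < 1 by lra.
have half0 : (0 : R) < 2^-1 by rewrite invr_gt0.
have [W WE] : exists W : R -> R -> R, forall a b,
    \int[mu]_(y in pos) (fpart y * osc ((1 - sg) + 1) (- ga) a b y) = W a b by eexists.
have WL a b : W a b = a * W 1 0 + b * W 0 1.
  have i a' b' : L1 pos (fun y => fpart y * osc ((1 - sg) + 1) (- ga) a' b' y).
    by apply: (L1_eq mpos) (L1_frac_osc (- ga) a' b' ltr01 s01') => y _; rewrite mul1r.
  rewrite -!WE -(RintZ _ mpos (i 1 0)) -(RintZ _ mpos (i 0 1)).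
  rewrite -(RintD mpos (L1Zl mpos a (i 1 0)) (L1Zl mpos b (i 0 1))).
  by apply: eq_Rintegral => y _; rewrite osc_lin; ring.
have iC a b : L1 hlf (osc (sg + 1) ga a b).
  apply: (@L1_hlf _ _ ((`|a| + `|b|) * pw (- (sg + 1)) 2^-1)); first exact: measurable_osc.
  move=> v /andP[v1 v2]; apply: le_trans (osc_bound _ _ _ _ _) _.
  by rewrite ler_wpM2l// ger_pw// ?ltW//; lra.
have [C CE] : exists C : R -> R -> R, forall a b,
    \int[mu]_(v in hlf) osc (sg + 1) ga a b v = C a b by eexists.
have CL a b : C a b = a * C 1 0 + b * C 0 1.
  rewrite -!CE -(RintZ _ mhlf (iC 1 0)) -(RintZ _ mhlf (iC 0 1)).
  rewrite -(RintD mhlf (L1Zl mhlf a (iC 1 0)) (L1Zl mhlf b (iC 0 1))).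
  by apply: eq_Rintegral => y _; rewrite osc_lin; ring.
(* The real part of (a + i b) W C, once v^-2, the scaling factor v^-1 and the v^3 from the
   oscillation cancel. *)
have H a b : W 1 0 * C a b + W 0 1 * C b (- a) = 0.
  rewrite -[RHS](@reflect_fubini sg ga a b s01 Z).
  rewrite -(CE a b) -(CE b (- a)) -(RintZ _ mhlf (iC a b)) -(RintZ _ mhlf (iC b (- a))).
  rewrite -(RintD mhlf (L1Zl mhlf _ (iC a b)) (L1Zl mhlf _ (iC b (- a)))).
  apply: eq_Rintegral => v; rewrite inE /= in_itv/= => /andP[v1 v2]; have v0 := lt_trans half0 v1.
  have E a' b' : osc (1 - sg + 1) (- ga) a' b' v^-1 = pw 3 v * osc (sg + 1) ga a' b' v.
    by rewrite oscV// opprK osc_shift; apply: osc_eq; ring.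
  have p3 : v ^- 2 * v^-1 * pw 3 v = 1.
    rewrite -invfM -exprSr (_ : 3 = 2 + 1 :> R); last by ring.
    by rewrite pwD pw1// pw2// -exprSr mulVf// expf_neq0// gt_eqF.
  rewrite (frac_osc_scale _ _ _ v0 s01') WE !E mulrA (WL (pw 3 v * _)).
  move: (W 1 0) (W 0 1) (osc _ _ a b v) (osc _ _ b (- a) v) => w1 w2 o1 o2.
  move: (v ^- 2 / v) (pw 3 v) p3 => q p p3.
  by rewrite -[LHS]mul1r -p3; ring.
(* The derivative of v^-s is -s v^(-s-1), so this evaluates -s C as 1 - 2^s. *)
have D a b : C (- sg * a + ga * b) (- sg * b - ga * a) = osc sg ga a b 1 - osc sg ga a b 2^-1.
  have [|||_ E] := @ftc_oc (osc sg ga a b) (osc (sg + 1) ga (- sg * a + ga * b) (- sg * b - ga * a)) 2^-1 1.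
  - by rewrite invf_lt1// ltr1n.
  - by move=> x /andP[x1 _]; apply: der_osc; exact: lt_le_trans x1.
  - by move=> x /andP[x1 _]; apply: continuous_osc; exact: lt_le_trans x1.
  by rewrite -CE E.
have H1 := H 1 0; have H2 := H 0 1.
rewrite (CL 0 (-1)) in H1; rewrite (CL 1 (- 0)) in H2.
have D1 := D 1 0; have D2 := D 0 1; rewrite CL in D1; rewrite CL in D2.
have p1 : 1 < pw (- sg) 2^-1.
  rewrite /pw lnV ?posrE// mulrNN -[X in X < _]expR0 ltr_expR; apply: mulr_gt0; first lra.
  by rewrite ln_gt0// ltr1n.
(* C = 0 would give 2^s = 1, against |2^s| = 2^sg > 1. *)
have nz : C 1 0 ^+ 2 + C 0 1 ^+ 2 != 0.
  rewrite paddr_eq0 ?sqr_ge0// !sqrf_eq0; apply/negP => /andP[/eqP c0 /eqP c1].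
  rewrite c0 c1 !mulr0 addr0 /osc pw_1 ln1 mulr0 cos0 sin0 in D1 D2.
  have := cos2Dsin2 (ga * ln 2^-1).
  move: (cos _) (sin _) (pw _ _) D1 D2 p1 => c s p D1 D2 p1 cs.
  have : p ^+ 2 * (c ^+ 2 + s ^+ 2) = 1 by nra.
  rewrite cs; nra.
move=> a b; rewrite WE WL.
move: H1 H2 nz; move: (C 1 0) (C 0 1) (W 1 0) (W 0 1) => c s w1 w2 H1 H2 nz.
(* Multiplication of W C = 0 by the conjugate of C, in coordinates. *)
have E1 : (c ^+ 2 + s ^+ 2) * w1 = 0.
  transitivity (c * (w1 * c + w2 * (0 * c + -1 * s)) + s * (w1 * s + w2 * (1 * c + - 0 * s))); first by ring.
  by rewrite H1 H2 !mulr0 addr0.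
have E2 : (c ^+ 2 + s ^+ 2) * w2 = 0.
  transitivity (c * (w1 * s + w2 * (1 * c + - 0 * s)) - s * (w1 * c + w2 * (0 * c + -1 * s))); first by ring.
  by rewrite H1 H2 !mulr0 subr0.
move/eqP: E1; rewrite mulf_eq0 (negbTE nz)/= => /eqP ->.
by move/eqP: E2; rewrite mulf_eq0 (negbTE nz)/= => /eqP ->; ring.
Qed.

End Reflection.

(** * Tails of band-limited test functions *)

Section TailEstimate.
Context {R : realType}.
Local Notation mu := (@lebesgue_measure R).
Local Notation L1 D f := (mu.-integrable D (EFin \o f)).
Local Notation pos := (`]0, +oo[%classic : set R).
Local Notation far := (`]1, +oo[%classic : set R).

Let mpos : measurable pos. Proof. exact: measurable_itv. Qed.
Let mfar : measurable far. Proof. exact: measurable_itv. Qed.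

Lemma sqr1D_gt0 (y : R) : 0 < 1 + y ^+ 2.
Proof. by rewrite ltr_wpDr ?sqr_ge0. Qed.

Lemma Rint_pos_opp (f : R -> R) : measurable_fun setT f -> L1 setT f ->
  \int[mu]_x f x = \int[mu]_(x in pos) (f x + f (- x)).
Proof.
move=> mf i.
have [io Eo] := L1_opp mf i.
have ip : L1 pos f by apply: L1_sub i.
have iop : L1 pos (fun x => f (- x)) by apply: L1_sub io.
rewrite (RintD mpos ip iop).
have mn : measurable (`]-oo, 0] : set R) by exact: measurable_itv.
pose g x := \1_(`]-oo, 0]) x * f x.
have mg : measurable_fun setT g by apply: measurable_funM => //; exact: measurable_indic.
have ig : L1 setT g by apply/(proj1 (L1_indic _ mn)); apply: L1_sub i.
have [_ Eg] := L1_opp mg ig.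
have -> : \int[mu]_(x in pos) f (- x) = \int[mu]_x g x.
  rewrite -Eg Rintegral_itv_obnd_cbnd; last by apply: L1_sub io.
  rewrite (Rintegral_indic `[0, +oo[); apply: eq_Rintegral => x _; rewrite /g !indicE.
  congr (_%:R * _); congr nat_of_bool; apply/idP/idP; rewrite !inE /= !in_itv/= ?andbT oppr_le0//.
rewrite /g -Rintegral_indic.
have E : (setT : set R) = pos `|` `]-oo, 0]%classic.
  apply/seteqP; split => // x _ /=; rewrite !in_itv/= andbT.
  by case: (ltP 0 x) => h; [left|right].
rewrite {1}E Rintegral_setU -?E//.
apply/disj_setPS => x [/=]; rewrite !in_itv/= andbT => x0 x1.
by move: (lt_le_trans x0 x1); rewrite ltxx.
Qed.

Definition jmass : R := \int[mu]_u jack u.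

Lemma Cjack_ge0 : 0 <= Cjack :> R. Proof. exact: sqr_ge0. Qed.

Lemma jack_weight (u : R) : (1 + u ^+ 2) * jack u <= Cjack / (1 + u ^+ 2).
Proof.
have p := sqr1D_gt0 u; have := jack_bound u.
move: (jack u) (1 + u ^+ 2) p Cjack => j A A0 C h.
apply: (@le_trans _ _ (A * (C / A ^+ 2))); first by rewrite ler_wpM2l// ltW.
by rewrite le_eqVlt; apply/orP; left; apply/eqP; field; rewrite gt_eqF.
Qed.

Lemma jmass_gt0 : 0 < jmass.
Proof.
have p0 := @pi_gt0 R.
have half : (0 : R) < 2^-1 by rewrite invr_gt0.
have L : mu `]2^-1, 1]%classic = (1 - 2^-1 : R)%:E.
  by rewrite lebesgue_measure_itv/= lte_fin ifT//; lra.
apply: (@lt_le_trans _ _ (\int[mu]_(v in `]2^-1, 1]) (1 : R))).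
  have -> : \int[mu]_(v in `]2^-1, 1]) (1 : R) = 1 * fine (mu `]2^-1, 1]%classic).
    by rewrite Rintegral_cst.
  by rewrite L/=; lra.
rewrite /jmass (Rintegral_indic `]2^-1, 1]).
apply: le_Rintegral => //.
- apply: (proj1 (L1_indic _ (measurable_itv _))).
  by apply: (@L1_hlf _ _ 1) => // v _; rewrite normr1.
- exact: L1_jack.
- move=> v _; rewrite indicE mulr1; case: (boolP (v \in `]2^-1, 1]%classic)) => [|_]; last exact: jack_ge0.
  rewrite inE /= in_itv/= => /andP[v1 v2].
  have v0 := lt_trans half v1.
  have c0 : cos (pi * v) <= 0.
    have -> : pi * v = pi * (v - 2^-1) + pi / 2 by field.
    by rewrite cosDpihalf oppr_le0 sin_ge0_pi//; apply/andP; split; nra.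
  rewrite /jack ler_pdivlMr ?exprn_gt0// mul1r.
  have : v ^+ 4 <= 1 by rewrite exprn_ile1// ltW.
  move: (cos _) c0 => c c0; nra.
Qed.

Lemma L1_jack_sub (z : R) : L1 setT (fun y => jack (y - z)).
Proof.
have [i _] := L1_shift (- z) (@measurable_jack R) L1_jack.
by apply: (L1_eq measurableT) i => y _; rewrite addrC.
Qed.

Lemma L1_jack_add (z : R) : L1 setT (fun y => jack (y + z)).
Proof.
have [i _] := L1_shift z (@measurable_jack R) L1_jack.
by apply: (L1_eq measurableT) i => y _; rewrite addrC.
Qed.

Lemma Rint_jack_sub (z : R) : \int[mu]_y jack (y - z) = jmass.
Proof.
have [_ E] := L1_shift (- z) (@measurable_jack R) L1_jack.
by rewrite /jmass -E; apply: eq_Rintegral => y _; rewrite addrC.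
Qed.

(* The odd reflection makes the truncation supported on [0, oo[, where no
   symmetry of the sums of fractional parts is needed. *)
Definition oddjack (y z : R) : R := jack (y - z) - jack (y + z).

Lemma oddjack_norm (y z : R) : `|oddjack y z| <= jack (y - z) + jack (y + z).
Proof.
apply: le_trans (ler_normB _ _) _.
by rewrite (ger0_norm (jack_ge0 (y - z))) (ger0_norm (jack_ge0 (y + z))).
Qed.

Lemma jack_le_cst (u : R) : jack u <= Cjack.
Proof.
have p := sqr1D_gt0 u; have := jack_weight u; have := jack_ge0 u.
have : 0 <= u ^+ 2 by exact: sqr_ge0.
rewrite (ler_pdivlMr _ _ p); move: (u ^+ 2) (jack u) (@Cjack R) => w j C w0 j0; nra.
Qed.

Lemma L1_oddjack (z : R) : L1 pos (fun y => oddjack y z).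
Proof.
have i1 : L1 pos (fun y => jack (y - z)) by apply: L1_sub (L1_jack_sub z).
have i2 : L1 pos (fun y => jack (y + z)) by apply: L1_sub (L1_jack_add z).
exact: (L1B mpos i1 i2).
Qed.

(** Unfolding the odd reflection and translating by z leaves the two Fourier integrals of [jack]:
    the cosine one vanishes for a >= 1, the sine one by parity. *)
Lemma oddjack_sine (a z : R) : 1 <= a ->
  \int[mu]_(y in pos) (sin (2 * pi * a * y) * oddjack y z) = 0.
Proof.
move=> a1; pose f y := sin (2 * pi * a * y) * jack (y - z).
have mf : measurable_fun setT f.
  by apply: measurable_funM; [by meas|apply: (measurableT_comp (@measurable_jack R)); meas].
have i : L1 setT f by apply: L1_sin => //; exact: L1_jack_sub.
transitivity (\int[mu]_(y in pos) (f y + f (- y))).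
  apply: eq_Rintegral => y _; rewrite /f /oddjack mulrN sinN -opprD jack_even; ring.
rewrite -Rint_pos_opp//.
have [_ <-] := L1_shift z mf i.
have ic : L1 setT (fun u => cos (2 * pi * a * u) * jack u).
  apply: (L1_bounded measurableT (M := 1)); [exact: L1_jack|by meas|].
  by move=> x _; exact: cos_norm.
have isin : L1 setT (fun u => sin (2 * pi * a * u) * jack u) by apply: L1_sin => //; exact: L1_jack.
transitivity (\int[mu]_u (sin (2 * pi * a * z) * (cos (2 * pi * a * u) * jack u) +
    cos (2 * pi * a * z) * (sin (2 * pi * a * u) * jack u))).
  apply: eq_Rintegral => u _; rewrite /f mulrDr sinD [z + u]addrC addrK; ring.
rewrite (RintD measurableT (L1Zl measurableT _ ic) (L1Zl measurableT _ isin)).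
by rewrite (RintZ _ measurableT ic) (RintZ _ measurableT isin) jack_cos// jack_sin !mulr0 addr0.
Qed.

Section Truncation.
Variables (psi : R -> R).
Hypotheses (mpsi : measurable_fun setT psi) (ipsi : L1 far psi).

(** The odd extension of psi restricted to ]1, oo[, convolved with the normalised Jackson kernel. *)
Definition trunc (y : R) : R := jmass^-1 * \int[mu]_(z in far) (psi z * oddjack y z).

Lemma L1_psi_jack (h : R -> R) : measurable_fun setT h -> (forall z, `|h z| <= 2 * Cjack) ->
  L1 far (fun z => psi z * h z).
Proof.
move=> mh hb; apply: (L1_eq mfar) (L1_bounded mfar (M := 2 * Cjack) ipsi _ _) => [z _|//|z _//].
- exact: mulrC.
- exact: measurable_funTS.
Qed.

Lemma measurable_oddjack2 (y : R) : measurable_fun setT (fun z => oddjack y z).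
Proof. by apply: measurable_funB; apply: (measurableT_comp (@measurable_jack R)); meas. Qed.

Lemma L1_psi_oddjack (y : R) : L1 far (fun z => psi z * oddjack y z).
Proof.
apply: L1_psi_jack; first exact: measurable_oddjack2.
move=> z; apply: le_trans (oddjack_norm _ _) _.
have := jack_le_cst (y - z); have := jack_le_cst (y + z); move: Cjack => C; lra.
Qed.

Lemma trunc_fubini (w : R -> R) : measurable_fun setT w -> (forall y, `|w y| <= 1) ->
  L1 pos (fun y => w y * trunc y) /\
  \int[mu]_(y in pos) (w y * trunc y) =
  jmass^-1 * \int[mu]_(z in far) (psi z * \int[mu]_(y in pos) (w y * oddjack y z)).
Proof.
move=> mw w1.
pose f (p : R * R) := psi p.1 * (w p.2 * oddjack p.2 p.1).
have mf : measurable_fun setT f.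
  apply: measurable_funM; first by apply: (measurableT_comp mpsi); meas.
  apply: measurable_funM; first by apply: (measurableT_comp mw); meas.
  by apply: measurable_funB; apply: (measurableT_comp (@measurable_jack R)); meas.
have iw z : L1 pos (fun y => w y * oddjack y z).
  apply: (L1_bounded mpos (M := 1)); first exact: L1_oddjack.
    exact: measurable_funTS.
  by move=> y _; exact: w1.
have E y : \int[mu]_(z in far) f (z, y) = jmass * (w y * trunc y).
  rewrite /trunc mulrCA mulVKf ?gt_eqF ?jmass_gt0//.
  rewrite -(RintZ _ mfar (L1_psi_oddjack y)).
  by apply: eq_Rintegral => z _; rewrite /f/= mulrCA.
have [||||i _ F] := @Rfubini_on R far pos f (fun z => 2 * jmass * `|psi z|) mfar mpos mf.
- by apply: L1Zl => //; exact: L1_norm.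
- by move=> z _; exact: (L1Zl mpos (psi z) (iw z)).
- move=> y _; apply: (L1_eq mfar) (L1Zl mfar (w y) (L1_psi_oddjack y)) => z _.
  by rewrite /f/= mulrCA.
- move=> z _; have i1 : L1 pos (fun y => jack (y - z)) by apply: L1_sub (L1_jack_sub z).
  have i2 : L1 pos (fun y => jack (y + z)) by apply: L1_sub (L1_jack_add z).
  have b (h : R -> R) : L1 setT h -> (forall y, 0 <= h y) -> \int[mu]_(y in pos) h y <= \int[mu]_y h y.
    move=> ih h0; rewrite Rintegral_indic; apply: le_Rintegral => //.
      by apply/(proj1 (L1_indic _ mpos)); apply: L1_sub ih.
    by move=> y _; rewrite indicE; case: (y \in _); rewrite ?mul1r ?mul0r.
  apply: (@le_trans _ _ (\int[mu]_(y in pos) (`|psi z| * (jack (y - z) + jack (y + z))))).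
    apply: le_Rintegral => //; first exact: (L1_norm (L1Zl mpos (psi z) (iw z))).
      by apply: L1Zl => //; exact: (L1D mpos i1 i2).
    move=> y _; rewrite (normrM (psi z)) ler_wpM2l// (normrM (w y)) -[leRHS]mul1r.
    by apply: ler_pM => //; exact: oddjack_norm.
  rewrite (RintZ _ mpos (L1D mpos i1 i2)) (RintD mpos i1 i2) [leRHS]mulrC ler_wpM2l// mulrDl !mul1r.
  apply: lerD.
    by rewrite -(Rint_jack_sub z); apply: b => [|y]; [exact: L1_jack_sub|exact: jack_ge0].
  rewrite -(Rint_jack_sub (- z)).
  rewrite (_ : (fun y => jack (y - - z)) = (fun y => jack (y + z))); last by apply/funext => y; rewrite opprK.
  by apply: b => [|y]; [exact: L1_jack_add|exact: jack_ge0].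
have j0 : jmass != 0 by exact: lt0r_neq0 jmass_gt0.
have iT : L1 pos (fun y => w y * trunc y).
  by apply: (L1_eq mpos) (L1Zl mpos jmass^-1 i) => y _; rewrite E mulKf.
split; first exact: iT.
transitivity (jmass^-1 * (jmass * \int[mu]_(y in pos) (w y * trunc y))); first by rewrite (mulKf j0).
congr (_ * _); rewrite -(RintZ _ mpos iT).
transitivity (\int[mu]_(z in far) (\int[mu]_(y in pos) f (z, y))).
  by rewrite F; apply: eq_Rintegral => y _; rewrite E.
by apply: eq_Rintegral => z _; rewrite -(RintZ _ mpos (iw z)).
Qed.

Lemma L1_trunc : L1 pos trunc.
Proof.
have [||i _] := @trunc_fubini (fun=> 1); [by []|by move=> y; rewrite normr1|].
by apply: (L1_eq mpos) i => y _; rewrite mul1r.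
Qed.

Lemma trunc_sine (a : R) : 1 <= a -> \int[mu]_(y in pos) (sin (2 * pi * a * y) * trunc y) = 0.
Proof.
move=> a1; have [||_ ->] := @trunc_fubini (fun y => sin (2 * pi * a * y)).
- by meas.
- by move=> y; exact: sin_norm.
rewrite Rint_eq0 ?mulr0// => z _; by rewrite oddjack_sine// mulr0.
Qed.

Variables (psi' : R -> R) (M : R).
Hypotheses (psiM : forall z, 1 <= z -> `|psi z| <= M)
  (dpsi : forall z, 1 <= z -> der_at psi z (psi' z))
  (psi'M : forall z, 1 <= z -> `|psi' z| <= M / z ^+ 2).

Definition cut (y : R) : R := (1 < y)%R%:R * psi y.

Let M0 : 0 <= M. Proof. by apply: le_trans (psiM (lexx 1)). Qed.

Lemma cut_norm (y : R) : `|cut y| <= M.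
Proof.
rewrite /cut; case: ltP => y1; rewrite ?mul0r ?normr0// mul1r psiM//; exact: ltW.
Qed.

Lemma psi_lipschitz (a y z : R) : 1 <= a -> a <= y -> a <= z ->
  `|psi y - psi z| <= M / a ^+ 2 * `|y - z|.
Proof.
move=> a1; have a0 : 0 < a by apply: lt_le_trans a1.
wlog yz : y z / z <= y => [H ay az|ay az].
  have [zy|/ltW yz] := leP z y; first exact: H.
  by rewrite distrC (distrC y); exact: H.
have [x /andP[x1 _]|c /andP[c1 _] ->] := @mvt _ psi psi' z y yz.
  by apply: dpsi; lra.
rewrite normrM ler_wpM2r//; apply: (@le_trans _ _ (M / c ^+ 2)); first by apply: psi'M; lra.
rewrite ler_wpM2l// lef_pV2 ?posrE ?exprn_gt0//; last lra.
by rewrite lerXn2r ?nnegrE//; lra.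
Qed.

(** For y < 2, near the jump, the trivial bound 2M suffices since 1 + y^2 <= 5, whence the constant
    10. It also suffices when |y - z| >= y/2. Otherwise both points lie beyond the jump and the
    bound on psi' gains a factor of order y^-2. *)
Lemma cut_variation (y z : R) : 0 < y ->
  `|cut y - cut z| * (1 + y ^+ 2) <= 10 * M * (1 + (y - z) ^+ 2).
Proof.
move=> y0; have B : `|cut y - cut z| <= 2 * M.
  apply: le_trans (ler_normB _ _) _; have := cut_norm y; have := cut_norm z; lra.
have M1 := M0; have n0 := normr_ge0 (cut y - cut z).
have u0 : 0 <= (y - z) ^+ 2 by exact: sqr_ge0.
have [y2|y2] := ltP y 2.
  have : y ^+ 2 <= 4 by nra.
  move: (`|_|) ((y - z) ^+ 2) B n0 u0 => d u B d0 u0; nra.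
have [h|h] := ltP `|y - z| (y / 2); last first.
  have : y ^+ 2 <= 4 * (y - z) ^+ 2.
    rewrite -(real_normK (num_real (y - z))); nra.
  move: (`|cut _ - _|) ((y - z) ^+ 2) B n0 u0 => d u B d0 u0; nra.
have z1 : y / 2 < z by move: h; rewrite ltr_norml => /andP[]; lra.
have E : `|cut y - cut z| <= M / (y / 2) ^+ 2 * `|y - z|.
  have y3 : 1 < y by lra.
  have z3 : 1 < z by lra.
  rewrite /cut y3 z3 !mul1r.
  by apply: psi_lipschitz; lra.
have E2 : M / (y / 2) ^+ 2 * (1 + y ^+ 2) <= 5 * M.
  have -> : M / (y / 2) ^+ 2 * (1 + y ^+ 2) = M * (4 / y ^+ 2 * (1 + y ^+ 2)).
    by field; rewrite gt_eqF.
  rewrite [5 * M]mulrC ler_wpM2l// mulrAC ler_pdivrMr ?exprn_gt0//; nra.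
have w : `|y - z| <= 1 + (y - z) ^+ 2.
  rewrite -(real_normK (num_real (y - z))); have : 0 <= `|y - z| by [].
  move: (`|y - z|) => v v0; nra.
have k0 : 0 <= M / (y / 2) ^+ 2 by rewrite divr_ge0// sqr_ge0.
have y1 := sqr1D_gt0 y.
apply: (@le_trans _ _ (M / (y / 2) ^+ 2 * (1 + y ^+ 2) * `|y - z|)).
  by rewrite mulrAC ler_wpM2r// ltW.
apply: (@le_trans _ _ (5 * M * (1 + (y - z) ^+ 2))).
  by apply: ler_pM => //; rewrite mulr_ge0// ltW.
rewrite ler_wpM2r//; [exact: ltW (sqr1D_gt0 _)|lra].
Qed.

Definition Ksq : R := \int[mu]_u (1 + u ^+ 2)^-1.

(** The jump of [cut] does not spoil the decay in y: the growth 1 + (y - z)^2 allowed by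
    [cut_variation] is absorbed by the fourth-order decay of [jack]. The reflected part
    [jack (y + z)] is small in y and in z at once; 11 is 10 from the variation plus 1 from this
    part. *)
Lemma trunc_error (y : R) : 0 < y ->
  `|cut y - trunc y| <= jmass^-1 * (11 * Cjack * Ksq) * M / (1 + y ^+ 2).
Proof.
move=> y0; have j0 := jmass_gt0; have y1 := sqr1D_gt0 y.
have mcut : measurable_fun setT cut.
  apply: measurable_funM => //.
  rewrite (_ : (fun y => _) = \1_far); first exact: measurable_indic.
  by apply/funext => z; rewrite indicE; congr (_%:R); congr nat_of_bool; apply/idP/idP; rewrite inE /= in_itv/= andbT.
have ij : L1 setT (fun z => jack (y - z)).
  by apply: (L1_eq measurableT) (L1_jack_sub y) => z _; rewrite -jack_even opprB.
have ija : L1 setT (fun z => jack (y + z)).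
  by apply: (L1_eq measurableT) (L1_jack_add y) => z _; rewrite addrC.
have Ej : \int[mu]_z jack (y - z) = jmass.
  by rewrite -(Rint_jack_sub y); apply: eq_Rintegral => z _; rewrite -jack_even opprB.
have ic : L1 setT (fun z => cut z * oddjack y z).
  apply: (L1_bounded measurableT (M := M)) => //; first exact: (L1B measurableT ij ija).
  by move=> z _; exact: cut_norm.
have Ec : \int[mu]_(z in far) (psi z * oddjack y z) = \int[mu]_z (cut z * oddjack y z).
  rewrite Rintegral_indic; apply: eq_Rintegral => z _; rewrite /cut mulrA indicE; congr (_ * _ * _).
  by congr (_%:R); congr nat_of_bool; apply/idP/idP; rewrite inE /= in_itv/= andbT.
pose h z := cut y * jack (y - z) - cut z * oddjack y z.
have ih : L1 setT h by apply: (L1B measurableT) => //; exact: L1Zl.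
have E : cut y - trunc y = jmass^-1 * \int[mu]_z h z.
  rewrite /h (RintB measurableT (L1Zl measurableT _ ij) ic) (RintZ _ measurableT ij) Ej.
  by rewrite mulrBr mulrCA mulVf ?gt_eqF// mulr1 -Ec.
have mk : measurable_fun setT (fun u : R => (1 + u ^+ 2)^-1) by meas.
have [ik1 Ek1] := L1_shift (- y) mk (L1_oneDsqr (R := R)).
have C0 := Cjack_ge0.
pose A := Cjack * M / (1 + y ^+ 2).
have A0 : 0 <= A by apply: divr_ge0; [exact: mulr_ge0 C0 M0|exact: ltW].
have -> : jmass^-1 * (11 * Cjack * Ksq) * M / (1 + y ^+ 2) = jmass^-1 * (10 * A * Ksq + A * Ksq).
  rewrite /A; move: (@Cjack R) Ksq ((1 + y ^+ 2)^-1) (jmass^-1) => a b c d; ring.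
rewrite E normrM (ger0_norm (_ : 0 <= jmass^-1)) ?invr_ge0 ?(ltW j0)// ler_wpM2l ?invr_ge0 ?(ltW j0)//.
have Ek : \int[mu]_x (1 + (- y + x) ^+ 2)^-1 = Ksq by exact: Ek1.
rewrite -{1}Ek -(RintZ _ measurableT ik1) /Ksq -(RintZ _ measurableT (L1_oneDsqr (R := R))).
have i1 := L1Zl measurableT (10 * A) ik1; have i2 := L1Zl measurableT A (L1_oneDsqr (R := R)).
rewrite -(RintD measurableT i1 i2).
apply: (Rintegral_le_norm measurableT) => //; first exact: (L1D measurableT i1 i2).
move=> z _.
have -> : h z = (cut y - cut z) * jack (y - z) + cut z * jack (y + z) by rewrite /h /oddjack; ring.
apply: le_trans (ler_normD _ _) _; apply: lerD.
  rewrite normrM (ger0_norm (jack_ge0 (y - z))).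
  have V := cut_variation z y0; have J := jack_weight (y - z).
  have u1 := sqr1D_gt0 (y - z).
  rewrite (_ : (- y + z) ^+ 2 = (y - z) ^+ 2); last by ring.
  have J0 := jack_ge0 (y - z).
  rewrite -ler_pdivlMr// in V.
  apply: (@le_trans _ _ (10 * M * (1 + (y - z) ^+ 2) / (1 + y ^+ 2) * jack (y - z))).
    by rewrite ler_wpM2r.
  have -> : 10 * M * (1 + (y - z) ^+ 2) / (1 + y ^+ 2) * jack (y - z) =
     10 * M / (1 + y ^+ 2) * ((1 + (y - z) ^+ 2) * jack (y - z)).
    by move: (jack _) (_^-1) => a b; ring.
  have -> : 10 * A / (1 + (y - z) ^+ 2) = 10 * M / (1 + y ^+ 2) * (Cjack / (1 + (y - z) ^+ 2)).
    by rewrite /A; move: Cjack (1 + (y - z) ^+ 2)^-1 (_^-1) => a b c; ring.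
  by rewrite ler_wpM2l//; apply: divr_ge0; [rewrite mulr_ge0|exact: ltW].
have z2 := sqr1D_gt0 z.
rewrite normrM (ger0_norm (jack_ge0 (y + z))).
have [z1|z1] := leP z 1.
  by rewrite /cut ltNge z1 mul0r normr0 mul0r mulr_ge0// invr_ge0 ltW.
apply: (@le_trans _ _ (M * jack (y + z))); first by rewrite ler_wpM2r ?jack_ge0// cut_norm.
have J := jack_weight (y + z); have J0 := jack_ge0 (y + z).
have -> : A / (1 + z ^+ 2) = M * (Cjack / (1 + z ^+ 2) / (1 + y ^+ 2)).
  by rewrite /A; move: Cjack (_^-1) (_^-1) => a b c; ring.
rewrite ler_wpM2l// ler_pdivlMr//.
apply: (@le_trans _ _ ((1 + (y + z) ^+ 2) * jack (y + z))).
  by rewrite mulrC ler_wpM2r//; nra.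
apply: (le_trans J); rewrite ler_wpM2l// lef_pV2 ?posrE ?sqr1D_gt0//; nra.
Qed.

End Truncation.

(** The constant must not depend on n or on the coefficients, which are unbounded. Subtracting from
    F its mean leaves frequencies >= 1 only, orthogonal to the smoothed test function; what remains
    is the smoothing error, of order (1 + z^2)^-1, and the mean, itself controlled by the same
    weighted norm of F. *)
Lemma frac_sum_tail : exists2 C : R, 0 <= C &
  forall n (c phi : 'I_n -> R) (psi psi' : R -> R) (M : R),
  (forall i, 1 <= phi i) -> measurable_fun setT psi -> L1 far psi ->
  (forall z, 1 <= z -> `|psi z| <= M) -> (forall z, 1 <= z -> der_at psi z (psi' z)) ->
  (forall z, 1 <= z -> `|psi' z| <= M / z ^+ 2) ->
  \int[mu]_(z in far) `|psi z| <= M ->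
  `|\int[mu]_(z in far) ((\sum_(i < n) c i * fpart (phi i * z)) * psi z)| <=
  C * M * \int[mu]_(z in pos) (`|\sum_(i < n) c i * fpart (phi i * z)| / (1 + z ^+ 2)).
Proof.
pose m0 := \int[mu]_(u in pos) eta u : R.
have m00 : 0 < m0 by exact: eta_mass.
pose K := jmass^-1 * (11 * Cjack * Ksq).
pose I0 := \int[mu]_(y in pos) (1 + y ^+ 2)^-1 : R.
have iq : L1 pos (fun y => (1 + y ^+ 2)^-1) by apply: L1_sub (L1_oneDsqr (R := R)).
have I00 : 0 <= I0 by apply: Rintegral_ge0 => y _; rewrite invr_ge0 ltW ?sqr1D_gt0.
have Kq0 : 0 <= Ksq by apply: Rintegral_ge0 => y _; rewrite invr_ge0 ltW ?sqr1D_gt0.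
have K0 : 0 <= K.
  apply: mulr_ge0; first by rewrite invr_ge0 (ltW jmass_gt0).
  by apply: mulr_ge0 Kq0; apply: mulr_ge0 Cjack_ge0.
pose P : R := (pi ^+ 2 + 4) / m0.
have P0 : 0 <= P by rewrite divr_ge0 ?(ltW m00)// addr_ge0 ?sqr_ge0.
exists (P + K * (1 + P * I0)).
  by rewrite addr_ge0// mulr_ge0// addr_ge0// mulr_ge0.
move=> n c phi psi psi' M phi1 mpsi ipsi psiM dpsi psi'M intM.
have M0 : 0 <= M by apply: le_trans (psiM _ (lexx 1)).
pose F z := \sum_(i < n) c i * fpart (phi i * z).
(* The mean value of F, as each {phi y} has mean 1/2. *)
pose a0 := \sum_(i < n) c i / 2.
pose B := \sum_(i < n) `|c i|.
have mF : measurable_fun setT F by rewrite /F; apply: measurable_sum => i; meas.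
have FB z : `|F z| <= B.
  apply: le_trans (ler_norm_sum _ _ _) _; apply: ler_sum => i _.
  by rewrite normrM -[leRHS]mulr1 ler_wpM2l// frac_norm.
have iF (D : set R) (T : R -> R) : measurable D -> L1 D T -> L1 D (fun z => F z * T z).
  move=> mD iT; apply: (L1_bounded mD (M := B)) => //; exact: measurable_funTS.
have orth (T : R -> R) : L1 pos T ->
    (forall a, 1 <= a -> \int[mu]_(y in pos) (sin (2 * pi * a * y) * T y) = 0) ->
    \int[mu]_(y in pos) ((F y - a0) * T y) = 0.
  move=> iT hT.
  have ii i : L1 pos (fun y => c i * ((fpart (phi i * y) - 2^-1) * T y)).
    apply: L1Zl => //; have i1 := L1_frac (phi i) mpos iT; have i2 := L1Zl mpos 2^-1 iT.
    by apply: (L1_eq mpos) (L1B mpos i1 i2) => y _; ring.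
  transitivity (\int[mu]_(y in pos) (\sum_(i < n) c i * ((fpart (phi i * y) - 2^-1) * T y))).
    apply: eq_Rintegral => y _; rewrite /F /a0 -sumrB mulr_suml; apply: eq_bigr => i _; ring.
  rewrite Rintegral_sum// big1// => i _.
  have p1 := phi1 i; have p0 : 0 < phi i by lra.
  have i1 : L1 pos (fun y => (fpart (phi i * y) - 2^-1) * T y).
    have i1 := L1_frac (phi i) mpos iT; have i2 := L1Zl mpos 2^-1 iT.
    by apply: (L1_eq mpos) (L1B mpos i1 i2) => y _; ring.
  rewrite (RintZ _ mpos i1) saw_orth ?mulr0// => a pa; apply: hT; lra.
pose J := \int[mu]_(z in pos) (`|F z| / (1 + z ^+ 2)).
have iJ : L1 pos (fun z => `|F z| / (1 + z ^+ 2)).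
  by apply: (L1_eq mpos) (L1_norm (iF _ _ mpos iq)) => z _; rewrite normrM (ger0_norm (_ : 0 <= (1 + z ^+ 2)^-1)) ?invr_ge0 ?(ltW (sqr1D_gt0 z)).
have J0 : 0 <= J by apply: Rintegral_ge0 => y _; rewrite divr_ge0// ltW ?sqr1D_gt0.
(* F - a0 is orthogonal to [eta], so a0 is the quotient of the integrals of F [eta] and of [eta]. *)
have A : `|a0| <= P * J.
  have := orth _ (L1_eta (R := R)) (fun a a1 => eta_sine_ge1 a1).
  have -> : \int[mu]_(y in pos) ((F y - a0) * eta y) = \int[mu]_(y in pos) (F y * eta y) - a0 * m0.
    rewrite /m0 -(RintZ _ mpos (L1_eta (R := R))) -(RintB mpos (iF _ _ mpos L1_eta) (L1Zl mpos a0 (L1_eta (R := R)))).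
    by apply: eq_Rintegral => y _; rewrite mulrBl.
  move/eqP; rewrite subr_eq0 => /eqP E.
  have Q : `|a0| * m0 <= (pi ^+ 2 + 4) * J.
    rewrite -(ger0_norm (ltW m00)) -normrM -E -(RintZ _ mpos iJ).
    apply: (Rintegral_le_norm mpos); [exact: (iF _ _ mpos L1_eta)|exact: L1Zl|].
    move=> y _; rewrite normrM mulrCA ler_wpM2l// ler_pdivlMr ?sqr1D_gt0//; exact: eta_bound.
  by rewrite /P mulrAC ler_pdivlMr.
have iT := L1_trunc mpsi ipsi.
have icut : L1 pos (cut psi).
  have := proj1 (L1_indic _ mfar) ipsi => i.
  apply: (@L1_sub _ _ setT) => //; apply: (L1_eq measurableT) i => z _; rewrite /cut indicE; congr (_%:R * _).
  by congr nat_of_bool; apply/idP/idP; rewrite inE /= in_itv/= andbT.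
pose r y := cut psi y - trunc psi y.
have ir : L1 pos r by exact: (L1B mpos icut iT).
have S1 : \int[mu]_(z in far) (F z * psi z) = \int[mu]_(z in pos) (F z * cut psi z).
  rewrite (Rintegral_indic far) (Rintegral_indic pos); apply: eq_Rintegral => z _.
  rewrite /cut !indicE; have -> : (z \in far) = (1 < z).
    by apply/idP/idP; rewrite inE /= in_itv/= andbT.
  have -> : (z \in pos) = (0 < z) by apply/idP/idP; rewrite inE /= in_itv/= andbT.
  case: (ltP 1 z) => z1; last by rewrite !mul0r !mulr0.
  by rewrite (lt_trans ltr01 z1) !mul1r.
(* Orthogonality to [trunc] replaces the cut function by the error r, at the cost of a term carrying
   the mean. *)
have S2 : \int[mu]_(z in pos) (F z * cut psi z) =
    \int[mu]_(z in pos) ((F z - a0) * r z) + a0 * \int[mu]_(z in pos) cut psi z.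
  have O := orth _ iT (fun a a1 => trunc_sine mpsi ipsi a1).
  have iz (T : R -> R) : L1 pos T -> L1 pos (fun z => (F z - a0) * T z).
    move=> i; apply: (L1_eq mpos) (L1B mpos (iF _ _ mpos i) (L1Zl mpos a0 i)) => z _.
    by rewrite mulrBl.
  transitivity (\int[mu]_(z in pos) ((F z - a0) * r z) + \int[mu]_(y in pos) ((F y - a0) * trunc psi y)
      + a0 * \int[mu]_(z in pos) cut psi z); last by rewrite O addr0.
  rewrite -(RintZ _ mpos icut) -(RintD mpos (iz _ ir) (iz _ iT)).
  rewrite -(RintD mpos (L1D mpos (iz _ ir) (iz _ iT)) (L1Zl mpos _ icut)).
  by apply: eq_Rintegral => z _; rewrite /r; ring.
rewrite -/(F _) S1 S2; apply: le_trans (ler_normD _ _) _.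
have iq2 := L1Zl mpos `|a0| iq.
have B1 : `|\int[mu]_(z in pos) ((F z - a0) * r z)| <= K * M * (J + `|a0| * I0).
  rewrite /J /I0 -(RintZ _ mpos iq) -(RintD mpos iJ iq2) -(RintZ _ mpos (L1D mpos iJ iq2)).
  apply: (Rintegral_le_norm mpos).
  - apply: (L1_eq mpos) (L1B mpos (iF _ _ mpos ir) (L1Zl mpos a0 ir)) => z _.
    by rewrite mulrBl.
  - by apply: L1Zl => //; exact: (L1D mpos iJ iq2).
  - move=> z; rewrite /= in_itv/= andbT => z0; rewrite normrM -mulrDl mulrCA.
    apply: ler_pM => //; first exact: ler_normB.
    exact: (trunc_error mpsi psiM dpsi psi'M z0).
have B2 : `|a0 * \int[mu]_(z in pos) cut psi z| <= `|a0| * M.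
  rewrite normrM ler_wpM2l//; apply: le_trans intM.
  apply: le_trans (le_normr_Rintegral _ icut) _; first by [].
  rewrite (Rintegral_indic far) (Rintegral_indic pos).
  apply: le_Rintegral => //.
  - by apply/(proj1 (L1_indic _ mpos)); exact: L1_norm.
  - by apply/(proj1 (L1_indic _ mfar)); exact: L1_norm.
  - move=> z _; rewrite /cut !indicE.
    have -> : (z \in far) = (1 < z) by apply/idP/idP; rewrite inE /= in_itv/= andbT.
    case: (ltP 1 z) => z1; last by rewrite !mul0r normr0 mulr0.
    by rewrite !mul1r; case: (z \in pos); rewrite ?mul1r ?mul0r.
apply: (@le_trans _ _ (K * M * (J + `|a0| * I0) + `|a0| * M)); first exact: lerD.
have key (a j k i p : R) : 0 <= a -> 0 <= j -> 0 <= k -> 0 <= i -> 0 <= p -> a <= p * j ->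
    k * M * (j + a * i) + a * M <= (p + k * (1 + p * i)) * M * j.
  move=> a00 j0 k0 i0 p0 apj.
  have h1 : k * M * (a * i) <= k * M * (p * j * i).
    by rewrite ler_wpM2l ?mulr_ge0// ler_wpM2r.
  have h2 : a * M <= p * j * M by rewrite ler_wpM2r.
  by rewrite mulrDr; lra.
exact: key.
Qed.

End TailEstimate.

(** * Zeros of zeta as vanishing moments *)

Section PowerSeries.
Context {R : realType}.
Implicit Types (a b : nat -> R) (f g : R -> R).

Definition psum a (t l : R) : Prop :=
  (\sum_(k < n) a k * t ^+ k) @[n --> \oo] --> l.

Lemma psum0 a (l : R) : psum a 0 l -> l = a 0.
Proof.
move=> H; have H2 : (\sum_(k < n) a k * 0 ^+ k) @[n --> \oo] --> a 0%N.
  apply: (@cvg_trans _ (cst (a 0%N) @ \oo)); last exact: cvg_cst.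
  apply: near_eq_cvg; exists 1%N => // n /= n0; case: n n0 => // n _.
  rewrite big_ord_recl/= mulr1 big1 ?addr0// => i _.
  by rewrite expr0n/= mulr0.
by rewrite -(cvg_lim (@Rhausdorff R) H) (cvg_lim (@Rhausdorff R) H2).
Qed.

Lemma geom_tail (q : R) (N n : nat) : 0 <= q <= 2^-1 -> 
  \sum_(N <= k < N + n) q ^+ k <= 2 * q ^+ N.
Proof.
move=> /andP[q0 q1].
suff : \sum_(N <= k < N + n) q ^+ k <= 2 * q ^+ N - 2 * q ^+ (N + n).
  move/le_trans; apply; rewrite gerBl mulr_ge0// exprn_ge0//.
elim: n => [|n IH]; first by rewrite addn0 big_geq// subrr.
rewrite addnS big_nat_recr ?leq_addr//=.
apply: (le_trans (lerD IH (lexx _))).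
have : 0 <= q ^+ (N + n) by rewrite exprn_ge0.
rewrite exprS; move: (q ^+ (N + n)) (q ^+ N) => x y x0; nra.
Qed.

(** Convergence at the single point r bounds all terms there; for |t| <= r/2 the remainder is then
    dominated by a geometric series, uniformly in t. *)
Lemma psum_remainder a (r l0 : R) (N : nat) : 0 < r -> psum a r l0 ->
  exists2 C : R, 0 <= C & forall t l, `|t| <= r / 2 -> psum a t l ->
    `|l - \sum_(k < N) a k * t ^+ k| <= C * `|t| ^+ N.
Proof.
move=> r0 H.
have [B B0 HB] : exists2 B : R, 0 <= B & forall k, `|a k * r ^+ k| <= B.
  have c : cvgn (series (fun k => a k * r ^+ k)).
    apply/cvg_ex; exists l0; rewrite /series/=.
    by under eq_cvg do rewrite big_mkord.
  have /cvg_seq_bounded/pinfty_ex_gt0[B B0 HB] : cvgn (fun k => a k * r ^+ k).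
    by apply/cvg_ex; exists 0; exact: cvg_series_cvg_0.
  exists B; [exact: ltW|move=> k; exact: HB].
exists (B * 2 / r ^+ N); first by rewrite divr_ge0 ?mulr_ge0// exprn_ge0// ltW.
move=> t l tr Hl; pose q := `|t| / r.
have q01 : 0 <= q <= 2^-1.
  rewrite divr_ge0 ?(ltW r0)//=.
  by rewrite ler_pdivrMr// mulrC.
have E : B * 2 / r ^+ N * `|t| ^+ N = B * (2 * q ^+ N).
  by rewrite /q expr_div_n; move: (r ^+ N)^-1 (`|t| ^+ N) => x y; ring.
rewrite E.
have Hc : `|\sum_(k < n) a k * t ^+ k - \sum_(k < N) a k * t ^+ k| @[n --> \oo]
    --> `|l - \sum_(k < N) a k * t ^+ k|.
  by apply: cvg_norm; apply: cvgB => //; exact: cvg_cst.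
rewrite -(cvg_lim (@Rhausdorff R) Hc); apply: limr_le; first by apply/cvg_ex; eexists; exact: Hc.
near=> n; have Nn : (N <= n)%N by near: n; exists N.
rewrite -(big_mkord xpredT (fun k => a k * t ^+ k)) (big_cat_nat (n := N))//= big_mkord addrAC subrr add0r.
apply: (le_trans (ler_norm_sum _ _ _)).
rewrite -(subnKC Nn).
apply: (@le_trans _ _ (B * \sum_(N <= k < N + (n - N)) q ^+ k)); last first.
  by rewrite ler_wpM2l// geom_tail.
rewrite mulr_sumr; apply: ler_sum => k _.
have -> : `|a k * t ^+ k| = `|a k * r ^+ k| * q ^+ k.
  rewrite !normrM !normrX (ger0_norm (ltW r0)) /q expr_div_n -mulrA; congr (_ * _).
  by rewrite mulrC divfK// expf_neq0// gt_eqF.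
by rewrite ler_wpM2r// exprn_ge0//; case/andP: q01.
Unshelve. all: by end_near. Qed.

(** By induction: once the lower coefficients vanish, |a_k| <= const t for all small t > 0. Values
    to the right of 0 are enough, which both the identity theorem and [zero_moments] exploit. *)
Lemma psum_coef0 a f (r C : R) (m : nat) : 0 < r ->
  (forall t, 0 <= t <= r -> psum a t (f t)) ->
  (forall t, 0 < t <= r -> `|f t| <= C * t ^+ m) -> forall k, (k < m)%N -> a k = 0.
Proof.
move=> r0 H Hf.
elim/ltn_ind => k IH km.
have IHk j : (j < k)%N -> a j = 0 by move=> jk; apply: IH => //; exact: ltn_trans km.
have [D D0 HD] := psum_remainder k.+1 r0 (H r (introT andP (conj (ltW r0) (lexx r)))).
have HC : 0 <= `|C| by [].
have B (t : R) : 0 < t -> t <= r / 2 -> t <= 1 -> `|a k| <= (D + `|C|) * t.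
  move=> t0 tr t1.
  have tk : 0 < t ^+ k by rewrite exprn_gt0.
  have := HD t (f t); rewrite (ger0_norm (ltW t0)) => /(_ tr).
  have tr' : t <= r by apply: (le_trans tr); lra.
  have h1 : 0 <= t <= r by rewrite tr' ltW.
  have h2 : 0 < t <= r by rewrite tr' t0.
  move=> /(_ (H t h1)); rewrite big_ord_recr/= big1 ?add0r; last first.
    by move=> j _; rewrite IHk ?mul0r.
  have := Hf t h2 => F1 F2.
  have F3 : `|f t| <= `|C| * t ^+ k.+1.
    apply: (le_trans F1); apply: (@le_trans _ _ (`|C| * t ^+ m)).
      by rewrite ler_wpM2r ?exprn_ge0 ?(ltW t0)// ler_norm.
    by rewrite ler_wpM2l// ler_wiXn2l// ltW.
  have F4 : `|a k * t ^+ k| <= (D + `|C|) * t ^+ k.+1.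
    have -> : a k * t ^+ k = f t - (f t - a k * t ^+ k) by ring.
    apply: (le_trans (ler_normB _ _)); rewrite mulrDl addrC; exact: lerD.
  move: F4; rewrite normrM (ger0_norm (ltW tk)) exprS mulrA ler_pM2r//.
apply/eqP; rewrite -normr_eq0 eq_le normr_ge0 andbT leNgt; apply/negP => a0.
pose d := D + `|C| + 1; have d0 : 0 < d by rewrite /d; lra.
(* For this t the bound gives |a k| <= |a k| / 2. *)
pose t := Num.min (Num.min (r / 2) 1) (`|a k| / (2 * d)).
have t0 : 0 < t.
  by rewrite !lt_min ltr01 andbT; apply/andP; split; apply: divr_gt0 => //; exact: mulr_gt0.
have tr : t <= r / 2 by rewrite /t !ge_min lexx.
have t1 : t <= 1 by rewrite /t !ge_min lexx orbT.
have := B t t0 tr t1.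
have : t <= `|a k| / (2 * d) by rewrite /t ge_min lexx orbT.
rewrite ler_pdivlMr ?mulr_gt0//.
have : D + `|C| <= d by rewrite /d; lra.
clearbody t; clearbody d; move: (`|a k|) (D + `|C|) a0 => x y x0 yd h1 h2.
by have := ler_wpM2r (ltW t0) yd; lra.
Qed.

Definition ana f (x : R) : Prop := exists a, exists2 r : R, 0 < r &
  forall t, `|t| < r -> psum a t (f (x + t)).

Lemma ana_ext f g x : (forall y, f y = g y) -> ana f x -> ana g x.
Proof. by move=> fg; have -> : f = g by apply/funext. Qed.

Lemma anaD f g x : ana f x -> ana g x -> ana (fun y => f y + g y) x.
Proof.
move=> [a [r r0 Ha]] [b [s s0 Hb]]; exists (fun k => a k + b k), (Num.min r s).
  by rewrite lt_min r0.
move=> t; rewrite lt_min => /andP[tr ts].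
rewrite /psum; under eq_cvg do (under eq_bigr do rewrite mulrDl; rewrite big_split/=).
by apply: cvgD; [exact: Ha|exact: Hb].
Qed.

Lemma anaZ (c : R) f x : ana f x -> ana (fun y => c * f y) x.
Proof.
move=> [a [r r0 Ha]]; exists (fun k => c * a k), r => // t tr.
rewrite /psum; under eq_cvg do (under eq_bigr do rewrite -mulrA; rewrite -mulr_sumr).
by apply: cvgM; [exact: cvg_cst|exact: Ha].
Qed.

Lemma ana_cst (c x : R) : ana (fun=> c) x.
Proof.
exists (fun k => if k is 0%N then c else 0), 1 => // t _.
apply: (@cvg_trans _ (cst c @ \oo)); last exact: cvg_cst.
apply: near_eq_cvg; exists 1%N => // n /= n0; case: n n0 => // n _.
by rewrite big_ord_recl/= mulr1 big1 ?addr0// => i _; rewrite mul0r.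
Qed.

(** At x the factor y is x + (y - x), and y - x shifts the coefficients by one. *)
Lemma anaX f x : ana f x -> ana (fun y => y * f y) x.
Proof.
move=> [a [r r0 Ha]].
suff : ana (fun y => x * f y + (y - x) * f y) x.
  by apply: ana_ext => y; ring.
apply: anaD; first by apply: anaZ; exists a, r.
exists (fun k => if k is j.+1 then a j else 0), r => // t tr; rewrite addrAC subrr add0r.
rewrite /psum -cvg_shiftS /=.
rewrite (_ : (fun n => _) = (fun n => t * \sum_(i < n) a i * t ^+ i)); last first.
  apply/funext => n; rewrite big_ord_recl/= mul0r add0r mulr_sumr; apply: eq_bigr => i _.
  by rewrite exprS; ring.
by apply: cvgM; [exact: cvg_cst|exact: Ha].
Qed.

(** Consider the infimum of the points to the right of which f vanishes. If it were positive, the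
    expansion there would be zero on the right, hence have zero coefficients, and f would vanish
    further to the left. *)
Lemma ana_identity f : (forall x, 0 < x -> ana f x) -> (forall x, 1 < x -> f x = 0) ->
  forall x, 0 < x -> f x = 0.
Proof.
move=> Hf f1.
pose S := [set x : R | 0 < x /\ forall y, x < y -> f y = 0].
have S1 : S 1 by split.
have lbS : lbound S 0 by move=> x [x0 _]; exact: ltW.
have hS : has_inf S by split; [exists 1|exists 0].
have i0 : 0 <= inf S by apply: lb_le_inf => //; exists 1.
have fi y : inf S < y -> f y = 0.
  move=> iy; have yi : 0 < y - inf S by rewrite subr_gt0.
  have [z [z0 fz]] := inf_adherent yi hS; rewrite addrC subrK => zy.
  exact: fz.
have [e|] := eqVneq (inf S) 0; first by move=> x x0; apply: fi; rewrite e.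
move=> in0; have ip : 0 < inf S by rewrite lt_neqAle eq_sym in0.
have [a [r r0 Ha]] := Hf _ ip.
have a0 k : a k = 0.
  have r2 : 0 < r / 2 by rewrite divr_gt0.
  have rl : r / 2 < r by lra.
  apply: (@psum_coef0 a (fun t => f (inf S + t)) (r / 2) 0 k.+1 r2) => // t.
    move=> /andP[t0 t1]; apply: Ha; rewrite ger0_norm//; exact: le_lt_trans rl.
  move=> /andP[t0 t1]; rewrite fi ?normr0 ?mul0r//; lra.
have fr t : `|t| < r -> f (inf S + t) = 0.
  move=> tr; have H := Ha t tr.
  rewrite -(cvg_lim (@Rhausdorff R) H); apply: cvg_lim => //.
  by under eq_cvg do (rewrite big1; last by move=> k _; rewrite a0 mul0r); exact: cvg_cst.
(* To the left of the infimum, within the radius of convergence and still positive. *)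
pose x := inf S - Num.min r (inf S) / 2.
have mp : 0 < Num.min r (inf S) by rewrite lt_min r0.
have m1 : Num.min r (inf S) <= r by rewrite ge_min lexx.
have m2 : Num.min r (inf S) <= inf S by rewrite ge_min lexx orbT.
have Sx : S x.
  split; first by rewrite /x; lra.
  move=> y xy; have [yi|yi] := ltP (inf S) y; first exact: fi.
  have -> : y = inf S + (y - inf S) by ring.
  by apply: fr; rewrite ler0_norm; rewrite /x in xy; lra.
have : inf S <= x by apply: ge_inf => //; exists 0.
by rewrite /x; lra.
Qed.

End PowerSeries.

(** * From complex analytic functions to real power series *)

Section ComplexBridge.
Context {R : realType}.
Local Notation normc := ComplexField.Normc.normc.
Local Open Scope complex_scope.

(** In the order of [R[i]] a positive radius has zero imaginary part, so a neighbourhood contains a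
    disc of real radius. *)
Lemma nbhs_normc (P : R[i]^o -> Prop) (a : R[i]^o) : (\forall s \near a, P s) ->
  exists2 r : R, 0 < r & forall z : R[i], normc (z - a) < r -> P z.
Proof.
move=> /nbhs_ballP[e /= e0 H]; move: e0; rewrite ltcE => /andP[e1 e2].
exists (complex.Re e) => // z hz; apply: H.
rewrite /ball/= distrC ltcE; apply/andP; split; first by rewrite (eqP e1).
exact: hz.
Qed.

Lemma ReD (z w : R[i]) : complex.Re (z + w) = complex.Re z + complex.Re w.
Proof. by case: z => a b; case: w. Qed.

Lemma ReM (z w : R[i]) : complex.Re (z * w) =
  complex.Re z * complex.Re w - complex.Im z * complex.Im w.
Proof. by case: z => a b; case: w. Qed.

Lemma ImM (z w : R[i]) : complex.Im (z * w) =
  complex.Re z * complex.Im w + complex.Im z * complex.Re w.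
Proof. by case: z => a b; case: w. Qed.

Lemma Re_sum (I : Type) (s : seq I) (f : I -> R[i]) :
  complex.Re (\sum_(i <- s) f i) = \sum_(i <- s) complex.Re (f i).
Proof.
by elim: s => [|i s IH]; rewrite ?big_nil// !big_cons ReD IH.
Qed.

Lemma Re_normc (z : R[i]) : `|complex.Re z| <= normc z.
Proof.
case: z => a b /=; rewrite -sqrtr_sqr ler_wsqrtr// lerDl sqr_ge0//.
Qed.

Lemma normc_le (z : R[i]) : normc z <= `|complex.Re z| + `|complex.Im z|.
Proof.
case: z => a b /=; rewrite -[leRHS]ger0_norm ?addr_ge0// -sqrtr_sqr ler_wsqrtr//.
rewrite sqrrD !real_normK ?num_real// lerD2r lerDl mulrn_wge0// mulr_ge0//.
Qed.

Lemma cvg_ReM (u : nat -> R[i]^o) (l : R[i]^o) (c : R[i]) : u n @[n --> \oo] --> l ->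
  complex.Re (c * u n) @[n --> \oo] --> complex.Re (c * l).
Proof.
move=> /cvgrPdist_lt H; apply/cvgrPdist_lt => e e0.
have c0 : 0 < normc c + 1.
  by rewrite ltr_wpDl//; exact: le_trans (Re_normc c).
have e0' : 0 < (e / (normc c + 1))%:C by rewrite ltcR divr_gt0.
apply: filterS (H _ e0') => n; rewrite ltcE => /andP[_ h].
have -> : complex.Re (c * l) - complex.Re (c * u n) = complex.Re (c * (l - u n)).
  by rewrite mulrBr; case: (c * l) => ? ?; case: (c * u n).
apply: (le_lt_trans (Re_normc _)); rewrite ComplexField.Normc.normcM.
have {}h : normc (l - u n) < e / (normc c + 1) by exact: h.
move: h; rewrite ltr_pdivlMr// mulrC; apply: le_lt_trans.
by rewrite ler_wpM2r ?lerDl//; exact: le_trans (Re_normc _).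
Qed.

Lemma normcR (t : R) : normc t%:C = `|t|.
Proof. by rewrite /= expr0n/= addr0 sqrtr_sqr. Qed.

(** Restriction to the line through a in the direction v, followed by the real-linear form z -> Re
    (c z); c = 1 and c = 'i recover real and imaginary parts. *)
Lemma line_psum (f : R[i]^o -> R[i]^o) (a : R[i]^o) (v c : R[i]) : normc v = 1 ->
  analytic_at f a -> exists (al : nat -> R), exists2 r : R, 0 < r &
    forall t : R, `|t| < r -> psum al t (complex.Re (c * f (a + t%:C * v))).
Proof.
move=> v1 [co /nbhs_normc[r r0 H]].
exists (fun k => complex.Re (c * (co k * v ^+ k))), r => // t tr.
have h : normc (a + t%:C * v - a) < r.
  by rewrite addrAC subrr add0r ComplexField.Normc.normcM v1 mulr1 normcR.
have := cvg_ReM (c := c) (H _ h); rewrite /psum.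
apply: cvg_trans; apply: near_eq_cvg; near=> n.
rewrite /series/= mulr_sumr Re_sum big_mkord; apply: eq_bigr => k _.
rewrite addrAC subrr add0r exprMn -rmorphXn/= -[RHS]mulrC.
have -> : c * (co k * ((t ^+ k)%:C * v ^+ k)) = (t ^+ k)%:C * (c * (co k * v ^+ k)).
  by ring.
by rewrite ReM /= mul0r subr0.
Unshelve. all: by end_near. Qed.

End ComplexBridge.

(** * Mellin integrals as power series in the exponent *)

Section MellinExpansion.
Context {R : realType}.
Local Notation mu := (@lebesgue_measure R).
Local Notation L1 D f := (mu.-integrable D (EFin \o f)).
Local Notation pos := (`]0, +oo[%classic : set R).
Local Notation far := (`]1, +oo[%classic : set R).

Let mpos : measurable pos. Proof. exact: measurable_itv. Qed.
Let mfar : measurable far. Proof. exact: measurable_itv. Qed.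

Lemma exp_partial (z : R) n : `|\sum_(k < n) z ^+ k / k`!%:R| <= expR `|z|.
Proof.
apply: (le_trans (ler_norm_sum _ _ _)).
have -> : \sum_(k < n) `|z ^+ k / k`!%:R| = series (exp_coeff `|z|) n.
  rewrite /series/= big_mkord; apply: eq_bigr => k _.
  by rewrite /exp_coeff/= normrM normrX (@ger0_norm _ k`!%:R^-1)// invr_ge0.
apply: nondecreasing_cvgn_le; last exact: is_cvg_series_exp_coeff.
by apply: nondecreasing_series => k _ _; rewrite /exp_coeff/= divr_ge0// exprn_ge0.
Qed.

Lemma exp_term (z : R) k : `|z| ^+ k / k`!%:R <= expR `|z|.
Proof.
have := exp_partial `|z| k.+1; rewrite normr_id; apply: le_trans.
rewrite [leRHS]ger0_norm; last by apply: sumr_ge0 => i _; rewrite divr_ge0// exprn_ge0.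
by rewrite big_ord_recr/= lerDr; apply: sumr_ge0 => i _; rewrite divr_ge0// exprn_ge0.
Qed.

Lemma exp_cvg (z : R) : (\sum_(k < n) z ^+ k / k`!%:R) @[n --> \oo] --> expR z.
Proof.
have := is_cvg_series_exp_coeff z; rewrite /series/= => h.
have {}h : (\sum_(0 <= k < n) exp_coeff z k) @[n --> \oo] --> expR z by exact: h.
by apply: cvg_trans h; apply: near_eq_cvg; near=> n; rewrite big_mkord.
Unshelve. all: by end_near. Qed.

(** One of the two powers is exp(r |ln y|), according to the sign of ln y; this converts exponential
    majorants into integrable powers. *)
Lemma exp_pw (r z y : R) : `|z| <= r -> expR `|z * ln y| <= pw r y + pw (- r) y.
Proof.
move=> zr; have r0 : 0 <= r by apply: le_trans zr.
apply: (@le_trans _ _ (expR (r * `|ln y|))).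
  by rewrite ler_expR normrM ler_wpM2r.
rewrite /pw; have [l0|l0] := leP 0 (ln y).
  by rewrite ger0_norm// lerDl expR_ge0.
by rewrite ltr0_norm// mulrN -mulNr lerDr expR_ge0.
Qed.

(** The factor y^-t is expanded in powers of t ln y under the integral, its partial sums being
    dominated by y^r + y^-r; hence the two integrability conditions with a margin r. The
    coefficients are logarithmic moments, so the expansion gives analyticity in the exponent and
    access to the moments. *)
Lemma mellin_expand (D : set R) (w : R -> R) (x r ga al be : R) :
  measurable D -> D `<=` pos -> measurable_fun setT w -> 0 < r ->
  L1 D (fun y => w y * pw (- x - 1 + r) y) -> L1 D (fun y => w y * pw (- x - 1 - r) y) ->
  (forall k, L1 D (fun y => w y * (ln y ^+ k * osc (x + 1) ga al be y))) /\
  forall t, `|t| <= r -> psum (fun k => (-1) ^+ k / k`!%:R *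
      \int[mu]_(y in D) (w y * (ln y ^+ k * osc (x + 1) ga al be y))) t
    (\int[mu]_(y in D) (w y * osc (x + t + 1) ga al be y)).
Proof.
move=> mD Dp mw r0 i1 i2; pose M := `|al| + `|be|.
have M0 : 0 <= M by rewrite addr_ge0.
pose g y := M * (`|w y * pw (- x - 1 + r) y| + `|w y * pw (- x - 1 - r) y|).
have ig : L1 D g by apply: L1Zl => //; exact: (L1D mD (L1_norm i1) (L1_norm i2)).
have bound (c y : R) : `|c| <= expR `|r * ln y| -> `|w y * (c * osc (x + 1) ga al be y)| <= g y.
  move=> h; have hb := osc_bound (x + 1) ga al be y; rewrite -/M in hb.
  have h2 : `|c| <= pw r y + pw (- r) y.
    by apply: (le_trans h); apply: exp_pw; rewrite ger0_norm// ltW.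
  have -> : g y = `|w y| * ((pw r y + pw (- r) y) * (M * pw (- (x + 1)) y)).
    rewrite /g (normrM (w y) (pw _ _)) (normrM (w y) (pw (- x - 1 - r) y)).
    rewrite (ger0_norm (pw_ge0 (- x - 1 + r) y)) (ger0_norm (pw_ge0 (- x - 1 - r) y)) !pwD opprD pwD.
    by move: (pw _ _) (pw _ _) (pw _ _) (pw _ _) => a b c' d; ring.
  rewrite (normrM (w y)) ler_wpM2l// (normrM c).
  by apply: ler_pM.
have mo : measurable_fun setT (osc (x + 1) ga al be) by exact: measurable_osc.
have ik k : L1 D (fun y => w y * (ln y ^+ k * osc (x + 1) ga al be y)).
  apply: (@L1_le _ _ mD _ (fun y => k`!%:R / r ^+ k * g y)).
  - by apply: measurable_funTS; apply: measurable_funM => //; apply: measurable_funM => //; meas.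
  - move=> y _.
    have f0 : (0 : R) < k`!%:R by rewrite ltr0n fact_gt0.
    have rk : 0 < r ^+ k by rewrite exprn_gt0.
    have hc : `|(r * ln y) ^+ k / k`!%:R| <= expR `|r * ln y|.
      by rewrite normrM normrX (@ger0_norm _ k`!%:R^-1) ?invr_ge0 ?(ltW f0)//; exact: exp_term.
    have := bound _ y hc; rewrite -(ler_pdivrMl _ _ (divr_gt0 f0 rk)); apply: le_trans.
    have -> : (r * ln y) ^+ k / k`!%:R = (k`!%:R / r ^+ k)^-1 * ln y ^+ k.
      by rewrite exprMn invf_div; move: (k`!%:R^-1) => a; ring.
    have q0 : 0 <= (k`!%:R / r ^+ k)^-1 by rewrite invr_ge0 divr_ge0 ?ltW.
    move: (_^-1) q0 => q q0; rewrite -[X in X * _ <= _](ger0_norm q0) -normrM.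
    by rewrite mulrCA !mulrA.
  - exact: L1Zl.
split=> // t tr.
pose F n y := w y * ((\sum_(k < n) (- t * ln y) ^+ k / k`!%:R) * osc (x + 1) ga al be y).
have EF n : \int[mu]_(y in D) F n y = \sum_(k < n) ((-1) ^+ k / k`!%:R *
      \int[mu]_(y in D) (w y * (ln y ^+ k * osc (x + 1) ga al be y))) * t ^+ k.
  transitivity (\int[mu]_(y in D) (\sum_(k < n) ((-1) ^+ k / k`!%:R * t ^+ k) * (w y * (ln y ^+ k * osc (x + 1) ga al be y)))).
    apply: eq_Rintegral => y _; rewrite /F mulr_suml mulr_sumr; apply: eq_bigr => k _.
    rewrite exprMn (exprNn t); move: (osc _ _ _ _ _) (k`!%:R^-1) (w y) (ln y ^+ k) => a b c d; ring.
  rewrite Rintegral_sum//; last by move=> k; exact: L1Zl.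
  by apply: eq_bigr => k _; rewrite RintZ// mulrAC.
rewrite /psum; under eq_cvg do rewrite -EF.
apply: (@Rintegral_dct _ D set0 F _ g) => //.
- move=> n; apply: measurable_funTS; apply: measurable_funM => //; apply: measurable_funM => //.
  by apply: measurable_sum => k; meas.
- apply: measurable_funTS; apply: measurable_funM => //; exact: measurable_osc.
- move=> y Dy _; have y0 : 0 < y by have := Dp _ Dy; rewrite /= in_itv/= andbT.
  have -> : osc (x + t + 1) ga al be y = expR (- t * ln y) * osc (x + 1) ga al be y.
    by rewrite -[expR _]/(pw (- t) y) osc_shift; apply: osc_eq; ring.
  rewrite /F; apply: cvgM; first exact: cvg_cst.
  by apply: cvgM; [exact: exp_cvg|exact: cvg_cst].
- move=> n y _; apply: bound; apply: (le_trans (exp_partial _ _)).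
  by rewrite ler_expR !normrM ler_wpM2r// normrN (ger0_norm (ltW r0)).
Qed.

Lemma far_pos : far `<=` pos.
Proof. by move=> y; rewrite /= !in_itv/= !andbT; exact: lt_trans. Qed.

Lemma L1_far_frac_pw (a : R) : a < -1 -> L1 far (fun y => fpart y * pw a y).
Proof.
move=> a1; apply: (@L1_bounded _ _ mfar _ _ 1).
- apply: (@L1_sub _ _ `[1, +oo[%classic) => //; last exact: L1_pw_infty.
  by move=> y /=; rewrite !in_itv/= !andbT => /ltW.
- by apply: measurable_funTS; meas.
- by move=> y _; exact: frac_norm.
Qed.

Lemma ana_far (x ga al be : R) : 0 < x ->
  ana (fun x => \int[mu]_(y in far) (fpart y * osc (x + 1) ga al be y)) x.
Proof.
move=> x0; have mf : measurable_fun setT (@Defs.frac R) by exact: measurable_frac.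
have r0 : 0 < x / 2 by rewrite divr_gt0.
have [||_ H] := @mellin_expand far (@Defs.frac R) x (x / 2) ga al be mfar far_pos mf r0.
- by apply: L1_far_frac_pw; lra.
- by apply: L1_far_frac_pw; lra.
by eexists; exists (x / 2) => // t /ltW; exact: H.
Qed.

End MellinExpansion.

(** * The Mellin formula for zeta in the critical strip *)

Section Dirichlet.
Context {R : realType}.
Local Notation mu := (@lebesgue_measure R).
Local Notation L1 D f := (mu.-integrable D (EFin \o f)).
Local Notation pos := (`]0, +oo[%classic : set R).
Local Notation far := (`]1, +oo[%classic : set R).
Local Notation normc := ComplexField.Normc.normc.
Local Open Scope complex_scope.

Let mpos : measurable pos. Proof. exact: measurable_itv. Qed.
Let mfar : measurable far. Proof. exact: measurable_itv. Qed.

(* Re (c y^-s) with s = sg + i ga *)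
Definition oscc (sg ga : R) (c : R[i]) (y : R) : R :=
  osc sg ga (complex.Re c) (complex.Im c) y.

Lemma der_oscc (sg ga : R) (c : R[i]) (y : R) : 0 < y ->
  der_at (oscc sg ga c) y (- oscc (sg + 1) ga ((sg +i* ga) * c) y).
Proof.
move=> y0; apply: der_eq; first exact: der_osc.
by rewrite /oscc ReM ImM /osc /=; ring.
Qed.

Lemma oscc_norm (sg ga : R) (c : R[i]) (y : R) :
  `|oscc sg ga c y| <= (`|complex.Re c| + `|complex.Im c|) * pw (- sg) y.
Proof. exact: osc_bound. Qed.

Lemma measurable_oscc sg ga c : measurable_fun setT (oscc sg ga c).
Proof. exact: measurable_osc. Qed.

Lemma L1_far_oscc (sg ga : R) (c : R[i]) : 1 < sg -> L1 far (oscc sg ga c).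
Proof.
move=> s1; apply: (@L1_le _ _ mfar _ (fun y => (`|complex.Re c| + `|complex.Im c|) * pw (- sg) y)).
- by apply: measurable_funTS; exact: measurable_oscc.
- by move=> y _; exact: oscc_norm.
- apply: L1Zl => //; apply: (@L1_sub _ _ `[1, +oo[%classic) => //; last by apply: L1_pw_infty; lra.
  by move=> y /=; rewrite !in_itv/= !andbT => /ltW.
Qed.

Lemma cvg_addn_pinfty (x : R) : (x + n.+1%:R : R) @[n --> \oo] --> +oo%R.
Proof.
apply/cvgryPge => A; exists (Num.bound `|A - x|) => // n /= h.
have := archi_boundP (normr_ge0 (A - x)) => h1.
have h2 : (Num.bound `|A - x|)%:R <= n%:R :> R by rewrite ler_nat.
have := ler_norm (A - x); rewrite -natr1; lra.
Qed.

(** The identity s times the integral of y^(-s-1) over ]x, oo[ equals x^-s, obtained by cutting at x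
    + n + 1 and letting n grow. *)
Lemma oscc_tail (sg ga x : R) (c : R[i]) : 0 < sg -> 1 <= x ->
  \int[mu]_(y in `]x, +oo[) oscc (sg + 1) ga ((sg +i* ga) * c) y = oscc sg ga c x.
Proof.
move=> s0 x1; set f := oscc (sg + 1) ga _.
have x0 : 0 < x by apply: lt_le_trans x1.
have mx : measurable (`]x, +oo[ : set R) by exact: measurable_itv.
have i : L1 `]x, +oo[ f.
  apply: (@L1_sub _ _ far) => //; last by apply: L1_far_oscc; lra.
  by move=> y /=; rewrite !in_itv/= !andbT; exact: le_lt_trans.
pose F (n : nat) y := \1_(`]x, x + n.+1%:R]%classic) y * f y.
have xn (n : nat) : x < x + n.+1%:R by rewrite ltrDl.
have mS (n : nat) : measurable (`]x, x + n.+1%:R]%classic : set R) by exact: measurable_itv.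
have C1 : \int[mu]_(y in `]x, +oo[) F n y @[n --> \oo] --> \int[mu]_(y in `]x, +oo[) f y.
  apply: (@Rintegral_dct _ _ set0 _ _ (fun y => `|f y|)) => //.
  - move=> n; apply: measurable_funTS; apply: measurable_funM; last exact: measurable_oscc.
    exact: measurable_indic.
  - by apply: measurable_funTS; exact: measurable_oscc.
  - exact: L1_norm.
  - move=> y; rewrite /= in_itv/= andbT => xy _.
    apply: (@cvg_trans _ (cst (f y) @ \oo)); last exact: cvg_cst.
    apply: near_eq_cvg; near=> n; rewrite /F indicE mem_set ?mul1r//=.
    rewrite in_itv/= xy/=; near: n; exact: (cvgryPge _).1 (cvg_addn_pinfty x) y.
  - move=> n y _; rewrite /F normrM indicE -[leRHS]mul1r ler_wpM2r//.
    by case: (y \in _); rewrite ?normr1 ?normr0.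
have C2 : \int[mu]_(y in `]x, +oo[) F n y @[n --> \oo] --> oscc sg ga c x.
  have E n : \int[mu]_(y in `]x, +oo[) F n y = oscc sg ga c x - oscc sg ga c (x + n.+1%:R).
    transitivity (\int[mu]_(y in `]x, x + n.+1%:R]) f y).
      rewrite (Rintegral_indic `]x, +oo[) (Rintegral_indic `]x, x + n.+1%:R]).
      apply: eq_Rintegral => y _; rewrite /F !indicE.
      case: (boolP (y \in `]x, x + n.+1%:R]%classic)) => [|_]; last by rewrite mul0r mulr0.
      by rewrite inE /= in_itv/= => /andP[xy _]; rewrite mem_set ?mul1r//= in_itv/= xy.
    have [||_ ->] := @ftc_oc R (fun y => - oscc sg ga c y) f x (x + n.+1%:R) (xn n).
    - move=> y /andP[xy _]; have y0 := lt_le_trans x0 xy.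
      by apply: der_eq (derN (der_oscc sg ga c y0)) _; rewrite opprK.
    - move=> y /andP[xy _]; have y0 := lt_le_trans x0 xy; exact: continuous_osc.
    - ring.
  rewrite (_ : (fun n => _) = (fun n => oscc sg ga c x - oscc sg ga c (x + n.+1%:R))); last by apply/funext => n; rewrite E.
  rewrite -[X in _ --> X]subr0; apply: cvgB; first exact: cvg_cst.
  pose M := `|complex.Re c| + `|complex.Im c|.
  apply: norm_cvg0.
  have H : M * pw (- sg) (x + n.+1%:R) @[n --> \oo] --> (0 : R).
    rewrite -[X in _ --> X](mulr0 M); apply: cvgM; first exact: cvg_cst.
    apply: (cvg_comp _ _ (cvg_addn_pinfty x)); apply: pw_cvg0; lra.
  apply: (@squeeze_cvgr _ _ _ _ (fun=> 0) (fun n => M * pw (- sg) (x + n.+1%:R))) => //; last exact: cvg_cst.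
  by near=> n; rewrite normr_ge0/=; exact: oscc_norm.
by rewrite -(cvg_lim (@Rhausdorff R) C1) (cvg_lim (@Rhausdorff R) C2).
Unshelve. all: by end_near. Qed.

Lemma natpowc_oscc (k : nat) (sg ga : R) (c : R[i]) :
  complex.Re (c * natpowc k.+1 (- (sg +i* ga))) = oscc sg ga c k.+1%:R.
Proof.
rewrite /natpowc /cexp /oscc /osc /pw; case: c => a b /=.
rewrite !mulr0 subr0 add0r !mul0r !subr0 !mulNr cosN sinN; ring.
Qed.

Lemma floor_sum_le (y : R) (n : nat) : 0 <= y -> \sum_(k < n) (k.+1%:R < y)%R%:R <= y :> R.
Proof.
move=> y0.
have [J HJ] : exists J : nat, y < J%:R by exists (Num.bound y); exact: archi_boundP.
apply: (@le_trans _ _ (\sum_(k < n + J) (k.+1%:R <= y)%R%:R)).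
  rewrite big_split_ord/= -[leLHS]addr0; apply: lerD; last by apply: sumr_ge0 => i _; exact: ler0n.
  apply: ler_sum => k _; rewrite ler_nat; case: (ltP k.+1%:R y) => // /ltW h.
  by rewrite h.
rewrite floor_sum ?floor_le//.
by rewrite y0 (lt_le_trans HJ)// ler_nat leq_addl.
Qed.

(** The inequalities are strict because the tail integrals run over ]k + 1, oo[; they differ from
    those of [floor_sum] only at integers. *)
Lemma floor_sum_lt (y : R) (n : nat) : 0 <= y < n%:R -> fpart (1 * y) <> 0 ->
  \sum_(k < n) (k.+1%:R < y)%R%:R = y - fpart y :> R.
Proof.
rewrite mul1r => y0n fy.
rewrite /Defs.frac opprB addrC subrK -(floor_sum y0n); apply: eq_bigr => k _.
congr (_%:R); congr nat_of_bool; rewrite lt_neqAle; case: eqP => // e; exfalso; apply: fy.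
by rewrite /Defs.frac -e -[k.+1%:R]/(k.+1%:Z%:~R) intrKfloor subrr.
Qed.

(** Each n^-s is written as a tail integral by [oscc_tail]; at y the integrands with n < y add up to
    the integer part of y. *)
Lemma dirichlet_floor (zeta : R[i]^o -> R[i]^o) (sg ga : R) (c : R[i]) :
  is_riemann_zeta zeta -> 1 < sg ->
  complex.Re (c * zeta (sg +i* ga)) =
  \int[mu]_(y in far) ((y - fpart y) * oscc (sg + 1) ga ((sg +i* ga) * c) y).
Proof.
move=> [_ hz] s1; have s0 : 0 < sg by lra.
set f := oscc (sg + 1) ga _.
have ifar : L1 far f by apply: L1_far_oscc; lra.
have iyf : L1 far (fun y => y * f y).
  apply: (L1_eq mfar) (L1_far_oscc ga ((sg +i* ga) * c) s1) => y.
  rewrite /= in_itv/= andbT => y1; have y0 : 0 < y by apply: lt_trans y1.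
  by rewrite /f -{2}(pw1 y0) /oscc osc_shift; apply: osc_eq; ring.
pose F (n : nat) y := (\sum_(k < n) (k.+1%:R < y)%R%:R) * f y.
have mI (k : nat) : measurable_fun setT (fun y : R => (k.+1%:R < y)%R%:R : R).
  rewrite (_ : (fun y : R => _) = \1_(`]k.+1%:R, +oo[%classic)).
    exact: measurable_indic.
  by apply/funext => v; rewrite indicE; congr (_%:R); congr nat_of_bool; apply/idP/idP; rewrite inE /= in_itv/= andbT.
have mf : measurable_fun setT f by exact: measurable_oscc.
have EF n : \int[mu]_(y in far) F n y = \sum_(k < n) oscc sg ga c k.+1%:R.
  have ii (k : nat) : L1 far (fun y => (k.+1%:R < y)%R%:R * f y).
    apply: (@L1_bounded _ _ mfar _ _ 1) => //; first exact: measurable_funTS.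
    by move=> y _; case: (_ < _); rewrite ?normr1 ?normr0.
  transitivity (\int[mu]_(y in far) (\sum_(k < n) (k.+1%:R < y)%R%:R * f y)).
    by apply: eq_Rintegral => y _; rewrite /F mulr_suml.
  rewrite Rintegral_sum//; apply: eq_bigr => k _.
  rewrite -oscc_tail//; last by rewrite ler1n.
  rewrite (Rintegral_indic far) (Rintegral_indic `]k.+1%:R, +oo[).
  apply: eq_Rintegral => y _; rewrite !indicE mulrA; congr (_ * _).
  have -> : (y \in far) = (1 < y) by apply/idP/idP; rewrite inE /= in_itv/= andbT.
  have -> : (y \in `]k.+1%:R, +oo[%classic) = (k.+1%:R < y) by apply/idP/idP; rewrite inE /= in_itv/= andbT.
  case: (ltP k.+1%:R y) => h; last by rewrite mulr0.
  by rewrite (le_lt_trans _ h) ?mul1r// ler1n.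
have C1 : \int[mu]_(y in far) F n y @[n --> \oo] -->
    \int[mu]_(y in far) ((y - fpart y) * f y).
  have cE := @countable_frac0 R 1 ltr01.
  have mF n : measurable_fun setT (F n).
    by apply: measurable_funM => //; apply: measurable_sum => k; exact: mI.
  apply: (@Rintegral_dct _ _ [set y : R | fpart (1 * y) = 0] F _ (fun y => `|y * f y|)) => //.
  - by move=> n; exact: measurable_funTS.
  - by apply: measurable_funTS; apply: measurable_funM => //; meas.
  - exact: L1_norm.
  - move=> y; rewrite /= in_itv/= andbT => y1 fy; have y0 : 0 < y by apply: lt_trans y1.
    apply: (@cvg_trans _ (cst ((y - fpart y) * f y) @ \oo)); last exact: cvg_cst.
    apply: near_eq_cvg; exists (Num.bound y) => // n /= yn; rewrite /F floor_sum_lt//.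
    by rewrite ltW//= (lt_le_trans (archi_boundP (ltW y0)))// ler_nat.
  - move=> n y; rewrite /= in_itv/= andbT => y1; have y0 : 0 < y by apply: lt_trans y1.
    rewrite /F !(normrM _ (f y)) ler_wpM2r// ger0_norm; last by apply: sumr_ge0 => i _; exact: ler0n.
    by rewrite (ger0_norm (ltW y0)) floor_sum_le// ltW.
have C2 : \int[mu]_(y in far) F n y @[n --> \oo] --> complex.Re (c * zeta (sg +i* ga)).
  have h := cvg_ReM (c := c) (hz (sg +i* ga) s1).
  apply: cvg_trans h; apply: near_eq_cvg; near=> n.
  rewrite EF /series/= mulr_sumr Re_sum big_mkord; apply: eq_bigr => k _.
  by rewrite natpowc_oscc.
by rewrite -(cvg_lim (@Rhausdorff R) C1) (cvg_lim (@Rhausdorff R) C2).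
Unshelve. all: by end_near. Qed.

Lemma L1_far_frac_oscc (sg ga : R) (c : R[i]) : 0 < sg -> 
  L1 far (fun y => fpart y * oscc (sg + 1) ga c y).
Proof.
move=> s0; apply: (@L1_bounded _ _ mfar _ _ 1).
- by apply: L1_far_oscc; lra.
- by apply: measurable_funTS; meas.
- by move=> y _; exact: frac_norm.
Qed.

(** The integer part is y - {y}, and the y part integrates to s/(s - 1). The factor s - 1 clears
    this pole, so both sides can be continued to Re s > 0. *)
Lemma dirichlet_far (zeta : R[i]^o -> R[i]^o) (sg ga : R) (d : R[i]) :
  is_riemann_zeta zeta -> 1 < sg ->
  complex.Re (((sg - 1) +i* ga) * d * zeta (sg +i* ga)) =
  complex.Re ((sg +i* ga) * d) -
  \int[mu]_(y in far) (fpart y * oscc (sg + 1) ga ((sg +i* ga) * (((sg - 1) +i* ga) * d)) y).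
Proof.
move=> hz s1; rewrite (dirichlet_floor _ _ hz s1).
set c := (sg +i* ga) * _; set f := oscc (sg + 1) ga c.
have s0 : 0 < sg by lra.
have ya (y : R) : 0 < y -> y * f y = oscc (sg - 1 + 1) ga (((sg - 1) +i* ga) * ((sg +i* ga) * d)) y.
  move=> y0; rewrite /f -{1}(pw1 y0) /oscc osc_shift /c mulrCA; apply: osc_eq; ring.
have iy : L1 far (fun y => y * f y).
  apply: (L1_eq mfar) (L1_far_oscc ga (((sg - 1) +i* ga) * ((sg +i* ga) * d)) (_ : 1 < sg - 1 + 1)) => [y|].
    by rewrite /= in_itv/= andbT => y1; rewrite ya//; apply: lt_trans y1.
  by lra.
have ifr := L1_far_frac_oscc ga c s0.
transitivity (\int[mu]_(y in far) (y * f y) - \int[mu]_(y in far) (fpart y * f y)).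
  by rewrite -(RintB mfar iy ifr); apply: eq_Rintegral => y _; rewrite mulrBl.
congr (_ - _).
transitivity (\int[mu]_(y in far) oscc (sg - 1 + 1) ga (((sg - 1) +i* ga) * ((sg +i* ga) * d)) y).
  apply: eq_Rintegral => y; rewrite inE /= in_itv/= andbT => y1.
  by rewrite ya//; apply: lt_trans y1.
rewrite oscc_tail//; last by lra.
by rewrite /oscc /osc pw_1 ln1 mulr0 cos0 sin0; ring.
Qed.

Lemma ana_line (f : R[i]^o -> R[i]^o) (x ga : R) (c : R[i]) : analytic_at f (x +i* ga) ->
  ana (fun x => complex.Re (c * f (x +i* ga))) x.
Proof.
move=> h; have n1 : normc (1 : R[i]) = 1 by exact: ComplexField.Normc.normc1.
have [al [r r0 H]] := line_psum c n1 h; exists al, r => // t tr.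
have := H t tr; rewrite mulr1 (_ : x +i* ga + t%:C = (x + t) +i* ga)//.
by apply/eqP; rewrite eq_complex/= addr0 !eqxx.
Qed.

Lemma psum_seq_cvg (al : nat -> R) (f : R -> R) (r : R) : 0 < r ->
  (forall t, `|t| < r -> psum al t (f t)) -> f n.+1%:R^-1 @[n --> \oo] --> f 0.
Proof.
move=> r0 H.
have r2 : 0 < r / 2 by rewrite divr_gt0.
have h1 : `|r / 2| < r by rewrite ger0_norm ?(ltW r2)//; lra.
have [C C0 HC] := @psum_remainder R al (r / 2) _ 1 r2 (H _ h1).
have h0 : `|0 : R| < r by rewrite normr0.
have e0 := psum0 (H 0 h0).
apply/cvgrPdist_le => e e_gt0.
have r4 : 0 < r / 2 / 2 by rewrite !divr_gt0.
have [N1 HN1] : exists N1 : nat, forall n : nat, (N1 <= n)%N -> n.+1%:R^-1 <= r / 2 / 2 /\ C * n.+1%:R^-1 <= e.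
  pose b := (r / 2 / 2)^-1 + C / e.
  have b0 : 0 <= b by apply: addr_ge0; [rewrite invr_ge0 ltW|rewrite divr_ge0// ltW].
  exists (Num.bound b) => n hn.
  have hb : b < n.+1%:R.
    by apply: (lt_le_trans (archi_boundP b0)); rewrite ler_nat (leq_trans hn).
  have p1 : 0 < n.+1%:R :> R by [].
  have q1 : 0 <= (r / 2 / 2)^-1 by rewrite invr_ge0 ltW.
  have q2 : 0 <= C / e by rewrite divr_ge0// ltW.
  split.
    by rewrite invf_ple ?posrE//; rewrite /b in hb; lra.
  by rewrite ler_pdivrMr// mulrC -ler_pdivrMr//; rewrite /b in hb; lra.
exists N1 => // n /= /HN1[t1 t2].
have p1 : 0 <= n.+1%:R^-1 :> R by rewrite invr_ge0.
have h2 : `|n.+1%:R^-1 : R| < r by rewrite (ger0_norm p1) (le_lt_trans t1)//; lra.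
have h3 : `|n.+1%:R^-1 : R| <= r / 2 / 2 by rewrite ger0_norm.
have := HC _ _ h3 (H _ h2); rewrite big_ord1 mulr1 expr1 -e0 (ger0_norm p1) distrC.
by move/le_trans; apply.
Qed.

Lemma far_osc_lin (x ga al be : R) : 0 < x ->
  \int[mu]_(y in far) (fpart y * osc (x + 1) ga al be y) =
  al * \int[mu]_(y in far) (fpart y * osc (x + 1) ga 1 0 y) +
  be * \int[mu]_(y in far) (fpart y * osc (x + 1) ga 0 1 y).
Proof.
move=> x0.
have i a b : L1 far (fun y => fpart y * osc (x + 1) ga a b y) by exact: (L1_far_frac_oscc ga (a +i* b) x0).
rewrite -(RintZ _ mfar (i 1 0)) -(RintZ _ mfar (i 0 1)).
rewrite -(RintD mfar (L1Zl mfar _ (i 1 0)) (L1Zl mfar _ (i 0 1))).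
by apply: eq_Rintegral => y _; rewrite osc_lin; ring.
Qed.

(** The difference of the two sides of [dirichlet_far], to be continued from x > 1. *)
Definition defect (zeta : R[i]^o -> R[i]^o) (d : R[i]) (x ga : R) : R :=
  complex.Re (((x - 1) +i* ga) * d * zeta (x +i* ga)) - complex.Re ((x +i* ga) * d) +
  \int[mu]_(y in far) (fpart y * oscc (x + 1) ga ((x +i* ga) * (((x - 1) +i* ga) * d)) y).

Definition farI (al be x ga : R) : R := \int[mu]_(y in far) (fpart y * osc (x + 1) ga al be y).

(** In this form the defect is a combination, with coefficients polynomial in x, of four functions
    known to be analytic in x. *)
Lemma defectE zeta (d : R[i]) (x ga : R) : 0 < x -> defect zeta d x ga =
  (x - 1) * complex.Re (d * zeta (x +i* ga)) + ga * complex.Re ('i * d * zeta (x +i* ga))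
  - (x * complex.Re d - ga * complex.Im d)
  + (((x * (x - 1) - ga ^+ 2) * complex.Re d - ga * (2 * x - 1) * complex.Im d) * farI 1 0 x ga
  + ((x * (x - 1) - ga ^+ 2) * complex.Im d + ga * (2 * x - 1) * complex.Re d) * farI 0 1 x ga).
Proof.
move=> x0; rewrite /defect /oscc far_osc_lin// /farI.
move: (\int[mu]_(y in far) (fpart y * osc (x + 1) ga 1 0 y)) (\int[mu]_(y in far) (fpart y * osc (x + 1) ga 0 1 y)) => A B.
by case: d => a b; case: (zeta _) => u v; rewrite /=; ring.
Qed.

(** For ga nonzero the horizontal line avoids the pole at 1, so [ana_identity] applies on the whole
    half line x > 0. *)
Lemma zeta_far_line (zeta : R[i]^o -> R[i]^o) (x ga : R) (d : R[i]) :
  is_riemann_zeta zeta -> ga != 0 -> 0 < x -> defect zeta d x ga = 0.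
Proof.
move=> hz ga0.
pose U x := complex.Re (d * zeta (x +i* ga)).
pose V x := complex.Re ('i * d * zeta (x +i* ga)).
pose A x := farI 1 0 x ga; pose B x := farI 0 1 x ga.
pose a := complex.Re d; pose b := complex.Im d.
(* The defect rearranged so that [anaD], [anaZ] and [anaX] apply term by term. *)
pose H x := x * U x + (- 1) * U x + ga * V x + (- a) * (x * 1) + ga * b
  + (a * (x * (x * A x)) + ((- a - 2 * ga * b) * (x * A x) + (- ga ^+ 2 * a + ga * b) * A x)
  + (b * (x * (x * B x)) + ((- b + 2 * ga * a) * (x * B x) + (- ga ^+ 2 * b - ga * a) * B x))).
have HE y : 0 < y -> H y = defect zeta d y ga.
  move=> y0; rewrite defectE// /H -/(U y) -/(V y) -/(A y) -/(B y) -/a -/b.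
  rewrite /a /b; move: (U y) (V y) (A y) (B y) (complex.Re d) (complex.Im d) => u v s t p q; ring.
move=> x0; rewrite -HE//; move: x x0; apply: ana_identity => x x0.
  have hU : ana U x.
    apply: ana_line; apply: hz.1; apply/eqP => /(congr1 (@complex.Im R))/= h.
    by rewrite h eqxx in ga0.
  have hV : ana V x.
    apply: ana_line; apply: hz.1; apply/eqP => /(congr1 (@complex.Im R))/= h.
    by rewrite h eqxx in ga0.
  have hA : ana A x by exact: ana_far.
  have hB : ana B x by exact: ana_far.
  have h1 : ana (fun y : R => y * 1) x by apply: anaX; exact: ana_cst.
  have hAB (F : R -> R) (c1 c2 c3 : R) : ana F x ->
      ana (fun y => c1 * (y * (y * F y)) + (c2 * (y * F y) + c3 * F y)) x.
    move=> hF; apply: anaD; first by apply: anaZ; apply: anaX; exact: anaX.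
    by apply: anaD; apply: anaZ; [exact: anaX|].
  apply: anaD; last by apply: anaD; exact: hAB.
  apply: anaD; last exact: ana_cst.
  apply: anaD; last exact: anaZ.
  apply: anaD; last exact: anaZ.
  by apply: anaD; [exact: anaX|exact: anaZ].
have p : 0 < x by lra.
by rewrite HE// /defect (dirichlet_far _ _ hz x0); ring.
Qed.

(** The real axis is blocked by the pole, so it is reached from the lines ga = 1/(n+1) by
    continuity; for x < 1 zeta is analytic at the limit point. *)
Lemma zeta_far (zeta : R[i]^o -> R[i]^o) (x ga : R) (d : R[i]) :
  is_riemann_zeta zeta -> 0 < x < 1 -> defect zeta d x ga = 0.
Proof.
move=> hz /andP[x0 x1]; have [->|ga0] := eqVneq ga 0; last exact: zeta_far_line.
have hx : analytic_at zeta (x +i* 0).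
  apply: hz.1; apply/eqP => /(congr1 (@complex.Re R))/= h; by rewrite h ltxx in x1.
have ni : normc ('i : R[i]) = 1 by rewrite /= expr0n/= expr1n add0r sqrtr1.
have cz c : complex.Re (c * zeta (x +i* n.+1%:R^-1)) @[n --> \oo] --> complex.Re (c * zeta (x +i* 0)).
  have [al [r r0 H]] := line_psum c ni hx.
  apply: (@psum_seq_cvg al (fun t => complex.Re (c * zeta (x +i* t))) r) => // t tr.
  have := H t tr; rewrite (_ : x +i* 0 + t%:C * 'i = x +i* t)//.
  by apply/eqP; rewrite eq_complex/=; apply/andP; split; apply/eqP; ring.
have tn : (n.+1%:R^-1 : R) @[n --> \oo] --> (0 : R) by exact: cvg_harmonic.
have cI al be : farI al be x n.+1%:R^-1 @[n --> \oo] --> farI al be x 0.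
  have i1 : L1 far (fun y => fpart y * pw (- x - 1) y) by apply: L1_far_frac_pw; lra.
  apply: (@Rintegral_dct _ far set0 (fun n y => fpart y * osc (x + 1) n.+1%:R^-1 al be y) _
    (fun y => (`|al| + `|be|) * (fpart y * pw (- x - 1) y))) => //.
  - by move=> n; apply: measurable_funTS; apply: measurable_funM; [exact: measurable_frac|exact: measurable_osc].
  - by apply: measurable_funTS; apply: measurable_funM; [exact: measurable_frac|exact: measurable_osc].
  - exact: L1Zl.
  - move=> y _ _; rewrite /osc.
    have h : n.+1%:R^-1 * ln y @[n --> \oo] --> (0 * ln y : R) by apply: cvgM => //; exact: cvg_cst.
    apply: cvgM; first exact: cvg_cst; apply: cvgM; first exact: cvg_cst.
    apply: cvgD; apply: cvgM; try exact: cvg_cst.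
      by apply: continuous_cvg => //; exact: continuous_cos.
    by apply: continuous_cvg => //; exact: continuous_sin.
  - move=> n y _; rewrite normrM ger0_norm ?frac_ge0// mulrCA ler_wpM2l ?frac_ge0//.
    by rewrite -opprD; exact: osc_bound.
have c1 : defect zeta d x n.+1%:R^-1 @[n --> \oo] --> defect zeta d x 0.
  rewrite defectE//; under eq_cvg do rewrite defectE//.
  have cc (k : R) : (fun=> k : R) n @[n --> \oo] --> k by exact: cvg_cst.
  have c2 : n.+1%:R^-1 ^+ 2 @[n --> \oo] --> (0 ^+ 2 : R).
    by rewrite [X in _ --> X]expr2; under eq_cvg do rewrite expr2; exact: cvgM.
  apply: cvgD; first apply: cvgB; first apply: cvgD.
  - by apply: cvgM => //; exact: cc.
  - by apply: cvgM.
  - by apply: cvgB; [exact: cc|apply: cvgM => //; exact: cc].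
  - apply: cvgD; apply: cvgM => //.
    + apply: cvgB; apply: cvgM; try exact: cc.
        by apply: cvgB => //; exact: cc.
      by apply: cvgM => //; exact: cc.
    + apply: cvgD; apply: cvgM; try exact: cc.
        by apply: cvgB => //; exact: cc.
      by apply: cvgM => //; exact: cc.
have c3 : defect zeta d x n.+1%:R^-1 @[n --> \oo] --> (0 : R).
  apply: (@cvg_trans _ (cst (0 : R) @ \oo)); last exact: cvg_cst.
  by apply: near_eq_cvg; near=> n; rewrite zeta_far_line// invr_eq0 pnatr_eq0.
by rewrite -(cvg_lim (@Rhausdorff R) c1) (cvg_lim (@Rhausdorff R) c3).
Unshelve. all: by end_near. Qed.

(** On ]0, 1[ the integrand is y^-s, which contributes 1/(1 - s) when Re s < 1. This is exactly what
    cancels the polar term of [dirichlet_far] when the integral is extended to ]0, oo[. *)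
Theorem zeta_strip (zeta : R[i]^o -> R[i]^o) (x ga : R) (d : R[i]) :
  is_riemann_zeta zeta -> 0 < x < 1 ->
  \int[mu]_(y in pos) (fpart y * oscc (x + 1) ga ((x +i* ga) * (((x - 1) +i* ga) * d)) y) =
  - complex.Re (((x - 1) +i* ga) * d * zeta (x +i* ga)).
Proof.
move=> hz x01; have /andP[x0 x1] := x01.
set c := (x +i* ga) * _.
have i : L1 pos (fun y => fpart y * oscc (x + 1) ga c y).
  by apply: (L1_eq mpos) (L1_frac_osc ga (complex.Re c) (complex.Im c) ltr01 x01) => y _; rewrite mul1r.
rewrite (Rintegral_split ler01 i).
have := zeta_far ga d hz x01; rewrite /defect -/c => h.
suff -> : \int[mu]_(y in `]0, 1]) (fpart y * oscc (x + 1) ga c y) = - complex.Re ((x +i* ga) * d) by lra.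
have m01 : measurable (`]0, 1] : set R) by exact: measurable_itv.
pose f y := oscc x ga c y.
have E (y : R) : 0 < y < 1 -> fpart y * oscc (x + 1) ga c y = f y.
  move=> /andP[y0 y1]; rewrite frac_small ?(ltW y0)// -{1}(pw1 y0) /oscc osc_shift.
  by apply: osc_eq; ring.
have mf : measurable_fun setT f by exact: measurable_oscc.
have fb y : `|f y| <= (`|complex.Re c| + `|complex.Im c|) * pw (- x) y by exact: oscc_norm.
have if01 : L1 `]0, 1] f.
  apply: (@L1_le _ _ m01 _ (fun y => (`|complex.Re c| + `|complex.Im c|) * pw (- x) y)) => //.
    exact: measurable_funTS.
  by apply: L1Zl => //; apply: L1_pw_0; lra.
have -> : \int[mu]_(y in `]0, 1]) (fpart y * oscc (x + 1) ga c y) = \int[mu]_(y in `]0, 1]) f y.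
  (* The endpoint 1 is dropped because {1} = 0 while the formula for y < 1 would give 1. *)
  have hb (g : R -> R) : L1 `]0, 1] g -> \int[mu]_(y in `]0, 1]) g y = \int[mu]_(y in `]0, 1[) g y.
    by move=> ig; rewrite Rintegral_itv_bndo_bndc//; apply: (@L1_sub _ _ `]0, 1]%classic) => // y; rewrite /= !in_itv/= => /andP[-> /ltW ->].
  rewrite !hb//; last first.
    by apply: (@L1_sub _ _ pos) => // y; rewrite /= !in_itv/= => /andP[->].
  by apply: eq_Rintegral => y; rewrite inE /= in_itv/=; exact: E.
(* A cut-off tending to 0, written as an inverse so that the boundary term becomes a decaying power
   at infinity. *)
pose eps (n : nat) : R := (1 + n.+1%:R)^-1.
have eps0 n : 0 < eps n by rewrite invr_gt0 addr_gt0.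
have eps1 n : eps n < 1 by rewrite invf_lt1 ?addr_gt0// ltrDl.
pose F (n : nat) y := \1_(`]eps n, 1]%classic) y * f y.
have C1 : \int[mu]_(y in `]0, 1]) F n y @[n --> \oo] --> \int[mu]_(y in `]0, 1]) f y.
  apply: (@Rintegral_dct _ _ set0 _ _ (fun y => `|f y|)) => //.
  - move=> n; apply: measurable_funTS; apply: measurable_funM; last exact: measurable_oscc.
    by apply: measurable_indic; exact: measurable_itv.
  - exact: measurable_funTS.
  - exact: L1_norm.
  - move=> y; rewrite /= in_itv/= => /andP[y0 y1] _.
    apply: (@cvg_trans _ (cst (f y) @ \oo)); last exact: cvg_cst.
    apply: near_eq_cvg; near=> n; rewrite /F indicE mem_set ?mul1r//=.
    rewrite in_itv/= y1 andbT /eps invf_plt ?posrE ?addr_gt0//.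
    near: n; exact: (cvgryPgt _).1 (cvg_addn_pinfty 1) y^-1.
  - move=> n y _; rewrite /F normrM indicE -[leRHS]mul1r ler_wpM2r//.
    by case: (y \in _); rewrite ?normr1 ?normr0.
pose g y := oscc (x - 1) ga ((x +i* ga) * d) y.
have C2 : \int[mu]_(y in `]0, 1]) F n y @[n --> \oo] --> - complex.Re ((x +i* ga) * d).
  have En n : \int[mu]_(y in `]0, 1]) F n y = g (eps n) - g 1.
    transitivity (\int[mu]_(y in `]eps n, 1]) f y).
      rewrite (Rintegral_indic `]0, 1]) (Rintegral_indic `]eps n, 1]).
      apply: eq_Rintegral => y _; rewrite /F !indicE.
      case: (boolP (y \in `]eps n, 1]%classic)) => [|_]; last by rewrite mul0r mulr0.
      by rewrite inE /= in_itv/= => /andP[xy y1]; rewrite mem_set ?mul1r//= in_itv/= y1 (lt_trans (eps0 n) xy).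
    have [||_ ->] := @ftc_oc R (fun y => - g y) f (eps n) 1 (eps1 n).
    - move=> y /andP[xy _]; have y0 := lt_le_trans (eps0 n) xy.
      apply: der_eq (derN (der_oscc (x - 1) ga ((x +i* ga) * d) y0)) _.
      rewrite opprK /f /c mulrCA /oscc; apply: osc_eq; ring.
    - move=> y /andP[xy _]; have y0 := lt_le_trans (eps0 n) xy; exact: continuous_osc.
    - ring.
  rewrite (_ : (fun n => _) = (fun n => g (eps n) - g 1)); last by apply/funext => n; rewrite En.
  have g1 : g 1 = complex.Re ((x +i* ga) * d).
    by rewrite /g /oscc /osc pw_1 ln1 mulr0 cos0 sin0; ring.
  rewrite -[X in _ --> - X]g1 -[X in _ --> X]add0r; apply: cvgB; last exact: cvg_cst.
  pose M := `|complex.Re ((x +i* ga) * d)| + `|complex.Im ((x +i* ga) * d)|.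
  apply: norm_cvg0.
  have H : M * pw (x - 1) (1 + n.+1%:R) @[n --> \oo] --> (0 : R).
    rewrite -[X in _ --> X](mulr0 M); apply: cvgM; first exact: cvg_cst.
    apply: (cvg_comp _ _ (cvg_addn_pinfty 1)); apply: pw_cvg0; lra.
  apply: (@squeeze_cvgr _ _ _ _ (fun=> 0) (fun n => M * pw (x - 1) (1 + n.+1%:R))) => //; last exact: cvg_cst.
  near=> n; rewrite normr_ge0/=; apply: (le_trans (oscc_norm _ _ _ _)).
  rewrite /eps pwV ?addr_gt0//; rewrite le_eqVlt; apply/orP; left; apply/eqP; congr (_ * _); apply: pw_eq; ring.
by rewrite -(cvg_lim (@Rhausdorff R) C1) (cvg_lim (@Rhausdorff R) C2).
Unshelve. all: by end_near. Qed.

End Dirichlet.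

(** * Logarithmic moments at a zero *)

Section Moments.
Context {R : realType}.
Local Notation mu := (@lebesgue_measure R).
Local Notation L1 D f := (mu.-integrable D (EFin \o f)).
Local Notation pos := (`]0, +oo[%classic : set R).
Local Notation normc := ComplexField.Normc.normc.
Local Open Scope complex_scope.

Let mpos : measurable pos. Proof. exact: measurable_itv. Qed.

Variables (zeta : R[i]^o -> R[i]^o).
Hypothesis hz : is_riemann_zeta zeta.

Lemma normcX (z : R[i]) n : normc (z ^+ n) = normc z ^+ n.
Proof.
elim: n => [|n IH]; first exact: ComplexField.Normc.normc1.
by rewrite !exprS ComplexField.Normc.normcM IH.
Qed.

Lemma strip_mellin (x ga : R) (c : R[i]) : 0 < x < 1 ->
  \int[mu]_(y in pos) (fpart y * oscc (x + 1) ga c y) =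
  - complex.Re (c / (x +i* ga) * zeta (x +i* ga)).
Proof.
move=> x01; have /andP[x0 x1] := x01.
have s0 : x +i* ga != 0 :> R[i] by rewrite eq_complex/= gt_eqF.
have s1 : (x - 1) +i* ga != 0 :> R[i] by rewrite eq_complex/= lt_eqF ?subr_lt0.
have := zeta_strip ga (c / ((x +i* ga) * ((x - 1) +i* ga))) hz x01.
move: (x +i* ga) ((x - 1) +i* ga) s0 s1 => s s' s0 s1.
have -> : s * (s' * (c / (s * s'))) = c by field; rewrite s0 s1.
move=> ->; congr (- complex.Re (_ * _)).
by field; rewrite s0 s1.
Qed.

Lemma zero_mellin (x ga : R) : 0 < x < 1 -> zeta (x +i* ga) = 0 -> mellin_zero x ga.
Proof.
move=> x01 z0 a b; have := strip_mellin ga (a +i* b) x01.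
by rewrite z0 mulr0 /= oppr0.
Qed.

(** Only real displacements t matter, since the exponent is expanded along a horizontal line. The
    cofactor g is bounded near its centre through the expansions of its real and imaginary parts. *)
Lemma order_bound (x ga : R) (m : nat) : vanishing_order zeta (x +i* ga) m ->
  exists2 C : R, 0 <= C & exists2 r : R, 0 < r &
    forall t, `|t| < r -> normc (zeta ((x + t) +i* ga)) <= C * `|t| ^+ m.
Proof.
move=> [g [ga_an _ /nbhs_normc[r1 r10 Hz]]].
have n1 : normc (1 : R[i]) = 1 by exact: ComplexField.Normc.normc1.
have E t : (x +i* ga) + t%:C * 1 = (x + t) +i* ga.
  by apply/eqP; rewrite eq_complex/=; apply/andP; split; apply/eqP; ring.
have bd c : exists2 B : R, 0 <= B & exists2 r : R, 0 < r &
    forall t, `|t| < r -> `|complex.Re (c * g ((x + t) +i* ga))| <= B.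
  have [al [r r0 H]] := line_psum c n1 ga_an.
  have r2 : 0 < r / 2 by rewrite divr_gt0.
  have h1 : `|r / 2| < r by rewrite ger0_norm ?(ltW r2)//; lra.
  have [B B0 HB] := @psum_remainder R al (r / 2) _ 0 r2 (H _ h1).
  exists B => //; exists (r / 2 / 2); first by rewrite divr_gt0.
  move=> t tr; have tr' : `|t| < r by lra.
  by rewrite -E; have := HB t _ (ltW tr) (H _ tr'); rewrite big_ord0 subr0 expr0 [B * 1]mulr1.
have [B1 B10 [s1 s10 H1]] := bd 1; have [B2 B20 [s2 s20 H2]] := bd 'i.
exists (B1 + B2); first exact: addr_ge0.
exists (Num.min r1 (Num.min s1 s2)); first by rewrite !lt_min r10 s10.
move=> t; rewrite !lt_min => /and3P[t1 t2 t3].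
rewrite Hz; last by rewrite -E addrAC subrr add0r mulr1 normcR.
rewrite ComplexField.Normc.normcM mulrC.
have -> : (x + t) +i* ga - (x +i* ga) = t%:C by rewrite -E addrAC subrr add0r mulr1.
rewrite normcX normcR ler_wpM2r ?exprn_ge0//.
apply: (le_trans (normc_le _)); apply: lerD.
  by have := H1 t t2; rewrite mul1r.
by have := H2 t t3; case: (g _) => u v; rewrite /= mul0r mul1r sub0r normrN.
Qed.

Lemma oscc_scale_norm (x ga th : R) (c : R[i]) (r : R) : 0 < th -> 
  exists2 C : R, 0 <= C & forall t, 0 <= t <= r ->
    normc (oscc (x + t + 1) ga c th^-1 +i* osc (x + t + 1) ga (complex.Im c) (- complex.Re c) th^-1) <= C.
Proof.
move=> t0; pose M := `|complex.Re c| + `|complex.Im c|.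
have M0 : 0 <= M by exact: addr_ge0.
exists (M * 2 * (pw (- (x + 1)) th^-1 * expR (r * `|ln th|))).
  by apply: mulr_ge0; [exact: mulr_ge0|exact: mulr_ge0 (pw_ge0 _ _) (expR_ge0 _)].
move=> t /andP[t1 t2]; apply: (le_trans (normc_le _)).
have P : pw (- (x + t + 1)) th^-1 <= pw (- (x + 1)) th^-1 * expR (r * `|ln th|).
  rewrite (_ : - (x + t + 1) = - (x + 1) + - t); last by ring.
  rewrite pwD ler_wpM2l ?pw_ge0// /pw ler_expR lnV ?posrE// mulrNN.
  apply: (le_trans (ler_norm _)); rewrite normrM (ger0_norm t1).
  by rewrite ler_wpM2r.
apply: (@le_trans _ _ (M * 2 * pw (- (x + t + 1)) th^-1)); last first.
  by rewrite ler_wpM2l// mulr_ge0.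
rewrite mulr2n mulrDr mulr1 mulrDl; apply: lerD; first exact: oscc_norm.
have h := osc_bound (x + t + 1) ga (complex.Im c) (- complex.Re c) th^-1.
by rewrite normrN [`|_| + `|_|]addrC in h; exact: h.
Qed.

(** As a function of t, the integral at exponent x + t is a bounded multiple of zeta(x + t + i ga),
    hence O(t^m); its Taylor coefficients are the logarithmic moments up to (-1)^k / k!, so
    [psum_coef0] annihilates those of order < m. *)
Theorem zero_moments (x ga : R) (m : nat) : 0 < x < 1 ->
  vanishing_order zeta (x +i* ga) m -> forall (k : nat) (th al be : R), (k < m)%N -> 0 < th ->
  L1 pos (fun y => fpart (th * y) * (ln y ^+ k * osc (x + 1) ga al be y)) /\
  \int[mu]_(y in pos) (fpart (th * y) * (ln y ^+ k * osc (x + 1) ga al be y)) = 0.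
Proof.
move=> x01 /order_bound[C C0 [r0 r00 Hz]] k th al be km th0.
have /andP[x0 x1] := x01.
(* x - r and x + r stay inside the strip, and r inside the disc where the order estimate holds. *)
pose r := Num.min (Num.min (x / 2) ((1 - x) / 2)) (r0 / 2).
have rp : 0 < r by rewrite !lt_min !divr_gt0 ?subr_gt0.
have rx : r <= x / 2 by rewrite /r !ge_min lexx.
have rx1 : r <= (1 - x) / 2 by rewrite /r !ge_min lexx orbT.
have rr : r <= r0 / 2 by rewrite /r !ge_min lexx orbT.
clearbody r.
have mw : measurable_fun setT (fun y => fpart (th * y)) by meas.
have ip (a : R) : 0 < a < 1 -> L1 pos (fun y => fpart (th * y) * pw (- x - 1 + (x - a)) y).
  move=> a01; apply: (L1_eq mpos) (L1_frac_pw th0 a01) => y _; congr (_ * _); apply: pw_eq; ring.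
have [||ik H] := @mellin_expand R pos (fun y => fpart (th * y)) x r ga al be mpos (fun=> id) mw rp.
- apply: (L1_eq mpos) (ip (x - r) _) => [y _|]; last by lra.
  congr (_ * _); apply: pw_eq; ring.
- apply: (L1_eq mpos) (ip (x + r) _) => [y _|]; last by lra.
  congr (_ * _); apply: pw_eq; ring.
split; first exact: ik.
have [B B0 HB] := oscc_scale_norm x ga (al +i* be) r th0.
have := @psum_coef0 R _ (fun t => \int[mu]_(y in pos) (fpart (th * y) * osc (x + t + 1) ga al be y)) r
  (th^-1 * (B / x * C)) m rp _ _ k km.
move=> /(_ (fun k => (-1) ^+ k / k`!%:R *
      \int[mu]_(y in pos) (fpart (th * y) * (ln y ^+ k * osc (x + 1) ga al be y)))) K.
have /eqP : (-1) ^+ k / k`!%:R *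
      \int[mu]_(y in pos) (fpart (th * y) * (ln y ^+ k * osc (x + 1) ga al be y)) = 0.
  apply: K => [t /andP[t0 t1]|t /andP[t0 t1]]; first by apply: H; rewrite ger0_norm.
  have xt : 0 < x + t < 1 by lra.
  rewrite frac_osc_scale// normrM ger0_norm ?invr_ge0 ?(ltW th0)// -!mulrA ler_wpM2l ?invr_ge0 ?(ltW th0)//.
  pose c := osc (x + t + 1) ga al be th^-1 +i* osc (x + t + 1) ga be (- al) th^-1 : R[i].
  rewrite -[X in `|X|]/(\int[mu]_(y in pos) (fpart y * oscc (x + t + 1) ga c y)).
  rewrite strip_mellin// normrN; apply: (le_trans (Re_normc _)).
  rewrite !ComplexField.Normc.normcM ComplexField.Normc.normcV [leRHS]mulrA.
  have hn : x <= normc ((x + t) +i* ga).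
    apply: le_trans (Re_normc _); rewrite /= ger0_norm; lra.
  have h1 : normc c <= B by apply: (HB t); rewrite t1 ltW.
  have h2 : normc (zeta ((x + t) +i* ga)) <= C * t ^+ m.
    have := Hz t; rewrite (ger0_norm (ltW t0)); apply; lra.
  have c0 : 0 <= normc c by exact: le_trans (Re_normc _).
  have z0 : 0 <= normc (zeta ((x + t) +i* ga)) by exact: le_trans (Re_normc _).
  have nx : 0 < normc ((x + t) +i* ga) by apply: lt_le_trans hn.
  apply: ler_pM => //; first by rewrite divr_ge0// ltW.
  by apply: ler_pM => //; rewrite ?invr_ge0 ?(ltW nx)// lef_pV2.
have nz : (-1) ^+ k / k`!%:R != 0 :> R.
  apply: mulf_neq0; first by rewrite expf_neq0// oppr_eq0 oner_eq0.
  by rewrite invr_eq0 pnatr_eq0 -lt0n fact_gt0.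
by rewrite mulf_eq0 (negbTE nz)/= => /eqP.
Qed.

End Moments.

(** * Lower bounds for the distance *)

Section TestInequality.
Context {R : realType}.
Local Notation mu := (@lebesgue_measure R).
Local Notation L1 D f := (mu.-integrable D (EFin \o f)).
Local Notation pos := (`]0, +oo[%classic : set R).
Local Notation far := (`]1, +oo[%classic : set R).

Let mpos : measurable pos. Proof. exact: measurable_itv. Qed.
Let mfar : measurable far. Proof. exact: measurable_itv. Qed.

Definition fracsum n (c th : 'I_n -> R) (y : R) : R := \sum_(i < n) c i * fpart (th i * y).

(* chi - f after the change of variable y = 1/t *)
Definition residual n (c th : 'I_n -> R) (y : R) : R := \1_(`[1, +oo[%classic) y - fracsum c th y.

Lemma measurable_fracsum n (c th : 'I_n -> R) : measurable_fun setT (fracsum c th).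
Proof. by rewrite /fracsum; apply: measurable_sum => i; meas. Qed.

Lemma measurable_residual n (c th : 'I_n -> R) : measurable_fun setT (residual c th).
Proof. by apply: measurable_funB; [exact: measurable_indic|exact: measurable_fracsum]. Qed.

Lemma fracsum_norm n (c th : 'I_n -> R) y : `|fracsum c th y| <= \sum_(i < n) `|c i|.
Proof.
apply: le_trans (ler_norm_sum _ _ _) _; apply: ler_sum => i _.
by rewrite normrM -[leRHS]mulr1 ler_wpM2l// frac_norm.
Qed.

Lemma fracsum_orth (Y : R -> R) n (c th : 'I_n -> R) :
  (forall i, 0 < th i) -> (forall t, 0 < t -> L1 pos (fun y => fpart (t * y) * Y y) /\
    \int[mu]_(y in pos) (fpart (t * y) * Y y) = 0) ->
  L1 pos (fun y => fracsum c th y * Y y) /\ \int[mu]_(y in pos) (fracsum c th y * Y y) = 0.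
Proof.
move=> t0 H.
have E y : \sum_(i < n) c i * (fpart (th i * y) * Y y) = fracsum c th y * Y y.
  by rewrite /fracsum mulr_suml; apply: eq_bigr => i _; rewrite mulrA.
have ii i : L1 pos (fun y => c i * (fpart (th i * y) * Y y)) by apply: L1Zl => //; exact: (H _ (t0 i)).1.
split; first by apply: (L1_eq mpos) (L1_sum mpos _ ii) => y _; exact: E.
transitivity (\int[mu]_(y in pos) (\sum_(i < n) c i * (fpart (th i * y) * Y y))).
  by apply: eq_Rintegral => y _; rewrite E.
rewrite Rintegral_sum// big1// => i _.
have [i1 e] := H _ (t0 i); by rewrite (RintZ _ mpos i1) e mulr0.
Qed.

(** Under y = 1/t the measure dt becomes dy / y^2, hence the division by y. *)
Definition l2dist n (c th : 'I_n -> R) : R := Num.sqrt (\int[mu]_(y in pos) ((residual c th y / y) ^+ 2)).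

Lemma l2dist_sub (D : set R) n (c th : 'I_n -> R) : measurable D -> D `<=` pos ->
  L1 pos (fun y => (residual c th y / y) ^+ 2) ->
  L1 D (fun y => (residual c th y / y) ^+ 2) /\
  Num.sqrt (\int[mu]_(y in D) ((residual c th y / y) ^+ 2)) <= l2dist c th.
Proof.
move=> mD Dp i; have iD : L1 D (fun y => (residual c th y / y) ^+ 2) by exact: (L1_sub mD mpos Dp i).
split=> //; apply: ler_wsqrtr; rewrite (Rintegral_indic D) (Rintegral_indic pos).
apply: le_Rintegral => //.
- exact: (proj1 (L1_indic _ mD)).
- exact: (proj1 (L1_indic _ mpos)).
- move=> y _; rewrite ler_wpM2r ?sqr_ge0// !indicE ler_nat.
  case: (boolP (y \in D)) => [|//]; rewrite inE => /Dp h; by rewrite mem_set.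
Qed.

(** Since every theta is at most 1, F is linear on ]0, 1[, say A y; there the residual divided by y
    is the constant -A, so |A| is at most the distance. *)
Lemma head_bound (Y : R -> R) (M : R) n (c th : 'I_n -> R) :
  (forall i, 0 <= th i <= 1) -> measurable_fun setT Y -> L1 `]0, 1] (fun y => y * Y y) ->
  \int[mu]_(y in `]0, 1]) `|y * Y y| <= M ->
  L1 `]0, 1] (fun y => fracsum c th y * Y y) ->
  L1 pos (fun y => (residual c th y / y) ^+ 2) ->
  `|\int[mu]_(y in `]0, 1]) (fracsum c th y * Y y)| <= l2dist c th * M.
Proof.
move=> th1 mY iyY hM iFY iG.
have m01 : measurable (`]0, 1[ : set R) by exact: measurable_itv.
have m01' : measurable (`]0, 1] : set R) by exact: measurable_itv.
have s01 : `]0, 1[%classic `<=` (`]0, 1]%classic : set R).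
  by move=> y /=; rewrite !in_itv/= => /andP[-> /ltW].
pose A := \sum_(i < n) c i * th i.
have FA y : 0 < y < 1 -> fracsum c th y = y * A.
  move=> /andP[y0 y1]; rewrite /fracsum /A mulr_sumr; apply: eq_bigr => i _.
  have /andP[t0 t1] := th1 i; rewrite frac_small; first by ring.
  by rewrite mulr_ge0 ?(ltW y0)//=; nra.
have iyY' : L1 `]0, 1[ (fun y => y * Y y) by exact: (L1_sub m01 m01' s01 iyY).
have oc (f : R -> R) : L1 `]0, 1] f -> \int[mu]_(y in `]0, 1]) f y = \int[mu]_(y in `]0, 1[) f y.
  by move=> i; rewrite Rintegral_itv_bndo_bndc//; exact: (L1_sub m01 m01' s01 i).
rewrite oc//.
have -> : \int[mu]_(y in `]0, 1[) (fracsum c th y * Y y) = A * \int[mu]_(y in `]0, 1[) (y * Y y).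
  rewrite -(RintZ _ m01 iyY'); apply: eq_Rintegral => y; rewrite inE /= in_itv/= => y01.
  by rewrite FA//; ring.
have N0 : 0 <= l2dist c th by exact: sqrtr_ge0.
rewrite normrM; apply: ler_pM => //; last first.
  apply: le_trans hM; rewrite oc; last exact: L1_norm.
  exact: le_normr_Rintegral.
have sp : `]0, 1[%classic `<=` pos by move=> y /=; rewrite !in_itv/= => /andP[->].
have [iD] := l2dist_sub m01 sp iG; apply: le_trans.
rewrite -sqrtr_sqr; apply: ler_wsqrtr.
have -> : \int[mu]_(y in `]0, 1[) ((residual c th y / y) ^+ 2) = \int[mu]_(y in `]0, 1[) (A ^+ 2).
  apply: eq_Rintegral => y; rewrite inE /= in_itv/= => y01; have /andP[y0 y1] := y01.
  rewrite /residual FA// indicE memNset ?sub0r; last by rewrite /= in_itv/= andbT; apply/negP; rewrite -ltNge.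
  by rewrite mulNr [y * A]mulrC mulfK ?gt_eqF// sqrrN.
have -> : \int[mu]_(y in `]0, 1[) (A ^+ 2) = A ^+ 2 * fine (mu `]0, 1[%classic) by rewrite Rintegral_cst.
by rewrite lebesgue_measure_itv/= lte01/= oppr0 addr0 mulr1.
Qed.

(** The dilation y = X z brings all theta X above 1, as [frac_sum_tail] demands. The normalisation
    X^(3/2) is that of y^(-rho-1) on the critical line; against the Jacobian X it leaves the gain
    X^(-1/2). *)
Lemma tail_bound : exists2 K : R, 0 <= K & forall n (c th : 'I_n -> R) (X M : R) (Y psi' : R -> R),
  1 <= X -> (forall i, X^-1 <= th i) -> measurable_fun setT Y ->
  L1 far (fun z => pw (3 / 2) X * Y (X * z)) ->
  (forall z, 1 <= z -> `|pw (3 / 2) X * Y (X * z)| <= M) ->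
  (forall z, 1 <= z -> der_at (fun z => pw (3 / 2) X * Y (X * z)) z (psi' z)) ->
  (forall z, 1 <= z -> `|psi' z| <= M / z ^+ 2) ->
  \int[mu]_(z in far) `|pw (3 / 2) X * Y (X * z)| <= M ->
  L1 pos (fun y => fracsum c th y * Y y) ->
  L1 pos (fun y => (residual c th y / y) ^+ 2) ->
  `|\int[mu]_(y in `]X, +oo[) (fracsum c th y * Y y)| <= K * M * (l2dist c th + pw (- 2^-1) X).
Proof.
have [C C0 HC] := @frac_sum_tail R.
pose I0 := \int[mu]_(y in pos) (1 + y ^+ 2)^-1 : R.
have iq : L1 pos (fun y => (1 + y ^+ 2)^-1) by apply: L1_sub (L1_oneDsqr (R := R)).
have I00 : 0 <= I0 by apply: Rintegral_ge0 => y _; rewrite invr_ge0 ltW ?sqr1D_gt0.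
exists (C * (I0 + Num.sqrt I0)); first by rewrite mulr_ge0// addr_ge0// sqrtr_ge0.
move=> n c th X M Y psi' X1 thX mY ipsi psiM dpsi psi'M intM iFY iG.
have X0 : 0 < X by apply: lt_le_trans X1.
have M0 : 0 <= M by apply: le_trans (psiM _ (lexx 1)).
have N0 : 0 <= l2dist c th by exact: sqrtr_ge0.
pose psi z := pw (3 / 2) X * Y (X * z).
have mpsi : measurable_fun setT psi.
  by apply: measurable_funM => //; apply: (measurableT_comp mY); meas.
have phi1 i : 1 <= th i * X by rewrite -ler_pdivrMr// mul1r.
have := HC n c (fun i => th i * X) psi psi' M phi1 mpsi ipsi psiM dpsi psi'M intM.
have FE z : \sum_(i < n) c i * fpart (th i * X * z) = fracsum c th (X * z).
  by rewrite /fracsum; apply: eq_bigr => i _; rewrite mulrA.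
under eq_Rintegral do rewrite FE.
under [in X in _ <= X -> _]eq_Rintegral do rewrite FE.
set J := \int[mu]_(z in pos) _ => B.
have mX : measurable (`]X, +oo[ : set R) by exact: measurable_itv.
have T1 : \int[mu]_(y in `]X, +oo[) (fracsum c th y * Y y) =
    pw (- 2^-1) X * \int[mu]_(z in far) (fracsum c th (X * z) * psi z).
  pose f y := \1_(`]X, +oo[%classic) y * (fracsum c th y * Y y).
  have mf : measurable_fun setT f.
    apply: measurable_funM; first exact: measurable_indic.
    by apply: measurable_funM => //; exact: measurable_fracsum.
  have XS : `]X, +oo[%classic `<=` pos by move=> y; rewrite /= !in_itv/= !andbT; exact: lt_trans.
  have if0 : L1 pos f.
    apply: (@L1_sub _ _ setT) => //; apply: (proj1 (L1_indic _ mX)); exact: (L1_sub mX mpos XS iFY).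
  have [i2 E2] := L1_scale X0 mf if0.
  transitivity (\int[mu]_(y in pos) f y).
    rewrite (Rintegral_indic `]X, +oo[) (Rintegral_indic pos); apply: eq_Rintegral => y _.
    rewrite /f !indicE; case: (boolP (y \in `]X, +oo[%classic)) => [|_]; last by rewrite !mul0r mulr0.
    by rewrite inE => /XS h; rewrite mem_set// !mul1r.
  have -> : \int[mu]_(y in pos) f y = X * \int[mu]_(y in pos) f (X * y).
    by rewrite E2 mulrA mulfV ?mul1r// gt_eqF.
  have ip : L1 far (fun z => fracsum c th (X * z) * psi z).
    apply: (@L1_bounded _ _ mfar _ _ (\sum_(i < n) `|c i|)) => //.
      by apply: measurable_funTS; apply: (measurableT_comp (measurable_fracsum c th)); meas.
    by move=> z _; exact: fracsum_norm.
  rewrite -(RintZ _ mpos i2) -(RintZ _ mfar ip) (Rintegral_indic far) (Rintegral_indic pos).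
  apply: eq_Rintegral => z _; rewrite !indicE.
  have -> : (z \in far) = (1 < z) by apply/idP/idP; rewrite inE /= in_itv/= andbT.
  have -> : (z \in pos) = (0 < z) by apply/idP/idP; rewrite inE /= in_itv/= andbT.
  rewrite /f indicE; have -> : (X * z \in `]X, +oo[%classic) = (1 < z).
    by apply/idP/idP; rewrite inE /= in_itv/= andbT ltr_pMr.
  case: (ltP 1 z) => z1; last by rewrite !mul0r !mulr0.
  rewrite (lt_trans ltr01 z1) !mul1r /psi.
  have pX : X = pw (- 2^-1) X * pw (3 / 2) X by rewrite -pwD -{1}(pw1 X0); apply: pw_eq; field.
  rewrite {1}pX.
  move: (fracsum _ _ _) (Y _) => u v; ring.
(* Here |F| <= 1 + |residual|, and the residual part is the product of residual/z and z/(1 + z^2),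
   to which Cauchy-Schwarz applies. *)
have J1 : J <= I0 + pw 2^-1 X * l2dist c th * Num.sqrt I0.
  pose g z := residual c th (X * z) / z.
  pose h (z : R) := z / (1 + z ^+ 2).
  have mg : measurable_fun setT g.
    apply: measurable_funM; last exact: measurable_invr.
    by apply: (measurableT_comp (measurable_residual c th)); meas.
  have mh : measurable_fun setT h by meas.
  have mG2 : measurable_fun setT (fun y => (residual c th y / y) ^+ 2).
    by apply: measurable_funX; apply: measurable_funM; [exact: measurable_residual|exact: measurable_invr].
  have [i2 E2] := L1_scale X0 mG2 iG.
  have gE z : 0 < z -> g z ^+ 2 = X ^+ 2 * (residual c th (X * z) / (X * z)) ^+ 2.
    by move=> z0; rewrite /g; move: (residual _ _ _) => u; field; rewrite !gt_eqF.
  have ig : L1 pos (fun z => g z ^+ 2).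
    apply: (L1_eq mpos) (L1Zl mpos (X ^+ 2) i2) => z; rewrite /= in_itv/= andbT => z0.
    by rewrite gE.
  have Eg : \int[mu]_(z in pos) (g z ^+ 2) = X * \int[mu]_(y in pos) ((residual c th y / y) ^+ 2).
    transitivity (\int[mu]_(z in pos) (X ^+ 2 * (residual c th (X * z) / (X * z)) ^+ 2)).
      by apply: eq_Rintegral => z; rewrite inE /= in_itv/= andbT => z0; exact: gE.
    by rewrite (RintZ _ mpos i2) E2 mulrA expr2 mulfK// gt_eqF.
  have hq z : h z ^+ 2 <= (1 + z ^+ 2)^-1.
    have p := sqr1D_gt0 z; rewrite /h expr_div_n ler_pdivrMr ?exprn_gt0//.
    by rewrite [_ ^+ 2 in leRHS]expr2 mulKf ?gt_eqF// lerDr.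
  have ih : L1 pos (fun z => h z ^+ 2).
    apply: (@L1_le _ _ mpos _ (fun z => (1 + z ^+ 2)^-1)) => //.
      by apply: measurable_funTS; exact: measurable_funX.
    by move=> z _; rewrite ger0_norm ?sqr_ge0.
  have ih' : \int[mu]_(z in pos) (h z ^+ 2) <= I0 by apply: le_Rintegral.
  have mgT : measurable_fun pos (fun z => `|g z|) by apply: measurable_funTS; exact: measurable_fun_normr.
  have mhT : measurable_fun pos (fun z => `|h z|) by apply: measurable_funTS; exact: measurable_fun_normr.
  have sq (k : R -> R) : L1 pos (fun z => k z ^+ 2) -> L1 pos (fun z => `|k z| ^+ 2).
    by apply: (L1_eq mpos) => z _; rewrite real_normK// num_real.
  have [igh CS] := cauchy_schwarz mpos mgT mhT (sq _ ig) (sq _ ih).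
  have iFa : L1 pos (fun z => `|fracsum c th (X * z)| / (1 + z ^+ 2)).
    apply: (@L1_bounded _ _ mpos _ _ (\sum_(i < n) `|c i|)) => //.
      apply: measurable_funTS; apply: measurable_fun_normr.
      by apply: (measurableT_comp (measurable_fracsum c th)); meas.
    by move=> z _; rewrite normr_id; exact: fracsum_norm.
  apply: (@le_trans _ _ (\int[mu]_(z in pos) ((1 + z ^+ 2)^-1 + `|g z| * `|h z|))).
    apply: le_Rintegral => //; first exact: (L1D mpos iq igh).
    move=> z; rewrite /= in_itv/= andbT => z0; have p := sqr1D_gt0 z.
    have -> : `|g z| * `|h z| = `|residual c th (X * z)| / (1 + z ^+ 2).
      rewrite -normrM -[X in _ = _ * X]ger0_norm ?invr_ge0 ?(ltW p)// -normrM /g /h.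
      by move: (residual _ _ _) => u; congr `|_|; field; rewrite !gt_eqF.
    have -> : (1 + z ^+ 2)^-1 + `|residual c th (X * z)| / (1 + z ^+ 2) =
        (1 + `|residual c th (X * z)|) / (1 + z ^+ 2) by rewrite [RHS]mulrDl mul1r.
    rewrite ler_wpM2r ?invr_ge0 ?(ltW p)//.
    have -> : fracsum c th (X * z) = \1_(`[1, +oo[%classic) (X * z) - residual c th (X * z) by rewrite /residual; ring.
    apply: (le_trans (ler_normB _ _)); rewrite lerD2r indicE.
    by case: (_ \in _); rewrite ?normr1 ?normr0.
  rewrite (RintD mpos iq igh) -/I0 lerD2l.
  apply: (le_trans (ler_norm _)); apply: (le_trans CS).
  have sqE (k : R -> R) : \int[mu]_(z in pos) (`|k z| ^+ 2) = \int[mu]_(z in pos) (k z ^+ 2).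
    by apply: eq_Rintegral => z _; rewrite real_normK// num_real.
  rewrite !sqE Eg; apply: ler_pM; rewrite ?sqrtr_ge0//; last exact: ler_wsqrtr.
  rewrite sqrtrM ?(ltW X0)// /l2dist ler_wpM2r ?sqrtr_ge0//.
  rewrite -(ger0_norm (pw_ge0 2^-1 X)) -sqrtr_sqr ler_wsqrtr// expr2 -pwD.
  by rewrite -{1}(pw1 X0) le_eqVlt; apply/orP; left; apply/eqP; apply: pw_eq; field.
rewrite T1 normrM ger0_norm ?pw_ge0//.
apply: (@le_trans _ _ (pw (- 2^-1) X * (C * M * (I0 + pw 2^-1 X * l2dist c th * Num.sqrt I0)))).
  rewrite ler_wpM2l ?pw_ge0//; apply: (le_trans B); rewrite ler_wpM2l ?mulr_ge0//.
have pp : pw (- 2^-1) X * pw 2^-1 X = 1 by rewrite -pwD addNr pw0.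
have p0 := pw_ge0 (- 2^-1) X.
have S0 : 0 <= Num.sqrt I0 by exact: sqrtr_ge0.
move: (l2dist c th) (Num.sqrt I0) (pw (- 2^-1) X) (pw 2^-1 X) N0 S0 pp p0 => N S p q N0 S0 pp p0.
have -> : p * (C * M * (I0 + q * N * S)) = C * M * (p * I0 + (p * q) * N * S) by ring.
rewrite pp mul1r.
have : 0 <= C * M * (N * I0 + S * p) by rewrite mulr_ge0 ?mulr_ge0// addr_ge0// mulr_ge0.
lra.
Qed.

(** On ]1, X] one has 1 = residual + F, so the integral of Y there is a pairing with the residual
    plus one with F. The total pairing with F over ]0, oo[ being zero, the latter is minus head and
    tail, which are of lower order. *)
Theorem test_inequality : exists2 K : R, 0 <= K & forall n (c th : 'I_n -> R) (X M : R) (Y psi' : R -> R),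
  1 <= X -> (forall i, X^-1 <= th i <= 1) -> measurable_fun setT Y ->
  (forall t, 0 < t -> L1 pos (fun y => fpart (t * y) * Y y) /\
    \int[mu]_(y in pos) (fpart (t * y) * Y y) = 0) ->
  L1 `]0, 1] (fun y => y * Y y) -> \int[mu]_(y in `]0, 1]) `|y * Y y| <= M ->
  L1 `]1, X] Y -> L1 `]1, X] (fun y => (y * Y y) ^+ 2) ->
  L1 far (fun z => pw (3 / 2) X * Y (X * z)) ->
  (forall z, 1 <= z -> `|pw (3 / 2) X * Y (X * z)| <= M) ->
  (forall z, 1 <= z -> der_at (fun z => pw (3 / 2) X * Y (X * z)) z (psi' z)) ->
  (forall z, 1 <= z -> `|psi' z| <= M / z ^+ 2) ->
  \int[mu]_(z in far) `|pw (3 / 2) X * Y (X * z)| <= M ->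
  L1 pos (fun y => (residual c th y / y) ^+ 2) ->
  `|\int[mu]_(y in `]1, X]) Y y| <=
    l2dist c th * Num.sqrt (\int[mu]_(y in `]1, X]) ((y * Y y) ^+ 2)) +
    K * M * (l2dist c th + pw (- 2^-1) X).
Proof.
have [K K0 HK] := tail_bound; exists (K + 1); first exact: addr_ge0.
move=> n c th X M Y psi' X1 thX mY orth i01 hM01 iY iY2 ipsi psiM dpsi psi'M intM iG.
have X0 : 0 < X by apply: lt_le_trans X1.
have Xi : 0 < X^-1 by rewrite invr_gt0.
have M0 : 0 <= M by apply: le_trans (psiM _ (lexx 1)).
have N0 : 0 <= l2dist c th by exact: sqrtr_ge0.
have th0 i : 0 < th i by have /andP[h _] := thX i; exact: lt_le_trans h.
have [iFY oFY] := fracsum_orth c th0 orth.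
have thX1 i : X^-1 <= th i by have /andP[] := thX i.
have th01 i : 0 <= th i <= 1 by have /andP[_ ->] := thX i; rewrite ltW.
have T := HK n c th X M Y psi' X1 thX1 mY ipsi psiM dpsi psi'M intM iFY iG.
have m01 : measurable (`]0, 1] : set R) by exact: measurable_itv.
have m1X : measurable (`]1, X] : set R) by exact: measurable_itv.
have sp1 : `]0, 1]%classic `<=` pos by move=> y /=; rewrite !in_itv/= => /andP[->].
have sp2 : `]1, X]%classic `<=` pos by move=> y /=; rewrite !in_itv/= andbT => /andP[h _]; exact: lt_trans h.
have H := head_bound th01 mY i01 hM01 (L1_sub m01 mpos sp1 iFY) iG.
have iFY1 : L1 far (fun y => fracsum c th y * Y y) by apply: (L1_sub mfar mpos _ iFY); exact: far_pos.
have E1 := Rintegral_split ler01 iFY; rewrite oFY (Rintegral_split X1 iFY1) in E1.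
have iFX : L1 `]1, X] (fun y => fracsum c th y * Y y) by exact: (L1_sub m1X mpos sp2 iFY).
have [iGX GX] := l2dist_sub m1X sp2 iG.
have mg : measurable_fun `]1, X] (fun y => residual c th y / y).
  by apply: measurable_funTS; apply: measurable_funM; [exact: measurable_residual|exact: measurable_invr].
have mh : measurable_fun `]1, X] (fun y => y * Y y) by apply: measurable_funTS; exact: measurable_funM.
have [iGY CS] := cauchy_schwarz m1X mg mh iGX iY2.
have E2 : \int[mu]_(y in `]1, X]) Y y = \int[mu]_(y in `]1, X]) (residual c th y / y * (y * Y y)) +
    \int[mu]_(y in `]1, X]) (fracsum c th y * Y y).
  rewrite -(RintD m1X iGY iFX); apply: eq_Rintegral => y; rewrite inE /= in_itv/= => /andP[y1 _].
  have y0 : 0 < y by apply: lt_trans y1.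
  have -> : residual c th y / y * (y * Y y) = residual c th y * Y y.
    by rewrite [LHS]mulrA divfK// gt_eqF.
  have -> : residual c th y = 1 - fracsum c th y.
    by rewrite /residual indicE mem_set//= in_itv/= (ltW y1).
  by ring.
rewrite E2.
move: E1 T H CS GX; move: (\int[mu]_(y in `]0, 1]) _) (\int[mu]_(y in `]X, +oo[) _) (\int[mu]_(y in `]1, X]) (fracsum c th y * Y y)) => a b d E1 T H CS GX.
have -> : d = - (a + b) by lra.
apply: (le_trans (ler_normB _ _)); apply: lerD.
  by apply: (le_trans CS); rewrite ler_wpM2r ?sqrtr_ge0.
apply: (le_trans (ler_normD _ _)); have p0 := pw_ge0 (- 2^-1) X.
have : 0 <= M * pw (- 2^-1) X by exact: mulr_ge0.
lra.
Qed.

End TestInequality.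

(** * The Hilbert matrix and the extremal polynomial *)

Section MassPolynomial.
Context {R : realType}.

Let node (j : nat) : R := - j.+1%:R.

Lemma node_inj : injective node.
Proof. by move=> i j /oppr_inj/eqP; rewrite eqr_nat => /eqP[]. Qed.

(* Partial fractions of P(x) / prod_l (x + l + 1), evaluated at x. *)
Lemma cauchy_interpolation (m : nat) (P : {poly R}) (x : R) : (size P <= m)%N ->
  (forall l, (l < m)%N -> x + l.+1%:R != 0) ->
  \sum_(j < m) P.[node j] / (\prod_(l < m | l != j) (node j - node l)) / (x + j.+1%:R) =
  P.[x] / \prod_(l < m) (x + l.+1%:R).
Proof.
move=> sP x0.
pose w (j : 'I_m) : R := \prod_(l < m | l != j) (node j - node l).
have w0 j : w j != 0.
  apply/prodf_neq0 => l lj; rewrite subr_eq0; apply: contra lj => /eqP/node_inj e.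
  by apply/eqP/val_inj.
pose B (j : 'I_m) : {poly R} := \prod_(l < m | l != j) ('X - (node l)%:P).
have sB j : (size (B j) <= m)%N.
  rewrite /B -big_filter size_prod_XsubC size_filter.
  have := cardC1 j; rewrite card_ord /= cardE size_filter => e.
  have -> : count (fun i => i != j) (index_enum 'I_m) = m.-1.
    by rewrite -[RHS]e /index_enum; case: index_enum_key; apply: eq_count => i; rewrite inE.
  by case: m {sP x0 w w0 B e} j => // -[].
have BE (j k : 'I_m) : (B j).[node k] = if k == j then w j else 0.
  rewrite /B horner_prod; case: eqVneq => [->|kj].
    by apply: eq_bigr => l _; rewrite hornerXsubC.
  by rewrite (bigD1 k)//= hornerXsubC subrr mul0r.
pose D := P - \sum_(j < m) (P.[node j] / w j) *: B j.
have D0 : D = 0.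
  apply: (@roots_geq_poly_eq0 _ D [seq node j | j : 'I_m]).
  - apply/allP => _ /mapP[k _ ->]; rewrite /root /D hornerD hornerN horner_sum (bigD1 k)//= big1.
      by rewrite hornerZ BE eqxx divfK// addr0 subrr.
    by move=> j jk; rewrite hornerZ BE eq_sym (negbTE jk) mulr0.
  - rewrite map_inj_uniq ?enum_uniq// => i j /node_inj e; exact: val_inj.
  - rewrite size_map -cardT card_ord (leq_trans (size_polyD _ _))// geq_max sP size_polyN.
    apply: (leq_trans (size_sum _ _ _)); apply/bigmax_leqP => j _.
    exact: leq_trans (size_scale_leq _ _) (sB j).
have -> : P.[x] = \sum_(j < m) P.[node j] / w j * (B j).[x].
  have := congr1 (fun q => q.[x]) D0; rewrite /D hornerD hornerN horner_sum horner0 => /eqP.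
  by rewrite subr_eq0 => /eqP ->; apply: eq_bigr => j _; rewrite hornerZ.
rewrite mulr_suml; apply: eq_bigr => j _; rewrite -/(w j).
have -> : \prod_(l < m) (x + l.+1%:R) = (x + j.+1%:R) * (B j).[x].
  rewrite (bigD1 j)//=; congr (_ * _); rewrite /B horner_prod; apply: eq_bigr => l _.
  by rewrite hornerXsubC /node opprK.
have B0 : (B j).[x] != 0.
  rewrite /B horner_prod; apply/prodf_neq0 => l _; rewrite hornerXsubC /node opprK; exact: x0.
have xj := x0 j (ltn_ord j).
move: (x + j.+1%:R) xj (B j).[x] B0 (P.[node j] / w j) => u u0 v v0 k.
by field; rewrite u0 v0.
Qed.

(** The unknowns are the residues of P(x) / prod_l (x + l + 1), with P of degree m - 1 vanishing at
    1, ..., m - 1 and P(0) = m!: evaluation at x = i is then the i-th equation. The first residue is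
    P(-1) / (m-1)! = m^2. *)
Lemma hilbert_solution (m : nat) : exists h : nat -> R,
  (forall i, (i < m)%N -> \sum_(j < m) h j / (i + j).+1%:R = (i == 0)%N%:R) /\ ((0 < m)%N -> h 0%N = m%:R ^+ 2).
Proof.
case: m => [|m]; first by exists (fun=> 0); split.
pose q : {poly R} := \prod_(i <- iota 1 m) ('X - (i%:R)%:P).
have q0 : q.[0] != 0.
  rewrite /q horner_prod prodf_seq_neq0; apply/allP => i; rewrite mem_iota => /andP[i1 _].
  by rewrite hornerXsubC sub0r oppr_eq0 pnatr_eq0 -lt0n.
pose P := (m.+1`!%:R / q.[0]) *: q.
have sP : (size P <= m.+1)%N.
  by rewrite (leq_trans (size_scale_leq _ _))// size_prod_XsubC size_iota.
have P0 : P.[0] = m.+1`!%:R by rewrite hornerZ divfK.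
have Pi i : (0 < i < m.+1)%N -> P.[i%:R] = 0.
  move=> /andP[i0 im]; rewrite hornerZ; suff -> : q.[i%:R] = 0 by rewrite mulr0.
  apply/eqP; rewrite /q horner_prod prodf_seq_eq0; apply/hasP; exists i; first by rewrite mem_iota i0.
  by rewrite hornerXsubC subrr eqxx.
(* The solution is indexed by nat whereas the product runs over ordinals different from j; the test
   supplies the proof that j is an ordinal. *)
exists (fun j => if (j < m.+1)%N =P true is ReflectT jm then
  P.[node j] / (\prod_(l < m.+1 | l != Ordinal jm) (node j - node l)) else 0).
split.
  move=> i im.
  transitivity (\sum_(j < m.+1) P.[node j] / (\prod_(l < m.+1 | l != j) (node j - node l)) / (i%:R + j.+1%:R)).
    apply: eq_bigr => j _; rewrite -natrD addnS; congr (_ / _).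
    case: eqP => [jm|]; last by rewrite ltn_ord.
    by congr (_ / _); apply: eq_bigl => l; congr (l != _); exact: val_inj.
  rewrite (@cauchy_interpolation m.+1 P i%:R sP); last by move=> l _; rewrite -natrD pnatr_eq0 addnS.
  case: i im => [|i] im; last by rewrite Pi ?im// mul0r.
  rewrite P0; have -> : \prod_(l < m.+1) (0 + l.+1%:R) = m.+1`!%:R :> R.
    by rewrite fact_prod natr_prod big_add1 big_mkord; apply: eq_bigr => l _; rewrite add0r.
  by rewrite divff// pnatr_eq0 -lt0n fact_gt0.
move=> _; case: eqP => // jm.
have -> : \prod_(l < m.+1 | l != Ordinal jm) (node 0 - node l) = m`!%:R.
  rewrite big_mkcond big_ord_recl/= mul1r fact_prod natr_prod big_add1 big_mkord.
  apply: eq_bigr => l _; rewrite /node /bump/= -[1%:R]/(1%N%:R) opprK addrC.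
  by rewrite -[l.+2%:R]natr1 addrK.
have q1 : q.[node 0] = m.+1%:R * q.[0].
  rewrite /q; elim: m {P sP P0 Pi jm q0 q} => [|m IH].
    by rewrite !big_nil !hornerC mulr1.
  have -> : iota 1 m.+1 = iota 1 m ++ [:: m.+1] by rewrite -[in LHS](addn1 m) iotaD add1n.
  rewrite !big_cat/= !big_seq1 !hornerM IH !hornerXsubC /node sub0r.
  rewrite -[m.+2%:R]natr1; move: (\prod_(i <- iota 1 m) ('X - (i%:R)%:P)).[0] (m.+1%:R) => u v; ring.
rewrite /P hornerZ q1 factS natrM.
have f0 : (m`!%:R : R) != 0 by rewrite pnatr_eq0 -lt0n fact_gt0.
by move: (m`!%:R) (m.+1%:R) q.[0] f0 q0 => u v s u0 s0; field; rewrite u0.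
Qed.

(* [p] represents evaluation at 0 on the polynomials of degree < m in L^2([0, 1]). *)
Lemma mass_poly (m : nat) : exists p Q : {poly R},
  [/\ (size p <= m)%N, p.[0] = m%:R ^+ 2, Q^`() = p * p & Q.[1] - Q.[0] = m%:R ^+ 2].
Proof.
case: m => [|m]; first by exists 0, 0; rewrite size_poly0 horner0 deriv0 mulr0 horner0 subr0 expr0n.
have [h [H h0]] := hilbert_solution m.+1; rewrite -h0//.
pose p := \sum_(i < m.+1) h i *: 'X^i.
pose Q := \sum_(i < m.+1) \sum_(j < m.+1) (h i * h j / (i + j).+1%:R) *: 'X^((i + j).+1).
have sp : (size p <= m.+1)%N.
  apply: (leq_trans (size_sum _ _ _)); apply/bigmax_leqP => j _.
  by rewrite (leq_trans (size_scale_leq _ _))// size_polyXn.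
exists p, Q; split => //.
- rewrite horner_sum big_ord_recl/= hornerZ hornerXn expr0 mulr1 big1 ?addr0// => i _.
  by rewrite hornerZ hornerXn expr0n mulr0.
- rewrite /Q /p mulr_suml raddf_sum/=; apply: eq_bigr => i _.
  rewrite mulr_sumr raddf_sum/=; apply: eq_bigr => j _.
  rewrite derivZ derivXn/= -[X in _ *: X = _]scaler_nat scalerA divfK ?pnatr_eq0//.
  by rewrite -scalerAl -scalerAr scalerA -exprD.
- have -> : Q.[0] = 0.
    rewrite horner_sum big1// => i _; rewrite horner_sum big1// => j _.
    by rewrite hornerZ hornerXn expr0n mulr0.
  (* Q(1) is the quadratic form of the Hilbert matrix at h; the matrix sends h to the first basis
     vector, so only h_0 remains. *)
  rewrite subr0 horner_sum big_ord_recl/= [X in _ + X]big1; last first.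
    move=> i _; transitivity (h (bump 0 i) * \sum_(j < m.+1) h j / (bump 0 i + j).+1%:R).
      rewrite horner_sum mulr_sumr; apply: eq_bigr => j _.
      by rewrite hornerZ hornerXn expr1n mulr1 mulrA.
    by rewrite (H _ (ltn_ord (lift ord0 i))) /bump/= mulr0.
  rewrite addr0 horner_sum; transitivity (h 0%N * \sum_(j < m.+1) h j / (0 + j).+1%:R).
    rewrite mulr_sumr; apply: eq_bigr => j _.
    by rewrite hornerZ hornerXn expr1n mulr1 mulrA.
  by rewrite H// mulr1.
Qed.

End MassPolynomial.

(** * Admissible test functions *)

Section TrialFunctions.
Context {R : realType}.
Local Notation mu := (@lebesgue_measure R).
Local Notation L1 D f := (mu.-integrable D (EFin \o f)).
Local Notation pos := (`]0, +oo[%classic : set R).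
Local Notation far := (`]1, +oo[%classic : set R).

Let mpos : measurable pos. Proof. exact: measurable_itv. Qed.
Let mfar : measurable far. Proof. exact: measurable_itv. Qed.
Let m01 : measurable (`]0, 1] : set R). Proof. exact: measurable_itv. Qed.

(** The conditions of [test_inequality] on Y, gathered with a single constant M so that they add up
    over several zeros. *)
Definition admissible (X M : R) (Y : R -> R) : Prop :=
  [/\ measurable_fun setT Y, forall y, 0 < y -> {for y, continuous Y},
      forall t, 0 < t -> L1 pos (fun y => fpart (t * y) * Y y) /\
        \int[mu]_(y in pos) (fpart (t * y) * Y y) = 0,
      L1 `]0, 1] (fun y => y * Y y) /\ \int[mu]_(y in `]0, 1]) `|y * Y y| <= M &
      L1 far (fun z => pw (3 / 2) X * Y (X * z)) /\
      [/\ forall z, 1 <= z -> `|pw (3 / 2) X * Y (X * z)| <= M,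
      exists2 psi', forall z, 1 <= z -> der_at (fun z => pw (3 / 2) X * Y (X * z)) z (psi' z) &
        forall z, 1 <= z -> `|psi' z| <= M / z ^+ 2 &
      \int[mu]_(z in far) `|pw (3 / 2) X * Y (X * z)| <= M]].

Lemma admissible_ext X M Y1 Y2 : (forall y, Y1 y = Y2 y) -> admissible X M Y1 -> admissible X M Y2.
Proof. by move=> h; have -> : Y1 = Y2 by apply/funext. Qed.

Lemma admissible0 X : admissible X 0 (fun=> 0).
Proof.
split=> //.
- by move=> y _; exact: cvg_cst.
- move=> t t0; have E : (fun y : R => fpart (t * y) * 0) = (fun=> 0) by apply/funext => y; rewrite mulr0.
  by rewrite E; split; [exact: L1_0|exact: Rint_eq0].
- have E : (fun y : R => y * 0) = (fun=> 0) by apply/funext => y; rewrite mulr0.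
  by rewrite E; split; [exact: L1_0|rewrite Rint_eq0// => y _; rewrite mulr0 normr0].
- have E : (fun y : R => pw (3 / 2) X * 0) = (fun=> 0) by apply/funext => y; rewrite mulr0.
  rewrite E; split; [exact: L1_0|split].
  + by move=> z _; rewrite mulr0 normr0.
  + by exists (fun=> 0) => [z _|z _]; [exact: der_cst|rewrite normr0 mul0r].
  + by rewrite Rint_eq0// => y _; rewrite mulr0 normr0.
Qed.

Lemma Rint_norm_add (D : set R) (f g : R -> R) (a b : R) : measurable D -> L1 D f -> L1 D g ->
  \int[mu]_(x in D) `|f x| <= a -> \int[mu]_(x in D) `|g x| <= b ->
  \int[mu]_(x in D) `|f x + g x| <= a + b.
Proof.
move=> mD i1 i2 h1 h2; apply: le_trans (lerD h1 h2).
rewrite -(RintD mD (L1_norm i1) (L1_norm i2)); apply: le_Rintegral => //.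
- by apply: L1_norm; exact: L1D.
- exact: (L1D mD (L1_norm i1) (L1_norm i2)).
- by move=> x _; exact: ler_normD.
Qed.

Lemma admissibleD X M1 M2 Y1 Y2 : admissible X M1 Y1 -> admissible X M2 Y2 ->
  admissible X (M1 + M2) (fun y => Y1 y + Y2 y).
Proof.
move=> [m1 c1 o1 [h1 n1] [i1 [b1 [p1 d1 e1] k1]]] [m2 c2 o2 [h2 n2] [i2 [b2 [p2 d2 e2] k2]]].
split.
- exact: measurable_funD.
- by move=> y y0; apply: cvgD; [exact: c1|exact: c2].
- move=> t t0; have [j1 z1] := o1 t t0; have [j2 z2] := o2 t t0.
  have E (y : R) : fpart (t * y) * Y1 y + fpart (t * y) * Y2 y = fpart (t * y) * (Y1 y + Y2 y) by rewrite [RHS]mulrDr.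
  split; first by apply: (L1_eq mpos) (L1D mpos j1 j2) => y _; exact: E.
  transitivity (\int[mu]_(y in pos) (fpart (t * y) * Y1 y + fpart (t * y) * Y2 y)).
    by apply: eq_Rintegral => y _; rewrite -E.
  by rewrite (RintD mpos j1 j2) z1 z2 addr0.
- have E : (fun y => y * (Y1 y + Y2 y)) = (fun y => y * Y1 y + y * Y2 y) by apply/funext => y; rewrite mulrDr.
  rewrite E; split; first exact: (L1D m01 h1 h2).
  rewrite (_ : (fun y => `|y * (Y1 y + Y2 y)|) = (fun y => `|y * Y1 y + y * Y2 y|)); last by apply/funext => y; rewrite mulrDr.
  exact: Rint_norm_add.
- have E : (fun z => pw (3 / 2) X * (Y1 (X * z) + Y2 (X * z))) =
      (fun z => pw (3 / 2) X * Y1 (X * z) + pw (3 / 2) X * Y2 (X * z)) by apply/funext => y; rewrite mulrDr.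
  split; first by rewrite E; exact: (L1D mfar i1 i2).
  split.
  + by move=> z z1; rewrite mulrDr; apply: (le_trans (ler_normD _ _)); apply: lerD; [exact: b1|exact: b2].
  + exists (fun z => p1 z + p2 z) => z z1; first by rewrite E; apply: derD; [exact: d1|exact: d2].
    by rewrite mulrDl; apply: (le_trans (ler_normD _ _)); apply: lerD; [exact: e1|exact: e2].
  + rewrite (_ : (fun z => `|_|) = (fun z => `|pw (3 / 2) X * Y1 (X * z) + pw (3 / 2) X * Y2 (X * z)|)); last first.
      by apply/funext => y; rewrite mulrDr.
    exact: Rint_norm_add.
Qed.

Lemma admissible_sum X n (M : 'I_n -> R) (Y : 'I_n -> R -> R) :
  (forall i, admissible X (M i) (Y i)) -> admissible X (\sum_i M i) (fun y => \sum_i Y i y).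
Proof.
elim: n M Y => [|n IH] M Y H.
  by rewrite big_ord0; apply: admissible_ext (admissible0 X) => y; rewrite big_ord0.
rewrite big_ord_recl.
have := admissibleD (H ord0) (IH _ _ (fun i => H (lift ord0 i))).
by apply: admissible_ext => y; rewrite big_ord_recl.
Qed.

(** A polynomial in the logarithm costs an arbitrarily small power: each monomial is absorbed by a
    term of the exponential series, whence the factor i! / e^i. *)
Lemma poly_log_bound (p : {poly R}) (e : R) : 0 < e ->
  exists2 K : R, 0 <= K & forall u w, 0 <= w -> `|u| <= 1 + w -> `|p.[u]| <= K * expR (e * w).
Proof.
move=> e0; exists (\sum_(i < size p) `|p`_i| * (i`!%:R / e ^+ i * expR e)).
  apply: sumr_ge0 => i _; apply: mulr_ge0 => //; apply: mulr_ge0; last exact: expR_ge0.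
  by apply: divr_ge0; [exact: ler0n|exact: exprn_ge0 (ltW e0)].
move=> u w w0 uw; rewrite horner_coef; apply: (le_trans (ler_norm_sum _ _ _)).
rewrite mulr_suml; apply: ler_sum => i _; rewrite normrM -[leRHS]mulrA ler_wpM2l//.
rewrite normrX; apply: (@le_trans _ _ ((1 + w) ^+ i)); first by rewrite lerXn2r ?nnegrE//; lra.
have f0 : (0 : R) < i`!%:R by rewrite ltr0n fact_gt0.
have w1 : 0 <= e * (1 + w) by apply: mulr_ge0; lra.
have := exp_term (e * (1 + w)) i; rewrite (ger0_norm w1) => h.
have ei : 0 < e ^+ i by rewrite exprn_gt0.
have -> : (1 + w) ^+ i = i`!%:R / e ^+ i * ((e * (1 + w)) ^+ i / i`!%:R).
  by rewrite exprMn; move: ((1 + w) ^+ i) (e ^+ i) (i`!%:R) ei f0 => x y z y0 z0; field; rewrite !gt_eqF.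
have q0 : 0 <= i`!%:R / e ^+ i by apply: divr_ge0; exact: ltW.
rewrite -[leRHS]mulrA (ler_wpM2l q0)//.
by apply: (le_trans h); rewrite mulrDr mulr1 expRD.
Qed.

(** The real part of (a + i b) p(ln y / L) y^(-s-1): a profile p spread over the logarithmic scale
    [0, L]. *)
Definition comp (p : {poly R}) (L sg ga a b y : R) : R := p.[ln y / L] * osc (sg + 1) ga a b y.

Lemma der_comp_log (p : {poly R}) (L y : R) : 0 < y ->
  der_at (fun y => p.[ln y / L]) y (p^`().[ln y / L] / (L * y)).
Proof.
move=> y0; apply: der_eq.
  apply: (@der_comp _ (horner p) (fun y => ln y / L)); first exact: is_derive_poly.
  by apply: derM; [exact: der_ln|exact: der_cst].
by rewrite mulr0 addr0 invfM [L^-1 * _]mulrC mulrA.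
Qed.

Lemma der_trial (p : {poly R}) (L sg ga a b y : R) : 0 < y ->
  der_at (comp p L sg ga a b) y
    (p^`().[ln y / L] / L * osc (sg + 2) ga a b y +
     p.[ln y / L] * osc (sg + 2) ga (- (sg + 1) * a + ga * b) (- (sg + 1) * b - ga * a) y).
Proof.
move=> y0; apply: der_eq.
  by apply: derM; [exact: der_comp_log|exact: der_osc].
have -> : osc (sg + 1) ga a b y = y * osc (sg + 2) ga a b y.
  by rewrite -{2}(pw1 y0) osc_shift; apply: osc_eq; ring.
rewrite (_ : sg + 1 + 1 = sg + 2); last by ring.
congr (_ + _); rewrite invfM; move: (osc (sg + 2) ga a b y) (p^`().[ln y / L]) (L^-1) => u v w.
by field; rewrite gt_eqF.
Qed.

Lemma continuous_trial (p : {poly R}) (L sg ga a b y : R) : 0 < y ->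
  {for y, continuous (comp p L sg ga a b)}.
Proof. by move=> y0; exact: (der_continuous (der_trial p L sg ga a b y0)). Qed.

Lemma measurable_trial (p : {poly R}) (L sg ga a b : R) : measurable_fun setT (comp p L sg ga a b).
Proof.
apply: measurable_funM; last exact: measurable_osc.
rewrite (_ : (fun y => _) = (fun y => \sum_(i < size p) p`_i * (ln y / L) ^+ i)); last first.
  by apply/funext => y; rewrite horner_coef.
by apply: measurable_sum => i; meas.
Qed.

Definition moments_vanish (m : nat) (x ga : R) : Prop :=
  forall (k : nat) (th al be : R), (k < m)%N -> 0 < th ->
  L1 pos (fun y => fpart (th * y) * (ln y ^+ k * osc (x + 1) ga al be y)) /\
  \int[mu]_(y in pos) (fpart (th * y) * (ln y ^+ k * osc (x + 1) ga al be y)) = 0.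

Lemma trial_orth (p : {poly R}) (m : nat) (L sg ga a b t : R) : (size p <= m)%N ->
  moments_vanish m sg ga -> 0 < t ->
  L1 pos (fun y => fpart (t * y) * comp p L sg ga a b y) /\
  \int[mu]_(y in pos) (fpart (t * y) * comp p L sg ga a b y) = 0.
Proof.
move=> sp mv t0.
have E y : fpart (t * y) * comp p L sg ga a b y =
    \sum_(i < size p) (p`_i / L ^+ i) * (fpart (t * y) * (ln y ^+ i * osc (sg + 1) ga a b y)).
  rewrite /comp horner_coef mulr_suml mulr_sumr; apply: eq_bigr => i _.
  rewrite expr_div_n; move: (osc _ _ _ _ _) (fpart _) (L ^+ i)^-1 => u v w; ring.
have mi (i : 'I_(size p)) : (i < m)%N by exact: leq_trans (ltn_ord i) sp.
have ii (i : 'I_(size p)) : L1 pos (fun y => (p`_i / L ^+ i) * (fpart (t * y) * (ln y ^+ i * osc (sg + 1) ga a b y))).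
  by apply: L1Zl => //; exact: (mv i t a b (mi i) t0).1.
rewrite (_ : (fun y => _) = (fun y => \sum_(i < size p) (p`_i / L ^+ i) * (fpart (t * y) * (ln y ^+ i * osc (sg + 1) ga a b y)))); last first.
  by apply/funext => y; exact: E.
split; first exact: L1_sum.
rewrite Rintegral_sum// big1// => i _.
have [i1 z] := mv i t a b (mi i) t0.
by rewrite (RintZ _ mpos i1) z mulr0.
Qed.

(** The point is that M does not depend on L. Since sg >= 1/2, the factor X^(3/2) X^(-sg-1) is at
    most 1, and beyond the cut the profile is evaluated at 1 + ln z / L, whose growth in z is
    logarithmic uniformly in L >= 1. *)
Lemma admissible_trial (p : {poly R}) (m : nat) (sg ga a b : R) : (size p <= m)%N ->
  2^-1 <= sg < 1 -> moments_vanish m sg ga ->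
  exists M : R, forall L, 1 <= L -> admissible (expR L) M (comp p L sg ga a b).
Proof.
move=> sp /andP[s0 s1] mv.
(* A small loss in the exponent pays for the polynomial: y^(-e-sg) remains integrable at 0, and, as
   e < sg, z^(e-sg-1) at infinity. *)
pose e := (1 - sg) / 2; have e0 : 0 < e by rewrite /e; lra.
have [K K0 HK] := poly_log_bound p e0.
have [K' K'0 HK'] := poly_log_bound p^`() e0.
pose A := `|a| + `|b|.
pose a' := - (sg + 1) * a + ga * b; pose b' := - (sg + 1) * b - ga * a.
pose A' := `|a'| + `|b'|.
have A0 : 0 <= A by exact: addr_ge0.
have A'0 : 0 <= A' by exact: addr_ge0.
have i1 : L1 `]0, 1] (pw (- e - sg)) by apply: L1_pw_0; rewrite /e; lra.
have i2 : L1 far (pw (e - sg - 1)).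
  apply: (@L1_sub _ _ `[1, +oo[%classic) => //.
    by move=> y /=; rewrite !in_itv/= !andbT => /ltW.
  by apply: L1_pw_infty; rewrite /e; lra.
pose I1 := \int[mu]_(y in `]0, 1]) pw (- e - sg) y.
pose I2 := \int[mu]_(y in far) pw (e - sg - 1) y.
have I10 : 0 <= I1 by apply: Rintegral_ge0 => y _; exact: pw_ge0.
have I20 : 0 <= I2 by apply: Rintegral_ge0 => y _; exact: pw_ge0.
pose M0 := K * A + K' * A + K * A'.
have KA : 0 <= K * A by exact: mulr_ge0.
have M00 : K * A <= M0 by rewrite /M0; have := mulr_ge0 K'0 A0; have := mulr_ge0 K0 A'0; lra.
pose M := M0 * (1 + I1 + I2).
have MM : M0 <= M.
  by rewrite /M ler_peMr//; [exact: le_trans M00|lra].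
have MI1 : K * A * I1 <= M.
  apply: ler_pM => //; lra.
have MI2 : K * A * I2 <= M.
  apply: ler_pM => //; lra.
exists M => L L1'; have L0 : 0 < L by lra.
have Li : 0 <= L^-1 <= 1 by rewrite invr_ge0 (ltW L0)/= invf_le1.
pose X := expR L; have X0 : 0 < X by exact: expR_gt0.
have X1 : 1 <= X by rewrite -expR0 ler_expR ltW.
have lnX : ln X = L by exact: expRK.
have U z : 1 <= z -> ln (X * z) / L = 1 + ln z / L.
  move=> z1; have z0 : 0 < z by exact: lt_le_trans ltr01 z1.
  by rewrite lnM ?posrE// lnX mulrDl divff// gt_eqF.
have lz (z : R) : 1 <= z -> 0 <= ln z by exact: ln_ge0.
have uz z : 1 <= z -> `|1 + ln z / L| <= 1 + ln z.
  move=> z1; have h := lz z z1; have /andP[l1 l2] := Li.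
  rewrite ger0_norm; last by rewrite addr_ge0// mulr_ge0.
  by rewrite lerD2l -[leRHS]mulr1 ler_wpM2l.
have ez z : expR (e * ln z) = pw e z by [].
have far1 z : 1 <= z -> `|pw (3 / 2) X * comp p L sg ga a b (X * z)| <= K * A * pw (e - sg - 1) z.
  move=> z1; have z0 : 0 < z by exact: lt_le_trans ltr01 z1.
  rewrite /comp U// (normrM (pw _ _)) (ger0_norm (pw_ge0 _ _)) (normrM (p.[_])).
  have h1 := HK _ _ (lz z z1) (uz z z1); rewrite ez in h1.
  have h2 := osc_bound (sg + 1) ga a b (X * z); rewrite -/A pwM// in h2.
  have h3 : pw (3 / 2) X * pw (- (sg + 1)) X <= 1.
    by rewrite -pwD -[leRHS](pw0 X) pw_ler//; lra.
  apply: (@le_trans _ _ (pw (3 / 2) X * (K * pw e z * (A * (pw (- (sg + 1)) X * pw (- (sg + 1)) z))))).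
    by rewrite ler_wpM2l ?pw_ge0//; apply: ler_pM.
  have -> : pw (e - sg - 1) z = pw e z * pw (- (sg + 1)) z by rewrite -pwD; apply: pw_eq; ring.
  have : 0 <= K * A * (pw e z * pw (- (sg + 1)) z) by rewrite mulr_ge0// mulr_ge0 ?pw_ge0.
  move: (pw e z) (pw (- (sg + 1)) z) (pw (3 / 2) X) (pw (- (sg + 1)) X) h3 => u v q r h3 h4.
  have -> : q * (K * u * (A * (r * v))) = K * A * (u * v) * (q * r) by ring.
  by rewrite ler_piMr.
have mY : measurable_fun setT (comp p L sg ga a b) by exact: measurable_trial.
have ip : L1 far (fun z => pw (3 / 2) X * comp p L sg ga a b (X * z)).
  apply: (@L1_le _ _ mfar _ (fun z => K * A * pw (e - sg - 1) z)); last exact: L1Zl.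
    by apply: measurable_funTS; apply: measurable_funM => //; apply: (measurableT_comp mY); meas.
  by move=> z; rewrite /= in_itv/= andbT => /ltW; exact: far1.
have head y : 0 < y <= 1 -> `|y * comp p L sg ga a b y| <= K * A * pw (- e - sg) y.
  move=> /andP[y0 y1]; have l0 : ln y <= 0 by exact: ln_le0.
  have hw : 0 <= - ln y by rewrite oppr_ge0.
  have hu : `|ln y / L| <= 1 + - ln y.
    have /andP[l1 l2] := Li; rewrite normrM (ler0_norm l0) (ger0_norm l1).
    by apply: (le_trans (ler_wpM2l hw l2)); rewrite mulr1 lerDr.
  have := HK _ _ hw hu; rewrite mulrN -mulNr -[expR _]/(pw (- e) y) => h1.
  have h2 := osc_bound (sg + 1) ga a b y; rewrite -/A in h2.
  rewrite /comp (normrM y) (normrM (p.[_])) (ger0_norm (ltW y0)).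
  apply: (@le_trans _ _ (y * (K * pw (- e) y * (A * pw (- (sg + 1)) y)))).
    by rewrite (ler_wpM2l (ltW y0))//; apply: ler_pM.
  have -> : pw (- e - sg) y = y * pw (- e) y * pw (- (sg + 1)) y.
    by rewrite -{2}(pw1 y0) -!pwD; apply: pw_eq; ring.
  by rewrite le_eqVlt; apply/orP; left; apply/eqP; move: (pw _ _) (pw _ _) => u v; ring.
have iy : L1 `]0, 1] (fun y => y * comp p L sg ga a b y).
  apply: (@L1_le _ _ m01 _ (fun y => K * A * pw (- e - sg) y)); last exact: L1Zl.
    by apply: measurable_funTS; exact: measurable_funM.
  by move=> y; rewrite /= in_itv/=; exact: head.
split=> //.
- by move=> y; exact: continuous_trial.
- by move=> t t0; exact: trial_orth sp mv t0.
- split=> //; apply: le_trans MI1; rewrite /I1 -(RintZ _ m01 i1).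
  apply: le_Rintegral; [exact: m01|exact: (L1_norm iy)|exact: (L1Zl m01 _ i1)|].
  by move=> y; rewrite /= in_itv/=; exact: head.
- split=> //; split.
  + move=> z z1; apply: (le_trans (far1 z z1)); apply: le_trans MM; apply: le_trans M00.
    rewrite -[leRHS]mulr1 ler_wpM2l// -[leRHS](pw0 z) pw_ler//; rewrite /e; lra.
  + exists (fun z => pw (3 / 2) X * ((p^`().[ln (X * z) / L] / L * osc (sg + 2) ga a b (X * z) +
       p.[ln (X * z) / L] * osc (sg + 2) ga a' b' (X * z)) * X)) => z z1.
      have z0 : 0 < z by exact: lt_le_trans ltr01 z1.
      apply: der_eq.
        apply: derM; first exact: der_cst.
        apply: (@der_comp _ (comp p L sg ga a b) (fun z => X * z)).
          by apply: der_trial; rewrite mulr_gt0.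
        by apply: derM; [exact: der_cst|exact: der_id].
      by rewrite mul0r add0r mul0r add0r mulr1.
    have z0 : 0 < z by exact: lt_le_trans ltr01 z1.
    rewrite U//.
    have h1 := HK _ _ (lz z z1) (uz z z1); rewrite ez in h1.
    have h1' := HK' _ _ (lz z z1) (uz z z1); rewrite ez in h1'.
    have h2 := osc_bound (sg + 2) ga a b (X * z); rewrite -/A pwM// in h2.
    have h2' := osc_bound (sg + 2) ga a' b' (X * z); rewrite -/A' pwM// in h2'.
    have h3 : X * pw (3 / 2) X * pw (- (sg + 2)) X <= 1.
      by rewrite -{1}(pw1 X0) -!pwD -[leRHS](pw0 X) pw_ler//; lra.
    have h4 : pw e z * pw (- (sg + 2)) z <= z ^- 2.
      by rewrite -pwD -pw2// -pwN pw_ler// /e; lra.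
    rewrite (normrM (pw _ _)) (ger0_norm (pw_ge0 _ _)) (normrM (_ + _)) (ger0_norm (ltW X0)).
    have n1 : `|p^`().[1 + ln z / L] / L * osc (sg + 2) ga a b (X * z) +
        p.[1 + ln z / L] * osc (sg + 2) ga a' b' (X * z)| <=
        (K' * A + K * A') * (pw e z * (pw (- (sg + 2)) X * pw (- (sg + 2)) z)).
      apply: (le_trans (ler_normD _ _)); rewrite [leRHS]mulrDl; apply: lerD.
        rewrite (normrM (_ / L)) (normrM (p^`().[_])) (ger0_norm (_ : 0 <= L^-1)); last by case/andP: Li.
        apply: (@le_trans _ _ (K' * pw e z * (A * (pw (- (sg + 2)) X * pw (- (sg + 2)) z)))).
          apply: ler_pM => //; first by rewrite mulr_ge0//; case/andP: Li.
          by rewrite -[leRHS]mulr1; apply: ler_pM => //; case/andP: Li.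
        by rewrite le_eqVlt; apply/orP; left; apply/eqP; move: (pw _ _) (pw _ _) (pw _ _) => u v w; ring.
      rewrite (normrM (p.[_])).
      apply: (@le_trans _ _ (K * pw e z * (A' * (pw (- (sg + 2)) X * pw (- (sg + 2)) z)))).
        exact: ler_pM.
      by rewrite le_eqVlt; apply/orP; left; apply/eqP; move: (pw _ _) (pw _ _) (pw _ _) => u v w; ring.
    apply: (@le_trans _ _ (pw (3 / 2) X * ((K' * A + K * A') * (pw e z * (pw (- (sg + 2)) X * pw (- (sg + 2)) z)) * X))).
      by rewrite ler_wpM2l ?pw_ge0// (ler_wpM2r (ltW X0)).
    have c0 : 0 <= K' * A + K * A' by rewrite addr_ge0 ?mulr_ge0.
    have c1 : K' * A + K * A' <= M by apply: le_trans MM; rewrite /M0 -addrA lerDr.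
    have -> : pw (3 / 2) X * ((K' * A + K * A') * (pw e z * (pw (- (sg + 2)) X * pw (- (sg + 2)) z)) * X) =
       (K' * A + K * A') * ((pw e z * pw (- (sg + 2)) z) * (X * pw (3 / 2) X * pw (- (sg + 2)) X)).
      by move: (pw e z) (pw (- (sg + 2)) z) (pw (3 / 2) X) (pw (- (sg + 2)) X) => u v q r; ring.
    have g1 : 0 <= pw e z * pw (- (sg + 2)) z by apply: mulr_ge0; exact: pw_ge0.
    have g2 : 0 <= X * pw (3 / 2) X * pw (- (sg + 2)) X.
      by apply: mulr_ge0; [apply: mulr_ge0; [exact: ltW|]|]; exact: pw_ge0.
    apply: ler_pM; [exact: c0|exact: mulr_ge0|exact: c1|].
    by rewrite -[leRHS]mulr1; apply: ler_pM.
  + apply: le_trans MI2; rewrite /I2 -(RintZ _ mfar i2).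
    apply: le_Rintegral; [exact: mfar|exact: (L1_norm ip)|exact: (L1Zl mfar _ i2)|].
    by move=> y; rewrite /= in_itv/= andbT => /ltW; exact: far1.
Qed.

End TrialFunctions.

(** * Pairings and norms of the test functions for large L *)

Section Asymptotics.
Context {R : realType}.
Local Notation mu := (@lebesgue_measure R).
Local Notation L1 D f := (mu.-integrable D (EFin \o f)).
Local Notation pos := (`]0, +oo[%classic : set R).
Local Notation far := (`]1, +oo[%classic : set R).
Implicit Types (p : {poly R}) (L sg ga a b y : R).

Let mpos : measurable pos. Proof. exact: measurable_itv. Qed.
Let mfar : measurable far. Proof. exact: measurable_itv. Qed.
Let mX (X : R) : measurable (`]1, X] : set R). Proof. exact: measurable_itv. Qed.

Lemma L1_mid (f : R -> R) (X : R) : (forall y, 0 < y -> {for y, continuous f}) -> L1 `]1, X] f.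
Proof.
move=> c; apply: (@L1_sub _ _ `[1, X]%classic) => //.
  by move=> y /=; rewrite !in_itv/= => /andP[/ltW -> ->].
apply: continuous_compact_integrable; first exact: segment_compact.
apply: continuous_in_subspaceT => y; rewrite inE /= in_itv/= => /andP[y1 _].
by apply: c; lra.
Qed.

Lemma L1_comp p L sg ga a b X : L1 `]1, X] (comp p L sg ga a b).
Proof. by apply: L1_mid => y y0; exact: continuous_trial. Qed.

Lemma continuous_sqM (f : R -> R) y : {for y, continuous f} ->
  {for y, continuous (fun y => (y * f y) ^+ 2)}.
Proof.
move=> c; have c1 : {for y, continuous (fun y => y * f y)} by apply: cvgM; [exact: cvg_id|exact: c].
by apply: (@cvg_comp _ _ _ _ (fun z : R => z ^+ 2) _ _ _ c1); exact: exprn_continuous.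
Qed.

(** The coefficient on the left is s (a + i b). Integrating y^(-s-1) leaves boundary terms, while
    differentiating the profile brings out 1/L, which makes the new integral an error term. *)
Lemma ibp p L sg ga a b : 1 <= L ->
  \int[mu]_(y in `]1, expR L]) comp p L sg ga (sg * a - ga * b) (sg * b + ga * a) y =
  p.[0] * a - p.[1] * osc sg ga a b (expR L) +
  L^-1 * \int[mu]_(y in `]1, expR L]) comp p^`() L sg ga a b y.
Proof.
move=> L1'; set X := expR L; have L0 : 0 < L by lra.
have X1 : 1 < X by rewrite -[ltLHS]expR0 ltr_expR.
have ih := L1_comp p^`() L sg ga a b X.
pose f := comp p L sg ga (sg * a - ga * b) (sg * b + ga * a); pose h := comp p^`() L sg ga a b.
have ig : L1 `]1, X] f by exact: L1_comp.
pose G y := - (p.[ln y / L] * osc sg ga a b y).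
have dG y : 1 <= y <= X -> der_at G y (f y - L^-1 * h y).
  move=> /andP[y1 _]; have y0 : 0 < y by lra.
  apply: der_eq; first by apply: derN; apply: derM; [exact: der_comp_log|exact: der_osc].
  rewrite /f /h /comp.
  have -> : osc sg ga a b y = y * osc (sg + 1) ga a b y.
    by rewrite -{2}(pw1 y0) osc_shift; apply: osc_eq; ring.
  have -> : osc (sg + 1) ga (- sg * a + ga * b) (- sg * b - ga * a) y =
      - osc (sg + 1) ga (sg * a - ga * b) (sg * b + ga * a) y by rewrite /osc; ring.
  rewrite invfM; move: (osc (sg + 1) ga a b y) (osc _ _ _ _ y) (p^`().[ln y / L]) (p.[ln y / L]) (L^-1) => u v w s t.
  by field; rewrite gt_eqF.
have cG y : 1 <= y <= X -> {for y, continuous (fun y => f y - L^-1 * h y)}.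
  move=> /andP[y1 _]; have y0 : 0 < y by lra.
  apply: cvgB; first exact: continuous_trial.
  by apply: cvgM; [exact: cvg_cst|exact: continuous_trial].
have [_ E] := ftc_oc X1 dG cG.
rewrite (RintB (@mX X) ig (L1Zl (@mX X) L^-1 ih)) (RintZ _ (@mX X) ih) in E.
have -> : \int[mu]_(y in `]1, X]) f y = G X - G 1 + L^-1 * \int[mu]_(x in `]1, X]) comp p^`() L sg ga a b x.
  by rewrite -E subrK.
rewrite /G expRK divff ?gt_eqF// ln1 mul0r.
have -> : osc sg ga a b 1 = a by rewrite /osc pw_1 ln1 mulr0 cos0 sin0; ring.
by ring.
Qed.

Lemma comp_bound p : exists2 K : R, 0 <= K & forall L sg ga a b y, 1 <= L -> 1 <= y <= expR L ->
  `|comp p L sg ga a b y| <= K * (`|a| + `|b|) * pw (- (sg + 1)) y.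
Proof.
have [K K0 H] := poly_log_bound p ltr01; exists K => // L sg ga a b y L1' /andP[y1 yX].
have L0 : 0 < L by lra.
have y0 : 0 < y by lra.
have u1 : `|ln y / L| <= 1 + 0.
  rewrite ger0_norm ?divr_ge0 ?ln_ge0 ?(ltW L0)// addr0 ler_pdivrMr// mul1r.
  by rewrite -[leRHS]expRK ler_ln ?posrE ?expR_gt0.
have := H _ _ (lexx 0) u1; rewrite mulr0 expR0 mulr1 => h.
by rewrite /comp normrM -mulrA; apply: ler_pM => //; exact: osc_bound.
Qed.

Lemma endpoint_bound p : exists2 K : R, 0 <= K & forall L sg ga a b, 1 <= L ->
  `|p.[1] * osc sg ga a b (expR L)| <= K * (`|a| + `|b|) * pw (- sg) (expR L).
Proof.
exists `|p.[1]| => // L sg ga a b L1'.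
by rewrite normrM -mulrA ler_wpM2l//; exact: osc_bound.
Qed.

Lemma int_inv L : 1 <= L -> \int[mu]_(y in `]1, expR L]) pw (- (0 + 1)) y = L.
Proof.
move=> L1'; have X1 : 1 < expR L by rewrite -[ltLHS]expR0 ltr_expR; lra.
have [||_ ->] := @ftc_oc R (@ln R) (pw (- (0 + 1))) 1 (expR L) X1.
- move=> y /andP[y1 _]; have y0 : 0 < y by lra.
  by apply: der_eq (der_ln y0) _; rewrite add0r pwN pw1.
- by move=> y /andP[y1 _]; apply: continuous_pw; lra.
by rewrite expRK ln1 subr0.
Qed.

Lemma L1_mid_pw (e X : R) : L1 `]1, X] (pw e).
Proof. by apply: L1_mid => y y0; exact: continuous_pw. Qed.

Lemma comp_int_bound p : exists2 K : R, 0 <= K & forall L sg ga a b, 1 <= L ->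
  `|\int[mu]_(y in `]1, expR L]) comp p L sg ga a b y| <=
  K * (`|a| + `|b|) * \int[mu]_(y in `]1, expR L]) pw (- (sg + 1)) y.
Proof.
have [K K0 H] := comp_bound p; exists K => // L sg ga a b L1'.
have ip := L1_mid_pw (- (sg + 1)) (expR L).
rewrite -(RintZ _ (@mX _) ip); apply: (Rintegral_le_norm (@mX _)); first exact: L1_comp.
  exact: (L1Zl (@mX _) _ ip).
by move=> y; rewrite /= in_itv/= => /andP[/ltW y1 yX]; apply: H; rewrite ?y1.
Qed.

(** Off-diagonal terms: the coefficient is divided by i de before [ibp], and the 1/L of the
    remaining integral compensates the integral L of dy / y. *)
Lemma oscillating_bound p (de a b : R) : de != 0 ->
  exists2 K : R, 0 <= K & forall L, 1 <= L -> `|\int[mu]_(y in `]1, expR L]) comp p L 0 de a b y| <= K.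
Proof.
move=> d0; have [K1 K10 H1] := endpoint_bound p; have [K2 K20 H2] := comp_int_bound p^`().
pose a' := b / de; pose b' := - a / de.
exists (`|p.[0] * a'| + K1 * (`|a'| + `|b'|) + K2 * (`|a'| + `|b'|)).
  by apply: addr_ge0; [apply: addr_ge0 => //|]; apply: mulr_ge0 => //; exact: addr_ge0.
move=> L L1'; have L0 : 0 < L by lra.
have -> : a = 0 * a' - de * b' by rewrite /b'; field.
have -> : b = 0 * b' + de * a' by rewrite /a'; field.
rewrite ibp//.
have h1 := H1 L 0 de a' b' L1'; rewrite oppr0 pw0 mulr1 in h1.
have h2 := H2 L 0 de a' b' L1'; rewrite int_inv// in h2.
have h3 : `|L^-1 * \int[mu]_(y in `]1, expR L]) comp p^`() L 0 de a' b' y| <= K2 * (`|a'| + `|b'|).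
  by rewrite normrM ger0_norm ?invr_ge0 ?(ltW L0)// ler_pdivrMl// mulrC.
apply: (le_trans (ler_normD _ _)); apply: lerD => //.
by apply: (le_trans (ler_normB _ _)); exact: lerD.
Qed.

(** With [inv_le_isqrt], this brings the error terms to the common scale 1 / sqrt L. *)
Lemma pw_half_le L : 1 <= L -> pw (- 2^-1) (expR L) <= (Num.sqrt L)^-1.
Proof.
move=> L1'; have L0 : 0 < L by lra.
have s0 : 0 < Num.sqrt L by rewrite sqrtr_gt0.
rewrite -(@ler_pXn2r _ 2)// ?nnegrE ?pw_ge0 ?invr_ge0 ?(ltW s0)//.
rewrite exprVn sqr_sqrtr ?(ltW L0)// expr2 -pwD (_ : - 2^-1 + - 2^-1 = -1 :> R); last by field.
rewrite pwN pw1 ?expR_gt0// lef_pV2 ?posrE ?expR_gt0//.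
by have := expR_ge1Dx L; lra.
Qed.

Lemma inv_le_isqrt L : 1 <= L -> L^-1 <= (Num.sqrt L)^-1.
Proof.
move=> L1'; have L0 : 0 < L by lra.
have s1 : 1 <= Num.sqrt L by rewrite -[leLHS]sqrtr1 ler_wsqrtr.
rewrite lef_pV2 ?posrE//; last by lra.
by rewrite -[leRHS](sqr_sqrtr (ltW L0)) expr2 ler_peMr//; lra.
Qed.

(** With coefficient s = 1/2 + i ga the boundary term at 1 in [ibp] is exactly p(0), and the one at
    exp L is of order exp(-L/2). *)
Lemma leading_bound p ga :
  exists2 K : R, 0 <= K & forall L, 1 <= L ->
    `|\int[mu]_(y in `]1, expR L]) comp p L 2^-1 ga 2^-1 ga y - p.[0]| <= K / Num.sqrt L.
Proof.
have [K1 K10 H1] := endpoint_bound p; have [K2 K20 H2] := comp_int_bound p^`().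
have ip : L1 far (pw (- (2^-1 + 1))).
  apply: (@L1_sub _ _ `[1, +oo[%classic) => //.
    by move=> y /=; rewrite !in_itv/= !andbT => /ltW.
  by apply: L1_pw_infty; lra.
pose J := \int[mu]_(y in far) pw (- (2^-1 + 1)) y.
have J0 : 0 <= J by apply: Rintegral_ge0 => y _; exact: pw_ge0.
exists (K1 + K2 * J); first by rewrite addr_ge0// mulr_ge0.
move=> L L1'; have L0 : 0 < L by lra.
have /= := ibp p 2^-1 ga 1 0 L1'; rewrite !mulr1 !mulr0 subr0 add0r => ->.
have s0 : 0 < Num.sqrt L by rewrite sqrtr_gt0.
have h1 := H1 L 2^-1 ga 1 0 L1'; rewrite normr1 normr0 addr0 mulr1 in h1.
have h2 := H2 L 2^-1 ga 1 0 L1'; rewrite normr1 normr0 addr0 mulr1 in h2.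
have hJ : \int[mu]_(y in `]1, expR L]) pw (- (2^-1 + 1)) y <= J.
  rewrite /J (Rintegral_indic far) (Rintegral_indic `]1, expR L]); apply: le_Rintegral => //.
  - by apply: (proj1 (L1_indic _ (@mX _))); apply: (L1_sub (@mX _) mfar _ ip) => y /=; rewrite !in_itv/= andbT => /andP[].
  - exact: (proj1 (L1_indic _ mfar)).
  - move=> y _; rewrite ler_wpM2r ?pw_ge0// !indicE ler_nat.
    case: (boolP (y \in `]1, expR L]%classic)) => [|//]; rewrite inE /= in_itv/= => /andP[y1 _].
    by rewrite mem_set//= in_itv/= y1.
have h3 : `|L^-1 * \int[mu]_(y in `]1, expR L]) comp p^`() L 2^-1 ga 1 0 y| <= K2 * J / Num.sqrt L.
  rewrite normrM ger0_norm ?invr_ge0 ?(ltW L0)// mulrC; apply: ler_pM => //; first by rewrite invr_ge0 ltW.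
    by apply: (le_trans h2); rewrite ler_wpM2l.
  exact: inv_le_isqrt.
have h4 : `|p.[1] * osc 2^-1 ga 1 0 (expR L)| <= K1 / Num.sqrt L.
  by apply: (le_trans h1); rewrite ler_wpM2l//; exact: pw_half_le.
rewrite addrAC [_ - _ - _]addrAC subrr add0r mulrDl.
apply: (le_trans (ler_normD _ _)); rewrite normrN; exact: lerD.
Qed.

Lemma diagonal_int p (Q : {poly R}) L (c : R) : 1 <= L -> Q^`() = p ->
  \int[mu]_(y in `]1, expR L]) comp p L 0 0 c 0 y = c * (L * (Q.[1] - Q.[0])).
Proof.
move=> L1' Qp; have L0 : 0 < L by lra.
have X1 : 1 < expR L by rewrite -[ltLHS]expR0 ltr_expR.
have [||_ ->] := @ftc_oc R (fun y => c * (L * Q.[ln y / L])) (comp p L 0 0 c 0) 1 (expR L) X1.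
- move=> y /andP[y1 _]; have y0 : 0 < y by lra.
  apply: der_eq; first by apply: derM; [exact: der_cst|apply: derM; [exact: der_cst|exact: der_comp_log]].
  rewrite Qp /comp /osc add0r pwN pw1// !mul0r cos0 !add0r addr0 mulr1 invfM.
  by move: (p.[ln y / L]) => u; field; rewrite !gt_eqF.
- by move=> y /andP[y1 _]; apply: continuous_trial; lra.
by rewrite expRK divff ?gt_eqF// ln1 mul0r; ring.
Qed.

(** Letting L grow gives S <= liminf (dist sqrt L) sqrt S; the error terms are made explicit so that
    finite sums can be treated one at a time. *)
Definition lower_bound (S : R) : Prop := exists2 K : R, 0 <= K &
  forall L n (c th : 'I_n -> R), 1 <= L -> (forall i, (expR L)^-1 <= th i <= 1) ->
  L1 pos (fun y => (residual c th y / y) ^+ 2) ->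
  S - K / Num.sqrt L <= l2dist c th * Num.sqrt L * (Num.sqrt S + K / Num.sqrt L).

Lemma comp_scale p L sg ga a b r y : comp p L sg ga (r * a) (r * b) y = r * comp p L sg ga a b y.
Proof. by rewrite /comp /osc; ring. Qed.

Section OnLine.
Variables (n : nat) (ga : 'I_n -> R) (p : 'I_n -> {poly R}).

Let r i : R := (2^-1 ^+ 2 + ga i ^+ 2)^-1.

(** The coefficient at each zero is rho/|rho|^2: the pairing with 1 then has limit p(0)/|rho|^2, and
    the norm the same weight. *)
Definition trial L y : R := \sum_i comp (p i) L 2^-1 (ga i) (r i * 2^-1) (r i * ga i) y.

Definition zero_sum (m : 'I_n -> nat) : R := \sum_i (m i)%:R ^+ 2 / (2^-1 ^+ 2 + ga i ^+ 2).

Let r0 i : 0 < r i.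
Proof.
have h : 0 < (2^-1 : R) ^+ 2 by rewrite exprn_gt0// invr_gt0.
by rewrite invr_gt0; have := sqr_ge0 (ga i); lra.
Qed.

Lemma trial_mass (m : 'I_n -> nat) : (forall i, (p i).[0] = (m i)%:R ^+ 2) -> exists2 K : R, 0 <= K & forall L, 1 <= L ->
  zero_sum m - K / Num.sqrt L <= \int[mu]_(y in `]1, expR L]) trial L y.
Proof.
move=> p0; have H i := leading_bound (p i) (ga i).
have [K K0 HK] := fin_all_exists2 H.
exists (\sum_i r i * K i); first by apply: sumr_ge0 => i _; exact: (mulr_ge0 (ltW (r0 i)) (K0 i)).
move=> L L1'.
have ic i : L1 `]1, expR L] (comp (p i) L 2^-1 (ga i) (r i * 2^-1) (r i * ga i)) by exact: L1_comp.
rewrite /trial Rintegral_sum// /zero_sum mulr_suml -sumrB; apply: ler_sum => i _.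
have ip := L1_comp (p i) L 2^-1 (ga i) 2^-1 (ga i) (expR L).
rewrite (_ : \int[mu]_(y in _) _ = r i * \int[mu]_(y in `]1, expR L]) comp (p i) L 2^-1 (ga i) 2^-1 (ga i) y); last first.
  by rewrite -(RintZ _ (@mX _) ip); apply: eq_Rintegral => y _; rewrite comp_scale.
have := HK i L L1'; rewrite ler_norml p0 => /andP[h _].
have := ler_wpM2l (ltW (r0 i)) h; rewrite /r; move: (_^-1) (\int[mu]_(_ in _) _) => u v; lra.
Qed.

(** [trial] is a real part, bounded here by the modulus of the complex sum. The squared modulus
    involves only the differences ga i - ga j; squaring the real part directly would bring in the
    sums ga i + ga j as well, which do not oscillate for conjugate zeros. *)
Lemma trial_sq L y : 0 < y -> (y * trial L y) ^+ 2 <=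
  \sum_i \sum_j r i * r j * comp (p i * p j) L 0 (ga i - ga j)
    (2^-1 ^+ 2 + ga i * ga j) (2^-1 * (ga i - ga j)) y.
Proof.
move=> y0; pose t := ln y; pose q i := r i * (p i).[ln y / L].
pose a i := q i * (2^-1 * cos (ga i * t) + ga i * sin (ga i * t)).
pose b i := q i * (2^-1 * sin (ga i * t) - ga i * cos (ga i * t)).
pose h := pw (- 2^-1) y.
have hh : h * h = pw (-1) y by rewrite -pwD; apply: pw_eq; field.
have E1 : y * trial L y = h * \sum_i a i.
  rewrite /trial !mulr_sumr; apply: eq_bigr => i _; rewrite /a /q /comp /osc -/t.
  have -> : pw (- (2^-1 + 1)) y = pw (-1) y * h by rewrite -pwD; apply: pw_eq; field.
  rewrite pwN pw1// /h; move: (cos (ga i * t)) (sin (ga i * t)) (p i).[t / L] (r i) (pw (- 2^-1) y) => c s u v w.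
  by field; rewrite gt_eqF.
apply: (@le_trans _ _ (pw (-1) y * ((\sum_i a i) ^+ 2 + (\sum_i b i) ^+ 2))).
  by rewrite E1 exprMn expr2 hh ler_wpM2l ?pw_ge0// lerDl sqr_ge0.
rewrite le_eqVlt; apply/orP; left; apply/eqP.
rewrite !expr2 !mulr_suml -big_split/= mulr_sumr; apply: eq_bigr => i _.
rewrite !mulr_sumr -big_split/= mulr_sumr; apply: eq_bigr => j _.
rewrite /a /b /q /comp /osc hornerM -/t mulrBl cosB sinB add0r.
move: (cos (ga i * t)) (sin (ga i * t)) (cos (ga j * t)) (sin (ga j * t)) (p i).[t / L] (p j).[t / L] (r i) (r j) (pw (-1) y) => c s c' s' u v w w' e.
by ring.
Qed.

(** Diagonal terms give L m^2 / |rho|^2 exactly, through the antiderivative Q of p^2; the others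
    oscillate, the ordinates being distinct, and stay bounded. *)
Lemma trial_energy (m : 'I_n -> nat) (Q : 'I_n -> {poly R}) : injective ga -> (forall i, (Q i)^`() = p i * p i) ->
  (forall i, (Q i).[1] - (Q i).[0] = (m i)%:R ^+ 2) -> exists2 K : R, 0 <= K & forall L, 1 <= L ->
  L1 `]1, expR L] (fun y => (y * trial L y) ^+ 2) /\
  \int[mu]_(y in `]1, expR L]) ((y * trial L y) ^+ 2) <= L * zero_sum m + K.
Proof.
move=> ga_inj Qp Qm; pose f L i j y := r i * r j * comp (p i * p j) L 0 (ga i - ga j)
    (2^-1 ^+ 2 + ga i * ga j) (2^-1 * (ga i - ga j)) y.
have if_ L i j : L1 `]1, expR L] (f L i j) by apply: L1Zl => //; exact: L1_comp.
have H (ij : 'I_n * 'I_n) : exists2 K : R, 0 <= K & forall L, 1 <= L ->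
    \int[mu]_(y in `]1, expR L]) f L ij.1 ij.2 y <=
    (if ij.1 == ij.2 then L * ((m ij.1)%:R ^+ 2 / (2^-1 ^+ 2 + ga ij.1 ^+ 2)) else 0) + K.
  case: ij => i j /=; case: eqVneq => [<-|ij].
    exists 0 => // L L1'; rewrite addr0 /f.
    rewrite (RintZ _ (@mX _) (L1_comp _ _ _ _ _ _ _)) subrr mulr0 (diagonal_int _ L1' (Qp i)) Qm.
    rewrite le_eqVlt; apply/orP; left; apply/eqP; rewrite -expr2 /r.
    have := r0 i; rewrite invr_gt0 => e0; move: (2^-1 ^+ 2 + ga i ^+ 2) e0 => e e0.
    by field; rewrite gt_eqF.
  have d0 : ga i - ga j != 0 by rewrite subr_eq0; apply: contra ij => /eqP/ga_inj ->.
  have [K K0 HK] := oscillating_bound (p i * p j) (2^-1 ^+ 2 + ga i * ga j) (2^-1 * (ga i - ga j)) d0.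
  have rr : 0 <= r i * r j by exact: mulr_ge0 (ltW (r0 i)) (ltW (r0 j)).
  exists (r i * r j * K); first exact: mulr_ge0.
  move=> L L1'; rewrite add0r /f (RintZ _ (@mX _) (L1_comp _ _ _ _ _ _ _)).
  rewrite (ler_wpM2l rr)//; exact: le_trans (ler_norm _) (HK L L1').
have [K K0 HK] := fin_all_exists2 H.
exists (\sum_i \sum_j K (i, j)); first by apply: sumr_ge0 => i _; apply: sumr_ge0.
move=> L L1'.
have iY2 : L1 `]1, expR L] (fun y => (y * trial L y) ^+ 2).
  apply: L1_mid => y y0; apply: continuous_sqM.
  have H1 (s : seq 'I_n) : {for y, continuous (fun y => \sum_(i <- s) comp (p i) L 2^-1 (ga i) (r i * 2^-1) (r i * ga i) y)}.
    elim: s => [|i s IH].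
      rewrite (_ : (fun y => _) = (fun=> 0)); first exact: cvg_cst.
      by apply/funext => z; rewrite big_nil.
    rewrite (_ : (fun y => _) = (fun y => comp (p i) L 2^-1 (ga i) (r i * 2^-1) (r i * ga i) y +
      \sum_(i <- s) comp (p i) L 2^-1 (ga i) (r i * 2^-1) (r i * ga i) y)); last by apply/funext => z; rewrite big_cons.
    by apply: cvgD; [exact: continuous_trial|exact: IH].
  exact: H1.
split=> //.
apply: (@le_trans _ _ (\int[mu]_(y in `]1, expR L]) (\sum_i \sum_j f L i j y))).
  apply: le_Rintegral; [exact: mX|by []|by apply: L1_sum => // i; exact: L1_sum|].
  by move=> y; rewrite /= in_itv/= => /andP[y1 _]; apply: trial_sq; lra.
rewrite Rintegral_sum//; last by move=> i; exact: L1_sum.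
rewrite /zero_sum mulr_sumr -big_split/=; apply: ler_sum => i _.
rewrite Rintegral_sum//.
apply: (le_trans (ler_sum _ (fun j _ => HK (i, j) L L1'))); rewrite big_split/= lerD2r.
by rewrite (bigD1 i)//= eqxx big1 ?addr0// => j ji; rewrite eq_sym (negbTE ji).
Qed.

End OnLine.

Lemma sqrt_add_le (x y : R) : 0 <= x -> 0 <= y -> Num.sqrt (x + y) <= Num.sqrt x + Num.sqrt y.
Proof.
move=> x0 y0; rewrite -[leRHS]ger0_norm ?addr_ge0 ?sqrtr_ge0// -sqrtr_sqr ler_wsqrtr//.
by rewrite sqrrD !sqr_sqrtr// addrAC lerDl mulrn_wge0// mulr_ge0 ?sqrtr_ge0.
Qed.

(** [test_inequality] with X = exp L: [trial_mass] bounds the left side from below and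
    [trial_energy] the norm from above; head and tail go into K. *)
Theorem lower_bound_online (n : nat) (ga : 'I_n -> R) (m : 'I_n -> nat) : injective ga ->
  (forall i, moments_vanish (m i) 2^-1 (ga i)) -> lower_bound (zero_sum ga m).
Proof.
move=> gi mv.
have [p Hp] := fin_all_exists (fun i => @mass_poly R (m i)).
have [Q HQ] := fin_all_exists Hp.
have p0 i : (p i).[0] = (m i)%:R ^+ 2 by have [] := HQ i.
have sp i : (size (p i) <= m i)%N by have [] := HQ i.
have Qp i : (Q i)^`() = p i * p i by have [] := HQ i.
have Qm i : (Q i).[1] - (Q i).[0] = (m i)%:R ^+ 2 by have [] := HQ i.
have [K1 K10 H1] := trial_mass ga p0.
have [K2 K20 H2] := trial_energy gi Qp Qm.
have [K3 K30 H3] := @test_inequality R.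
have half1 : (2^-1 <= 2^-1 :> R) && (2^-1 < 1 :> R) by apply/andP; split; lra.
pose r i : R := (2^-1 ^+ 2 + ga i ^+ 2)^-1.
have [M HM] := fin_all_exists (fun i => admissible_trial (ga := ga i) (r i * 2^-1) (r i * ga i) (sp i) half1 (mv i)).
have S0 : 0 <= zero_sum ga m.
  by apply: sumr_ge0 => i _; rewrite divr_ge0 ?sqr_ge0// addr_ge0 ?sqr_ge0.
pose MM := `|\sum_i M i|.
have KM : 0 <= K3 * MM by apply: mulr_ge0 => //; exact: normr_ge0.
exists (K1 + Num.sqrt K2 + 2 * (K3 * MM)).
  by have := sqrtr_ge0 K2; lra.
move=> L nf c th L1' thL iG; have L0 : 0 < L by lra.
have X1 : 1 <= expR L by rewrite -[leLHS]expR0 ler_expR; lra.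
have adm := admissible_sum (fun i => HM i L L1').
have [mY cY oY [i01 h01] [ipsi [b1 [psi' d1 e1] k1]]] := adm.
have iY : L1 `]1, expR L] (trial ga p L) by apply: L1_mid; exact: cY.
have [iY2 hY2] := H2 L L1'.
have T := H3 nf c th (expR L) (\sum_i M i) _ psi' X1 thL mY oY i01 h01 iY iY2 ipsi b1 d1 e1 k1 iG.
have B1 := H1 L L1'.
have N0 : 0 <= l2dist c th by exact: sqrtr_ge0.
have s0 : 0 < Num.sqrt L by rewrite sqrtr_gt0.
have B2 : Num.sqrt (\int[mu]_(y in `]1, expR L]) ((y * trial ga p L y) ^+ 2)) <=
    Num.sqrt L * Num.sqrt (zero_sum ga m) + Num.sqrt K2.
  apply: (le_trans (ler_wsqrtr hY2)); rewrite -sqrtrM ?(ltW L0)//.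
  by apply: sqrt_add_le => //; rewrite mulr_ge0// ltW.
have B3 := pw_half_le L1'.
have B4 : K3 * (\sum_i M i) <= K3 * MM by rewrite ler_wpM2l// ler_norm.
have A : zero_sum ga m - K1 / Num.sqrt L <=
   l2dist c th * (Num.sqrt L * Num.sqrt (zero_sum ga m) + Num.sqrt K2) +
   K3 * MM * (l2dist c th + (Num.sqrt L)^-1).
  apply: (le_trans B1); apply: (le_trans (ler_norm _)); apply: (le_trans T); apply: lerD.
    by rewrite ler_wpM2l.
  apply: (@le_trans _ _ (K3 * MM * (l2dist c th + pw (- 2^-1) (expR L)))).
    by rewrite ler_wpM2r// addr_ge0 ?pw_ge0.
  by rewrite (ler_wpM2l KM)// lerD2l.
have q0 := sqrtr_ge0 K2; have z0 := sqrtr_ge0 (zero_sum ga m).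
move: A KM q0 z0; move: (zero_sum ga m) (K3 * MM) (Num.sqrt K2) (Num.sqrt (zero_sum ga m)) (Num.sqrt L) (l2dist c th) N0 s0 K10.
move=> S km q z s N N0 s0 K10 A KM q0 z0.
have si : 0 < s^-1 by rewrite invr_gt0.
have -> : N * s * (z + (K1 + q + 2 * km) / s) = N * (s * z) + N * (K1 + q + 2 * km) by field; rewrite gt_eqF.
have h1 := mulr_ge0 N0 K10; have h2 := mulr_ge0 N0 KM.
have h3 := mulr_ge0 KM (ltW si); have h4 := mulr_ge0 q0 (ltW si).
move: A h3 h4; move: (s^-1) => si' A h3 h4; clear - A h1 h2 h3 h4; lra.
Qed.

(** For sg > 1/2 the function y^(-sg) is square integrable at infinity, so the norm of the test
    function stays bounded in L while its pairing with 1 tends to 1: the distance itself is bounded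
    below. *)
Theorem lower_bound_offline (sg ga : R) : 2^-1 < sg < 1 -> mellin_zero sg ga ->
  exists2 K : R, 0 < K & forall L n (c th : 'I_n -> R), 1 <= L ->
    (forall i, (expR L)^-1 <= th i <= 1) ->
    L1 pos (fun y => (residual c th y / y) ^+ 2) -> 1 - K / Num.sqrt L <= K * l2dist c th.
Proof.
move=> /andP[s1 s2] Z; have s01 : 0 < sg < 1 by lra.
have mv : moments_vanish 1 sg ga.
  move=> k th al be; rewrite ltnS leqn0 => /eqP -> th0.
  have E (y : R) : fpart (th * y) * (ln y ^+ 0 * osc (sg + 1) ga al be y) = fpart (th * y) * osc (sg + 1) ga al be y.
    by rewrite expr0 mul1r.
  split; first by apply: (L1_eq mpos) (L1_frac_osc ga al be th0 s01) => y _; rewrite E.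
  by rewrite -[RHS](mellin_zero_scale al be s01 th0 Z); apply: eq_Rintegral => y _; rewrite E.
have half1 : 2^-1 <= sg < 1 by rewrite (ltW s1).
have sp : (size (1%R : {poly R}) <= 1)%N by rewrite size_poly1.
have [M HM] := admissible_trial sg ga sp half1 mv.
have [K3 K30 H3] := @test_inequality R.
have [B B0 HB] := comp_bound 1.
pose A := B * (`|sg| + `|ga|).
have A0 : 0 <= A by rewrite mulr_ge0// addr_ge0.
have ip : L1 far (pw (- sg - sg)).
  apply: (@L1_sub _ _ `[1, +oo[%classic) => //.
    by move=> y /=; rewrite !in_itv/= !andbT => /ltW.
  by apply: L1_pw_infty; lra.
pose J := \int[mu]_(y in far) pw (- sg - sg) y.
pose E := Num.sqrt (A ^+ 2 * J).
pose MM := `|M|.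
have E0 : 0 <= E by exact: sqrtr_ge0.
have KM : 0 <= K3 * MM by apply: mulr_ge0 => //; exact: normr_ge0.
exists (1 + E + K3 * MM); first by lra.
move=> L n c th L1' thL iG; have L0 : 0 < L by lra.
have X1 : 1 <= expR L by rewrite -[leLHS]expR0 ler_expR; lra.
have [mY cY oY [i01 h01] [ipsi [b1 [psi' d1 e1] k1]]] := HM L L1'.
have iY := L1_mid (expR L) cY.
have iY2 : L1 `]1, expR L] (fun y => (y * comp 1 L sg ga sg ga y) ^+ 2).
  by apply: L1_mid => y y0; apply: continuous_sqM; exact: continuous_trial.
have T := H3 n c th (expR L) M _ psi' X1 thL mY oY i01 h01 iY iY2 ipsi b1 d1 e1 k1 iG.
have I1 : 1 - (Num.sqrt L)^-1 <= \int[mu]_(y in `]1, expR L]) comp 1 L sg ga sg ga y.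
  have := ibp 1 sg ga 1 0 L1'; rewrite !mulr1 !mulr0 subr0 add0r => ->.
  have one (x : R) : (1 : {poly R}).[x] = 1 by rewrite hornerE.
  have -> : (1 : {poly R})^`() = 0 by exact: derivC.
  rewrite !one mul1r (Rint_eq0 (@mX _)) ?mulr0 ?addr0; last first.
    by move=> y _; rewrite /comp horner0 mul0r.
  rewrite lerD2l lerN2; apply: (le_trans (ler_norm _)); apply: (le_trans (osc_bound _ _ _ _ _)).
  rewrite normr1 normr0 addr0 mul1r; apply: le_trans (pw_half_le L1'); apply: pw_ler => //; lra.
have I2 : Num.sqrt (\int[mu]_(y in `]1, expR L]) ((y * comp 1 L sg ga sg ga y) ^+ 2)) <= E.
  apply: ler_wsqrtr; rewrite /J -(RintZ _ mfar ip) (Rintegral_indic far) (Rintegral_indic `]1, expR L]).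
  apply: le_Rintegral; [by []|exact: (proj1 (L1_indic _ (@mX _)))|exact: (proj1 (L1_indic _ mfar) (L1Zl mfar _ ip))|].
  move=> y _; rewrite !indicE; case: (boolP (y \in `]1, expR L]%classic)) => [|_]; last first.
    by rewrite mul0r !mulr_ge0 ?sqr_ge0 ?pw_ge0.
  rewrite inE /= in_itv/= => /andP[y1 yX]; have y0 : 0 < y by exact: lt_trans ltr01 y1.
  rewrite mem_set ?mul1r; last by rewrite /= in_itv/= y1.
  have y1X : 1 <= y <= expR L by rewrite (ltW y1).
  have h := HB L sg ga sg ga y L1' y1X; rewrite -/A in h.
  have -> : pw (- sg - sg) y = (y * pw (- (sg + 1)) y) ^+ 2.
    by rewrite -{2}(pw1 y0) -pwD expr2 -pwD; apply: pw_eq; ring.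
  rewrite -exprMn -real_normK ?num_real// lerXn2r ?nnegrE//.
    by rewrite !mulr_ge0 ?pw_ge0// ltW.
  by rewrite normrM (ger0_norm (ltW y0)) mulrCA ler_wpM2l// ltW.
have N0 : 0 <= l2dist c th by exact: sqrtr_ge0.
have B3 := pw_half_le L1'.
have B4 : K3 * M <= K3 * MM by rewrite ler_wpM2l// ler_norm.
have si : 0 < (Num.sqrt L)^-1 by rewrite invr_gt0 sqrtr_gt0.
have T2 : 1 - (Num.sqrt L)^-1 <= l2dist c th * E + K3 * MM * (l2dist c th + (Num.sqrt L)^-1).
  apply: (le_trans I1); apply: (le_trans (ler_norm _)); apply: (le_trans T); apply: lerD.
    by rewrite ler_wpM2l.
  apply: (@le_trans _ _ (K3 * MM * (l2dist c th + pw (- 2^-1) (expR L)))).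
    by rewrite ler_wpM2r// addr_ge0 ?pw_ge0.
  by rewrite ler_wpM2l// lerD2l.
have h1 := mulr_ge0 E0 (ltW si).
clear I2; move: T2 h1; move: (l2dist c th) (K3 * MM) E (Num.sqrt L)^-1 N0 KM E0 si => N km e x N0 KM E0 si T2 h1; clear - T2 h1 N0 KM E0 si; lra.
Qed.

End Asymptotics.

(** * From the residual to the distance and its lower limit *)

Section Conclusion.
Context {R : realType}.
Local Notation mu := (@lebesgue_measure R).
Local Notation L1 D f := (mu.-integrable D (EFin \o f)).
Local Notation pos := (`]0, +oo[%classic : set R).
Local Notation normc := ComplexField.Normc.normc.
Local Open Scope complex_scope.

Let mpos : measurable pos. Proof. exact: measurable_itv. Qed.

(** As chi is real, replacing the complex coefficients by their real parts can only decrease the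
    distance; the substitution y = 1/t then gives the residual. *)
Lemma L2norm_residual n (c : 'I_n -> R[i]) (th : 'I_n -> R) :
  let g := fun t => chi t - \sum_(i < n) c i * (Defs.frac (th i / t))%:C in
  (L2norm g < +oo)%E ->
  L1 pos (fun y => (residual (fun i => complex.Re (c i)) th y / y) ^+ 2) /\
  ((l2dist (fun i => complex.Re (c i)) th)%:E <= L2norm g)%E.
Proof.
move=> g gfin; pose c' i := complex.Re (c i).
pose h t := (residual c' th t^-1) ^+ 2.
have Reg t : 0 < t -> complex.Re (g t) = residual c' th t^-1.
  move=> t0; rewrite /g /residual /fracsum.
  have -> : complex.Re (chi t - \sum_(i < n) c i * (Defs.frac (th i / t))%:C) =
      complex.Re (chi t) - complex.Re (\sum_(i < n) c i * (Defs.frac (th i / t))%:C).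
    by case: (chi t) => ? ?; case: (\sum_(_ < _) _).
  congr (_ - _).
    rewrite /chi /= !indicE; congr (_%:R); congr nat_of_bool.
    by apply/idP/idP; rewrite !inE /= !in_itv/= ?andbT t0 /= invf_ge1.
  by rewrite Re_sum; apply: eq_bigr => i _; rewrite ReM /= mulr0 subr0.
have mres : measurable_fun setT (residual c' th) by exact: measurable_residual.
have mh : measurable_fun setT h.
  by apply: measurable_funX; apply: (measurableT_comp mres); exact: measurable_invr.
pose k y := (residual c' th y) ^+ 2.
have mk : measurable_fun setT k by exact: measurable_funX.
have m2 : measurable_fun setT (fun y => (residual c' th y / y) ^+ 2).
  by apply: measurable_funX; apply: measurable_funM => //; exact: measurable_invr.
have E : (\int[mu]_(t in pos) (h t)%:E = \int[mu]_(y in pos) ((residual c' th y / y) ^+ 2)%:E)%E.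
  rewrite -[LHS]mul1e -ge0_integral_inv//; last by move=> t; exact: sqr_ge0.
  by apply: eq_integral => y _; rewrite /h invrK expr_div_n mulrC.
have Imsum : forall t, complex.Im (g t) = - \sum_(i < n) complex.Im (c i) * fpart (th i / t).
  move=> t; rewrite /g.
  have -> : complex.Im (chi t - \sum_(i < n) c i * (Defs.frac (th i / t))%:C) =
      complex.Im (chi t) - complex.Im (\sum_(i < n) c i * (Defs.frac (th i / t))%:C).
    by case: (chi t) => ? ?; case: (\sum_(_ < _) _).
  rewrite /chi /= sub0r; congr (- _); elim/big_rec2: _ => // i u v _ <-.
  by case: v => v1 v2; case: (c i) => c1 c2; rewrite /= mulr0 add0r.
have mi (a : 'I_n -> R) : measurable_fun setT (fun t : R => \sum_(i < n) a i * fpart (th i / t)).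
  by apply: measurable_sum => i; meas.
have nE t : 0 < t -> normc (g t) ^+ 2 = h t + (\sum_(i < n) complex.Im (c i) * fpart (th i / t)) ^+ 2.
  move=> t0; rewrite /h -Reg// -(sqrrN (\sum_(i < n) _)) -Imsum.
  by case: (g t) => a b; rewrite /= sqr_sqrtr// addr_ge0// sqr_ge0.
have hg : (\int[mu]_(t in pos) (h t)%:E <= \int[mu]_(t in pos) (normc (g t) ^+ 2)%:E)%E.
  have -> : (\int[mu]_(t in pos) (normc (g t) ^+ 2)%:E =
      \int[mu]_(t in pos) (h t + (\sum_(i < n) complex.Im (c i) * fpart (th i / t)) ^+ 2)%:E)%E.
    by apply: eq_integral => t; rewrite inE /= in_itv/= andbT => t0; rewrite nE.
  apply: ge0_le_integral => //.
  - by move=> t _; rewrite lee_fin sqr_ge0.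
  - by apply/measurable_EFinP; exact: measurable_funTS.
  - apply/measurable_EFinP; apply: measurable_funTS; apply: measurable_funD => //.
    by apply: measurable_funX; exact: mi.
  - by move=> t _; rewrite lee_fin lerDl sqr_ge0.
have Ifin : (\int[mu]_(t in pos) (normc (g t) ^+ 2)%:E < +oo)%E.
  by move: gfin; rewrite /L2norm; case: (integral _ _ _) => [r _|//|_]; rewrite ?ltry ?ltNyr.
have i2 : L1 pos (fun y => (residual c' th y / y) ^+ 2).
  apply/integrableP; split; first by apply/measurable_EFinP; exact: measurable_funTS.
  rewrite (_ : (fun x => `|_|) = (fun y => ((residual c' th y / y) ^+ 2)%:E))%E; last first.
    by apply/funext => y /=; rewrite ger0_norm// sqr_ge0.
  by rewrite -E; exact: le_lt_trans hg Ifin.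
split=> //.
have -> : ((l2dist c' th)%:E = sqrte (\int[mu]_(y in pos) ((residual c' th y / y) ^+ 2)%:E))%E.
  by rewrite /l2dist -(EFin_Rintegral mpos i2).
rewrite /L2norm lee_sqrt; last by apply: integral_ge0 => t _; rewrite lee_fin sqr_ge0.
by rewrite -E.
Qed.

Lemma D_lower_bound (lambda e : R) : 0 < lambda < 1 -> 
  (forall n (c th : 'I_n -> R), (forall i, lambda <= th i <= 1) ->
    L1 pos (fun y => (residual c th y / y) ^+ 2) -> e <= l2dist c th) ->
  (e%:E <= Defs.D lambda)%E.
Proof.
move=> l01 H; apply: le_ereal_inf_tmp => _ [_ [n [th [c [thl ->]]]] <-].
(* An element at infinite distance satisfies every lower bound, so finiteness of the norm may be
   assumed. *)
have [fin|] := ltP (L2norm (fun t => chi t - \sum_(i < n) c i * (Defs.frac (th i / t))%:C)) +oo%E.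
  have [i2 h] := L2norm_residual fin; apply: le_trans h; rewrite lee_fin.
  exact: H thl i2.
by apply: le_trans; rewrite leey.
Qed.

(** With lambda = exp(-L), a bound for all large L becomes a bound on a right neighbourhood of 0. *)
Lemma liminf_lower_bound (eta L0 : R) : 1 <= L0 ->
  (forall L n (c th : 'I_n -> R), L0 <= L -> (forall i, (expR L)^-1 <= th i <= 1) ->
    L1 pos (fun y => (residual c th y / y) ^+ 2) -> eta <= l2dist c th * Num.sqrt L) ->
  (eta%:E <= limf_einf (fun lambda : R =>
                   Defs.D lambda * (Num.sqrt (ln (1 / lambda)))%:E)
                (0 : R)^'+)%E.
Proof.
move=> L01 H; rewrite limf_einfE.
pose V := `]0, (expR L0)^-1[%classic : set R.
have e0 : 0 < (expR L0)^-1 by rewrite invr_gt0 expR_gt0.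
apply: (@le_trans _ _ (ereal_inf [set Defs.D lambda * (Num.sqrt (ln (1 / lambda)))%:E | lambda in V]%E)); last first.
  apply: ereal_sup_ubound; exists V => //=.
  rewrite /V; near=> x; rewrite /= in_itv/=; apply/andP; split; near: x.
    exact: nbhs_right_gt.
  exact: nbhs_right_lt.
apply: le_ereal_inf_tmp => _ [lambda + <-]; rewrite /V /= in_itv/= => /andP[l0 l1].
set L := ln (1 / lambda).
have eL : (expR L)^-1 = lambda by rewrite lnK ?posrE ?div1r ?invrK// invr_gt0.
have LL0 : L0 <= L.
  rewrite -ler_expR -lef_pV2 ?posrE ?expR_gt0// eL; exact: ltW.
have s0 : 0 < Num.sqrt L by rewrite sqrtr_gt0; lra.
have l01 : 0 < lambda < 1.
  rewrite l0 (lt_le_trans l1)// invf_le1 ?expR_gt0// -[leLHS]expR0 ler_expR; lra.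
have h : ((eta / Num.sqrt L)%:E <= Defs.D lambda)%E.
  apply: D_lower_bound => // n c th thl iG; rewrite ler_pdivrMr//; apply: (H L n c th) => //.
  by rewrite eL.
apply: (@le_trans _ _ ((eta / Num.sqrt L)%:E * (Num.sqrt L)%:E)%E).
  by rewrite -EFinM divfK// gt_eqF.
by apply: lee_wpmul2r => //; rewrite lee_fin ltW.
Unshelve. all: by end_near. Qed.

Lemma online_liminf (S eta : R) : 0 <= S -> eta < Num.sqrt S -> @lower_bound R S ->
  (eta%:E <= limf_einf (fun lambda : R =>
                   Defs.D lambda * (Num.sqrt (ln (1 / lambda)))%:E)
                (0 : R)^'+)%E.
Proof.
move=> S0 es [K K0 H].
have [e0|e0] := leP eta 0.
  apply: (@liminf_lower_bound _ 1) => // L n c th _ _ _; apply: (le_trans e0).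
  by rewrite mulr_ge0// sqrtr_ge0.
set s := Num.sqrt S; have sS : s ^+ 2 = S by rewrite sqr_sqrtr.
have s0 : 0 < s by apply: lt_trans es.
pose d := S - eta * s.
have d0 : 0 < d.
  by rewrite /d -sS expr2 -mulrBl mulr_gt0// subr_gt0.
(* For sqrt L >= q the error terms K / sqrt L and eta K / sqrt L together stay below d, the gap
   between S and eta sqrt S. *)
pose q := (K + eta * K) / d + 1.
have q1 : 1 <= q by rewrite lerDr divr_ge0 ?(ltW d0)// addr_ge0// mulr_ge0// ltW.
have q2 : 1 <= q ^+ 2 by nra.
apply: (@liminf_lower_bound _ (q ^+ 2)) => // L n c th qL thL iG.
have L1' : 1 <= L by apply: le_trans qL.
have L0 : 0 < L by lra.
have sL : q <= Num.sqrt L.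
  by rewrite -[leLHS](ger0_norm (_ : 0 <= q)) -?sqrtr_sqr ?ler_wsqrtr//; lra.
have l0 : 0 < Num.sqrt L by rewrite sqrtr_gt0.
have := H L n c th L1' thL iG; rewrite -/s.
rewrite leNgt => h; rewrite leNgt; apply/negP => T; move/negP: h; apply.
have K1 : K / Num.sqrt L * (1 + eta) < d.
  rewrite mulrAC ltr_pdivrMr//.
  have : K + eta * K = (q - 1) * d by rewrite /q addrK divfK// gt_eqF.
  have := ler_wpM2r (ltW d0) sL; lra.
have x0 : 0 <= K / Num.sqrt L by rewrite divr_ge0// ltW.
have p0 : 0 < s + K / Num.sqrt L by lra.
have := ltW T; rewrite -(ler_pM2r p0) => T2.
apply: (le_lt_trans T2); rewrite /d in K1.
by move: K1; move: (K / Num.sqrt L) => x K1; lra.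
Qed.

Lemma offline_liminf (sg ga eta : R) : 2^-1 < sg < 1 -> mellin_zero sg ga ->
  (eta%:E <= limf_einf (fun lambda : R =>
                   Defs.D lambda * (Num.sqrt (ln (1 / lambda)))%:E)
                (0 : R)^'+)%E.
Proof.
move=> s01 Z; have [K K0 H] := lower_bound_offline s01 Z.
(* Were [l2dist] sqrt L below eta, then sqrt L < K (1 + |eta|) would follow, which this q
   excludes. *)
pose q := K * (1 + `|eta|) + 1.
have Ke : 0 <= K * (1 + `|eta|) by rewrite mulr_ge0 ?(ltW K0)// addr_ge0.
have q1 : 1 <= q by rewrite lerDr.
have q2 : 1 <= q ^+ 2 by nra.
apply: (@liminf_lower_bound _ (q ^+ 2)) => // L n c th qL thL iG.
have L1' : 1 <= L by apply: le_trans qL.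
have L0 : 0 < L by lra.
have sL : q <= Num.sqrt L.
  by rewrite -[leLHS](ger0_norm (_ : 0 <= q)) -?sqrtr_sqr ?ler_wsqrtr//; lra.
have l0 : 0 < Num.sqrt L by rewrite sqrtr_gt0.
have := H L n c th L1' thL iG.
apply: contraTT; rewrite -!ltNge => T.
have ee := ler_norm eta.
rewrite -(ltr_pM2r l0) mulrBl divfK ?gt_eqF// mul1r.
have : K * (l2dist c th * Num.sqrt L) < K * `|eta| by rewrite ltr_pM2l//; exact: lt_le_trans T ee.
by rewrite /q in sL; lra.
Qed.

(** Where no vanishing order exists, the multiplicity takes its default value 0 and the condition is
    empty. *)
Lemma multiplicity_moments (zeta : R[i]^o -> R[i]^o) (x ga : R) : is_riemann_zeta zeta -> 0 < x < 1 ->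
  moments_vanish (multiplicity zeta (x +i* ga)) x ga.
Proof.
move=> hz x01; have [ex|nex] := pselect (exists m, vanishing_order zeta (x +i* ga) m).
  move=> k th al be km th0; have hm := xgetPex 0%N ex.
  exact: (zero_moments hz x01 hm al be km th0).
move=> k th al be; rewrite /multiplicity xgetPN// => m hm; apply: nex; by exists m.
Qed.

(** Points of the critical line are determined by their ordinates, so a duplicate-free list yields
    the injectivity that [lower_bound_online] asks for. *)
Lemma online_finite_sum (zeta : R[i]^o -> R[i]^o) (s : seq R[i]) : is_riemann_zeta zeta ->
  uniq s -> (forall rho, rho \in s -> complex.Re rho = 2^-1) ->
  @lower_bound R (\sum_(rho <- s) (multiplicity zeta rho)%:R ^+ 2 / normc rho ^+ 2).
Proof.
move=> hz us hs.
pose t := in_tuple s.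
pose ga i := complex.Im (tnth t i); pose m i := multiplicity zeta (tnth t i).
have tE i : tnth t i = 2^-1 +i* ga i.
  by have := hs _ (mem_tnth i t); rewrite /ga; case: (tnth t i) => a b /= ->.
have gi : injective ga.
  move=> i j e; have /tuple_uniqP inj : uniq t by [].
  by apply: inj; rewrite !tE e.
have half : (0 < 2^-1 :> R) && (2^-1 < 1 :> R) by apply/andP; split; lra.
have mv i : moments_vanish (m i) 2^-1 (ga i).
  by rewrite /m tE; exact: multiplicity_moments.
have := lower_bound_online gi mv; congr lower_bound.
rewrite [RHS]big_tnth /zero_sum; apply: eq_bigr => i _; congr (_ / _).
have := tE i; rewrite /t /= => ->.
by rewrite /= sqr_sqrtr// addr_ge0// sqr_ge0.
Qed.

End Conclusion.

Theorem theorem5p5 (R : realType) (zeta : R[i]^o -> R[i]^o)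
    (hzeta : is_riemann_zeta zeta) :
  (sqrte (\esum_(rho in nontrivial_zeros zeta)
            ((multiplicity zeta rho)%:R ^+ 2
               / ComplexField.Normc.normc rho ^+ 2)%:E)
   <= limf_einf (fun lambda : R =>
                   D lambda * (Num.sqrt (ln (1 / lambda)))%:E)
                (0 : R)^'+)%E.
Proof.
set b := limf_einf _ _.
have inf_b : (forall eta : R, (eta%:E <= b)%E) -> b = +oo%E.
  move=> h; apply/eqP; rewrite -leye_eq leNgt; apply/negP => bf.
  have := h 0; case: b h bf => // l h _ _.
  by have := h (l + 1); rewrite lee_fin; lra.
(* A single zero off the line, reflected if it lies to the left, makes the lower limit infinite. *)
have [off|on] := pselect (exists2 rho, nontrivial_zeros zeta rho & complex.Re rho != 2^-1).
  have [[x ga] [/= x01 z0] xh] := off.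
  have Z := zero_mellin hzeta x01 z0.
  rewrite inf_b ?leey// => eta; move: xh; rewrite neq_lt => /orP[xh|xh].
    apply: (@offline_liminf _ (1 - x) (- ga)); first by move: x01 => /andP[]; lra.
    exact: mellin_zero_reflect.
  by apply: (@offline_liminf _ x ga) => //; rewrite xh; case/andP: x01.
have b0 : (0%:E <= b)%E.
  apply: (@liminf_lower_bound _ _ 1) => // L n c th _ _ _.
  by rewrite mulr_ge0// sqrtr_ge0.
case: (ltP b +oo%E) => [bfin|]; last by rewrite leye_eq => /eqP ->; rewrite leey.
have [l bl] : exists l : R, b = l%:E by case: b b0 bfin {inf_b} => // l _ _; exists l.
have l0 : 0 <= l by rewrite -lee_fin -bl.
rewrite bl -[l]ger0_norm// -sqrtr_sqr -[(Num.sqrt _)%:E]/(sqrte (l ^+ 2)%:E) lee_sqrt ?lee_fin ?sqr_ge0//.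
(* The sum over all zeros is the supremum of its finite subsums, each covered by
   [online_finite_sum]. *)
apply: ge_ereal_sup => _ [A [finA AS] <-].
rewrite fsbig_finite//= sumEFin lee_fin.
set s := finmap.enum_fset (fset_set A); set S := \sum_(i <- s) _.
have S0 : 0 <= S by apply: sumr_ge0 => rho _; rewrite divr_ge0 ?sqr_ge0.
have us : uniq s by exact: finmap.fset_uniq.
have lS : lower_bound S.
  apply: online_finite_sum => // rho rs; apply/eqP; apply: contrapT => /negP ne; apply: on.
  by exists rho => //; apply: AS; move: rs; rewrite in_fset_set// inE.
have : Num.sqrt S <= l.
  (* Otherwise the midpoint of l and sqrt S would be a lower bound of l exceeding l. *)
  rewrite leNgt; apply/negP => lt; have lm : l < (l + Num.sqrt S) / 2 < Num.sqrt S by lra.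
  have /andP[h1 h2] := lm.
  by have := online_liminf S0 h2 lS; rewrite -/b bl lee_fin leNgt h1.
move=> h; rewrite -(sqr_sqrtr S0) lerXn2r// nnegrE// sqrtr_ge0.
Qed.
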